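(* Let $i\in I\setminus X$ be such that $\tau(i)=i$ and let $j\in X$. Write $a=a_{ij}$. Then in $U_q(\mathfrak g')$ $$F_{ij}(B_i,B_j)=\sum_{m=0}^{-1-a}\sum_{m'=0}^{-1-a-m}\sum_{t=0}^{\frac{1-a-m-m'}{2}}\rho_{m,m',t}\,\mathcal Z_i^tB_i^mB_jB_i^{m'}\mathcal Z_i^{\frac{1-a-m-m'}{2}-t}+\sum_{m=0}^{-1-a}\sum_{t=0}^{\frac{-1-a-m}{2}}\sigma_{m,t}\,\mathcal Z_i^t\mathcal W_{ij}K_j\mathcal Z_i^{\frac{-1-a-m}{2}-t}B_i^m,$$ where terms with $a+m+m'$ even (first sum), resp. $a+m$ even (second sum), are zero, and where $$\rho_{m,m',t}=(a+m+m')_p\left(\frac{c_iq_i^2}{q_i-q_i^{-1}}\right)^{\frac{1-a-m-m'}{2}}\sum_{k=m'}^{1-a-m}\sum_{\boldsymbol\ell\in\mathcal L_{m,m',k}}\sum_{\boldsymbol s\in\mathscr S_{m,m',k,t}}(-1)^{k+1}\begin{bmatrix}1-a\\k\end{bmatrix}_{q_i}q_i^{\theta_{\boldsymbol\ell,\boldsymbol s,k}}\prod_{r=1}^{1-a}\left(\left(\zeta^{(r-1)}_{\boldsymbol\ell,\boldsymbol s}+1\right)_{q_i^2}\right)^{(1-\ell_r)s_{r-|\boldsymbol\ell|_{1;r}}},$$ with $\theta_{\boldsymbol\ell,\boldsymbol s,k}=-a\,\zeta^{(1-a-k)}_{\boldsymbol\ell,\boldsymbol s}-2\sum_{r=1}^{1-a}\zeta^{(r-1)}_{\boldsymbol\ell,\boldsymbol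 s}$, and $$\begin{aligned}\sigma_{m,t}=\ &(a+m)_p\,c_i^{\frac{1-a-m}{2}}\sum_{k=1}^{1-a}\sum_{d=0}^{k-1}\sum_{m'=0}^m\sum_{\boldsymbol\ell\in\mathcal L'_{m,m',k,d}}\sum_{\boldsymbol s\in\mathscr S'_{m,m',k,t,d}}(-1)^{k+1}\begin{bmatrix}1-a\\k\end{bmatrix}_{q_i}\frac{q_i^{\kappa}}{(q_i-q_i^{-1})^{\frac{1-a-m}{2}}(q_j-q_j^{-1})}\\ &\times\left(\prod_{r\in\mathcal R_{k,d}}\left(\alpha_{\zeta^{(r-1)}_{\boldsymbol\ell,\boldsymbol s}-\nu_{r,k}}\right)^{(1-\ell_r)(1-s_{r-|\boldsymbol\ell|_{1;r}})}\right)\left[\sum_{u=\max(0,\xi_0)}^{T-1}q_i^{au}\omega^{(0)}_u+\sum_{u=\max(0,\xi_1)}^{T}q_i^{au}\omega^{(1)}_u\right]^{1-\delta_{T,0}}\\ &\times\left[\alpha_{\zeta^{(1-a-k+d)}_{\boldsymbol\ell,\boldsymbol s}}-q_i^{a}\left(q_i^{a}\alpha_{N_0}+\gamma_{N_0,N_0+N_1}\right)\right]^{\delta_{T,0}},\end{aligned}$$ where, for given $k,d,m',\boldsymbol\ell,\boldsymbol s$ and with $T$, $N_b$, $\xi_\lambda$ as defined in the context, $$\omega^{(0)}_u=\alpha_{\zeta^{(1-a-k+d)}_{\boldsymbol\ell,\boldsymbol s}}\,c^{(T-1)}_{u,\boldsymbol N}\left(q_i^{a}\alpha_{N_0-u}+\gamma_{N_0-u,|\boldsymbol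 N|_{0;T}-(T-1)}\right)\prod_{r=0}^{u-1}\alpha_{N_0-r},$$ $$\omega^{(1)}_u=-q_i^{a}\,c^{(T)}_{u,\boldsymbol N}\left(q_i^{a}\alpha_{N_0-u}+\gamma_{N_0-u,|\boldsymbol N|_{0;T+1}-T}\right)\prod_{r=0}^{u-1}\alpha_{N_0-r},$$ $$\kappa=-2\sum_{r=1}^{-a}\zeta^{(r-1)}_{\boldsymbol\ell,\boldsymbol s}\left(\ell_r+(1-\ell_r)(1-s_{r-|\boldsymbol\ell|_{1;r}})\right)-a\left(N_0-|\boldsymbol N|_{1;T+1}-m'+d\right)+2(k+t-d-1).$$
   Context: General conventions: $\mathbb N=\{0,1,2,\dots\}$; empty sums are $0$, empty products are $1$, $0^0=1$. For $d\in\mathbb Z$: $d_e=\lfloor d/2\rfloor$, $d_p=d-2d_e\in\{0,1\}$. For a binary tuple $\boldsymbol\ell=(\ell_1,\dots,\ell_N)\in\{0,1\}^N$: $|\boldsymbol\ell|=\ell_1+\dots+\ell_N$, and $|\boldsymbol\ell|_{r;s}=\ell_r+\dots+\ell_s$ if $r\le s$, $0$ otherwise. Expressions $(1-\ell_r)s_{r-|\boldsymbol\ell|_{1;r}}$ and $(1-\ell_r)(1-s_{r-|\boldsymbol\ell|_{1;r}})$ are read as $0$ when $\ell_r=1$. Binary tuples $\boldsymbol s$ are unrelated to the parameter vector $\mathbf s$ below. Quantum group: $\mathbb K$ is an algebraically closed field of characteristic $0$, $q$ an indeterminate. $I=\{0,\dots,n-1\}$ and $A=(a_{ij})_{i,j\in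 I}$ is an indecomposable symmetrizable generalized Cartan matrix ($a_{ii}=2$; $a_{ij}\in\mathbb Z_{\le0}$ for $i\ne j$; $a_{ij}=0\Leftrightarrow a_{ji}=0$), with mutually coprime positive integers $\epsilon_i$ such that $(\epsilon_ia_{ij})$ is symmetric. $\mathfrak g=\mathfrak g(A)$ is the Kac–Moody algebra with simple roots $\alpha_i$, coroots $h_i$, $\alpha_j(h_i)=a_{ij}$, root lattice $Q=\bigoplus_i\mathbb Z\alpha_i$, and $(\alpha_i,\alpha_j)=\epsilon_ia_{ij}$. Put $q_i=q^{\epsilon_i}$, $[m]_{q_i}=\frac{q_i^m-q_i^{-m}}{q_i-q_i^{-1}}$, $[m]_{q_i}!=\prod_{\ell=1}^m[\ell]_{q_i}$, $\begin{bmatrix}N\\ m\end{bmatrix}_{q_i}=\frac{[N]_{q_i}!}{[m]_{q_i}![N-m]_{q_i}!}$, $(N)_{q_i^2}=\frac{1-q_i^{2N}}{1-q_i^2}$, and $F_{ij}(x,y)=\sum_{\ell=0}^{1-a_{ij}}(-1)^\ell\begin{bmatrix}1-a_{ij}\\\ell\end{bmatrix}_{q_i}x^{1-a_{ij}-\ell}yx^\ell$. $U_q(\mathfrak g')$ is the $\mathbb K(q)$-algebra generated by $E_i,F_i,K_i^{\pm1}$ ($i\in I$) with relations: $K_i^{\pm1}K_i^{\mp1}=1$, the $K_i$ commute, $K_iE_j=q_i^{a_{ij}}E_jK_i$, $K_iF_j=q_i^{-a_{ij}}F_jK_i$, $[E_i,F_j]=\delta_{ij}\frac{K_i-K_i^{-1}}{q_i-q_i^{-1}}$,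 $F_{ij}(E_i,E_j)=F_{ij}(F_i,F_j)=0$ ($i\ne j$). Hopf structure: $\Delta(E_i)=E_i\otimes1+K_i\otimes E_i$, $\Delta(F_i)=F_i\otimes K_i^{-1}+1\otimes F_i$, $\Delta(K_i)=K_i\otimes K_i$, $\epsilon(E_i)=\epsilon(F_i)=0$, $\epsilon(K_i)=1$, $S(E_i)=-K_i^{-1}E_i$, $S(F_i)=-F_iK_i$, $S(K_i)=K_i^{-1}$. The left adjoint action is $\mathrm{ad}(x)(u)=x_{(1)}uS(x_{(2)})$. For $\beta=\sum m_i\alpha_i\in Q$, $K_\beta=\prod K_i^{m_i}$. Admissible pair: $r_i$ are the fundamental reflections, $r_i(h)=h-\alpha_i(h)h_i$, $r_i(\alpha)=\alpha-\alpha(h_i)\alpha_i$. A fixed admissible pair $(X,\tau)$ consists of $X\subseteq I$ of finite type and a permutation $\tau$ of $I$ with $\tau(X)=X$, $a_{\tau(i)\tau(j)}=a_{ij}$, such that $\tau^2=\mathrm{id}$; $h_{\tau(j)}=-w_X(h_j)$ and $\alpha_{\tau(j)}=-w_X(\alpha_j)$ for $j\in X$, where $w_X$ is the longest element of $W_X=\langle r_i:i\in X\rangle$; and $\alpha_i(\rho_X^\vee)\in\mathbb Z$ for all $i\in I\setminus X$ with $\tau(i)=i$, where $\rho_X^\vee$ is half the sum of the positive coroots of the root system generated by $X$. $\tau$ acts on $Q$ by $\tau(\alpha_i)=\alpha_{\tau(i)}$. The automorphism $\theta_q=\mathrm{Ad}(s(X,\tau))\circ T_{w_X}\circ\psi\circ\tau\circ\omega$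 of $U_q(\mathfrak g')$: $\omega(E_i)=-F_i$, $\omega(F_i)=-E_i$, $\omega(K_i)=K_i^{-1}$; $\tau(E_i)=E_{\tau(i)}$, $\tau(F_i)=F_{\tau(i)}$, $\tau(K_i)=K_{\tau(i)}$; $\psi(E_i)=E_iK_i$, $\psi(F_i)=K_i^{-1}F_i$, $\psi(K_i)=K_i$; $T_{w_X}=T_{i_1}\cdots T_{i_k}$ for a reduced expression $w_X=r_{i_1}\cdots r_{i_k}$, $T_i$ being Lusztig's automorphism $T''_{i,1}$ ($T_i(E_i)=-F_iK_i$, $T_i(F_i)=-K_i^{-1}E_i$, $T_i(K_\beta)=K_{r_i(\beta)}$, and for $j\neq i$ $T_i(E_j)=\sum_{r+s=-a_{ij}}(-1)^rq_i^{-r}E_i^{(s)}E_jE_i^{(r)}$, $T_i(F_j)=\sum_{r+s=-a_{ij}}(-1)^rq_i^{r}F_i^{(r)}F_jF_i^{(s)}$ with $x^{(r)}=x^r/[r]_{q_i}!$); $\mathrm{Ad}(s(X,\tau))$ multiplies elements of weight $\alpha\in Q$ by $s(X,\tau)(\alpha)$, where $s(X,\tau):Q\to\mathbb K^\times$ is the group morphism with $s(X,\tau)(\alpha_j)=1$ if $j\in X$ or $\tau(j)=j$, $(\sqrt{-1})^{\alpha_j(2\rho_X^\vee)}$ if $j\notin X$ and $\tau(j)>j$, $(-\sqrt{-1})^{\alpha_j(2\rho_X^\vee)}$ if $j\notin X$ and $\tau(j)<j$. Parameters and generators: $\mathbf c=(c_i)\in(\mathbb K(q)^\times)^{I\setminus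 X}$ with $c_i=c_{\tau(i)}$ whenever $\tau(i)\neq i$ and $(\alpha_i,-w_X\tau(\alpha_i))=0$; $\mathbf s=(s_i)\in\mathbb K(q)^{I\setminus X}$ such that $s_i\ne0$ implies $i\in I_{ns}$ and $a_{ji}\in-2\mathbb N\setminus\{0\}$ for all $j\in I_{ns}\setminus\{i\}$, where $I_{ns}=\{i\in I\setminus X:\tau(i)=i,\ a_{ij}=0\ \forall j\in X\}$. For $i\in I\setminus X$, $B_i=F_i+c_i\theta_q(F_iK_i)K_i^{-1}+s_iK_i^{-1}$; for $i\in X$, $B_i=F_i$. (The quantum symmetric pair coideal subalgebra $B_{\mathbf c,\mathbf s}$ is generated by all $B_i$, by $E_i,K_i^{\pm1}$ with $i\in X$, and by $K_\beta$ with $-w_X\tau(\beta)=\beta$.) $\mathcal M_X^+$ is the subalgebra generated by $E_i$, $i\in X$, and ${U^0_\Theta}'$ the one generated by $K_\beta$ with $\beta\in Q$, $-w_X\tau(\beta)=\beta$. Definition of $\mathcal Z_i$: by a result of Kolb, for each $i\in I\setminus X$ there are a monomial $Z_i^+=E_{j_1}\cdots E_{j_r}$ ($j_1,\dots,j_r\in X$) and $a_i\in\mathbb K(q)$ with $T_{w_X}(E_i)=a_i\,\mathrm{ad}(Z_i^+)(E_i)$, and $v_i\in\mathbb K(q)^\times$ with $\theta_q(F_iK_i)=-v_i\,\mathrm{ad}(Z^+_{\tau(i)})(E_{\tau(i)})$. Then $\mathcal Z_i=-v_i\,\mathrm{ad}(Z^+_{\tau(i)})(K_{\tau(i)}^2)K_{\tau(i)}^{-1}K_i^{-1}$.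 Definition of $\mathcal W_{ij}$ ($i\in I\setminus X$, $\tau(i)=i$, $j\in X$): by a result of Kolb there is $\mathcal W_{ij}\in\mathcal M_X^+$, independent of $\mathbf c$, with $\Delta(B_i)=B_i\otimes K_i^{-1}+1\otimes F_i+c_i\mathcal Z_i\otimes E_iK_i^{-1}+c_i\mathcal W_{ij}K_j\otimes(E_jE_i-q_i^{a_{ij}}E_iE_j)K_i^{-1}+\Upsilon_i$ for some $\Upsilon_i\in\mathcal M_X^+{U^0_\Theta}'\otimes\widehat U_i^+K_i^{-1}$, where $\widehat U_i^+$ is the set of weight vectors $u\in\mathcal M_X^+E_i\mathcal M_X^+$ of weight $\gamma>\alpha_i$, $\gamma\neq\alpha_i+\alpha_j$. Index sets and functions ($a=a_{ij}$): $\zeta^{(r)}_{\boldsymbol\ell,\boldsymbol s}=2|\boldsymbol s|_{1;r-|\boldsymbol\ell|_{1;r}}+|\boldsymbol\ell|_{1;r}-r$. $\mathcal L_{m,m',k}=\{\boldsymbol\ell\in\{0,1\}^{1-a}: |\boldsymbol\ell|_{1;1-a-k}=m,\ |\boldsymbol\ell|_{2-a-k;1-a}=m'\}$. $\mathscr S_{m,m',k,t}=\{\boldsymbol s\in\{0,1\}^{1-a-m-m'}: |\boldsymbol s|=\frac{1-a-m-m'}2,\ |\boldsymbol s|_{1;1-a-k-m}=1-a-k-m-t,\ |\boldsymbol s|_{1;p}\ge\frac p2\ \forall p\in\{1,\dots,1-a-m-m'\}\}$. $\mathcal L'_{m,m',k,d}=\{\boldsymbol\ell\in\{0,1\}^{-a}:|\boldsymbol\ell|=m,\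 |\boldsymbol\ell|_{1;1-a-k+d}=m'\}$. $\mathscr S'_{m,m',k,t,d}=\{\boldsymbol s\in\{0,1\}^{-a-m}:|\boldsymbol s|=\frac{1-a-m}2,\ |\boldsymbol s|_{1;p}\ge\frac{p+\delta^{(p)}}2\ \forall p\in\{1,\dots,-a-m\},\ |\boldsymbol s|_{1;1-a-k-m'+d}=1-a-k-m'-t+d\ne0\}$, where $\delta^{(p)}=0$ if $p<1-a-k+d-m'$ and $\delta^{(p)}=1$ otherwise. $\mathcal R_{k,d}=\{1,\dots,-a\}\setminus\{2-a-k,\dots,1-a-k+d\}$; $\nu_{r,k}=0$ if $r\le1-a-k$, $\nu_{r,k}=1$ if $r>1-a-k$. Scalars: $\alpha_N=(N)_{q_i^2}q_i^{-2N+2}$ for $N\ge 0$ and $\alpha_N=0$ for $N<0$; $\gamma_{M,N}=(N-M)_{q_i^2}q_i^{-a-2N+2}$. For integers $0\le u<b$ and $\boldsymbol N=(N_0,N_1,\dots)$, with $|\boldsymbol N|_{0;p}=N_0+\dots+N_p$, $$c^{(b)}_{u,\boldsymbol N}=\sum_{0\le p_1\le\dots\le p_{b-u}\le u}\ \prod_{r=1}^{b-u}\gamma_{N_0-u+p_r,\ |\boldsymbol N|_{0;b-p_r-r+1}-(b-p_r-r)},\qquad c^{(u)}_{u,\boldsymbol N}=1.$$ Quantities attached to $k,d,t,\boldsymbol\ell,\boldsymbol s$: $T=\zeta^{(1-a-k)}_{\boldsymbol\ell,\boldsymbol s}+t-|\boldsymbol s|_{1;1-a-k-|\boldsymbol\ell|_{1;1-a-k}}$;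 $N_0=\zeta^{(1-a-k)}_{\boldsymbol\ell,\boldsymbol s}$; for $b\in\{1,\dots,T\}$, $N_1+\dots+N_b=|\boldsymbol N|_{1;b}=r_b+a+k-b-1-|\boldsymbol\ell|_{2-a-k;r_b}$ with $$r_b=\sum_{r=2-a-k}^{1-a-k+d}r\,(1-\ell_r)(1-s_{r-|\boldsymbol\ell|_{1;r}})\,\delta_{\,r+a+k-b-1-|\boldsymbol\ell|_{2-a-k;r}\,,\ |\boldsymbol s|_{2-a-k-|\boldsymbol\ell|_{1;1-a-k}\,;\,r-|\boldsymbol\ell|_{1;r}}}$$ (Kronecker delta); and $N_{T+1}$ is determined by $|\boldsymbol N|_{0;T+1}=\zeta^{(1-a-k+d)}_{\boldsymbol\ell,\boldsymbol s}+T$. Also $|\boldsymbol N|_{1;p}=N_1+\dots+N_p$ and $\xi_\lambda=T-|\boldsymbol N|_{1;T+\lambda}+\lambda-1$ for $\lambda\in\{0,1\}$. *)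

(* Defs.v *)
From HB Require Import structures.
From mathcomp Require Import all_boot all_order perm all_algebra.
From mathcomp Require Import boolp classical_sets cardinality fsbigop.
From mathcomp Require Import monalg.

Set Implicit Arguments.
Unset Strict Implicit.
Unset Printing Implicit Defensive.

Import Order.TTheory GRing.Theory Num.Theory.
Local Open Scope ring_scope.
Local Open Scope quotient_scope.

Lemma malg_scaleAr (k : comNzRingType) (M : monomType) (c : k)
  (x y : {malg k[M]}) : c *: (x * y) = x * (c *: y).
Proof.
apply/malgP => m; rewrite mcoeffZ mcoeffMl.
rewrite (mcoeffMlw (d1 := msupp x) (d2 := msupp y)) ?msuppZ_le ?finmap.fsubset_refl //.
rewrite mulr_sumr; apply: eq_bigr => i _; rewrite mulr_sumr; apply: eq_bigr => j _.
by rewrite mcoeffZ mulrnAr mulrCA.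
Qed.

(* The free associative algebra k<G>, as the algebra of the free monoid on G. *)
Definition freealg (k : comNzRingType) (G : choiceType) := {malg k[{fmonom G}]}.

Section FreeAlgebra.
Context (k : comNzRingType) (G : choiceType).

HB.instance Definition _ := GRing.Lalgebra.on (freealg k G).

HB.instance Definition _ :=
  GRing.LSemiAlgebra_isSemiAlgebra.Build k (freealg k G) (@malg_scaleAr k {fmonom G}).

Definition gen (g : G) : freealg k G := << fmu g >>.

Definition word_eval (f : G -> k) (m : {fmonom G}) : k :=
  \prod_(g <- (m : seq G)) f g.

Lemma word_eval_morph f : mmorphism (word_eval f).
Proof.
split=> [x y|]; rewrite /word_eval; last by rewrite fm1 big_nil.
by rewrite fmM big_cat.
Qed.

HB.instance Definition _ f :=
  isMultiplicative.Build {fmonom G} k (word_eval f) (word_eval_morph f).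

Definition character (f : G -> k) : freealg k G -> k := mmap idfun (word_eval f).

HB.instance Definition _ f := GRing.RMorphism.on (character f).

Lemma characterB f x y : character f (x - y) = character f x - character f y.
Proof. exact: (raddfB (character f)). Qed.

Lemma characterM f x y : character f (x * y) = character f x * character f y.
Proof. exact: (rmorphM (character f)). Qed.

Lemma character1 f : character f 1 = 1.
Proof. exact: (rmorph1 (character f)). Qed.

Lemma characterZ f c x : character f (c *: x) = c * character f x.
Proof. exact: mmap_is_linear. Qed.

Lemma character_gen f g : character f (gen g) = f g.
Proof. by rewrite /character /gen mmapU mul1r /word_eval fmU big_seq1. Qed.

End FreeAlgebra.

Section QuotientAlgebra.
Context (k : comNzRingType) (A : algType k) (rel : A -> Prop).

Inductive ideal_gen : A -> Prop :=
| ideal_rel r : rel r -> ideal_gen r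
| ideal_0 : ideal_gen 0
| ideal_D x y : ideal_gen x -> ideal_gen y -> ideal_gen (x + y)
| ideal_M a x b : ideal_gen x -> ideal_gen (a * x * b).

Definition ideal_pred : {pred A} := fun x => `[< ideal_gen x >].

Lemma ideal_predP x : reflect (ideal_gen x) (x \in ideal_pred).
Proof. exact: asboolP. Qed.

Lemma ideal_zmod_closed : zmod_closed ideal_pred.
Proof.
split=> [|x y /ideal_predP hx /ideal_predP hy]; apply/ideal_predP.
  exact: ideal_0.
apply: ideal_D hx _; rewrite -mulN1r -[_ * y]mulr1; exact: ideal_M.
Qed.

HB.instance Definition _ := GRing.isZmodClosed.Build A ideal_pred ideal_zmod_closed.

Definition quotalg := Quotient.quot (ideal_pred : zmodClosed A).

HB.instance Definition _ := GRing.Zmodule.on quotalg.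
HB.instance Definition _ := Choice.on quotalg.
HB.instance Definition _ : EqQuotient A _ quotalg :=
  EqQuotient.on (Quotient.quot (ideal_pred : zmodClosed A)).

Definition quot_pi (x : A) : quotalg := \pi_quotalg x.

Lemma quot_pi_surj u : quot_pi (repr u) = u.
Proof. exact: reprK. Qed.

Lemma quot_pi_eq x y : (quot_pi x = quot_pi y) <-> ideal_gen (x - y).
Proof.
split=> [/eqP|h].
  by rewrite -Quotient.idealrBE => /ideal_predP.
by apply/eqP; rewrite -Quotient.idealrBE; apply/ideal_predP.
Qed.

Lemma quot_piD : {morph quot_pi : x y / x + y}.
Proof. by move=> x y; rewrite /quot_pi Quotient.pi_add. Qed.

Definition quot_one : quotalg := quot_pi 1.
Definition quot_mul (u v : quotalg) : quotalg := quot_pi (repr u * repr v).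
Definition quot_scale (c : k) (u : quotalg) : quotalg := quot_pi (c *: repr u).

Lemma ideal_repr x : ideal_gen (repr (quot_pi x) - x).
Proof. by apply/quot_pi_eq; rewrite quot_pi_surj. Qed.

Lemma ideal_Ml a x : ideal_gen x -> ideal_gen (a * x).
Proof. by move=> h; rewrite -[a * x]mulr1; apply: ideal_M. Qed.

Lemma ideal_Mr b x : ideal_gen x -> ideal_gen (x * b).
Proof. by move=> h; rewrite -[x]mul1r; apply: ideal_M. Qed.

Lemma quot_piM : {morph quot_pi : x y / x * y >-> quot_mul x y}.
Proof.
move=> x y; apply/esym/quot_pi_eq.
rewrite -[_ - _](subrKA (x * repr (quot_pi y))) -mulrBl -mulrBr.
by apply: ideal_D; [apply: ideal_Mr|apply: ideal_Ml]; apply: ideal_repr.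
Qed.

Lemma quot_piZ c x : quot_pi (c *: x) = quot_scale c (quot_pi x).
Proof.
apply/esym/quot_pi_eq; rewrite -scalerBr -[_ - _]mul1r scalerAl.
exact/ideal_Ml/ideal_repr.
Qed.

Lemma quot_mulA : associative quot_mul.
Proof.
move=> x y z; rewrite -[x]quot_pi_surj -[y]quot_pi_surj -[z]quot_pi_surj.
by rewrite -!quot_piM mulrA.
Qed.

Lemma quot_mul1l : left_id quot_one quot_mul.
Proof. by move=> x; rewrite -[x]quot_pi_surj -quot_piM mul1r. Qed.

Lemma quot_mul1r : right_id quot_one quot_mul.
Proof. by move=> x; rewrite -[x]quot_pi_surj -quot_piM mulr1. Qed.

Lemma quot_mulDl : left_distributive quot_mul +%R.
Proof.
move=> x y z; rewrite -[x]quot_pi_surj -[y]quot_pi_surj -[z]quot_pi_surj.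
by rewrite -quot_piD -!quot_piM -quot_piD mulrDl.
Qed.

Lemma quot_mulDr : right_distributive quot_mul +%R.
Proof.
move=> x y z; rewrite -[x]quot_pi_surj -[y]quot_pi_surj -[z]quot_pi_surj.
by rewrite -quot_piD -!quot_piM -quot_piD mulrDr.
Qed.

HB.instance Definition _ := GRing.Zmodule_isPzRing.Build quotalg
  quot_mulA quot_mul1l quot_mul1r quot_mulDl quot_mulDr.

Lemma quot_scaleA a b u : quot_scale a (quot_scale b u) = quot_scale (a * b) u.
Proof. by rewrite -[u]quot_pi_surj -!quot_piZ scalerA. Qed.

Lemma quot_scale1 : left_id 1 quot_scale.
Proof. by move=> u; rewrite -[u]quot_pi_surj -!quot_piZ scale1r. Qed.

Lemma quot_scaleDr : right_distributive quot_scale +%R.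
Proof.
move=> c u v; rewrite -[u]quot_pi_surj -[v]quot_pi_surj.
by rewrite -quot_piD -!quot_piZ -quot_piD scalerDr.
Qed.

Lemma quot_scaleDl u : {morph quot_scale^~ u : a b / a + b}.
Proof.
by move=> a b; rewrite -[u]quot_pi_surj -!quot_piZ -quot_piD scalerDl.
Qed.

HB.instance Definition _ := GRing.Zmodule_isLmodule.Build k quotalg
  quot_scaleA quot_scale1 quot_scaleDr quot_scaleDl.

Lemma quot_scaleAl (c : k) (u v : quotalg) : c *: (u * v) = c *: u * v.
Proof.
rewrite -[u]quot_pi_surj -[v]quot_pi_surj.
by rewrite -[LHS]/(quot_scale _ (quot_mul _ _)) -[RHS]/(quot_mul (quot_scale _ _) _)
           -quot_piM -!quot_piZ -quot_piM scalerAl.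
Qed.

Lemma quot_scaleAr (c : k) (u v : quotalg) : c *: (u * v) = u * (c *: v).
Proof.
rewrite -[u]quot_pi_surj -[v]quot_pi_surj.
by rewrite -[LHS]/(quot_scale _ (quot_mul _ _)) -[RHS]/(quot_mul _ (quot_scale _ _))
           -quot_piM -!quot_piZ -quot_piM scalerAr.
Qed.

Lemma quot_pi_zmod : zmod_morphism quot_pi.
Proof.
move=> x y; rewrite quot_piD; congr (_ + _).
apply: (addrI (quot_pi y)); rewrite -quot_piD !subrr.
by apply: (addrI (quot_pi 0)); rewrite -quot_piD !addr0.
Qed.

HB.instance Definition _ := GRing.isZmodMorphism.Build A quotalg quot_pi quot_pi_zmod.
HB.instance Definition _ := GRing.isMonoidMorphism.Build A quotalg quot_pi
  (erefl, quot_piM).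
HB.instance Definition _ := GRing.isScalable.Build k A quotalg *:%R quot_pi quot_piZ.

Section Lift.
Context (f : {rmorphism A -> k}) (frel : forall r, rel r -> f r = 0).

Definition quot_lift (u : quotalg) : k := f (repr u).

Lemma quot_lift_pi x : quot_lift (quot_pi x) = f x.
Proof.
apply/eqP; rewrite -subr_eq0 -rmorphB; apply/eqP.
elim: {x} (ideal_repr x) => [r|//|x y _ hx _ hy|a x b _ hx].
- exact: frel.
- by rewrite rmorph0.
- by rewrite rmorphD hx hy addr0.
- by rewrite !rmorphM hx mulr0 mul0r.
Qed.

Lemma quot_liftB : {morph quot_lift : u v / u - v}.
Proof.
move=> u v; rewrite -[u]quot_pi_surj -[v]quot_pi_surj -raddfB !quot_lift_pi.
exact: rmorphB.
Qed.

Lemma quot_liftM : {morph quot_lift : u v / u * v}.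
Proof.
move=> u v; rewrite -[u]quot_pi_surj -[v]quot_pi_surj -rmorphM !quot_lift_pi.
exact: rmorphM.
Qed.

Lemma quot_lift1 : quot_lift 1 = 1.
Proof. by rewrite -(rmorph1 quot_pi) quot_lift_pi rmorph1. Qed.

Lemma quotalg_neq0 : 1 != 0 :> quotalg.
Proof.
apply/eqP => /(congr1 quot_lift); rewrite quot_lift1 -[0](rmorph0 quot_pi).
by rewrite quot_lift_pi rmorph0 => /eqP; rewrite oner_eq0.
Qed.

End Lift.

End QuotientAlgebra.

Section TensorAlgebra.
Context (k : comNzRingType) (A B : algType k).

(* A (x) B presented by the symbols x (x) y: bilinearity makes the span of the
   symbols the tensor product of modules, and the last two families of relators
   give it the product (x (x) y)(x' (x) y') = xx' (x) yy', with unit 1 (x) 1. *)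
Inductive tensor_rel : freealg k (A * B)%type -> Prop :=
| tensor_addl a a' b : tensor_rel (gen k (a + a', b) - gen k (a, b) - gen k (a', b))
| tensor_addr a b b' : tensor_rel (gen k (a, b + b') - gen k (a, b) - gen k (a, b'))
| tensor_scalel c a b : tensor_rel (gen k (c *: a, b) - c *: gen k (a, b))
| tensor_scaler c a b : tensor_rel (gen k (a, c *: b) - c *: gen k (a, b))
| tensor_mul a b a' b' :
    tensor_rel (gen k (a, b) * gen k (a', b') - gen k (a * a', b * b'))
| tensor_one : tensor_rel (gen k (1, 1) - 1).

Definition tensor := quotalg tensor_rel.

Lemma tensor_rel_counit (f : {rmorphism A -> k}) (h : {rmorphism B -> k}) :
    (forall c x, f (c *: x) = c * f x) -> (forall c x, h (c *: x) = c * h x) ->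
  forall r, tensor_rel r -> character (fun p => f p.1 * h p.2) r = 0.
Proof.
move=> fZ hZ r; case: r /.
- move=> a a' b.
  by rewrite !characterB !character_gen /= rmorphD mulrDl addrAC addrK subrr.
- move=> a b b'.
  by rewrite !characterB !character_gen /= rmorphD mulrDr addrAC addrK subrr.
- by move=> c a b; rewrite characterB characterZ !character_gen /= fZ mulrA subrr.
- by move=> c a b; rewrite characterB characterZ !character_gen /= hZ mulrCA subrr.
- move=> a b a' b'; rewrite characterB characterM !character_gen /= !rmorphM.
  by rewrite mulrACA subrr.
- rewrite characterB character1 character_gen -[X in _ - X]mulr1.
  by apply/eqP; rewrite subr_eq0 [_.1]/= [_.2]/= (rmorph1 f) (rmorph1 h).
Qed.

Definition pure (x : A) (y : B) : tensor := quot_pi tensor_rel (gen k (x, y)).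

End TensorAlgebra.

Notation "x '(x)' y" := (pure x y) (at level 40, left associativity).

(* [sweedler t] is some decomposition of t as a finite sum of pure tensors. *)
Definition sweedler (k : comNzRingType) (A B : algType k) (t : tensor A B) :
    seq (A * B) :=
  xget [::] [set s : seq (A * B) | t = \sum_(p <- s) p.1 (x) p.2]%classic.

Inductive span (k : pzRingType) (V : lmodType k) (S : V -> Prop) : V -> Prop :=
| span_in v : S v -> span S v
| span_0 : span S 0
| span_D u v : span S u -> span S v -> span S (u + v)
| span_Z c v : span S v -> span S (c *: v).

Inductive subalg_gen (k : comNzRingType) (A : algType k) (S : A -> Prop) : A -> Prop :=
| subalg_in x : S x -> subalg_gen S x
| subalg_1 : subalg_gen S 1
| subalg_D x y : subalg_gen S x -> subalg_gen S y -> subalg_gen S (x + y)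
| subalg_M x y : subalg_gen S x -> subalg_gen S y -> subalg_gen S (x * y)
| subalg_Z c x : subalg_gen S x -> subalg_gen S (c *: x).

Section QuantumIntegers.
Context (F : fieldType).
Implicit Types x y : F.

Definition qint x (m : int) : F := (x ^ m - x ^ (- m)) / (x - x^-1).
Definition qfact x (m : nat) : F := \prod_(1 <= l < m.+1) qint x l.
Definition qbinom x (N m : nat) : F := qfact x N / (qfact x m * qfact x (N - m)).
Definition qround y (N : int) : F := (1 - y ^ N) / (1 - y).

End QuantumIntegers.

(* F_ij(X, Y), with x = q_i and N = 1 - a_ij *)
Definition serre (F : fieldType) (A : algType F) (x : F) (N : nat) (X Y : A) : A :=
  \sum_(0 <= l < N.+1) ((-1) ^+ l * qbinom x N l) *: (X ^+ (N - l) * Y * X ^+ l).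

Inductive uq_gen (n : nat) : Type :=
| genE of 'I_n | genF of 'I_n | genK of 'I_n | genKV of 'I_n.

Section UqGenChoice.
Context (n : nat).

Definition uq_gen_code (g : uq_gen n) : 'I_4 * 'I_n :=
  match g with
  | genE i => (inord 0, i) | genF i => (inord 1, i)
  | genK i => (inord 2, i) | genKV i => (inord 3, i)
  end.

Definition uq_gen_decode (c : 'I_4 * 'I_n) : uq_gen n :=
  match val c.1 with
  | 0 => genE c.2 | 1 => genF c.2 | 2 => genK c.2 | _ => genKV c.2
  end%N.

Lemma uq_gen_codeK : cancel uq_gen_code uq_gen_decode.
Proof. by case=> i; rewrite /uq_gen_decode /= inordK. Qed.

HB.instance Definition _ := Choice.copy (uq_gen n) (can_type uq_gen_codeK).

End UqGenChoice.

Section Relators.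
Context (F : fieldType) (n : nat) (A : 'M[int]_n) (qi : 'I_n -> F).
Context (U : algType F) (E Fm Kp Kn : 'I_n -> U).

Inductive uq_rel : U -> Prop :=
| uq_KKV i : uq_rel (Kp i * Kn i - 1)
| uq_KVK i : uq_rel (Kn i * Kp i - 1)
| uq_KK i j : uq_rel (Kp i * Kp j - Kp j * Kp i)
| uq_KE i j : uq_rel (Kp i * E j - qi i ^ A i j *: (E j * Kp i))
| uq_KF i j : uq_rel (Kp i * Fm j - qi i ^ (- A i j) *: (Fm j * Kp i))
| uq_EF i j : uq_rel (E i * Fm j - Fm j * E i
    - ((i == j)%:R / (qi i - (qi i)^-1)) *: (Kp i - Kn i))
| uq_serreE i j : i != j -> uq_rel (serre (qi i) `|1 - A i j|%N (E i) (E j))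
| uq_serreF i j : i != j -> uq_rel (serre (qi i) `|1 - A i j|%N (Fm i) (Fm j)).

Lemma uq_rel_counit (f : {rmorphism U -> F}) :
    (forall c u, f (c *: u) = c * f u) ->
    (forall i, [/\ f (E i) = 0, f (Fm i) = 0, f (Kp i) = 1 & f (Kn i) = 1]) ->
  forall r, uq_rel r -> f r = 0.
Proof.
move=> fZ fg; have fE i : f (E i) = 0 by case: (fg i).
have fF i : f (Fm i) = 0 by case: (fg i).
have fK i : f (Kp i) = 1 by case: (fg i).
have fV i : f (Kn i) = 1 by case: (fg i).
have fserre x N X Y : f Y = 0 -> f (serre x N X Y) = 0.
  move=> Y0; rewrite raddf_sum big1 // => l _.
  by rewrite /= fZ !rmorphM /= Y0 mulr0 mul0r mulr0.
move=> r; case: r / => [i|i|i j|i j|i j|i j|i j _|i j _]; rewrite ?fserre //;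
  rewrite !(rmorphB, rmorphM, rmorph1, fZ) /= ?(fE, fF, fK, fV) ?(mulr0, mul0r, mulr1) ?subrr //.
by rewrite mulr0 subr0.
Qed.

End Relators.

Section QuantumGroup.
Context (F : fieldType) (n : nat) (A : 'M[int]_n) (qi : 'I_n -> F).

Let g : uq_gen n -> freealg F (uq_gen n) := @gen F (uq_gen n).

Definition Uq := quotalg
  (uq_rel A qi (fun i => g (genE i)) (fun i => g (genF i))
               (fun i => g (genK i)) (fun i => g (genKV i))).

Definition counit_gen (g : uq_gen n) : F :=
  match g with genE _ | genF _ => 0 | genK _ | genKV _ => 1 end.

Let chi : {rmorphism freealg F (uq_gen n) -> F} := character counit_gen.

Lemma counit_genP i : [/\ chi (g (genE i)) = 0, chi (g (genF i)) = 0,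
  chi (g (genK i)) = 1 & chi (g (genKV i)) = 1].
Proof. by split; apply: character_gen. Qed.

HB.instance Definition _ := GRing.PzRing.on Uq.
HB.instance Definition _ := GRing.Lmodule.on Uq.
HB.instance Definition _ := GRing.PzSemiRing_isNonZero.Build Uq
  (quotalg_neq0 (f := chi)
    (uq_rel_counit (A := A) (qi := qi) (f := chi) (characterZ counit_gen) counit_genP)).
HB.instance Definition _ := GRing.LSemiModule_isLSemiAlgebra.Build F Uq
  (@quot_scaleAl _ _ _).
HB.instance Definition _ := GRing.LSemiAlgebra_isSemiAlgebra.Build F Uq
  (@quot_scaleAr _ _ _).

Definition uq_counit : Uq -> F := quot_lift chi.

Let chi_rel := uq_rel_counit (A := A) (qi := qi) (f := chi) (characterZ counit_gen) counit_genP.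

HB.instance Definition _ := GRing.isZmodMorphism.Build Uq F uq_counit
  (quot_liftB chi_rel).
HB.instance Definition _ := GRing.isMonoidMorphism.Build Uq F uq_counit
  (quot_lift1 chi_rel, quot_liftM chi_rel).

Lemma uq_counitZ c u : uq_counit (c *: u) = c * uq_counit u.
Proof.
rewrite -[u]quot_pi_surj -[_ *: _]quot_piZ /uq_counit !(quot_lift_pi chi_rel).
exact: characterZ.
Qed.

Definition Uq2 := tensor Uq Uq.

HB.instance Definition _ := GRing.PzRing.on Uq2.
HB.instance Definition _ := GRing.Lmodule.on Uq2.
HB.instance Definition _ := GRing.PzSemiRing_isNonZero.Build Uq2
  (quotalg_neq0 (tensor_rel_counit (f := uq_counit) (h := uq_counit)
    uq_counitZ uq_counitZ)).
HB.instance Definition _ := GRing.LSemiModule_isLSemiAlgebra.Build F Uq2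
  (@quot_scaleAl _ _ _).
HB.instance Definition _ := GRing.LSemiAlgebra_isSemiAlgebra.Build F Uq2
  (@quot_scaleAr _ _ _).

End QuantumGroup.

Section RootDatum.
Context (n : nat) (A : 'M[int]_n).

(* Elements of the root lattice, and of the coroot lattice, are given by their
   coordinates on the simple (co)roots. *)
Notation lattice := 'rV[int]_n.

Definition gcm (eps : 'I_n -> nat) : Prop :=
  [/\ [/\ forall i, A i i = 2,
       forall i j, i != j -> A i j <= 0 &
       forall i j, A i j = 0 <-> A j i = 0],
      forall J : {set 'I_n}, J != finset.set0 ->
        (forall i j, i \in J -> j \notin J -> A i j = 0) -> J = finset.setT,
      forall i, (0 < eps i)%N,
      (\big[gcdn/0]_i eps i = 1)%N &
      forall i j, (eps i)%:Z * A i j = (eps j)%:Z * A j i].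

Definition simple (i : 'I_n) : lattice := delta_mx 0 i.

(* al(h), from alpha_j(h_i) = a_ij *)
Definition pairing (al h : lattice) : int :=
  \sum_i \sum_j h 0 i * al 0 j * A i j.

Definition refl_root (i : 'I_n) (al : lattice) : lattice :=
  al - pairing al (simple i) *: simple i.
Definition refl_coroot (i : 'I_n) (h : lattice) : lattice :=
  h - pairing (simple i) h *: simple i.

Definition weyl_root (w : seq 'I_n) (al : lattice) : lattice :=
  foldr refl_root al w.
Definition weyl_coroot (w : seq 'I_n) (h : lattice) : lattice :=
  foldr refl_coroot h w.

Definition bform (eps : 'I_n -> nat) (al be : lattice) : int :=
  \sum_i \sum_j al 0 i * be 0 j * ((eps i)%:Z * A i j).

(* Two words represent the same element of the Weyl group iff they act in the
   same way on the root lattice, since that action is faithful. *)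
Definition reduced (w : seq 'I_n) : Prop :=
  forall v, weyl_root v =1 weyl_root w -> (size w <= size v)%N.

Section Parabolic.
Context (X : {set 'I_n}) (tau : {perm 'I_n}).

Definition word_in (w : seq 'I_n) : bool := all (fun i => i \in X) w.

(* A parabolic subset is of finite type iff its Weyl group W_X is finite. *)
Definition finite_type : Prop :=
  finite_set [set f | exists2 w, word_in w & f = weyl_root w]%classic.

Definition longest_word (w : seq 'I_n) : Prop :=
  [/\ word_in w, reduced w &
      forall v, word_in v -> reduced v -> (size v <= size w)%N].

Definition positive_coroots : set lattice :=
  [set h | (exists w j, [/\ word_in w, j \in X & h = weyl_coroot w (simple j)])
           /\ forall k, 0 <= h 0 k]%classic.

(* 2 rho_X^vee *)
Definition two_rho : lattice := \sum_(h \in positive_coroots) h.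

Definition tau_root (al : lattice) : lattice := \sum_i al 0 i *: simple (tau i).

Record admissible (wX : seq 'I_n) : Prop := Admissible {
  adm_finite : finite_type;
  adm_longest : longest_word wX;
  adm_tauX : forall i, (tau i \in X) = (i \in X);
  adm_tauA : forall i j, A (tau i) (tau j) = A i j;
  adm_tauK : forall i, tau (tau i) = i;
  adm_coroot : forall j, j \in X -> simple (tau j) = - weyl_coroot wX (simple j);
  adm_root : forall j, j \in X -> simple (tau j) = - weyl_root wX (simple j);
  (* alpha_i(rho_X^vee) is an integer *)
  adm_rho : forall i, i \notin X -> tau i = i ->
    exists z : int, pairing (simple i) two_rho = 2 * z
}.

Definition Theta (wX : seq 'I_n) (al : lattice) : lattice :=
  - weyl_root wX (tau_root al).

Definition I_ns : {set 'I_n} :=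
  [set i | [&& i \notin X, tau i == i & [forall (j | j \in X), A i j == 0]]].

End Parabolic.
End RootDatum.

Section Generators.
Context (F : fieldType) (n : nat) (A : 'M[int]_n) (qi : 'I_n -> F).

Definition uE (i : 'I_n) : Uq A qi := quot_pi _ (gen F (genE i)).
Definition uF (i : 'I_n) : Uq A qi := quot_pi _ (gen F (genF i)).
Definition uK (i : 'I_n) : Uq A qi := quot_pi _ (gen F (genK i)).
Definition uKV (i : 'I_n) : Uq A qi := quot_pi _ (gen F (genKV i)).

Definition uKz (i : 'I_n) (m : int) : Uq A qi :=
  match m with Posz k => uK i ^+ k | Negz k => uKV i ^+ k.+1 end.
Definition uKbeta (be : 'rV[int]_n) : Uq A qi := \prod_i uKz i (be 0 i).

(* [weight al u]: u lies in the component of degree al of the Q-grading *)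
Inductive weight : 'rV[int]_n -> Uq A qi -> Prop :=
| weight_E i : weight (simple i) (uE i)
| weight_F i : weight (- simple i) (uF i)
| weight_K i : weight 0 (uK i)
| weight_KV i : weight 0 (uKV i)
| weight_1 : weight 0 1
| weight_0 al : weight al 0
| weight_D al u v : weight al u -> weight al v -> weight al (u + v)
| weight_Z al c u : weight al u -> weight al (c *: u)
| weight_M al be u v : weight al u -> weight be v -> weight (al + be) (u * v).

Definition divpow (x : F) (u : Uq A qi) (r : nat) : Uq A qi :=
  (qfact x r)^-1 *: u ^+ r.

Record hopf_maps := HopfMaps {
  comul : {lrmorphism Uq A qi -> Uq2 A qi};
  counit : {rmorphism Uq A qi -> F};
  antipode : {linear Uq A qi -> Uq A qi};
  comulE : forall i, comul (uE i) = uE i (x) 1 + uK i (x) uE i;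
  comulF : forall i, comul (uF i) = uF i (x) uKV i + 1 (x) uF i;
  comulK : forall i, comul (uK i) = uK i (x) uK i;
  counitZ : forall c u, counit (c *: u) = c * counit u;
  counitE : forall i, counit (uE i) = 0;
  counitF : forall i, counit (uF i) = 0;
  counitK : forall i, counit (uK i) = 1;
  antipode1 : antipode 1 = 1;
  antipodeM : forall u v, antipode (u * v) = antipode v * antipode u;
  antipodeE : forall i, antipode (uE i) = - (uKV i * uE i);
  antipodeF : forall i, antipode (uF i) = - (uF i * uK i);
  antipodeK : forall i, antipode (uK i) = uKV i
}.

Definition ad (H : hopf_maps) (x u : Uq A qi) : Uq A qi :=
  \sum_(p <- sweedler (comul H x)) p.1 * u * antipode H p.2.

Section Theta.
Context (X : {set 'I_n}) (tau : {perm 'I_n}) (sqrtm1 : F).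

Definition s_simple (j : 'I_n) : F :=
  if (j \in X) || (tau j == j) then 1
  else (if (j < tau j)%N then sqrtm1 else - sqrtm1)
         ^ pairing A (simple j) (two_rho A X).

Definition s_char (al : 'rV[int]_n) : F := \prod_j s_simple j ^ al 0 j.

(* [lusztig i] is Lusztig's T''_{i,1}, and [Ads] is Ad(s(X, tau)). The maps are
   unique, being determined on generators (or on weight vectors for Ads). *)
Record theta_maps := ThetaMaps {
  om : {lrmorphism Uq A qi -> Uq A qi};
  tauU : {lrmorphism Uq A qi -> Uq A qi};
  psi : {lrmorphism Uq A qi -> Uq A qi};
  lusztig : 'I_n -> {lrmorphism Uq A qi -> Uq A qi};
  Ads : {linear Uq A qi -> Uq A qi};
  omE : forall i, om (uE i) = - uF i;
  omF : forall i, om (uF i) = - uE i;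
  omK : forall i, om (uK i) = uKV i;
  tauUE : forall i, tauU (uE i) = uE (tau i);
  tauUF : forall i, tauU (uF i) = uF (tau i);
  tauUK : forall i, tauU (uK i) = uK (tau i);
  psiE : forall i, psi (uE i) = uE i * uK i;
  psiF : forall i, psi (uF i) = uKV i * uF i;
  psiK : forall i, psi (uK i) = uK i;
  lusztigEi : forall i, lusztig i (uE i) = - (uF i * uK i);
  lusztigFi : forall i, lusztig i (uF i) = - (uKV i * uE i);
  lusztigK : forall i be, lusztig i (uKbeta be) = uKbeta (refl_root A i be);
  lusztigEj : forall i j, j != i -> lusztig i (uE j) =
    \sum_(0 <= r < `|A i j|%N.+1) ((-1) ^+ r * qi i ^- r) *:
      (divpow (qi i) (uE i) (`|A i j| - r) * uE j * divpow (qi i) (uE i) r);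
  lusztigFj : forall i j, j != i -> lusztig i (uF j) =
    \sum_(0 <= r < `|A i j|%N.+1) ((-1) ^+ r * qi i ^+ r) *:
      (divpow (qi i) (uF i) r * uF j * divpow (qi i) (uF i) (`|A i j| - r));
  AdsE : forall al u, weight al u -> Ads u = s_char al *: u
}.

Definition Tw (Th : theta_maps) (w : seq 'I_n) (u : Uq A qi) : Uq A qi :=
  foldr (fun i v => lusztig Th i v) u w.

Definition thetaq (Th : theta_maps) (wX : seq 'I_n) (u : Uq A qi) : Uq A qi :=
  Ads Th (Tw Th wX (psi Th (tauU Th (om Th u)))).

End Theta.

Section Coideal.
Context (eps : 'I_n -> nat) (X : {set 'I_n}) (tau : {perm 'I_n}).
Context (wX : seq 'I_n) (sqrtm1 : F).
Context (H : hopf_maps) (Th : theta_maps X tau sqrtm1).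

(* The families c and s are indexed by all of I; only their values outside X
   are constrained and used. *)
Record parameters (c s : 'I_n -> F) : Prop := MkParameters {
  c_neq0 : forall i, i \notin X -> c i != 0;
  c_tau : forall i, i \notin X -> tau i != i ->
    bform A eps (simple i) (Theta A tau wX (simple i)) = 0 -> c i = c (tau i);
  s_ns : forall i, i \notin X -> s i != 0 -> i \in I_ns A X tau /\
    forall j, j \in I_ns A X tau -> j != i ->
      A j i != 0 /\ exists k : nat, A j i = - (2 * k)%:Z
}.

Definition Bgen (c s : 'I_n -> F) (i : 'I_n) : Uq A qi :=
  if i \in X then uF i
  else uF i + c i *: (thetaq Th wX (uF i * uK i) * uKV i) + s i *: uKV i.

Definition MXplus : Uq A qi -> Prop :=
  subalg_gen (fun u => exists2 i, i \in X & u = uE i).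

Definition U0Theta : Uq A qi -> Prop :=
  subalg_gen (fun u => exists2 be, Theta A tau wX be = be & u = uKbeta be).

Definition monoE (w : seq 'I_n) : Uq A qi := \prod_(j <- w) uE j.

(* Possible choices of monomials Z_i^+ (given as words in X) and of scalars a_i, v_i *)
Record Zchoice (Zw : 'I_n -> seq 'I_n) (az v : 'I_n -> F) : Prop := ZChoice {
  Zw_X : forall i, i \notin X -> word_in X (Zw i);
  Zw_T : forall i, i \notin X ->
    Tw Th wX (uE i) = az i *: ad H (monoE (Zw i)) (uE i);
  Zw_neq0 : forall i, i \notin X -> v i != 0;
  Zw_theta : forall i, i \notin X -> thetaq Th wX (uF i * uK i) =
    - (v i *: ad H (monoE (Zw (tau i))) (uE (tau i)))
}.

Definition calZ (Zw : 'I_n -> seq 'I_n) (v : 'I_n -> F) (i : 'I_n) : Uq A qi :=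
  - (v i *: (ad H (monoE (Zw (tau i))) (uK (tau i) ^+ 2) * uKV (tau i) * uKV i)).

Definition Uhat (i j : 'I_n) (u : Uq A qi) : Prop :=
  span (fun x => exists m m', [/\ MXplus m, MXplus m' & x = m * uE i * m']) u /\
  exists ga, [/\ weight ga u, forall k, (simple i : 'rV[int]_n) 0 k <= ga 0 k,
                 ga != simple i & ga != simple i + simple j].

(* W does not depend on c and s, whereas the remainder Y may. *)
Definition calW (Zw : 'I_n -> seq 'I_n) (v : 'I_n -> F) (i j : 'I_n) (W : Uq A qi) :
    Prop :=
  MXplus W /\
  forall c s, parameters c s -> exists2 Y : Uq2 A qi,
    span (fun t => exists m z u,
      [/\ MXplus m, U0Theta z, Uhat i j u & t = (m * z) (x) (u * uKV i)]) Y &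
    comul H (Bgen c s i) =
      Bgen c s i (x) uKV i + 1 (x) uF i + c i *: (calZ Zw v i (x) (uE i * uKV i))
      + c i *: ((W * uK j) (x)
          ((uE j * uE i - qi i ^ A i j *: (uE i * uE j)) * uKV i))
      + Y.

End Coideal.
End Generators.

(* The scalars rho and sigma, for q_i = x, q_j = y, c_i = c and a_ij = - p.
   Binary tuples are boolean sequences, indexed from 1. The halves (1 - a - m)/2
   and the like are rounded down; in the cases where they are not integers the
   prefactor [parity] vanishes. *)
Section Coefficients.
Context (F : fieldType) (x y c : F) (p : nat).

Let a : int := - p%:Z.

Definition parity (d : int) : int := d - 2 * (d %/ 2)%Z.

(* l_r, and |l|_{r;s} *)
Definition entry (l : seq bool) (r : nat) : bool := nth false l r.-1.
Definition psum (l : seq bool) (r s : nat) : nat :=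
  (\sum_(r <= u < s.+1) entry l u)%N.

(* (1 - l_r) s_{r - |l|_{1;r}} and (1 - l_r) (1 - s_{r - |l|_{1;r}}) *)
Definition sel1 (l s : seq bool) (r : nat) : bool :=
  ~~ entry l r && entry s (r - psum l 1 r).
Definition sel0 (l s : seq bool) (r : nat) : bool :=
  ~~ entry l r && ~~ entry s (r - psum l 1 r).

Definition zeta (l s : seq bool) (r : nat) : int :=
  2 * (psum s 1 (r - psum l 1 r))%:Z + (psum l 1 r)%:Z - r%:Z.

Definition in_L (m m' k : nat) (l : seq bool) : bool :=
  (psum l 1 (p.+1 - k) == m) && (psum l (p.+2 - k) p.+1 == m').

Definition in_S (m m' k t : nat) (s : seq bool) : bool :=
  [&& 2 * psum s 1 (p.+1 - m - m') == p.+1 - m - m',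
      ((psum s 1 (p.+1 - k - m))%:Z == (p.+1 - k - m)%N%:Z - t%:Z :> int)%R &
      all (fun u => u <= 2 * psum s 1 u) (iota 1 (p.+1 - m - m'))]%N.

Definition theta_exp (l s : seq bool) (k : nat) : int :=
  - a * zeta l s (p.+1 - k) - 2 * \sum_(1 <= r < p.+2) zeta l s r.-1.

Definition rho (m m' t : nat) : F :=
  (parity (a + m%:Z + m'%:Z))%:~R
  * (c * x ^+ 2 / (x - x^-1)) ^+ (p.+1 - m - m')./2
  * \sum_(m' <= k < p.+2 - m)
    \sum_(l : p.+1.-tuple bool | in_L m m' k l)
    \sum_(s : (p.+1 - m - m').-tuple bool | in_S m m' k t s)
      (-1) ^+ k.+1 * qbinom x p.+1 k * x ^ theta_exp l s k
      * \prod_(1 <= r < p.+2) qround (x ^+ 2) (zeta l s r.-1 + 1) ^+ sel1 l s r.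

Definition in_L' (m m' k d : nat) (l : seq bool) : bool :=
  (psum l 1 p == m) && (psum l 1 (p.+1 - k + d) == m').

Definition in_S' (m m' k t d : nat) (s : seq bool) : bool :=
  let M := (p.+1 - k + d - m')%N in
  [&& 2 * psum s 1 (p - m) == p.+1 - m,
      all (fun u => u + (M <= u) <= 2 * psum s 1 u) (iota 1 (p - m)),
      ((psum s 1 M)%:Z == M%:Z - t%:Z :> int)%R &
      (M%:Z - t%:Z != 0 :> int)%R]%N.

Definition alphaN (N : int) : F :=
  if N < 0 then 0 else qround (x ^+ 2) N * x ^ (- 2 * N + 2).

Definition gammaMN (M N : int) : F :=
  qround (x ^+ 2) (N - M) * x ^ (- a - 2 * N + 2).

(* |N|_{r;p} *)
Definition isum (N : nat -> int) (r p : nat) : int := \sum_(r <= b < p.+1) N b.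

(* c^{(b)}_{u,N}; the tuple P lists p_1, ..., p_{b-u}, so r below is one less
   than in the usual indexing of the factors from 1 to b - u. *)
Definition cbuN (N : nat -> int) (b u : nat) : F :=
  if (u < b)%N then
    \sum_(P : (b - u).-tuple 'I_u.+1 | sorted (fun e f : 'I_u.+1 => (e <= f)%N) P)
      \prod_(r < b - u)
        let e := (b - tnth P r - r.+1)%N in
        gammaMN (N 0%N - u%:Z + (tnth P r)%:Z) (isum N 0 e.+1 - e%:Z)
  else 1.

Section Quantities.
Context (k d m' t : nat) (l s : seq bool).

(* T is a natural number whenever l is in L' and s in S'. *)
Definition T_ : nat :=
  absz (zeta l s (p.+1 - k) + t%:Z
        - (psum s 1 (p.+1 - k - psum l 1 (p.+1 - k)))%:Z)%R.

Definition r_b (b : nat) : nat :=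
  (\sum_(p.+2 - k <= r < (p.+1 - k + d).+1) r * sel0 l s r *
    (r%:Z + a + k%:Z - b%:Z - 1 - (psum l (p.+2 - k) r)%:Z ==
     (psum s (p.+2 - k - psum l 1 (p.+1 - k)) (r - psum l 1 r))%:Z :> int)%R)%N.

(* N_1 + ... + N_b for b <= T + 1 *)
Definition Ncum (b : nat) : int :=
  if b == 0%N then 0
  else if (b <= T_)%N then
    (r_b b)%:Z + a + k%:Z - b%:Z - 1 - (psum l (p.+2 - k) (r_b b))%:Z
  else zeta l s (p.+1 - k + d) + T_%:Z - zeta l s (p.+1 - k).

Definition N_ (b : nat) : int :=
  if b is b'.+1 then Ncum b - Ncum b' else zeta l s (p.+1 - k).

Definition xi (la : nat) : int := T_%:Z - isum N_ 1 (T_ + la) + la%:Z - 1.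

Definition omega0 (u : nat) : F :=
  alphaN (zeta l s (p.+1 - k + d)) * cbuN N_ T_.-1 u
  * (x ^ a * alphaN (N_ 0 - u%:Z)
     + gammaMN (N_ 0 - u%:Z) (isum N_ 0 T_ - (T_%:Z - 1)))
  * \prod_(0 <= r < u) alphaN (N_ 0 - r%:Z).

Definition omega1 (u : nat) : F :=
  - x ^ a * cbuN N_ T_ u
  * (x ^ a * alphaN (N_ 0 - u%:Z)
     + gammaMN (N_ 0 - u%:Z) (isum N_ 0 T_.+1 - T_%:Z))
  * \prod_(0 <= r < u) alphaN (N_ 0 - r%:Z).

Definition kappa : int :=
  - 2 * (\sum_(1 <= r < p.+1) zeta l s r.-1 * (entry l r + sel0 l s r)%N%:Z)
  - a * (N_ 0 - isum N_ 1 T_.+1 - m'%:Z + d%:Z)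
  + 2 * (k%:Z + t%:Z - d%:Z - 1).

Definition sigma_prod : F :=
  \prod_(1 <= r < p.+1 | ~~ (p.+2 - k <= r <= p.+1 - k + d)%N)
    alphaN (zeta l s r.-1 - (p.+1 - k < r)%N%:Z) ^+ sel0 l s r.

Definition sigma_sum : F :=
  \sum_(0 <= u < T_ | xi 0 <= u%:Z) x ^ (a * u%:Z) * omega0 u
  + \sum_(0 <= u < T_.+1 | xi 1 <= u%:Z) x ^ (a * u%:Z) * omega1 u.

Definition sigma_zero : F :=
  alphaN (zeta l s (p.+1 - k + d))
  - x ^ a * (x ^ a * alphaN (N_ 0) + gammaMN (N_ 0) (N_ 0 + N_ 1)).

End Quantities.

Definition sigma (m t : nat) : F :=
  (parity (a + m%:Z))%:~R * c ^+ (p.+1 - m)./2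
  * \sum_(1 <= k < p.+2) \sum_(0 <= d < k) \sum_(0 <= m' < m.+1)
    \sum_(l : p.-tuple bool | in_L' m m' k d l)
    \sum_(s : (p - m).-tuple bool | in_S' m m' k t d s)
      (-1) ^+ k.+1 * qbinom x p.+1 k
      * (x ^ kappa k d m' t l s / ((x - x^-1) ^+ (p.+1 - m)./2 * (y - y^-1)))
      * sigma_prod k d l s
      * sigma_sum k d t l s ^+ (T_ k t l s != 0%N)
      * sigma_zero k d t l s ^+ (T_ k t l s == 0%N).

End Coefficients.

Notation ratfun K := {fraction {poly K}}.

Definition cst (K : fieldType) (z : K) : ratfun K := FracField.tofrac z%:P.
Definition qvar (K : fieldType) : ratfun K := FracField.tofrac 'X.
Definition qpow (K : fieldType) (n : nat) (eps : 'I_n -> nat) (i : 'I_n) : ratfun K :=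
  qvar K ^+ eps i.

(* Main.v *)
(* Put e = - c_i v_i ad(Z_i^+)(E_i) K_i^-1, so that B_i = F_i + e as soon as a_ij <> 0.
   Applying Lusztig automorphisms to U_q(sl_2)-triples gives F_ij(e, F_j) = 0, while
   e F_i - q_i^2 F_i e and the analogous expression with F_j are multiples of Z_i and
   of W_ij K_j. These defects are absorbed by coupling e, F_i and F_j to operators on
   the covectors <0|F^h and <0|F^L f F^M of a lowest weight module: the coupled elements
   q-commute exactly, which makes the quantum Serre polynomial additive on their sum, so
   that it vanishes. Its vacuum component expresses F_ij(B_i, B_j) as a sum over lattice
   paths whose steps are multiplication by B_i, raising and lowering; paths that avoid a
   W-step give the first sum and the others give the second one. A path corresponds to
   the pair (l, s) where l marks the steps B_i and s the raising steps among the rest. *)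

From HB Require Import structures.
From Pilot Require Import Defs.
From mathcomp Require Import all_boot all_order perm all_algebra.
From mathcomp Require Import boolp functions monalg.
From mathcomp Require Import ring zify.
Set Implicit Arguments.
Unset Strict Implicit.
Unset Printing Implicit Defensive.
Import Order.TTheory GRing.Theory Num.Theory.
Local Open Scope ring_scope.

(** * A reflexive normalization in associative algebras *)

(** [Uq] is only a quotient of a free algebra, so an argument that an element of the positive part
    is zero, or that two expressions have equal components, needs an independence that the
    presentation does not show. It comes from lowest weight Verma modules built on the algebra
    presented by the E-Serre relations alone: they embed it into [Uq] and separate multiples of K_b
    from multiples of K_-b. Three facts rest on this: the vanishing of F_ij(e, F_j), the
    nonvanishing of T_{w_X}(E_i), and the identification of [W], which is given only through the
    coproduct of B_i. The integrality of alpha_i(rho_X^vee) excludes w_X(alpha_i) = alpha_i +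
    alpha_j, the one case in which a K_i^-1 term would spoil the defect relation of e with F_j. In
    sigma the two brackets, for T = 0 and T > 0, turn out to be the same quantity: (1 - q_i^(2a))
    times a single sum, and that sum is what the path count produces. *)

Inductive ncexpr (F : Type) : Type :=
| NCatom of nat | NCone | NCzero
| NCadd of ncexpr F & ncexpr F | NCopp of ncexpr F
| NCmul of ncexpr F & ncexpr F | NCscale of F & ncexpr F.
Arguments NCatom {F}. Arguments NCone {F}. Arguments NCzero {F}.

Fixpoint same_word (v w : seq nat) : bool :=
  match v, w with
  | [::], [::] => true
  | m :: v', n :: w' => if Nat.eqb m n then same_word v' w' else false
  | _, _ => false
  end.

Lemma same_wordP v w : reflect (v = w) (same_word v w).
Proof.
elim: v w => [|m v IH] [|n w] /=; try by constructor.
case E: (Nat.eqb m n); last first.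
  by constructor=> -[h _]; move: E; rewrite h PeanoNat.Nat.eqb_refl.
have -> : m = n by apply/PeanoNat.Nat.eqb_eq.
by case: IH => [->|h]; constructor => // -[].
Qed.

Section NoncommutativeNormalization.
Context (F : fieldType) (A : algType F).
Implicit Types (env : seq A) (e : ncexpr F) (l : seq (F * seq nat)).

Fixpoint ncdenote env e : A :=
  match e with
  | NCatom n => nth 0 env n
  | NCone => 1
  | NCzero => 0
  | NCadd a b => ncdenote env a + ncdenote env b
  | NCopp a => - ncdenote env a
  | NCmul a b => ncdenote env a * ncdenote env b
  | NCscale c a => c *: ncdenote env a
  end.

(** Private copies of the list operations: [nc] names them in its [cbv] list, and lists occurring
    inside coefficients or atoms stay folded. *)
Fixpoint nclinear (f : F * seq nat -> F * seq nat) l :=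
  match l with [::] => [::] | x :: l' => f x :: nclinear f l' end.

Fixpoint ncappend l l' :=
  match l with [::] => l' | x :: r => x :: ncappend r l' end.

Fixpoint wappend (v w : seq nat) :=
  match v with [::] => w | m :: v' => m :: wappend v' w end.

Fixpoint ncproduct l l' :=
  match l with
  | [::] => [::]
  | x :: r => ncappend (nclinear (fun y => (x.1 * y.1, wappend x.2 y.2)) l')
                       (ncproduct r l')
  end.

Fixpoint ncnorm e : seq (F * seq nat) :=
  match e with
  | NCatom n => [:: (1, [:: n])]
  | NCone => [:: (1, [::])]
  | NCzero => [::]
  | NCadd a b => ncappend (ncnorm a) (ncnorm b)
  | NCopp a => nclinear (fun y => (- y.1, y.2)) (ncnorm a)
  | NCmul a b => ncproduct (ncnorm a) (ncnorm b)
  | NCscale c a => nclinear (fun y => (c * y.1, y.2)) (ncnorm a)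
  end.

Definition wordval env (w : seq nat) : A := foldr (fun n a => nth 0 env n * a) 1 w.
Definition ncval env l : A := foldr (fun x a => x.1 *: wordval env x.2 + a) 0 l.

Lemma ncval_append env l l' : ncval env (ncappend l l') = ncval env l + ncval env l'.
Proof. by elim: l => [|x l IH] /=; rewrite ?add0r // IH addrA. Qed.

Lemma wordval_append env v w : wordval env (wappend v w) = wordval env v * wordval env w.
Proof. by elim: v => [|m v IH] /=; rewrite ?mul1r // IH mulrA. Qed.

Lemma ncval_product env l l' : ncval env (ncproduct l l') = ncval env l * ncval env l'.
Proof.
elim: l => [|x l IH] /=; rewrite ?mul0r // ncval_append IH mulrDl; congr (_ + _).
elim: l' {IH} => [|y l' IH] /=; rewrite ?mulr0 // IH mulrDr wordval_append.
by congr (_ + _); rewrite -scalerAl -scalerAr scalerA.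
Qed.

Lemma ncnormP env e : ncval env (ncnorm e) = ncdenote env e.
Proof.
elim: e => [n|||a IHa b IHb|a IHa|a IHa b IHb|c a IHa] //=.
- by rewrite addr0 scale1r mulr1.
- by rewrite addr0 scale1r.
- by rewrite ncval_append IHa IHb.
- rewrite -IHa; elim: (ncnorm a) => [|x l IH] /=; first by rewrite oppr0.
  by rewrite IH opprD scaleNr.
- by rewrite ncval_product IHa IHb.
- rewrite -IHa; elim: (ncnorm a) => [|x l IH] /=; first by rewrite scaler0.
  by rewrite IH scalerDr scalerA.
Qed.

Fixpoint nccoef (w : seq nat) l : F :=
  match l with
  | [::] => 0
  | x :: l' => if same_word w x.2 then x.1 + nccoef w l' else nccoef w l'
  end.

Fixpoint ncremove (w : seq nat) l :=
  match l with
  | [::] => [::]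
  | x :: l' => if same_word w x.2 then ncremove w l' else x :: ncremove w l'
  end.

(** [n] is fuel: each round removes all occurrences of the leading word, so the length of the list
    suffices. The value is a conjunction of equations because the coefficients are symbolic; their
    vanishing is left to [ring] or [field]. *)
Fixpoint nczero (n : nat) l : Prop :=
  match n, l with
  | _, [::] => True
  | 0%N, _ => False
  | n'.+1, x :: l' => x.1 + nccoef x.2 l' = 0 /\ nczero n' (ncremove x.2 l')
  end.

Lemma ncval_split env w l :
  ncval env l = nccoef w l *: wordval env w + ncval env (ncremove w l).
Proof.
elim: l => [|x l IH] /=; first by rewrite scale0r addr0.
by case: same_wordP => [<-|_] /=; rewrite IH; [rewrite scalerDl addrA|rewrite addrCA].
Qed.

Lemma nczeroP env n l : nczero n l -> ncval env l = 0.
Proof.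
elim: n l => [|n IH] [|x l] //= [h /IH hl].
by rewrite (ncval_split _ x.2) hl addr0 -scalerDl h scale0r.
Qed.

Lemma nc_eq env e1 e2 :
  (let l := ncnorm (NCadd e1 (NCopp e2)) in nczero (size l) l) ->
  ncdenote env e1 = ncdenote env e2.
Proof.
move=> /nczeroP h; apply/eqP; rewrite -subr_eq0; apply/eqP.
exact: etrans (esym (ncnormP env (NCadd e1 (NCopp e2)))) (h env).
Qed.

End NoncommutativeNormalization.

Ltac nc_index x l :=
  lazymatch l with
  | x :: _ => constr:(0%N)
  | _ :: ?l' => let n := nc_index x l' in constr:(S n)
  end.

Ltac nc_mem x l :=
  lazymatch l with
  | nil => constr:(false)
  | x :: _ => constr:(true)
  | _ :: ?l' => nc_mem x l'
  end.

Ltac nc_atoms F A t l :=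
  lazymatch t with
  | ?a + ?b => let l1 := nc_atoms F A a l in nc_atoms F A b l1
  | ?a * ?b => let l1 := nc_atoms F A a l in nc_atoms F A b l1
  | - ?a => nc_atoms F A a l
  | ?c *: ?a => nc_atoms F A a l
  | 0 => l
  | 1 => l
  | _ => let b := nc_mem t l in
         lazymatch b with true => l | false => constr:(t :: l) end
  end.

Ltac nc_reify F A t l :=
  lazymatch t with
  | ?a + ?b => let x := nc_reify F A a l in let y := nc_reify F A b l in
               constr:(NCadd x y)
  | ?a * ?b => let x := nc_reify F A a l in let y := nc_reify F A b l in
               constr:(NCmul x y)
  | - ?a => let x := nc_reify F A a l in constr:(NCopp x)
  | ?c *: ?a => let x := nc_reify F A a l in constr:(NCscale c x)
  | 0 => constr:(@NCzero F)
  | 1 => constr:(@NCone F)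
  | _ => let n := nc_index t l in constr:(@NCatom F n)
  end.

(* Reduces an identity in an algebra over a field to the identities between the
   coefficients of the words in its atoms. *)
Ltac nc :=
  lazymatch goal with
  | |- @eq ?T ?s ?t =>
    let p := constr:(@nc_eq _ _ (@nil T)) in
    lazymatch type of p with
    | forall e : ncexpr ?F1, _ =>
      let l1 := nc_atoms F1 T s (@nil T) in
      let l := nc_atoms F1 T t l1 in
      let x := nc_reify F1 T s l in
      let y := nc_reify F1 T t l in
      apply: (@nc_eq _ _ l x y);
      cbv [ncnorm ncappend nclinear ncproduct wappend nczero nccoef ncremove
           same_word Nat.eqb size fst snd];
      repeat split
    end
  end.

(** * Quantum binomials, iterated q-commutators and the Serre polynomial *)

Definition not_root_of_unity (F : fieldType) (q : F) :=
  q != 0 /\ forall n : nat, (0 < n)%N -> q ^+ n != 1.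

Section QuantumBinomials.
Context (F : fieldType) (q : F) (hq : not_root_of_unity q).

Lemma q_neq0 : q != 0. Proof. by case: hq. Qed.

Lemma qz_neq0 (m : int) : q ^ m != 0.
Proof. by rewrite expfz_neq0 // q_neq0. Qed.

Lemma qz_inj (m n : int) : q ^ m = q ^ n -> m = n.
Proof.
move=> h; apply/eqP; rewrite -subr_eq0; apply/negP => hmn; case: hq => q0 hn.
have h1 : q ^ (m - n) = 1 by rewrite expfzDr // -invr_expz h mulfV // qz_neq0.
have h2 : q ^ (n - m) = 1 by rewrite -opprB -invr_expz h1 invr1.
case: (m - n) hmn h1 h2 (opprB m n) => k hk h1 h2 h3.
  by have := hn k; rewrite -exprnP in h1; rewrite h1 eqxx; case: k hk {h1 h3} => // k _ /(_ isT).
have := hn k.+1 isT; move: h2; rewrite -h3 NegzE opprK -exprnP => ->.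
by rewrite eqxx.
Qed.

Lemma q_sub_inv_neq0 : q - q^-1 != 0.
Proof.
apply/negP => h; have h2 : q ^ 1 = q ^ (-1 : int).
  by apply/eqP; rewrite -subr_eq0 expr1z.
by have := qz_inj h2.
Qed.

Lemma qint_neq0 (m : int) : m != 0 -> qint q m != 0.
Proof.
move=> hm; rewrite /qint mulf_neq0 ?invr_eq0 ?q_sub_inv_neq0 //.
rewrite subr_eq0; apply/negP => /eqP /qz_inj; lia.
Qed.

Lemma qfact_neq0 n : qfact q n != 0.
Proof.
rewrite /qfact prodf_seq_neq0; apply/allP => l; rewrite mem_index_iota => hl.
by rewrite implyTb; apply: qint_neq0; lia.
Qed.

Lemma qfactS n : qfact q n.+1 = qfact q n * qint q n.+1.
Proof. by rewrite /qfact big_nat_recr. Qed.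

Lemma qfact0 : qfact q 0 = 1.
Proof. by rewrite /qfact big_geq. Qed.

Lemma qbinom0 n : qbinom q n 0 = 1.
Proof. by rewrite /qbinom qfact0 mul1r subn0 mulfV // qfact_neq0. Qed.

Lemma qbinomnn n : qbinom q n n = 1.
Proof. by rewrite /qbinom subnn qfact0 mulr1 mulfV // qfact_neq0. Qed.

Lemma qintD (m n : int) : qint q (m + n) = q ^ n * qint q m + q ^ (- m) * qint q n.
Proof.
rewrite /qint !mulrA -mulrDl; congr (_ / _).
rewrite !mulrBr -!expfzDr ?q_neq0 // addrA [n + m]addrC [- m + n]addrC subrK.
by congr (_ - _ ^ _); rewrite opprD.
Qed.

(** Split [n+1] = q^(n-k) [k+1] + q^(-k-1) [n-k] by [qintD] and multiply by [n]! / ([k+1]!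
    [n-k]!). *)
Lemma qbinom_pascal n k : (k < n)%N ->
  qbinom q n.+1 k.+1 = q ^ (n - k)%:Z * qbinom q n k + q ^ (- k.+1%:Z) * qbinom q n k.+1.
Proof.
move=> hk; rewrite /qbinom subSS qfactS.
have -> : n.+1%:Z = k.+1%:Z + (n - k)%N%:Z by lia.
rewrite qintD; have -> : (n - k = (n - k.+1).+1)%N by lia.
rewrite !qfactS; set A := qint q k.+1%:Z; set B := qint q (_.+1)%:Z.
have hA : A != 0 by apply: qint_neq0.
have hB : B != 0 by apply: qint_neq0.
have h1 := qfact_neq0 k; have h2 := qfact_neq0 (n - k.+1).
have := qz_neq0 ((n - k.+1).+1%:Z); have := qz_neq0 (- k.+1%:Z).
move: (q ^ _) (q ^ _) (qfact q n) h1 h2 => a b c h1 h2 ha hb.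
by field; rewrite ?hA ?hB ?h1 ?h2.
Qed.

End QuantumBinomials.

Section QuantumCommutators.
Context (F : fieldType) (A : algType F).
Implicit Types (X Y : A) (c : F) (cs : seq F).

Definition qop X c Y : A := X * Y - c *: (Y * X).
Definition qops X cs Y : A := foldr (qop X) Y cs.

Lemma qop_zmod X c : zmod_morphism (qop X c).
Proof.
by move=> Y Y'; rewrite /qop; nc; ring.
Qed.
HB.instance Definition _ X c := GRing.isZmodMorphism.Build A A (qop X c) (qop_zmod X c).

Lemma qop_scale X c : scalable (qop X c).
Proof.
by move=> a Y; rewrite /qop scalerBr -scalerAr -scalerAl !scalerA [c * a]mulrC.
Qed.
HB.instance Definition _ X c := GRing.isScalable.Build F A A *:%R (qop X c) (qop_scale X c).

(** Left and right multiplication by [X] commute, and [qop X c] is a linear combination of them; so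
    the order of the constants in [qops] is irrelevant. *)
Lemma qopC X c d Y : qop X c (qop X d Y) = qop X d (qop X c Y).
Proof.
by rewrite /qop; nc; ring.
Qed.

Lemma qops_qop X cs c Y : qops X cs (qop X c Y) = qop X c (qops X cs Y).
Proof. by elim: cs => //= d cs ->; rewrite qopC. Qed.

Lemma qops_cat X cs cs' Y : qops X (cs ++ cs') Y = qops X cs (qops X cs' Y).
Proof. by rewrite /qops foldr_cat. Qed.

Lemma qops_comm X cs cs' Y : qops X cs (qops X cs' Y) = qops X cs' (qops X cs Y).
Proof. by elim: cs => //= c cs ->; rewrite qops_qop. Qed.

Lemma qops_rcons X cs c Y : qops X (rcons cs c) Y = qop X c (qops X cs Y).
Proof. by rewrite -cats1 qops_cat /= qops_qop. Qed.

Lemma qopsD X cs Y Y' : qops X cs (Y + Y') = qops X cs Y + qops X cs Y'.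
Proof. by elim: cs => //= c cs ->; rewrite raddfD. Qed.

Lemma qops0 X cs : qops X cs 0 = 0.
Proof. by elim: cs => //= c cs ->; rewrite raddf0. Qed.

Lemma qopsZ X cs a Y : qops X cs (a *: Y) = a *: qops X cs Y.
Proof. by elim: cs => //= c cs ->; rewrite linearZ. Qed.

Definition qgeom (q c : F) (n : nat) : seq F := [seq c * q ^+ (2 * t) | t <- iota 0 n].

Lemma qgeomS q c n : qgeom q c n.+1 = rcons (qgeom q c n) (c * q ^+ (2 * n)).
Proof. by rewrite /qgeom -[n.+1]addn1 iotaD map_cat cats1. Qed.

End QuantumCommutators.

Section Serre.
Context (F : fieldType) (q : F) (hq : not_root_of_unity q) (A : algType F).
Implicit Types (X Y : A).

(** The q-binomial theorem for the product of the operators L - c q^(2t) R, t < n, where L and R are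
    left and right multiplication by [X]. *)
Lemma qops_qgeom X Y c n : qops X (qgeom q c n) Y =
  \sum_(0 <= l < n.+1) ((-1) ^+ l * qbinom q n l * c ^+ l * q ^+ (l * n.-1)) *:
     (X ^+ (n - l) * Y * X ^+ l).
Proof.
elim: n => [|n IH].
  by rewrite big_nat1 qbinom0 // !expr0 !mulr1 mul1r scale1r.
rewrite qgeomS qops_rcons IH raddf_sum /=.
pose M l := X ^+ (n - l) * Y * X ^+ l.+1.
pose a l := (-1) ^+ l * qbinom q n l * c ^+ l * q ^+ (l * n.-1).
have step l : (l < n.+1)%N ->
    qop X (c * q ^+ (2 * n)) (a l *: (X ^+ (n - l) * Y * X ^+ l)) =
    a l *: (X ^+ (n.+1 - l) * Y * X ^+ l) - (a l * (c * q ^+ (2 * n))) *: M l.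
  move=> hl; rewrite linearZ /= /qop scalerBr scalerA !mulrA -exprS -subSn //.
  by rewrite -[_ * X in X in _ - X]mulrA -exprSr.
rewrite (eq_big_nat _ _ (F2 := fun l => a l *: (X ^+ (n.+1 - l) * Y * X ^+ l)
   - (a l * (c * q ^+ (2 * n))) *: M l)) => [|l /andP[_ /step //]].
rewrite sumrB [X in X - _ = _]big_nat_recl // [X in _ - X = _]big_nat_recr // [RHS]big_nat_recl //.
rewrite [X in _ = _ + X]big_nat_recr //= -!addrA; congr (_ + _).
  by rewrite /a !expr0 !qbinom0.
rewrite opprD addrA -sumrB; congr (_ + _).
  apply: eq_big_nat => l /andP[_ hl]; rewrite subSS -/(M l) -scalerBl.
  congr (_ *: _); rewrite /a qbinom_pascal // !exprS.
  have -> : q ^+ (l.+1 * n) = q ^+ (l * n.-1) * (q ^+ n.-1 * q) * q ^+ l.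
    by rewrite -exprSr -!exprD; congr (_ ^+ _); nia.
  have -> : q ^+ (l.+1 * n.-1) = q ^+ (l * n.-1) * q ^+ n.-1.
    by rewrite -!exprD; congr (_ ^+ _); nia.
  have -> : q ^ (n - l)%N%:Z = q ^+ n.-1 * q / q ^+ l.
    by rewrite -exprSr exprnN !exprnP -!expfzDr ?q_neq0 //; congr (_ ^ _); lia.
  have -> : q ^ (- l.+1%:Z) = q^-1 / q ^+ l.
    by rewrite -exprN1 exprnN -!expfzDr ?q_neq0 //; congr (_ ^ _); lia.
  have -> : q ^+ (2 * n) = (q ^+ n.-1 * q) * (q ^+ n.-1 * q).
    by rewrite -exprSr -!exprD; congr (_ ^+ _); lia.
  have h0 := q_neq0 hq.
  by field; rewrite h0 expf_neq0.
rewrite subnn -scaleNr /M subnn; congr (_ *: _); rewrite /a !qbinomnn //.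
rewrite !mulr1 !exprS.
have -> : q ^+ (n.+1 * n) = q ^+ (n * n.-1) * q ^+ (2 * n).
  by rewrite -!exprD; congr (_ ^+ _); nia.
ring.
Qed.

(** At c = q^(1-N) the extra powers of q in the expansion cancel. The Serre polynomial is thus a
    product of q-commutators with constants q^(1-N), q^(3-N), ..., q^(N-1), and one vanishing factor
    annihilates it. *)
Lemma serreE X Y N : serre q N X Y = qops X (qgeom q (q ^ (1 - N%:Z)) N) Y.
Proof.
rewrite qops_qgeom; apply: eq_big_nat => l hl; congr (_ *: _).
rewrite -mulrA -[LHS]mulr1; congr (_ * _).
rewrite !exprnP exprz_exp -expfzDr ?q_neq0 //.
by rewrite (_ : _ + _ = 0) ?expr0z //; nia.
Qed.

End Serre.

Section GaussBinomial.
Context (F : fieldType) (q : F).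

(** The Gaussian binomial coefficient in the variable q^2, defined through one of its two Pascal
    rules; [gauss_ratio] leads to the other. *)
Fixpoint gauss (m s : nat) : F :=
  match m, s with
  | _, 0%N => 1
  | 0%N, _.+1 => 0
  | m'.+1, s'.+1 => gauss m' s'.+1 + q ^+ (2 * (m' - s')) * gauss m' s'
  end.

Lemma gauss0 m : gauss m 0 = 1. Proof. by case: m. Qed.

Lemma gauss_gt m s : (m < s)%N -> gauss m s = 0.
Proof.
elim: m s => [|m IH] [|s] //= hs.
by rewrite !IH ?mulr0 ?addr0 //; lia.
Qed.

Lemma gaussnn m : gauss m m = 1.
Proof. by elim: m => //= m IH; rewrite gauss_gt // IH subnn mulr1 add0r. Qed.

Lemma gauss_ratio m s : (s <= m)%N ->
  (1 - q ^+ (2 * s.+1)) * gauss m s.+1 = (1 - q ^+ (2 * (m - s))) * gauss m s.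
Proof.
elim: m s => [|m IH] s hs.
  by have -> : s = 0%N by [lia]; rewrite /= mulr0 expr0 subrr mul0r.
case: (ltnP m s) => [hms|hsm].
  have -> : s = m.+1 by lia.
  by rewrite (gauss_gt (s := m.+2)) // subnn expr0 mulr0 subrr mul0r.
case: s hs hsm => [|s] _ hsm.
  rewrite [gauss m.+1 1]/= mulrDr (IH 0%N) // !gauss0 !subn0 !mulr1.
  have -> : q ^+ (2 * m.+1) = q ^+ (2 * m) * q ^+ 2 by rewrite -exprD; congr (_ ^+ _); lia.
  ring.
rewrite [gauss m.+1 s.+2]/= [gauss m.+1 s.+1]/= mulrDr (IH s.+1) // [RHS]mulrDr.
have h := IH s (ltnW hsm).
have e1 : q ^+ (2 * (m - s)) = q ^+ (2 * (m - s.+1)) * q ^+ 2.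
  by rewrite -exprD; congr (_ ^+ _); lia.
have e2 : q ^+ (2 * s.+2) = q ^+ (2 * s.+1) * q ^+ 2.
  by rewrite -exprD; congr (_ ^+ _); lia.
rewrite subSS [X in _ = _ + X]mulrCA -h e1 e2; ring.
Qed.

Lemma gauss_pascal m s : (s <= m)%N ->
  gauss m.+1 s.+1 = q ^+ (2 * s.+1) * gauss m s.+1 + gauss m s.
Proof.
move=> hs /=; have := gauss_ratio hs; rewrite !mulrBl !mul1r => h.
apply/eqP; rewrite -subr_eq0; apply/eqP.
transitivity (gauss m s.+1 - q ^+ (2 * s.+1) * gauss m s.+1
  - (gauss m s - q ^+ (2 * (m - s)) * gauss m s)); first by ring.
by rewrite h subrr.
Qed.

End GaussBinomial.

(** * Additivity of the quantum Serre polynomial *)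

Section MixedSerre.
Context (F : fieldType) (q : F) (hq : not_root_of_unity q) (A : algType F).
Context (p : nat) (e f Fm : A).
Let a : int := - p%:Z.
Hypothesis he : e * Fm = q ^+ 2 *: (Fm * e).
Hypothesis hg : e * (f * Fm - q ^ a *: (Fm * f)) =
  q ^ (2 + a) *: ((f * Fm - q ^ a *: (Fm * f)) * e).

Let ea (t : int) := qop e (q ^ (a + 2 * t)).
Let fb (t : int) := qop Fm (q ^ (a + 2 * t)).
Let eas (t : int) (r : nat) u := foldr (fun k => ea (t + k%:Z)) u (iota 0 r).
Let fbs (s : nat) u := foldr (fun k => fb k%:Z) u (iota 0 s).

(** Moving an e-factor past an F-factor costs q^2 and lowers both parameters; this is the effect of
    e Fm = q^2 Fm e on q-commutators. *)
Let ea_fb s t u : ea s (fb t u) = q ^+ 2 *: fb (t - 1) (ea (s - 1) u).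
Proof.
rewrite /ea /fb /qop.
have -> : q ^ (a + 2 * (s - 1)) = q ^ (a + 2 * s) / q ^+ 2.
  by rewrite exprnN -expfzDr ?q_neq0 //; congr (_ ^ _); lia.
have -> : q ^ (a + 2 * (t - 1)) = q ^ (a + 2 * t) / q ^+ 2.
  by rewrite exprnN -expfzDr ?q_neq0 //; congr (_ ^ _); lia.
have q0 := q_neq0 hq; set c := q ^ (a + 2 * s); set d := q ^ (a + 2 * t).
have h : e * Fm - q ^+ 2 *: (Fm * e) = 0 by rewrite he subrr.
transitivity (q ^+ 2 *: (Fm * (e * u - (c / q ^+ 2) *: (u * e))
     - (d / q ^+ 2) *: ((e * u - (c / q ^+ 2) *: (u * e)) * Fm))
   + (e * Fm - q ^+ 2 *: (Fm * e)) * u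
   - (c * d / q ^+ 2) *: (u * (e * Fm - q ^+ 2 *: (Fm * e)))).
  by nc; try ring; field.
by rewrite h mul0r mulr0 scaler0 subr0 addr0.
Qed.

(** Modulo [he] this is hypothesis [hg] with the two commutators nested in the other order. *)
Let fb_eaf : fb (p%:Z - 1) (ea 0 f) = 0.
Proof.
rewrite /ea /fb /qop mulr0 addr0.
have -> : q ^ (a + 2 * (p%:Z - 1)) = (q ^ a * q ^+ 2)^-1.
  by rewrite exprnP -expfzDr ?q_neq0 // invr_expz; congr (_ ^ _); rewrite /a; lia.
have q0 := q_neq0 hq; have qa := qz_neq0 hq a.
transitivity ((- (q ^ a * q ^+ 2)^-1) *: (
  e * (f * Fm - q ^ a *: (Fm * f)) - q ^ (2 + a) *: ((f * Fm - q ^ a *: (Fm * f)) * e)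
  + q ^ a *: ((e * Fm - q ^+ 2 *: (Fm * e)) * f)
  - q ^ a *: (f * (e * Fm - q ^+ 2 *: (Fm * e))))).
  rewrite expfzDr //; move: (q ^ a) qa => d qa.
  by nc; try ring; field; rewrite q0 qa.
by rewrite hg he !subrr mul0r mulr0 scaler0 addr0 subr0 scaler0.
Qed.

Let eas_ea t r s u : eas t r (ea s u) = ea s (eas t r u).
Proof. by rewrite /eas; elim: (iota 0 r) => //= k l ->; rewrite /ea qopC. Qed.

Let fbs_fb s t u : fbs s (fb t u) = fb t (fbs s u).
Proof. by rewrite /fbs; elim: (iota 0 s) => //= k l ->; rewrite /fb qopC. Qed.

Let easS t r u : eas t r.+1 u = ea (t + r%:Z) (eas t r u).
Proof. by rewrite /eas -[r.+1]addn1 iotaD foldr_cat /= -/(eas t r _) eas_ea. Qed.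

Let fbsS s u : fbs s.+1 u = fb s%:Z (fbs s u).
Proof. by rewrite /fbs -[s.+1]addn1 iotaD foldr_cat /= -/(fbs s _) fbs_fb. Qed.

Let eaZ s c u : ea s (c *: u) = c *: ea s u. Proof. exact: linearZ. Qed.

Let fbsD s u v : fbs s (u + v) = fbs s u + fbs s v.
Proof. by elim: s => // s IH; rewrite !fbsS IH; apply: raddfD. Qed.

Let fbsZ s c u : fbs s (c *: u) = c *: fbs s u.
Proof. by elim: s => // s IH; rewrite !fbsS IH; apply: linearZ. Qed.

Let easD t r u v : eas t r (u + v) = eas t r u + eas t r v.
Proof. by elim: r => // r IH; rewrite !easS IH; apply: raddfD. Qed.

Let eas_fb k r t u :
  eas k r (fb t u) = q ^+ (2 * r) *: fb (t - r%:Z) (eas (k - 1) r u).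
Proof.
elim: r => [|r IH]; first by rewrite muln0 expr0 scale1r subr0.
rewrite !easS IH eaZ ea_fb scalerA -exprD -addrA -opprD; congr (_ *: fb _ (ea _ _)); last lia.
- by congr (_ ^+ _); lia.
- by congr (t - _); lia.
Qed.

Let eas_shift r u : eas (-1) r.+1 u = ea (-1) (eas 0 r u).
Proof.
elim: r => [|r IH]; first by rewrite easS /= addr0.
rewrite easS IH [in RHS]easS {1}/ea qopC; congr (ea _ (ea _ _)); lia.
Qed.

(** A noncommutative q-binomial theorem with all F-factors collected to the left of the e-factors.
    The coefficients match because the two Pascal rules of [gauss] agree. *)
Let mixed_expansion m u :
  qops (e + Fm) (qgeom q (q ^ a) m) u =
  \sum_(0 <= s < m.+1) gauss q m s *: fbs s (eas 0 (m - s) u).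
Proof.
elim: m u => [|m IH] u; first by rewrite big_nat1 /= scale1r.
rewrite qgeomS -cats1 qops_cat IH /=.
have -> : qop (e + Fm) (q ^ a * q ^+ (2 * m)) u = ea m%:Z u + fb m%:Z u.
  rewrite /ea /fb /qop; have -> : q ^ (a + 2 * m%:Z) = q ^ a * q ^+ (2 * m).
    by rewrite exprnP -expfzDr ?q_neq0.
  by nc; ring.
under eq_big_nat => s hs do rewrite easD eas_fb fbsD fbsZ scalerDr scalerA.
rewrite big_split /= [X in X + _ = _]big_nat_recl // [X in _ + X = _]big_nat_recr //.
rewrite [RHS]big_nat_recl // [X in _ = _ + X]big_nat_recr //= !subn0 !subnn -!addrA.
congr (_ + _); first by rewrite !gauss0 easS add0r eas_ea.
rewrite addrA -big_split /=; congr (_ + _); last first.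
  rewrite !gaussnn muln0 expr0 mul1r fbsS fbs_fb gauss_gt // add0r.
  by have -> : m%:Z - 0%N%:Z = m%:Z by [lia]; rewrite add0r.
apply: eq_big_nat => s /andP[_ hs]; rewrite subSS.
have -> : (m - s = (m - s.+1).+1)%N by lia.
rewrite eas_shift [in RHS]easS add0r eas_ea.
have -> : m%:Z - (m - s.+1).+1%:Z = s by lia.
rewrite fbs_fb -fbsS; set v := eas 0 _ u.
rewrite -!fbsZ -fbsD; congr (fbs _ _); rewrite /ea /qop.
have hP := gauss_pascal q (ltnW hs); rewrite /= in hP.
set g1 := gauss q m s.+1 in hP *; set g := gauss q m s in hP *.
have [k hk] : exists k, (m = k + s.+1)%N by exists (m - s.+1)%N; lia.
rewrite (_ : m - s.+1 = k)%N in hP *; last by lia.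
rewrite (_ : m - s = k.+1)%N in hP *; last by lia.
have q0 := q_neq0 hq.
have -> : q ^ (a + 2 * m%:Z) = q ^ a * q ^+ (2 * k) * q ^+ (2 * s.+1).
  by rewrite -mulrA -exprD exprnP -expfzDr //; congr (_ ^ _); lia.
have -> : q ^ (a + 2 * (-1)) = q ^ a / q ^+ 2.
  by rewrite exprnN -expfzDr //; congr (_ ^ _); lia.
have -> : q ^ (a + 2 * k%:Z) = q ^ a * q ^+ (2 * k).
  by rewrite exprnP -expfzDr //; congr (_ ^ _); lia.
have e1 : q ^+ (2 * k.+1) = q ^+ (2 * k) * q ^+ 2 by rewrite -exprD; congr (_ ^+ _); lia.
nc; first by ring.
rewrite hP e1; move: (qz_neq0 hq a) => qa.
by field.
Qed.

Let fbsE s u : fbs s u = qops Fm (qgeom q (q ^ a) s) u.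
Proof.
rewrite /fbs /qops /qgeom; elim: (iota 0 s) => //= k l ->; rewrite /fb.
by rewrite exprnP -expfzDr ?q_neq0.
Qed.

Let easE s u : eas 0 s u = qops e (qgeom q (q ^ a) s) u.
Proof.
rewrite /eas /qops /qgeom; elim: (iota 0 s) => //= k l ->; rewrite /ea add0r.
by rewrite exprnP -expfzDr ?q_neq0.
Qed.

(** The extreme terms of [mixed_expansion] are the two Serre polynomials. A mixed term contains
    [fb s (eas 1 r (ea 0 f))] with s + r = p - 1; moved inwards through the r e-factors, the
    F-factor gets parameter p - 1, where [fb_eaf] kills it. *)
Lemma serre_mixed : serre q p.+1 (e + Fm) f = serre q p.+1 e f + serre q p.+1 Fm f.
Proof.
rewrite !serreE // (_ : 1 - p.+1%:Z = a); last by rewrite /a; lia.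
rewrite mixed_expansion big_nat_recl // big_nat_recr //.
rewrite gauss0 scale1r subn0 subnn gaussnn scale1r -fbsE -easE; congr (_ + _).
rewrite big_nat big1 => [|s hs]; first exact: add0r.
rewrite fbsS subSS; have -> : (p - s = (p - s.+1).+1)%N by lia.
have eas0 r : eas 0 r.+1 f = eas 1 r (ea 0 f).
  elim: r => [|r IH]; first by rewrite easS.
  rewrite easS IH [in RHS]easS; congr (ea _ _); lia.
rewrite eas0 -fbs_fb; set r := (p - s.+1)%N.
suff -> : fb s%:Z (eas 1 r (ea 0 f)) = 0.
  have -> : fbs s 0 = 0 by rewrite -[0](scale0r (0 : A)) fbsZ !scale0r.
  by rewrite scaler0.
have := eas_fb 2 r (p%:Z - 1) (ea 0 f).
rewrite fb_eaf (_ : p%:Z - 1 - r%:Z = s%:Z); last by rewrite /r; lia.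
have -> : eas 2 r 0 = 0 by elim: (r) => // l IH; rewrite easS IH; apply: raddf0.
have -> : 2 - 1 = 1 :> int by [].
move/esym/eqP; rewrite scaler_eq0 expf_eq0 (negPf (q_neq0 hq)) andbF /=.
by move/eqP.
Qed.

End MixedSerre.

(** * Endomorphism algebras and algebras given by generators and relations *)

Section Endomorphisms.
Context (F : fieldType) (M : lmodType F) (m0 : M) (hm0 : m0 != 0).

Definition endo_pred : {pred (M -> M)} :=
  fun g => `[< forall a u v, g (a *: u + v) = a *: g u + g v >].

(* The witness that M is nonzero makes the identity differ from 0. *)
Record endo (h : m0 != 0) := Endo { endo_fun :> M -> M; _ : endo_fun \in endo_pred }.

Local Notation EndM := (endo hm0).

HB.instance Definition _ := [isSub of EndM for @endo_fun hm0].
HB.instance Definition _ := [Choice of EndM by <:].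

Lemma endo_submod_closed : submod_closed endo_pred.
Proof.
split=> [|c g h /asboolP hg /asboolP hh]; apply/asboolP => a u v /=.
  by rewrite scaler0 addr0.
rewrite -[LHS]/(c *: g (a *: u + v) + h (a *: u + v)).
rewrite -[RHS]/(a *: (c *: g u + h u) + (c *: g v + h v)) hg hh !scalerDr !scalerA.
by rewrite [a * c]mulrC -!addrA; congr (_ + _); rewrite addrCA.
Qed.

HB.instance Definition _ :=
  GRing.isSubmodClosed.Build F (M -> M) endo_pred endo_submod_closed.
HB.instance Definition _ := [SubChoice_isSubLmodule of EndM by <:].

Lemma endo_linear (g : EndM) a u v : g (a *: u + v) = a *: g u + g v.
Proof. by case: g => g /= /asboolP. Qed.

Lemma endoD_arg (g : EndM) u v : g (u + v) = g u + g v.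
Proof. by rewrite -[u in LHS]scale1r endo_linear scale1r. Qed.

Lemma endo0_arg (g : EndM) : g 0 = 0.
Proof. by apply: (addrI (g 0)); rewrite -endoD_arg !addr0. Qed.

Lemma endoZ_arg (g : EndM) a u : g (a *: u) = a *: g u.
Proof. by rewrite -[_ *: u]addr0 endo_linear endo0_arg addr0. Qed.

Lemma endo_one_subproof : idfun \in endo_pred.
Proof. exact/asboolP. Qed.
Definition endo_one : EndM := Endo hm0 endo_one_subproof.

Lemma endo_mul_subproof (g h : EndM) : (g : M -> M) \o h \in endo_pred.
Proof. by apply/asboolP => a u v /=; rewrite !endo_linear. Qed.
Definition endo_mul (g h : EndM) : EndM := Endo hm0 (endo_mul_subproof g h).

Lemma endoP (g h : EndM) : (forall u, g u = h u) -> g = h.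
Proof. by move=> gh; apply: val_inj; apply/funext. Qed.

Lemma endo_mulA : associative endo_mul. Proof. by move=> f g h; apply: endoP. Qed.
Lemma endo_mul1l : left_id endo_one endo_mul. Proof. by move=> g; apply: endoP. Qed.
Lemma endo_mul1r : right_id endo_one endo_mul. Proof. by move=> g; apply: endoP. Qed.
Lemma endo_mulDl : left_distributive endo_mul +%R.
Proof. by move=> f g h; apply: endoP. Qed.
Lemma endo_mulDr : right_distributive endo_mul +%R.
Proof. by move=> f g h; apply: endoP => u; apply: endoD_arg. Qed.
Lemma endo_one_neq0 : endo_one != 0.
Proof.
apply/negP => /eqP /(congr1 (fun g : EndM => g m0)) /= h.
by move: hm0; rewrite h eqxx.
Qed.

HB.instance Definition _ := GRing.Zmodule_isNzRing.Build EndM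
  endo_mulA endo_mul1l endo_mul1r endo_mulDl endo_mulDr endo_one_neq0.

Lemma endo_scaleAl (c : F) (g h : EndM) : c *: (g * h) = c *: g * h.
Proof. exact: endoP. Qed.
Lemma endo_scaleAr (c : F) (g h : EndM) : c *: (g * h) = g * (c *: h).
Proof. by apply: endoP => u; apply/esym/endoZ_arg. Qed.

HB.instance Definition _ := GRing.LSemiModule_isLSemiAlgebra.Build F EndM endo_scaleAl.
HB.instance Definition _ := GRing.LSemiAlgebra_isSemiAlgebra.Build F EndM endo_scaleAr.

Lemma endoM (g h : EndM) u : (g * h) u = g (h u). Proof. by []. Qed.
Lemma endo1 u : (1 : EndM) u = u. Proof. by []. Qed.
Lemma endoD (g h : EndM) u : (g + h) u = g u + h u. Proof. by []. Qed.
Lemma endoB (g h : EndM) u : (g - h) u = g u - h u. Proof. by []. Qed.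
Lemma endoZ c (g : EndM) u : (c *: g) u = c *: g u. Proof. by []. Qed.
Lemma endo0 u : (0 : EndM) u = 0. Proof. by []. Qed.
Lemma endo_sum I (r : seq I) (P : pred I) (G : I -> EndM) u :
  (\sum_(i <- r | P i) G i) u = \sum_(i <- r | P i) G i u.
Proof. by elim/big_rec2: _ => // i y1 y2 _ <-. Qed.

Definition mk_endo (g : M -> M) (hg : forall a u v, g (a *: u + v) = a *: g u + g v) :
  EndM := Endo hm0 (introT (asboolP _) hg).

End Endomorphisms.

Section FreeLift.
Context (k : comNzRingType) (G : choiceType) (B : algType k).

Definition word_map (g : G -> B) (m : {fmonom G}) : B := \prod_(x <- (m : seq G)) g x.

Lemma word_map_morph g : mmorphism (word_map g).
Proof.
split=> [x y|]; rewrite /word_map; last by rewrite fm1 big_nil.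
by rewrite fmM big_cat.
Qed.

HB.instance Definition _ g :=
  isMultiplicative.Build {fmonom G} B (word_map g) (word_map_morph g).

Definition free_lift (g : G -> B) : freealg k G -> B := mmap (in_alg B) (word_map g).

HB.instance Definition _ g := GRing.Additive.on (free_lift g).

Lemma free_lift_monoid g : monoid_morphism (free_lift g).
Proof.
have [h1 h2] := @commr_mmap_is_multiplicative {fmonom G} k B (in_alg B) (word_map g)
  (fun x m m' => etrans (mulr_algl _ _) (esym (mulr_algr _ _))).
by split.
Qed.
HB.instance Definition _ g :=
  GRing.isMonoidMorphism.Build (freealg k G) B (free_lift g) (free_lift_monoid g).

Lemma free_lift_scale g : scalable (free_lift g).
Proof. by move=> c x; rewrite /free_lift mmapZ /= mulr_algl. Qed.
HB.instance Definition _ g :=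
  GRing.isScalable.Build k (freealg k G) B *:%R (free_lift g) (free_lift_scale g).

Lemma free_lift_gen g x : free_lift g (gen k x) = g x.
Proof.
by rewrite /free_lift /gen mmapU /= scale1r mul1r /word_map fmU big_seq1.
Qed.

Lemma freealg_ind (P : freealg k G -> Prop) :
  P 1 -> (forall x u, P u -> P (gen k x * u)) ->
  (forall u v, P u -> P v -> P (u + v)) -> (forall c u, P u -> P (c *: u)) ->
  forall u, P u.
Proof.
move=> P1 PM PD PZ u; rewrite (monalgE u); apply: (big_ind P) => // [|m _].
  by rewrite -[0](scale0r (1 : freealg k G)); apply: PZ.
have -> : << u@_m *g m >> = u@_m *: (<< m >> : freealg k G).
  by apply/malgP => m'; rewrite mcoeffZ !mcoeffU mulr_natr.
apply: PZ; case: m => s; elim: s => [|x s IH].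
  have <- : @mone {fmonom G} = FMonom [::] by apply: val_inj; rewrite /= fm1.
  exact: P1.
have -> : << FMonom (x :: s) >> = gen k x * << FMonom s >> :> freealg k G.
  rewrite /gen malgM_def fgmulUU mulr1; congr << _ *g _ >>; apply: val_inj.
  by rewrite /= fmM fmU.
exact: PM.
Qed.

End FreeLift.

Section QuotientLift.
Context (k : comNzRingType) (A : algType k) (rel : A -> Prop) (B : algType k).
Context (g : {lrmorphism A -> B}) (grel : forall r, rel r -> g r = 0).

Definition quot_map (u : quotalg rel) : B := g (repr u).

Lemma quot_map_pi x : quot_map (quot_pi rel x) = g x.
Proof.
apply/eqP; rewrite -subr_eq0 -rmorphB; apply/eqP.
elim: {x} (ideal_repr rel x) => [r|//|x y _ hx _ hy|a x b _ hx].
- exact: grel.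
- by rewrite rmorph0.
- by rewrite rmorphD hx hy addr0.
- by rewrite !rmorphM hx mulr0 mul0r.
Qed.

Lemma quot_mapB : zmod_morphism quot_map.
Proof.
move=> u v; rewrite -[u]quot_pi_surj -[v]quot_pi_surj -raddfB !quot_map_pi.
exact: rmorphB.
Qed.

Lemma quot_mapM : {morph quot_map : u v / u * v}.
Proof.
move=> u v; rewrite -[u]quot_pi_surj -[v]quot_pi_surj -rmorphM !quot_map_pi.
exact: rmorphM.
Qed.

Lemma quot_map1 : quot_map 1 = 1.
Proof. by rewrite -(rmorph1 (quot_pi rel)) quot_map_pi rmorph1. Qed.

Lemma quot_mapZ c u : quot_map (c *: u) = c *: quot_map u.
Proof.
rewrite -[u]quot_pi_surj -[X in quot_map X]/(quot_scale c (quot_pi rel (repr u))).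
by rewrite -quot_piZ !quot_map_pi linearZ.
Qed.

End QuotientLift.

(** * The covector representation *)

(* [Before h], [After h] and [Split L M] stand for the covectors <0|F^h (before and
   after f has been met) and <0|F^L f F^M of the algebra in which only the part
   [-K^-1] of [K - K^-1] is kept in the commutator of E and F. *)
Inductive state := Before of nat | After of nat | Split of nat & nat.

(** The format of most computations below: [z] is a combination of relators, zero by the relations
    at hand, and the other equation holds in a free algebra, where [nc] reduces it to
    coefficients. *)
Lemma eq_certificate (V : zmodType) (z u v : V) : z = 0 -> u = v + z -> u = v.
Proof. by move=> -> ->; rewrite addr0. Qed.

Section Covectors.
Context (F : fieldType) (q y c : F) (hq : not_root_of_unity q).
Context (U : algType F) (p : nat) (e f Fm Z W : U).

Let P := q ^+ p.
Let r := q ^- 2.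
Let dq := q - q^-1.

(** The trace 1 + r + ... + r^(h-1) of the factors K^-1 that appear when E is moved through F^h. *)
Fixpoint al (h : nat) : F := if h is h'.+1 then al h' + r ^+ h' else 0.

Definition kwt (s : state) : F :=
  match s with
  | Before h | After h => r ^+ h
  | Split L M => P * r ^+ L * r ^+ M
  end.

(** [m s] is the coefficient at the covector [s]: the first summand multiplies it by [Fm], weighted
    with K^-1, and the second moves covectors, so that the value at height h + 1 is read from height
    h. *)
Definition covF (m : state -> U) (s : state) : U :=
  kwt s *: (m s * Fm) +
  match s with
  | Before h => if h is h'.+1 then m (Before h') else 0
  | After h => if h is h'.+1 then m (After h') else 0
  | Split L M => if M is M'.+1 then m (Split L M') else 0
  end.

(** From <0|E = 0 and [E, F] = - c K^-1 / (q - q^-1): moving E to the left through F^(h+1) leaves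
    [al h.+1], and the K^-1 that accompanies E inside e contributes [r ^+ h]. *)
Definition epsE (h : nat) : F := c * al h.+1 * r ^+ h / dq.
(** Forced by two conditions: gwt L h.+1 = r * gwt L h makes the W-terms compatible with F
    ([sumW_F]), and gwt h.+1 h = epsE h * P^(h+1) * mu cancels the W-part of Z f - f Z
    ([covY_after]). *)
Definition gwt (L h : nat) : F :=
  c * (P ^+ L * (1 - P ^- 2) * al L * r ^+ h) / (dq * (y - y^-1)).

Definition cove (m : state -> U) (s : state) : U :=
  kwt s *: (m s * e) +
  match s with
  | Before h => epsE h *: (m (Before h.+1) * Z)
  | After h => epsE h *: (m (After h.+1) * Z) +
      \sum_(L < h.+2) gwt L h *: (m (Split L (h.+1 - L)) * W)
  | Split L M => (c * kwt s / dq) *: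
      (al L.+1 *: (m (Split L.+1 M) * Z) + (P * r ^+ L * al M.+1) *: (m (Split L M.+1) * Z))
  end.

Definition covf (m : state -> U) (s : state) : U :=
  match s with
  | Before _ => 0
  | After h => P ^+ h *: (m (Before h) * f)
  | Split L M => if M is _.+1 then 0 else m (Before L)
  end.

Lemma fctZD a (u v : state -> U) s : (a *: u + v) s = a *: u s + v s.
Proof. by []. Qed.

Lemma covF_linear a u v : covF (a *: u + v) = a *: covF u + covF v.
Proof.
apply/funext => s; rewrite fctZD /covF.
by case: s => [[|h]|[|h]|L [|M]]; rewrite !fctZD; nc; ring.
Qed.

Lemma cove_linear a u v : cove (a *: u + v) = a *: cove u + cove v.
Proof.
apply/funext => s; rewrite fctZD /cove; case: s => [h|h|L M]; rewrite !fctZD.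
- by nc; ring.
- have -> : \sum_(L < h.+2) gwt L h *: ((a *: u + v) (Split L (h.+1 - L)) * W) =
    a *: (\sum_(L < h.+2) gwt L h *: (u (Split L (h.+1 - L)) * W)) +
    \sum_(L < h.+2) gwt L h *: (v (Split L (h.+1 - L)) * W).
    rewrite scaler_sumr -big_split /=; apply: eq_bigr => L _.
    by rewrite fctZD; nc; ring.
  set Su := \sum_(L < h.+2) gwt L h *: (u _ * W).
  set Sv := \sum_(L < h.+2) gwt L h *: (v _ * W).
  by nc; ring.
- by nc; ring.
Qed.

Lemma covf_linear a u v : covf (a *: u + v) = a *: covf u + covf v.
Proof.
apply/funext => s; rewrite fctZD /covf.
by case: s => [h|h|L [|M]]; rewrite ?fctZD; nc; ring.
Qed.

Definition vacuum (s : state) : U := if s is Before 0 then 1 else 0.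

Lemma vacuum_neq0 : vacuum != 0.
Proof.
apply/negP => /eqP /(congr1 (fun m => m (Before 0))) /=.
by move/eqP; rewrite oner_eq0.
Qed.

Definition endF : endo vacuum_neq0 := mk_endo vacuum_neq0 covF_linear.
Definition ende : endo vacuum_neq0 := mk_endo vacuum_neq0 cove_linear.
Definition endf : endo vacuum_neq0 := mk_endo vacuum_neq0 covf_linear.

Let kappa := c * q ^+ 2 / dq.
Let mu := (1 - P ^- 2) / (y - y^-1).
Hypothesis heF : e * Fm = q ^+ 2 *: (Fm * e) + kappa *: Z.
Hypothesis hZF : Z * Fm = Fm * Z.
Hypothesis hWF : W * Fm = P *: (Fm * W).
Let V := Z * f - f * Z - mu *: W.
Hypothesis hVF : V * Fm = P^-1 *: (Fm * V).
Hypothesis hYF : (e * f - P^-1 *: (f * e)) * Fm =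
  (q ^+ 2 / P) *: (Fm * (e * f - P^-1 *: (f * e))) + (kappa / P) *: V.

Let P0 : P != 0. Proof. by rewrite expf_neq0 // q_neq0. Qed.
Let q0 : q != 0. Proof. exact: q_neq0. Qed.
Let d0 : dq != 0. Proof. exact: q_sub_inv_neq0. Qed.
Let rE : r = (q ^+ 2)^-1. Proof. by []. Qed.

Let dF : e * Fm - q ^+ 2 *: (Fm * e) - kappa *: Z = 0.
Proof. by rewrite heF -addrA -opprD subrr. Qed.
Let dZF : Z * Fm - Fm * Z = 0. Proof. by rewrite hZF subrr. Qed.
Let dWF : W * Fm - P *: (Fm * W) = 0. Proof. by rewrite hWF subrr. Qed.

Let sumW m h := \sum_(L < h.+2) gwt L h *: (m (Split L (h.+1 - L)) * W).

Let sumW_F m h : sumW (covF m) h = r ^+ h.+1 *: (sumW m h * Fm) +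
  r *: (if h is h'.+1 then sumW m h' else 0).
Proof.
have -> : r *: (if h is h'.+1 then sumW m h' else 0) =
    \sum_(L < h.+1) gwt L h *: (m (Split L (h - L)) * W).
  case: h => [|h].
    by rewrite big_ord1 scaler0 /gwt /= mulr0 mul0r mulr0 mul0r scale0r.
  rewrite /sumW scaler_sumr; apply: eq_bigr => L _; rewrite scalerA; congr (_ *: _).
  by rewrite /gwt [r ^+ _.+1]exprS; ring.
rewrite /sumW mulr_suml scaler_sumr [in RHS]big_ord_recr /= [LHS]big_ord_recr /=.
rewrite [RHS]addrAC -big_split /=; congr (_ + _).
  apply: eq_bigr => L _; rewrite /covF.
  have hL : (L <= h)%N by have := ltn_ord L; rewrite ltnS.
  rewrite subSn //.
  apply: (eq_certificate (z := (- (gwt L h * r ^+ h.+1)) *: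
     (m (Split L (h - L).+1) * (W * Fm - P *: (Fm * W))))); first by rewrite dWF mulr0 scaler0.
  have -> : r ^+ h.+1 = r ^+ L * r ^+ (h - L).+1 by rewrite -exprD; congr (_ ^+ _); lia.
  by rewrite /=; nc; ring.
rewrite /covF subnn /= addr0.
apply: (eq_certificate (z := (- (gwt h.+1 h * r ^+ h.+1)) *:
     (m (Split h.+1 0) * (W * Fm - P *: (Fm * W))))); first by rewrite dWF mulr0 scaler0.
by nc; ring.
Qed.

(** The defect [kappa *: Z] is absorbed by the differences of the Z-weights of neighbouring
    covectors, and the W-terms match by [sumW_F]. *)
Lemma covector_eF : endF * ende = q ^+ 2 *: (ende * endF).
Proof.
apply: endoP => m; rewrite endoZ !endoM /=; apply/funext => s.
rewrite -[RHS]/(q ^+ 2 *: cove (covF m) s).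
case: s => [h|h|L M].
- apply: (eq_certificate (z :=
      (r ^+ h * r ^+ h) *: (m (Before h) * (e * Fm - q ^+ 2 *: (Fm * e) - kappa *: Z))
      + (epsE h * r ^+ h) *: (m (Before h.+1) * (Z * Fm - Fm * Z)))).
    by rewrite dF dZF !mulr0 !scaler0 addr0.
  rewrite /covF /cove /epsE; case: h => [|h] /=; rewrite ?exprS ?expr0.
    by nc; try ring; rewrite ?rE /kappa; field; rewrite ?q0 ?d0.
  by nc; try ring; rewrite ?rE /kappa; field; rewrite ?q0 ?d0.
- apply: (eq_certificate (z :=
      (r ^+ h * r ^+ h) *: (m (After h) * (e * Fm - q ^+ 2 *: (Fm * e) - kappa *: Z))
      + (epsE h * r ^+ h) *: (m (After h.+1) * (Z * Fm - Fm * Z)))).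
    by rewrite dF dZF !mulr0 !scaler0 addr0.
  rewrite {1}/covF /cove -/(sumW m h) -/(sumW (covF m) h) sumW_F /covF /epsE.
  case: h => [|h] /=; rewrite ?exprS ?expr0 ?scaler0.
    set S0 := sumW m 0.
    by nc; try ring; rewrite ?rE /kappa; field; rewrite ?q0 ?d0.
  rewrite -/(sumW m h); set S1 := sumW m h; set S2 := sumW m h.+1.
  by nc; try ring; rewrite ?rE /kappa; field; rewrite ?q0 ?d0.
- set s := P * r ^+ L * r ^+ M.
  apply: (eq_certificate (z :=
      (s * s) *: (m (Split L M) * (e * Fm - q ^+ 2 *: (Fm * e) - kappa *: Z))
      + (s * c * s / dq * al L.+1) *: (m (Split L.+1 M) * (Z * Fm - Fm * Z))
      + (s * c * s / dq * (P * r ^+ L * al M.+1)) *: (m (Split L M.+1) * (Z * Fm - Fm * Z)))).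
    by rewrite dF dZF !mulr0 !scaler0 !addr0.
  rewrite /covF /cove /s; case: M @s => [|M] s /=; rewrite ?exprS ?expr0.
    by nc; try ring; rewrite ?rE /kappa; field; rewrite ?q0 ?d0.
  by nc; try ring; rewrite ?rE /kappa; field; rewrite ?q0 ?d0.
Qed.

Let Y0 := e * f - P^-1 *: (f * e).

Let covY m := covf (cove m) - P^-1 *: cove (covf m).

(** Only [After] components survive in [covY], and the choice of [gwt] leaves [V] in place of the
    full commutator of Z and f. Unlike that commutator, [V] q-commutes with [Fm]. *)
Let covY_after m h : covY m (After h) =
  (P * r) ^+ h *: (m (Before h) * Y0) + (epsE h * P ^+ h) *: (m (Before h.+1) * V).
Proof.
rewrite -[LHS]/(covf (cove m) (After h) - P^-1 *: cove (covf m) (After h)).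
rewrite /cove /covf big_ord_recr big1 /= => [|L _]; last first.
  by rewrite subSn ?mul0r ?scaler0 // -ltnS.
rewrite subnn add0r.
have -> : gwt h.+1 h = epsE h * P ^+ h.+1 * mu.
  by rewrite /gwt /epsE /mu [(dq * _)^-1]invfM; ring.
by rewrite /Y0 /V exprMn exprS; nc; try ring; field.
Qed.

Let covY_before m h : covY m (Before h) = 0.
Proof.
rewrite -[LHS]/(covf (cove m) (Before h) - P^-1 *: cove (covf m) (Before h)).
by rewrite /cove /covf; nc; ring.
Qed.

Let covY_split m L M : covY m (Split L M) = 0.
Proof.
rewrite -[LHS]/(covf (cove m) (Split L M) - P^-1 *: cove (covf m) (Split L M)).
rewrite /cove /covf; case: M => [|M] /=; last by nc; ring.
by rewrite /epsE /= expr0 !mulr1; nc; try ring; field; rewrite ?P0 ?d0.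
Qed.

Lemma covector_g : endF * (endf * ende - P^-1 *: (ende * endf)) =
  (q ^+ 2 / P) *: ((endf * ende - P^-1 *: (ende * endf)) * endF).
Proof.
apply: endoP => m; rewrite endoZ !endoM; apply/funext => s.
rewrite -[LHS]/(covF (covY m) s) -[RHS]/((q ^+ 2 / P) *: covY (covF m) s).
have dYF : Y0 * Fm - (q ^+ 2 / P) *: (Fm * Y0) - (kappa / P) *: V = 0.
  by rewrite hYF -addrA -opprD subrr.
have dVF : V * Fm - P^-1 *: (Fm * V) = 0 by rewrite hVF subrr.
case: s => [h|h|L M]; first 2 last.
- rewrite covY_split scaler0 /covF covY_split mul0r scaler0 add0r.
  by case: M => // M; rewrite covY_split.
- rewrite covY_before scaler0 /covF covY_before mul0r scaler0 add0r.
  by case: h => // h; rewrite covY_before.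
rewrite covY_after /covF; apply: (eq_certificate (z :=
   (r ^+ h * (P * r) ^+ h) *: (m (Before h) *
      (Y0 * Fm - (q ^+ 2 / P) *: (Fm * Y0) - (kappa / P) *: V)) +
   (r ^+ h * (epsE h * P ^+ h)) *: (m (Before h.+1) * (V * Fm - P^-1 *: (Fm * V))))).
  by rewrite dYF dVF !mulr0 !scaler0 addr0.
clear dYF dVF; case: h => [|h]; rewrite !covY_after; move: Y0 V => y0 v0;
  rewrite /epsE /= ?exprMn ?exprS ?expr0.
  by nc; try ring; rewrite ?rE /kappa; field; rewrite ?q0 ?d0 ?P0.
by nc; try ring; rewrite ?rE /kappa; field; rewrite ?q0 ?d0 ?P0.
Qed.

(* [endo]-composition reverses the words acting on covectors from the right,
   so the roles of e and F are exchanged here. *)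
Lemma covector_serre : serre q p.+1 (endF + ende) endf =
  serre q p.+1 endF endf + serre q p.+1 ende endf.
Proof.
have Pz : q ^ (- p%:Z) = P^-1 by rewrite exprnN.
apply: serre_mixed => //; first exact: covector_eF.
by rewrite expfzDr ?q_neq0 // Pz covector_g.
Qed.

End Covectors.

(** * Sums over words *)

Section Words.
Context (T : eqType) (A : seq T).

Fixpoint words (n : nat) : seq (seq T) :=
  if n is n'.+1 then [seq x :: w | x <- A, w <- words n'] else [:: [::]].

Lemma big_wordsS (V : nmodType) n (P : pred (seq T)) (G : seq T -> V) :
  \sum_(w <- words n.+1 | P w) G w =
  \sum_(x <- A) \sum_(w <- words n | P (x :: w)) G (x :: w).
Proof.
rewrite big_mkcond /= big_allpairs_dep; apply: eq_bigr => x _.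
by rewrite [RHS]big_mkcond.
Qed.

Lemma big_words_cat (V : nmodType) m n (G : seq T -> V) :
  \sum_(w <- words (m + n)) G w =
  \sum_(v <- words m) \sum_(w <- words n) G (v ++ w).
Proof.
elim: m G => [|m IH] G; first by rewrite big_seq1.
rewrite addSn !big_wordsS; apply: eq_bigr => x _.
by rewrite IH.
Qed.

Lemma mem_words n w : w \in words n = (size w == n) && all (mem A) w.
Proof.
elim: n w => [|n IH] [|x w] //=; first by apply/negbTE/negP => /allpairsP[[y v] []].
apply/allpairsP/idP => [[[y v] /= [hy hv [-> ->]]]|].
  by move: hv; rewrite IH eqSS hy => /andP[-> ->].
rewrite eqSS => /andP[hs /andP[hx hw]].
by exists (x, w); split; rewrite //= IH hs.
Qed.

Lemma words_uniq n : uniq A -> uniq (words n).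
Proof.
move=> uA; elim: n => //= n IH; apply: allpairs_uniq => // -[x v] [y w] _ _ /=.
by case=> -> ->.
Qed.

End Words.

Lemma big_tuple_words (T : finType) (V : nmodType) n (P : pred (seq T)) (G : seq T -> V) :
  \sum_(t : n.-tuple T | P t) G t = \sum_(w <- words (enum T) n | P w) G w.
Proof.
transitivity (\sum_(t <- enum {: n.-tuple T} | P t) G t).
  by rewrite big_enum_cond; apply: eq_bigl => t; rewrite inE.
rewrite -(big_map val P G).
apply: perm_big; apply: uniq_perm.
- by rewrite map_inj_uniq ?enum_uniq //; apply: val_inj.
- by apply/words_uniq/enum_uniq.
move=> w; rewrite mem_words; apply/mapP/andP => [[t _ ->]|[hs _]].
  by rewrite size_tuple; split=> //; apply/allP => x _; rewrite inE mem_enum.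
by exists (Tuple hs); rewrite ?mem_enum.
Qed.

Definition bits : seq bool := [:: true; false].
Definition letters : seq (option bool) := [:: None; Some true; Some false].

Lemma big_bool_words (V : nmodType) n (P : pred (seq bool)) (G : seq bool -> V) :
  \sum_(t : n.-tuple bool | P t) G t = \sum_(w <- words bits n | P w) G w.
Proof.
rewrite big_tuple_words; apply: perm_big; apply: uniq_perm; try exact/words_uniq/enum_uniq.
  exact: words_uniq.
move=> w; rewrite !mem_words; congr (_ && _); apply: eq_all => x.
by rewrite !inE mem_enum; case: x.
Qed.

(* The letters l_r = 1 become [None], and the others are filled with s. *)
Fixpoint merge (l s : seq bool) : seq (option bool) :=
  match l, s with
  | [::], _ => [::]
  | true :: l', _ => None :: merge l' s
  | false :: l', x :: s' => Some x :: merge l' s'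
  | false :: l', [::] => None :: merge l' [::]
  end.

Lemma big_merge (V : nmodType) n m (G : seq (option bool) -> V) : (m <= n)%N ->
  \sum_(w <- words letters n | count (pred1 None) w == m) G w =
  \sum_(l <- words bits n | count id l == m) \sum_(s <- words bits (n - m)) G (merge l s).
Proof.
elim: n m G => [|n IH] m G hm.
  have -> : m = 0%N by [lia].
  by rewrite /= !big_cons !big_nil /= ?big_cons ?big_nil !addr0.
rewrite !big_wordsS !big_cons !big_nil /= !addr0; congr (_ + _).
  case: m hm => [|m] hm.
    by rewrite !big_pred0 // => w; rewrite add1n.
  under eq_bigl => w do rewrite add1n eqSS.
  by rewrite IH //; apply: eq_big => // l; rewrite ?add1n ?eqSS.
under eq_bigl => w do rewrite add0n.
under [X in _ + X]eq_bigl => w do rewrite add0n.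
under [RHS]eq_bigl => w do rewrite add0n.
(* Here m = n.+1, so a word that does not begin with [None] runs out of letters and all three sums
   are empty. *)
case: (ltnP n m) => hnm.
  rewrite [X in X + _]big_seq_cond [X in _ + X]big_seq_cond [RHS]big_seq_cond.
  rewrite !big_pred0 ?addr0 // => w.
  - rewrite mem_words; apply/negP => /andP[/andP[/eqP hs _] /eqP hc].
    by move: hs hnm; rewrite -hc => hs; have := count_size _ w; rewrite hs => h1 h2; have := leq_trans h2 (h1 _); rewrite ltnn.
  - rewrite mem_words; apply/negP => /andP[/andP[/eqP hs _] /eqP hc].
    by move: hs hnm; rewrite -hc => hs; have := count_size _ w; rewrite hs => h1 h2; have := leq_trans h2 (h1 _); rewrite ltnn.
  - rewrite mem_words; apply/negP => /andP[/andP[/eqP hs _] /eqP hc].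
    by move: hs hnm; rewrite -hc => hs; have := count_size _ w; rewrite hs => h1 h2; have := leq_trans h2 (h1 _); rewrite ltnn.
rewrite !IH // -big_split /=; apply: eq_bigr => l _.
by rewrite subSn // big_wordsS !big_cons big_nil addr0.
Qed.

Local Notation split_weight := gwt.

(** * Matrix coefficients as sums over lattice paths *)

Section Evaluation.
Context (F : fieldType) (q y c : F) (hq : not_root_of_unity q).
Context (U : algType F) (p : nat) (e f Fm Z W : U).

Let P := q ^+ p.
Let r := q ^- 2.
Let dq := q - q^-1.
Let b := Fm + e.
Let al := al q.
Let kwt := kwt q p.
Let epsE := epsE q c.
Let gwt := gwt q y c p.

Definition single (s : state) (u : U) (s' : state) : U :=
  match s, s' with
  | Before h, Before h' | After h, After h' => if h == h' then u else 0
  | Split L M, Split L' M' => if (L == L') && (M == M') then u else 0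
  | _, _ => 0
  end.

(* Programs are words in b (true) and f (false), acting from the left to the right. *)
Fixpoint eval (w : seq bool) (s : state) : U :=
  match w with
  | [::] => if s is After 0 then 1 else 0
  | true :: w' => kwt s *: (b * eval w' s) +
    match s with
    | Before h => eval w' (Before h.+1) +
        (if h is h'.+1 then epsE h' *: (Z * eval w' (Before h')) else 0)
    | After h => eval w' (After h.+1) +
        (if h is h'.+1 then epsE h' *: (Z * eval w' (After h')) else 0)
    | Split L M => eval w' (Split L M.+1) +
        (if L is L'.+1 then (c * (P * r ^+ L' * r ^+ M) / dq * al L) *:
           (Z * eval w' (Split L' M)) else 0) +
        (if M is M'.+1 then (c * (P * r ^+ L * r ^+ M') / dq * (P * r ^+ L * al M)) *:
           (Z * eval w' (Split L M')) else 0) +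
        (if (L + M)%N is h.+1 then gwt L h *: (W * eval w' (After h)) else 0)
    end
  | false :: w' =>
    if s is Before h then P ^+ h *: (f * eval w' (After h)) + eval w' (Split h 0) else 0
  end.

Definition covb (m : state -> U) : state -> U := covF q p Fm m + cove q y c p e Z W m.

Fixpoint act (w : seq bool) (m : state -> U) : state -> U :=
  match w with
  | [::] => m
  | true :: w' => act w' (covb m)
  | false :: w' => act w' (covf q p f m)
  end.

Lemma covb_linear a u v : covb (a *: u + v) = a *: covb u + covb v.
Proof.
have E (m1 m2 m3 m4 : state -> U) :
    (a *: m1 + m2) + (a *: m3 + m4) = a *: (m1 + m3) + (m2 + m4).
  by rewrite scalerDr addrACA.
by rewrite /covb covF_linear cove_linear E.
Qed.

Lemma act_linear w a u v : act w (a *: u + v) = a *: act w u + act w v.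
Proof.
elim: w u v => [|[] w IH] u v //=; first by rewrite covb_linear IH.
by rewrite covf_linear IH.
Qed.

Lemma actD w u v : act w (u + v) = act w u + act w v.
Proof. by rewrite -[u in LHS]scale1r act_linear scale1r. Qed.

Lemma act0 w : act w 0 = 0.
Proof. by apply: (addrI (act w 0)); rewrite -actD !addr0. Qed.

Lemma actZ w a u : act w (a *: u) = a *: act w u.
Proof. by rewrite -[_ *: _]addr0 act_linear act0 addr0. Qed.

Let fctD (u v : state -> U) s : (u + v) s = u s + v s. Proof. by []. Qed.
Let fctZ a (u : state -> U) s : (a *: u) s = a *: u s. Proof. by []. Qed.
Let fct0 s : (0 : state -> U) s = 0. Proof. by []. Qed.

Let sum0 h (m : state -> U) : (forall L M, m (Split L M) = 0) ->
  \sum_(L < h.+2) split_weight q y c p L h *: (m (Split L (h.+1 - L)) * W) = 0.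
Proof. by move=> hm; rewrite big1 // => L _; rewrite hm mul0r scaler0. Qed.

Ltac by_states := rewrite ?fctZ ?fct0 /= ?eqSS;
  do 8?(case: eqVneq => [?|?]; try subst; try lia);
  rewrite /= /b /epsE /kwt /al /gwt /P /r /dq ?expr0; nc; try ring.

Lemma covb_before h u : covb (single (Before h) u) =
  kwt (Before h) *: single (Before h) (u * b) + single (Before h.+1) u +
  (if h is h'.+1 then epsE h' *: single (Before h') (u * Z) else 0).
Proof.
apply/funext => s; rewrite /covb !fctD !fctZ.
case: s => [k|k|L M]; rewrite /covF /cove.
- case: h => [|h]; case: k => [|k]; by_states.
- by rewrite (@sum0 k (single (Before h) u)) //; case: h => [|h]; case: k => [|k]; by_states.
- by case: M => [|M]; case: h => [|h]; by_states.
Qed.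

Lemma covb_after h u : covb (single (After h) u) =
  kwt (After h) *: single (After h) (u * b) + single (After h.+1) u +
  (if h is h'.+1 then epsE h' *: single (After h') (u * Z) else 0).
Proof.
apply/funext => s; rewrite /covb !fctD !fctZ.
case: s => [k|k|L M]; rewrite /covF /cove.
- by case: h => [|h]; case: k => [|k]; by_states.
- by rewrite (@sum0 k (single (After h) u)) //; case: h => [|h]; case: k => [|k]; by_states.
- by case: M => [|M]; case: h => [|h]; by_states.
Qed.

Let sum_single L M u h :
  \sum_(K < h.+2) split_weight q y c p K h *: (single (Split L M) u (Split K (h.+1 - K)) * W) =
  if (L + M == h.+1)%N then gwt L h *: (u * W) else 0.
Proof.
case: eqP => [hLM|hLM]; last first.
  rewrite big1 // => K _ /=; case: ifP; rewrite ?mul0r ?scaler0 // => /andP[/eqP h1 /eqP h2].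
  by case: hLM; have := ltn_ord K; lia.
have hL : (L < h.+2)%N by lia.
rewrite (bigD1 (Ordinal hL)) //= big1 ?addr0 => [|K hK].
  by rewrite eqxx (_ : M == h.+1 - L)%N //; lia.
rewrite /=; case: ifP; rewrite ?mul0r ?scaler0 // => /andP[/eqP h1 /eqP h2].
by case/negP: hK; apply/eqP/val_inj.
Qed.

Lemma covb_split L M u : covb (single (Split L M) u) =
  kwt (Split L M) *: single (Split L M) (u * b) + single (Split L M.+1) u +
  (if L is L'.+1 then (c * (P * r ^+ L' * r ^+ M) / dq * al L) *:
      single (Split L' M) (u * Z) else 0) +
  (if M is M'.+1 then (c * (P * r ^+ L * r ^+ M') / dq * (P * r ^+ L * al M)) *:
      single (Split L M') (u * Z) else 0) +
  (if (L + M)%N is h.+1 then gwt L h *: single (After h) (u * W) else 0).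
Proof.
apply/funext => s; rewrite /covb !fctD !fctZ.
case: s => [k|k|K N]; rewrite /covF /cove.
- case: k => [|k]; case: L => [|L]; case: M => [|M]; rewrite /= ?addn0 ?add0n ?addnS; by_states.
- rewrite sum_single; case: k => [|k]; case: L => [|L]; case: M => [|M]; rewrite /= ?addn0 ?add0n ?addnS; by_states.
- case: N => [|N]; case: L => [|L]; case: M => [|M]; rewrite /= ?addn0 ?add0n ?addnS; by_states.
Qed.

(** [eval] is the transposed description of [act]: in [covb_before], [covb_after] and [covb_split]
    every operator multiplies the value from the right, so [u] factors out. *)
Lemma act_single w s u : act w (single s u) (After 0) = u * eval w s.
Proof.
elim: w s u => [|[] w IH] s u.
- by case: s => [h|[|h]|L M] /=; rewrite ?mulr0 ?mulr1.
- case: s => [h|h|L M]; rewrite [act _ _]/= [eval _ _]/=.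
  + rewrite covb_before !actD actZ !fctD fctZ !IH.
    by case: h => [|h]; rewrite ?act0 ?fct0 ?actZ ?fctZ ?IH /kwt /=; nc; ring.
  + rewrite covb_after !actD actZ !fctD fctZ !IH.
    by case: h => [|h]; rewrite ?act0 ?fct0 ?actZ ?fctZ ?IH /kwt /=; nc; ring.
  + rewrite covb_split !actD actZ !fctD fctZ !IH.
    case: (L + M)%N => [|h]; case: L => [|L]; case: M => [|M];
      by rewrite ?act0 ?fct0 ?actZ ?fctZ ?IH /kwt /=; nc; ring.
- rewrite [act _ _]/= [eval _ _]/=; case: s => [h|h|L M].
  + have -> : covf q p f (single (Before h) u) =
        P ^+ h *: single (After h) (u * f) + single (Split h 0) u.
      apply/funext => s; rewrite fctD fctZ /covf.
      case: s => [k|k|L [|M]]; rewrite /single /=; last by rewrite andbF; nc; ring.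
      * by nc; ring.
      * by case: eqVneq => [->|_]; rewrite /P; nc; ring.
      * by rewrite andbT; case: eqVneq => [->|_]; nc; ring.
    by rewrite actD actZ fctD fctZ !IH; nc; ring.
  + have -> : covf q p f (single (After h) u) = 0.
      by apply/funext => s; rewrite /covf /single; case: s => [k|k|L [|M]]; rewrite ?fct0 /=; nc; ring.
    by rewrite act0 mulr0.
  + have -> : covf q p f (single (Split L M) u) = 0.
      by apply/funext => s; rewrite /covf /single; case: s => [k|k|K [|N]]; rewrite ?fct0 /=; nc; ring.
    by rewrite act0 mulr0.
Qed.

(** The truncated predecessor at height 0 is harmless, since [pweight] and [sweight] vanish on words
    that step below 0. *)
Fixpoint height (h : nat) (w : seq (option bool)) : nat :=
  match w with
  | [::] => h
  | None :: w' => height h w'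
  | Some true :: w' => height h.+1 w'
  | Some false :: w' => height h.-1 w'
  end.

Fixpoint pweight (h : nat) (w : seq (option bool)) : F :=
  match w with
  | [::] => 1
  | None :: w' => r ^+ h * pweight h w'
  | Some true :: w' => pweight h.+1 w'
  | Some false :: w' => if h is h'.+1 then epsE h' * pweight h' w' else 0
  end.

(** The base case is the weight of the W-step that closes a split stretch. A lowering step removes
    one F either in front of f or behind it, whence the sum of two terms. *)
Fixpoint sweight (L M : nat) (w : seq (option bool)) : F :=
  match w with
  | [::] => if (L + M)%N is h.+1 then gwt L h else 0
  | None :: w' => P * r ^+ L * r ^+ M * sweight L M w'
  | Some true :: w' => sweight L M.+1 w'
  | Some false :: w' =>
     (if L is L'.+1 then c * (P * r ^+ L' * r ^+ M) / dq * al L * sweight L' M w' else 0) +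
     (if M is M'.+1 then c * (P * r ^+ L * r ^+ M') / dq * (P * r ^+ L * al M) *
        sweight L M' w' else 0)
  end.

Let nk (w : seq (option bool)) := count (pred1 None) w.
Let nE (w : seq (option bool)) := count (pred1 (Some false)) w.

Hypothesis hbZ : b * Z = Z * b.

Let ZbX k l X : Z * (b ^+ k * Z ^+ l * X) = b ^+ k * Z ^+ l.+1 * X.
Proof.
have : GRing.comm Z (b ^+ k) by apply: commrX; apply/esym.
by rewrite exprS !mulrA => ->.
Qed.

Let sum_letters (V : nmodType) n (G : seq (option bool) -> V) :
  \sum_(w <- words letters n.+1) G w = \sum_(w <- words letters n) G (None :: w) +
  (\sum_(w <- words letters n) G (Some true :: w) +
   \sum_(w <- words letters n) G (Some false :: w)).
Proof. by rewrite big_wordsS !big_cons big_nil addr0. Qed.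

Let sumZ (I : Type) (s : seq I) (a : F) (X : U) (G : I -> F) (Y : I -> U) :
  a *: (X * \sum_(i <- s) G i *: Y i) = \sum_(i <- s) (a * G i) *: (X * Y i).
Proof.
by rewrite mulr_sumr scaler_sumr; apply: eq_bigr => i _; rewrite -scalerAr scalerA.
Qed.

Lemma eval_after n v h : eval (nseq n true ++ v) (After h) =
  \sum_(w <- words letters n)
    pweight h w *: (b ^+ nk w * Z ^+ nE w * eval v (After (height h w))).
Proof.
elim: n h => [|n IH] h; first by rewrite big_seq1 /= !expr0 !mul1r scale1r.
rewrite sum_letters [LHS]/= IH sumZ; congr (_ + _).
  by apply: eq_bigr => w _; rewrite /nk /nE /= add1n add0n [b ^+ _.+1]exprS !mulrA.
rewrite IH; congr (_ + _).
case: h => [|h].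
  by rewrite big1 // => w _; rewrite /= scale0r.
rewrite IH sumZ; apply: eq_bigr => w _; rewrite ZbX /=.
by rewrite /nk /nE /= add0n add1n.
Qed.

Lemma eval_before n v h : eval (nseq n true ++ v) (Before h) =
  \sum_(w <- words letters n)
    pweight h w *: (b ^+ nk w * Z ^+ nE w * eval v (Before (height h w))).
Proof.
elim: n h => [|n IH] h; first by rewrite big_seq1 /= !expr0 !mul1r scale1r.
rewrite sum_letters [LHS]/= IH sumZ; congr (_ + _).
  by apply: eq_bigr => w _; rewrite /nk /nE /= add1n add0n [b ^+ _.+1]exprS !mulrA.
rewrite IH; congr (_ + _).
case: h => [|h].
  by rewrite big1 // => w _; rewrite /= scale0r.
rewrite IH sumZ; apply: eq_bigr => w _; rewrite ZbX /=.
by rewrite /nk /nE /= add0n add1n.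
Qed.

(** Split by the position [d] of the W-step. There must be one, because a program ending in a split
    state evaluates to 0. *)
Lemma eval_split n L M : eval (nseq n true) (Split L M) =
  \sum_(d < n) \sum_(w <- words letters d)
    sweight L M w *: (b ^+ nk w * Z ^+ nE w *
      (W * eval (nseq (n - d.+1) true) (After (height (L + M) w).-1))).
Proof.
elim: n L M => [|n IH] L M; first by rewrite big_ord0.
rewrite big_ord_recl big_seq1 [LHS]/= [LHS]addrA [LHS]addrC; congr (_ + _).
  rewrite /= subSS subn0 !expr0 !mul1r.
  by case: (L + M)%N => [|h] //=; rewrite scale0r.
have sumZ2 (a : F) (X : U) (G : forall d : 'I_n, seq (option bool) -> F)
    (Y : forall d : 'I_n, seq (option bool) -> U) :
    a *: (X * \sum_(d < n) \sum_(w <- words letters d) G d w *: Y d w) =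
    \sum_(d < n) \sum_(w <- words letters d) (a * G d w) *: (X * Y d w).
  by rewrite mulr_sumr scaler_sumr; apply: eq_bigr => d _; apply: sumZ.
under [RHS]eq_bigr => d _ do rewrite lift0 subSS sum_letters.
rewrite !big_split /=; congr (_ + _).
  rewrite IH sumZ2; apply: eq_bigr => d _; apply: eq_bigr => w _.
  by rewrite /nk /nE /= add1n add0n [b ^+ _.+1]exprS !mulrA.
rewrite -addrA; congr (_ + _).
  rewrite IH; apply: eq_bigr => d _; apply: eq_bigr => w _.
  by rewrite addnS.
rewrite /nk /nE /=.
have sum0s (Y : forall d : 'I_n, seq (option bool) -> U) :
    0 = \sum_(d < n) \sum_(w <- words letters d) 0 *: Y d w :> U.
  by rewrite big1 // => d _; rewrite big1 // => w _; rewrite scale0r.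
case: L => [|L]; case: M => [|M]; rewrite ?IH ?sumZ2 ?add0r ?addr0.
- rewrite [LHS](sum0s (fun d w => 0)); apply: eq_bigr => d _; apply: eq_bigr => w _.
  by rewrite ?addr0 !scale0r.
- apply: eq_bigr => d _; apply: eq_bigr => w _; rewrite ?add0r ZbX.
  by rewrite add0n add1n.
- apply: eq_bigr => d _; apply: eq_bigr => w _; rewrite ?addr0 ZbX.
  by rewrite add0n add1n !addn0.
- rewrite -big_split /=; apply: eq_bigr => d _; rewrite -big_split /=; apply: eq_bigr => w _.
  by rewrite !ZbX add0n add1n !addSn !addnS /= scalerDl.
Qed.

End Evaluation.

Lemma qbinom_sym (F : fieldType) (q : F) n l : (l <= n)%N -> qbinom q n (n - l) = qbinom q n l.
Proof. by move=> hl; rewrite /qbinom subKn // [X in _ / X]mulrC. Qed.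

Lemma sign_sub (R : pzRingType) n l : (l <= n)%N ->
  (-1) ^+ (n - l) = (-1) ^+ n * (-1) ^+ l :> R.
Proof.
by move=> hl; rewrite -[in RHS](subnK hl) exprD -mulrA -expr2 sqrr_sign mulr1.
Qed.

(** Endomorphisms acting on coefficients from the right compose backwards, so Serre polynomials of
    the coupled elements come out reversed. *)
Lemma serre_rev (F : fieldType) (q : F) (A : algType F) n (X Y : A) :
  \sum_(0 <= l < n.+1) ((-1) ^+ l * qbinom q n l) *: (X ^+ l * Y * X ^+ (n - l)) =
  (-1) ^+ n *: serre q n X Y.
Proof.
rewrite /serre scaler_sumr [LHS]big_nat_rev /= add0n.
apply: eq_big_nat => l /andP[_ hl]; rewrite subSS qbinom_sym // subKn // scalerA.
by rewrite sign_sub // mulrA.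
Qed.

(** * The vanishing alternating sum and its expansion *)

Section Identity.
Context (F : fieldType) (q y c : F) (hq : not_root_of_unity q).
Context (U : algType F) (p : nat) (e f Fm Z W : U).

Let P := q ^+ p.
Let r := q ^- 2.
Let dq := q - q^-1.
Let b := Fm + e.
Let kappa := c * q ^+ 2 / dq.
Let mu := (1 - P ^- 2) / (y - y^-1).
Let V := Z * f - f * Z - mu *: W.

(* V stands for the K_j^-1 part of [f Z - Z f]. *)
Record quasi_relations : Prop := QuasiRelations {
  quasi_Ff : serre q p.+1 Fm f = 0;
  quasi_ef : serre q p.+1 e f = 0;
  quasi_eF : e * Fm = q ^+ 2 *: (Fm * e) + kappa *: Z;
  quasi_ZF : Z * Fm = Fm * Z;
  quasi_Ze : Z * e = e * Z;
  quasi_WF : W * Fm = P *: (Fm * W);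
  quasi_We : W * e = P *: (e * W);
  quasi_VF : V * Fm = P^-1 *: (Fm * V);
  quasi_efF : (e * f - P^-1 *: (f * e)) * Fm =
    (q ^+ 2 / P) *: (Fm * (e * f - P^-1 *: (f * e))) + (kappa / P) *: V
}.
Hypothesis rels : quasi_relations.

Local Notation EM := (endo (vacuum_neq0 U)).
Let EF : EM := endF q p Fm.
Let Ee : EM := ende q y c p e Z W.
Let Ef : EM := endf q p f.

Let vac0 : vacuum U = single (Before 0) 1.
Proof. by apply/funext => -[[|h]|h|L M]. Qed.

Let act_pow n v m : act q y c p e f Fm Z W (nseq n true ++ v) m =
  act q y c p e f Fm Z W v (((EF + Ee) ^+ n) m).
Proof. by elim: n m => //= n IH m; rewrite IH exprSr endoM. Qed.

Let act_pow0 n m : act q y c p e f Fm Z W (nseq n true) m = ((EF + Ee) ^+ n) m.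
Proof. by rewrite -[nseq n true]cats0 act_pow. Qed.

Let prog n k := nseq n true ++ false :: nseq k true.

Let eval_prog n k : eval q y c p e f Fm Z W (prog n k) (Before 0) =
  (((EF + Ee) ^+ k * Ef * (EF + Ee) ^+ n) (vacuum U)) (After 0).
Proof.
by rewrite -[LHS]mul1r -act_single -vac0 /prog act_pow /= act_pow0.
Qed.

Let EF_pow n (m : state -> U) :
  (EF ^+ n) m (Before 0) = m (Before 0) * Fm ^+ n /\
  (EF ^+ n) m (After 0) = m (After 0) * Fm ^+ n.
Proof.
elim: n m => [|n IH] m; first by rewrite !expr0 !mulr1.
rewrite exprSr endoM; have [-> ->] := IH (EF m).
by rewrite /EF /= /covF /= expr0 !scale1r !addr0 exprS !mulrA.
Qed.

(** On such covectors the couplings of e to Z and W do not reach the lowest components, because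
    [gwt 0 h] is 0; powers of e act there by plain multiplication. *)
Definition lowest_support (m : state -> U) : Prop :=
  [/\ forall h, m (Before h.+1) = 0, forall h, m (After h.+1) = 0 &
      forall L M, m (Split L.+1 M) = 0].

Let gwt0 h : gwt q y c p 0 h = 0.
Proof. by rewrite /gwt /= mulr0 mul0r mulr0 mul0r. Qed.

Let sum_support m h : lowest_support m ->
  \sum_(L < h.+2) gwt q y c p L h *: (m (Split L (h.+1 - L)) * W) = 0.
Proof.
move=> [_ _ hm]; rewrite big1 // => -[[|L] hL] _ /=; first by rewrite gwt0 scale0r.
by rewrite hm mul0r scaler0.
Qed.

Let Ee_support m : lowest_support m -> lowest_support (Ee m).
Proof.
move=> hm; have [h1 h2 h3] := hm; split=> [h|h|L M].
- by rewrite /Ee /= /cove !h1 !mul0r !scaler0 addr0.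
- by rewrite /Ee /= /cove !h2 (@sum_support m) // !mul0r !scaler0 !addr0.
- by rewrite /Ee /= /cove !h3 !mul0r !scaler0 !addr0 scaler0 addr0.
Qed.

Let Ee_pow n (m : state -> U) : lowest_support m -> lowest_support ((Ee ^+ n) m) /\
  (Ee ^+ n) m (Before 0) = m (Before 0) * e ^+ n /\
  (Ee ^+ n) m (After 0) = m (After 0) * e ^+ n.
Proof.
elim: n m => [|n IH] m hm; first by rewrite !expr0 !mulr1.
rewrite exprSr endoM; have [hs [-> ->]] := IH (Ee m) (Ee_support hm).
split=> //; have [h1 h2 h3] := hm.
rewrite /Ee /= /cove (@sum_support m) // h1 h2 !mul0r !scaler0 !addr0 /= expr0 !scale1r.
by rewrite exprS !mulrA.
Qed.

Let vac_support : lowest_support (vacuum U). Proof. by []. Qed.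

Let Ef_support m : lowest_support m -> lowest_support (Ef m).
Proof.
move=> [h1 h2 h3]; split=> [h|h|L [|M]]; rewrite /Ef /= /covf //.
by rewrite h1 mul0r scaler0.
Qed.

(** The [After 0] component of [covector_serre] at the vacuum. On its right side the coupled F and e
    act by multiplication, so F_ij(Fm, f) and F_ij(e, f) appear, and both vanish. *)
Lemma alternating_eval : \sum_(0 <= l < p.+2) ((-1) ^+ l * qbinom q p.+1 l) *:
  eval q y c p e f Fm Z W (prog (p.+1 - l) l) (Before 0) = 0.
Proof.
have [h1 h2 h3 h4 h5 h6 h7 h8 h9] := rels.
have := covector_serre hq h3 h4 h6 h8 h9.
move/(congr1 (fun g : EM => g (vacuum U) (After 0))).
rewrite endoD.
have -> : (serre q p.+1 EF Ef (vacuum U) + serre q p.+1 Ee Ef (vacuum U)) (After 0) =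
   serre q p.+1 EF Ef (vacuum U) (After 0) + serre q p.+1 Ee Ef (vacuum U) (After 0) by [].
have fct_sum (n : nat) (G : nat -> state -> U) s :
   (\sum_(0 <= l < n) G l) s = \sum_(0 <= l < n) G l s.
  by elim/big_rec2: _ => // i y1 y2 _ <-.
rewrite /serre !endo_sum !fct_sum.
under eq_bigr => l _.
  rewrite endoZ -[(_ *: _) (After 0)]/(_ *: (_ (After 0))) -eval_prog; over.
under [X in _ = X + _]eq_bigr => l _.
  rewrite endoZ -[(_ *: _) (After 0)]/(_ *: (_ (After 0))) !endoM (proj2 (EF_pow _ _)).
  rewrite [(Ef _) _]/= expr0 scale1r (proj1 (EF_pow _ _)) mul1r; over.
under [X in _ = _ + X]eq_bigr => l _.
  have [hs [hs1 _]] := Ee_pow l vac_support.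
  rewrite endoZ -[(_ *: _) (After 0)]/(_ *: (_ (After 0))) !endoM.
  rewrite (proj2 (proj2 (Ee_pow _ (Ef_support hs)))).
  rewrite [(Ef _) _]/= expr0 scale1r hs1 mul1r; over.
rewrite !serre_rev h1 h2 !scaler0 addr0 => h.
rewrite big_nat_rev /= add0n -[RHS](scaler0 _ ((-1) ^+ p.+1)) -[in RHS]h scaler_sumr.
apply: eq_big_nat => l /andP[_ hl]; rewrite subSS subKn // scalerA qbinom_sym // mulrA.
by rewrite sign_sub.
Qed.

Local Notation height := height.
Local Notation pweight := (pweight q c).
Local Notation sweight := (sweight q y c p).

Definition nk (w : seq (option bool)) := count (pred1 None) w.
Definition nE (w : seq (option bool)) := count (pred1 (Some false)) w.

Definition rmon t m m' t' : U := Z ^+ t * b ^+ m * f * b ^+ m' * Z ^+ t'.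
Definition smon t t' m : U := Z ^+ t * W * Z ^+ t' * b ^+ m.

Let hbZ : b * Z = Z * b.
Proof. by case: rels => *; rewrite /b mulrDr mulrDl; congr (_ + _); apply/esym. Qed.

Let P0 : P != 0. Proof. by rewrite expf_neq0 // q_neq0. Qed.

Let hbW n : b ^+ n * W = P ^- n *: (W * b ^+ n).
Proof.
have h1 : b * W = P^-1 *: (W * b).
  case: rels => _ _ _ _ _ h6 h7 _ _.
  by rewrite /b mulrDr h6 h7 -scalerDr scalerA mulVf // scale1r -mulrDl.
elim: n => [|n IH]; first by rewrite !expr0 mul1r mulr1 invr1 scale1r.
have -> : b ^+ n.+1 * W = b ^+ n * (b * W) by rewrite exprSr mulrA.
rewrite h1 -scalerAr [b ^+ n * _]mulrA IH -scalerAl scalerA -mulrA -exprSr.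
by congr (_ *: _); rewrite exprS invfM.
Qed.

Let bZ m n : b ^+ m * Z ^+ n = Z ^+ n * b ^+ m.
Proof. by apply/commrX/commr_sym/commrX/commr_sym. Qed.

(** The first sum collects the paths on which f leads to an [After] state, the second those that
    pass through split states and leave them by W. Powers of b are carried to the right of W, which
    produces [P ^- (nk v + nk u)]. *)
Lemma eval_expand n k : eval q y c p e f Fm Z W (prog n k) (Before 0) =
  \sum_(v <- words letters n) \sum_(w <- words letters k | height (height 0 v) w == 0%N)
     (P ^+ height 0 v * pweight 0 v * pweight (height 0 v) w) *:
       rmon (nE v) (nk v) (nk w) (nE w) +
  \sum_(d < k) \sum_(v <- words letters n) \sum_(u <- words letters d)
   \sum_(w <- words letters (k - d.+1) | height (height (height 0 v) u).-1 w == 0%N)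
     (pweight 0 v * sweight (height 0 v) 0 u * pweight (height (height 0 v) u).-1 w
        * P ^- (nk v + nk u)) *:
       smon (nE v + nE u) (nE w) (nk v + nk u + nk w).
Proof.
rewrite eval_before // exchange_big /= -big_split /=; apply: eq_bigr => v _.
set h := height 0 v.
have eA n' h' : eval q y c p e f Fm Z W (nseq n' true) (After h') =
    \sum_(w <- words letters n' | height h' w == 0%N)
      pweight h' w *: (b ^+ nk w * Z ^+ nE w).
  rewrite -[nseq n' true]cats0 eval_after // [RHS]big_mkcond; apply: eq_bigr => w _ /=.
  by case: (height h' w) => [|?]; rewrite ?mulr1 // mulr0 scaler0.
rewrite eA mulrDr scalerDr; congr (_ + _).
  rewrite !(mulr_sumr, scaler_sumr); apply: eq_bigr => w _.
  rewrite -[P ^+ h]/(P ^+ h) -!scalerAr !scalerA; congr (_ *: _); first by rewrite /P; ring.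
  by rewrite /rmon -(bZ (nk v) (nE v)) !mulrA.
rewrite eval_split // !(mulr_sumr, scaler_sumr); apply: eq_bigr => d _.
rewrite !(mulr_sumr, scaler_sumr); apply: eq_bigr => u _.
rewrite addn0 eA -!scalerAr !(mulr_sumr, scaler_sumr); apply: eq_bigr => w _.
rewrite -!scalerAr !scalerA.
have -> : b ^+ nk v * Z ^+ nE v * (b ^+ nk u * Z ^+ nE u * (W * (b ^+ nk w * Z ^+ nE w))) =
    P ^- (nk v + nk u) *: smon (nE v + nE u) (nE w) (nk v + nk u + nk w).
  have -> : b ^+ nk v * Z ^+ nE v * (b ^+ nk u * Z ^+ nE u * (W * (b ^+ nk w * Z ^+ nE w))) =
     Z ^+ (nE v + nE u) * (b ^+ (nk v + nk u) * W) * (Z ^+ nE w * b ^+ nk w).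
    rewrite bZ -(bZ (nk w)) exprD exprD !mulrA; congr (_ * _ * _ * _).
    by rewrite -!mulrA; congr (_ * _); rewrite (bZ (nk u)) !mulrA bZ.
  rewrite hbW -scalerAr -scalerAl; congr (_ *: _).
  rewrite /smon [b ^+ (_ + nk w)]exprD !mulrA; congr (_ * _).
  by rewrite -!mulrA bZ.
by rewrite scalerA; congr (_ *: _); ring.
Qed.

End Identity.

(** * Path words and pairs of binary tuples *)

Local Notation word := (seq (option bool)).

Definition hz (w : word) : int :=
  (count (pred1 (Some true)) w)%:Z - (count (pred1 (Some false)) w)%:Z.

Arguments hz : simpl never.

Fixpoint valid (h : nat) (w : word) : bool :=
  match w with
  | [::] => true
  | None :: w' => valid h w'
  | Some true :: w' => valid h.+1 w'
  | Some false :: w' => (0 < h)%N && valid h.-1 w'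
  end.

Lemma hz_cons x w :
  hz (x :: w) = (if x is Some b then if b then 1 else -1 else 0) + hz w.
Proof. by rewrite /hz; case: x => [[]|] /=; lia. Qed.

Lemma height_valid h w : valid h w -> (height h w)%:Z = h%:Z + hz w.
Proof.
elim: w h => [|[[]|] w IH] h /=; first by rewrite /hz subrr addr0.
- by move/IH => ->; rewrite hz_cons /=; lia.
- by case/andP => h0 /IH ->; rewrite hz_cons /=; lia.
- by move/IH => ->; rewrite hz_cons /=; lia.
Qed.

Lemma height_cat h v w : height h (v ++ w) = height (height h v) w.
Proof. by elim: v h => //= -[[]|] v IH h; rewrite ?IH. Qed.

Lemma valid_cat h v w : valid h (v ++ w) = valid h v && valid (height h v) w.
Proof. by elim: v h => //= -[[]|] v IH h; rewrite ?IH // andbA. Qed.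

Lemma count_letters (w : word) :
  (count (pred1 None) w + count (pred1 (Some true)) w + count (pred1 (Some false)) w)%N
  = size w.
Proof. by elim: w => //= -[[]|] w /=; lia. Qed.

Section PathWeights.
Context (F : fieldType) (q c : F) (hq : not_root_of_unity q).

Let r := q ^- 2.
Let dq := q - q^-1.

Lemma pweight_cat h v w :
  pweight q c h (v ++ w) = pweight q c h v * pweight q c (height h v) w.
Proof.
elim: v h => [|[[]|] v IH] h /=; rewrite ?mul1r //.
  by case: h => [|h]; rewrite ?mul0r // IH mulrA.
by rewrite IH mulrA.
Qed.

Lemma pweight_invalid h w : ~~ valid h w -> pweight q c h w = 0.
Proof.
elim: w h => [|[[]|] w IH] h //=; first exact: IH.
  by case: h => [|h] //= /IH ->; rewrite mulr0.
by move/IH => ->; rewrite mulr0.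
Qed.

(** Heights are integers here, so that products can be cut and shifted without a validity
    condition. *)
Fixpoint letterprod (g : option bool -> int -> F) (h : int) (w : word) : F :=
  match w with
  | [::] => 1
  | x :: w' => g x h * letterprod g (h + (if x is Some b then if b then 1 else -1 else 0)) w'
  end.

Lemma letterprodE g h w :
  letterprod g h w = \prod_(i < size w) g (nth None w i) (h + hz (take i w)).
Proof.
elim: w h => [|x w IH] h; first by rewrite big_ord0.
rewrite [LHS]/= IH [RHS]big_ord_recl; congr (_ * _); first by rewrite /hz /= subrr addr0.
by apply: eq_bigr => i _; rewrite lift0 /= hz_cons -[in LHS]addrA.
Qed.

Lemma al_alphaN n : al q n = alphaN q n%:Z.
Proof.
have q0 := q_neq0 hq; have q2 : 1 - q ^+ 2 != 0.
  by rewrite subr_eq0 eq_sym; case: hq => _; apply.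
rewrite /alphaN ltNge lez_nat leq0n /=.
elim: n => [|n /= ->]; first by rewrite /qround /= expr0z subrr !mul0r.
have hQ k : (q ^+ 2) ^ k%:Z = q ^+ (2 * k) by rewrite exprM.
rewrite /qround !hQ.
have -> : q ^ (-2 * n%:Z + 2) = q ^+ 2 / q ^+ (2 * n).
  by rewrite exprnN exprnP -expfzDr //; congr (_ ^ _); lia.
have -> : q ^ (-2 * n.+1%:Z + 2) = 1 / q ^+ (2 * n).
  by rewrite mul1r exprnN; congr (_ ^ _); lia.
have -> : q ^+ (2 * n.+1) = q ^+ 2 * q ^+ (2 * n) by rewrite -exprD; congr (_ ^+ _); lia.
rewrite exprVn -exprM.
by field; rewrite q2 expf_neq0.
Qed.

(** Collects the weights of the down-steps below the starting height, which are matched by no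
    up-step of the word. *)
Definition rfact (n : nat) : F := \prod_(i < n) qround (q ^+ 2) i.+1.

Definition rho_factor (x : option bool) (h : int) : F :=
  q ^ (- 2 * h) * (if x is Some true then qround (q ^+ 2) (h + 1) else 1).

(* Matching the steps from height i to i + 1 with those from i + 1 to i trades the
   weights of the latter for those of the former. *)
Lemma pweight_valid h w : valid h w -> height h w = 0%N ->
  pweight q c h w = (c * q ^+ 2 / dq) ^+ nE w * letterprod rho_factor h%:Z w *
    rfact h * q ^ (- (h * h.-1)%N%:Z).
Proof.
have q0 := q_neq0 hq; have d0 : dq != 0 := q_sub_inv_neq0 hq.
have q2 : 1 - q ^+ 2 != 0.
  by rewrite subr_eq0 eq_sym; case: hq => _; apply.
elim: w h => [|[[]|] w IH] h /=.
- by move=> _ ->; rewrite /rfact big_ord0 expr0 mul0n expr0z !mulr1.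
- move=> hv hh; rewrite (IH _ hv hh) /nE /= add0n /rho_factor /rfact big_ord_recr /=.
  rewrite (_ : h%:Z + 1 = h.+1%:Z); last by lia.
  have -> : q ^ (- (h.+1 * h)%N%:Z) = q ^ (- 2 * h%:Z) * q ^ (- (h * h.-1)%N%:Z).
    by rewrite -expfzDr //; congr (_ ^ _); case: (h) => [|k] /=; lia.
  ring.
- case: h => [|h] //= hv hh; rewrite (IH _ hv hh) /nE /= add1n [(_ / dq) ^+ _.+1]exprS.
  rewrite (_ : h.+1%:Z + -1 = h%:Z); last by lia.
  rewrite /rho_factor mulr1 /epsE al_alphaN /alphaN ltNge lez_nat leq0n /= /rfact.
  rewrite big_ord_recr /=.
  have -> : q ^ (- (h.+1 * h)%N%:Z) = q ^ (- (h * h.-1)%N%:Z) / q ^+ (2 * h).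
    by rewrite exprnN -expfzDr //; congr (_ ^ _); case: (h) => [|k] /=; lia.
  have -> : q ^ (-2 * h.+1%:Z + 2) = (q ^+ (2 * h))^-1.
    by rewrite exprnN; congr (_ ^ _); lia.
  have -> : q ^ (-2 * h.+1%:Z) = (q ^+ (2 * h))^-1 / q ^+ 2.
    by rewrite !exprnN -expfzDr //; congr (_ ^ _); lia.
  rewrite exprVn -exprM.
  by rewrite -/dq; field; rewrite expf_neq0 // d0 q0.
- move=> hv hh; rewrite (IH _ hv hh) /nE /= add0n /rho_factor mulr1 addr0.
  have -> : r ^+ h = q ^ (- 2 * h%:Z).
    by rewrite /r exprVn -exprM exprnN; congr (_ ^ _); lia.
  by rewrite -!mulrA mulrCA.
Qed.

End PathWeights.

Section Merge.
Implicit Types (l s : seq bool).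

Lemma count_takeS l r : count id (take r.+1 l) = (count id (take r l) + nth false l r)%N.
Proof. by elim: l r => [|x l IH] [|r] //=; rewrite ?take0 ?addn0 //= IH addnA. Qed.

Lemma count_take_le l r : (count id (take r l) <= r)%N.
Proof. by elim: r => [|r IH]; rewrite ?take0 // count_takeS; case: nth; lia. Qed.

Lemma psum1 l r : psum l 1 r = count id (take r l).
Proof.
elim: r => [|r IH]; first by rewrite /psum big_geq // take0.
by rewrite count_takeS -IH /psum big_nat_recr.
Qed.

Lemma psum_tail l a b : (a <= b)%N -> (psum l 1 a + psum l a.+1 b = psum l 1 b)%N.
Proof. by move=> hab; rewrite /psum -(@big_cat_nat _ _ _ a.+1). Qed.

Definition compatible l s := (size s + count id l == size l)%N.

Lemma compatible_take l s i : compatible l s -> (i <= size l)%N ->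
  (i - count id (take i l) <= size s)%N.
Proof.
rewrite /compatible => /eqP h hi; have := count_cat id (take i l) (drop i l).
rewrite cat_take_drop => hc.
have := count_size id (drop i l); rewrite size_drop.
have := count_take_le l i; lia.
Qed.

Lemma size_merge l s : size (merge l s) = size l.
Proof. by elim: l s => [|[] l IH] [|x s] //=; rewrite IH. Qed.

Lemma merge_take l s i :
  take i (merge l s) = merge (take i l) (take (i - count id (take i l)) s).
Proof.
elim: l s i => [|[] l IH] s [|i] //=; rewrite ?take0 //.
  by rewrite IH add1n subSS.
case: s => [|x s] /=; first by rewrite IH.
by rewrite add0n subSn ?count_take_le //= IH.
Qed.

Lemma compatible_cons_true l s : compatible (true :: l) s = compatible l s.
Proof. by rewrite /compatible /= add1n addnS eqSS. Qed.

Lemma compatible_cons_false l x s : compatible (false :: l) (x :: s) = compatible l s.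
Proof. by rewrite /compatible /= add0n addSn eqSS. Qed.

Lemma compatible_nil l : compatible (false :: l) [::] = false.
Proof. by rewrite /compatible /=; have := count_size id l; lia. Qed.

Definition compatibleE := (compatible_cons_true, compatible_cons_false, compatible_nil).

Lemma nk_merge l s : compatible l s -> nk (merge l s) = count id l.
Proof.
rewrite /nk; elim: l s => [|[] l IH] [|x s] //=; rewrite ?compatibleE // => /IH ->; by [].
Qed.

Lemma nF_merge l s : compatible l s -> count (pred1 (Some true)) (merge l s) = count id s.
Proof.
by elim: l s => [|[] l IH] [|[] s] //=; rewrite ?compatibleE // => /IH ->.
Qed.

Lemma nE_merge l s : compatible l s -> nE (merge l s) = count negb s.
Proof.
by rewrite /nE; elim: l s => [|[] l IH] [|[] s] //=; rewrite ?compatibleE // => /IH ->.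
Qed.

Lemma nth_merge l s i : compatible l s -> (i < size l)%N ->
  nth None (merge l s) i =
  if nth false l i then None else Some (nth false s (i - count id (take i l))).
Proof.
elim: l s i => [|[] l IH] s [|i] //; rewrite ?compatibleE.
- by move=> h /= hi; rewrite IH // add1n subSS.
- by case: s => [|x s]; rewrite ?compatibleE.
- case: s => [|x s]; rewrite ?compatibleE //= => h hi.
  by rewrite IH // add0n subSn ?count_take_le.
Qed.

Lemma sel_index l i : ~~ entry l i.+1 ->
  (i.+1 - psum l 1 i.+1).-1 = (i - count id (take i l))%N.
Proof.
rewrite psum1 count_takeS /entry /= => /negbTE ->; rewrite addn0.
by have := count_take_le l i; lia.
Qed.

Lemma sel1_merge l s i : compatible l s -> (i < size l)%N ->
  sel1 l s i.+1 = (nth None (merge l s) i == Some true).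
Proof.
move=> h hi; rewrite nth_merge // /sel1; have := @sel_index l i.
by rewrite /entry /=; case: (nth false l i) => //= -> //.
Qed.

Lemma sel0_merge l s i : compatible l s -> (i < size l)%N ->
  sel0 l s i.+1 = (nth None (merge l s) i == Some false).
Proof.
move=> h hi; rewrite nth_merge // /sel0; have := @sel_index l i.
by rewrite /entry /=; case: (nth false l i) => //= -> //.
Qed.

Lemma entry_merge l s i : compatible l s -> (i < size l)%N ->
  entry l i.+1 = (nth None (merge l s) i == None).
Proof. by move=> h hi; rewrite nth_merge // /entry /=; case: nth. Qed.

Lemma compatible_prefix l s i : compatible l s -> (i <= size l)%N ->
  compatible (take i l) (take (i - count id (take i l)) s).
Proof.
move=> h hi; rewrite /compatible !size_take_min.
by have := compatible_take h hi; have := count_take_le l i; lia.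
Qed.

(** Of the first i letters i - |l| come from [s], so 2|s| + |l| - i is the number of up-steps minus
    the number of down-steps. *)
Lemma zeta_merge l s i : compatible l s -> (i <= size l)%N ->
  zeta l s i = hz (take i (merge l s)).
Proof.
move=> h hi; have hp := compatible_prefix h hi.
rewrite /hz -/(nE _) merge_take nF_merge // nE_merge // /zeta !psum1.
have hs := compatible_take h hi; have hc := count_take_le l i.
have := count_predC id (take (i - count id (take i l)) s).
rewrite size_take_min; have -> : count (predC id) (take (i - count id (take i l)) s) =
  count negb (take (i - count id (take i l)) s) by apply: eq_count.
move: (count id (take (i - count id (take i l)) s)) => a; lia.
Qed.

Definition bvalid (h : nat) s := all (fun u => u <= 2 * psum s 1 u + h)%N (iota 1 (size s)).

Lemma bvalid_cons h x s :
  bvalid h (x :: s) = if x then bvalid h.+1 s else (0 < h)%N && bvalid h.-1 s.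
Proof.
have E h' s' : bvalid h' s' =
    all (fun u => u <= 2 * count id (take u s') + h')%N (iota 1 (size s')).
  by apply: eq_all => u; rewrite psum1.
rewrite !E [LHS]/= (iotaDl 1 1) all_map take0 /=; case: x => /=.
  by apply: eq_all => u /=; rewrite add1n /=; move: (count _ _) => b; apply/idP/idP; lia.
case: h => [|h] //=; by apply: eq_all => u /=; rewrite add1n /=; move: (count _ _) => b; apply/idP/idP; lia.
Qed.

(** The letters [None] do not change the height, so staying nonnegative is a ballot condition on [s]
    alone. *)
Lemma valid_merge h l s : compatible l s -> valid h (merge l s) = bvalid h s.
Proof.
elim: l s h => [|[] l IH] s h //=.
- by case: s.
- by rewrite compatibleE => /IH ->.
- case: s => [|x s]; rewrite ?compatibleE // => hc.
  by rewrite bvalid_cons /=; case: x; rewrite IH.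
Qed.

End Merge.

Lemma big_pow (F : fieldType) (q : F) (q0 : q != 0) n (a : nat -> int) :
  \prod_(i < n) q ^ a i = q ^ (\sum_(i < n) a i).
Proof. by elim/big_rec2: _ => // i x z _ ->; rewrite expfzDr. Qed.

(** * Matching single words with the summands of rho *)

Section RhoMatch.
Context (F : fieldType) (q c : F) (hq : not_root_of_unity q) (p : nat).

Let N := p.+1.
Let P := q ^+ p.

(** The exponents m, m', t of the monomial produced by a word when f stands after the first N - k
    steps. *)
Definition rho_key (k : nat) (w : seq (option bool)) : nat * nat * nat :=
  (nk (take (N - k) w), nk (drop (N - k) w), nE (take (N - k) w)).

Definition rho_coef (k : nat) (w : seq (option bool)) : F :=
  P ^+ height 0 (take (N - k) w) * pweight q c 0 w.

(** Validity is the ballot condition of S, final height 0 its condition on |s|, and t down-steps in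
    front of f the remaining one. The factor P^height gives the term - a zeta of the exponent theta;
    the rest of theta comes from [pweight_valid]. *)
Lemma rho_term m m' t k l s :
  (m + m' <= N)%N -> (k <= N)%N -> ~~ odd (N - m - m') ->
  size l = N -> count id l = (m + m')%N -> size s = (N - m - m')%N -> in_L p m m' k l ->
  (if (height 0 (merge l s) == 0%N) && (nE (take (N - k) (merge l s)) == t)
   then rho_coef k (merge l s) else 0) =
  (c * q ^+ 2 / (q - q^-1)) ^+ (N - m - m')./2 *
  (if in_S p m m' k t s then q ^ theta_exp p l s k *
     \prod_(1 <= r < p.+2) qround (q ^+ 2) (zeta l s r.-1 + 1) ^+ sel1 l s r else 0).
Proof.
move=> hmm hk hodd hl hcl hs /andP[/eqP hL1 /eqP hL2].
have q0 := q_neq0 hq.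
have hc : compatible l s by rewrite /compatible hs hcl hl; lia.
set w := merge l s; have hw : size w = N by rewrite size_merge.
have hnw : nk w = (m + m')%N by rewrite nk_merge.
have hcw := count_letters w.
have hE : nE w = count negb s by rewrite nE_merge.
have hT : count (pred1 (Some true)) w = count id s by rewrite nF_merge.
have hsz : (count id s + count negb s)%N = size s.
  by rewrite -(count_predC id s); congr (_ + _)%N.
case: (boolP (valid 0 w)) => [hv|hv]; last first.
  rewrite /rho_coef pweight_invalid // mulr0 if_same.
  suff -> : in_S p m m' k t s = false by rewrite mulr0.
  apply/negP => /and3P[_ _ hall]; case/negP: hv.
  rewrite /w valid_merge // /bvalid hs; apply/allP => u hu.
  by rewrite addn0; apply: (allP hall).
have hh := height_valid hv; rewrite add0r /hz -/(nE w) hT hE in hh.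
have hall : all (fun u => u <= 2 * psum s 1 u)%N (iota 1 (p.+1 - m - m')).
  move: hv; rewrite /w valid_merge // /bvalid hs => /allP h; apply/allP => u hu.
  by have := h u hu; rewrite addn0.
have -> : in_S p m m' k t s = (height 0 w == 0%N) && (nE (take (N - k) w) == t).
  rewrite /in_S hall andbT psum1 take_oversize; last by rewrite hs.
  congr (_ && _); first by lia.
  have hi : (N - k <= size l)%N by rewrite hl; lia.
  rewrite /w merge_take nE_merge ?compatible_prefix // psum1 in hL1 *.
  rewrite hL1; set s1 := take _ s.
  have : (count id s1 + count negb s1)%N = size s1.
    by rewrite -(count_predC id s1); congr (_ + _)%N.
  have := compatible_take hc hi; rewrite hL1 => h1.
  have hle : (m <= N - k)%N by rewrite -hL1 count_take_le.
  rewrite psum1 /s1 size_take_min -/s1 /N => h2.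
  rewrite -[in (_ - k - m)%N]/s1 -/N; move: h2; rewrite -/s1 -/N.
  move: (count id s1) (count negb s1) h1 => a b h1 h2; lia.
case: ifP => [/andP[/eqP h0 _]|_]; last by rewrite mulr0.
rewrite /rho_coef pweight_valid // /rfact big_ord0 mul0n oppr0 expr0z !mulr1.
have -> : nE w = (N - m - m')./2 by rewrite hE; lia.
rewrite mulrCA; congr (_ * _).
rewrite letterprodE hw /rho_factor big_split /=.
have hzw (i : 'I_N) : hz (take i w) = zeta l s i.
  by rewrite zeta_merge ?hl // ltnW.
rewrite mulrA; congr (_ * _); last first.
  rewrite big_add1 /= big_mkord; apply: eq_bigr => i _; rewrite add0r hzw.
  rewrite sel1_merge ?hl // -/w; case: (nth None w i) => [[]|] //=.
under eq_bigr => i _ do rewrite add0r hzw.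
rewrite (@big_pow _ _ q0 _ (fun i => -2 * zeta l s i)) /P -exprM exprnP -expfzDr //.
have hvt : valid 0 (take (N - k) w).
  by move: hv; rewrite -{1}(cat_take_drop (N - k) w) valid_cat => /andP[].
congr (_ ^ _); rewrite /theta_exp zeta_merge ?hl ?leq_subr // -/w.
rewrite PoszM (height_valid hvt) big_add1 /= big_mkord mulr_sumr -/N.
rewrite -!mulr_sumr add0r opprK mulNr; by [].
Qed.

End RhoMatch.

(** * Sums over nondecreasing sequences *)

Section Nondecreasing.
Context (F : fieldType).
Implicit Types (g : nat -> nat -> F).

(** Weighted lattice paths from (0, 0) to (b, u): a step increases b by one and either keeps u, with
    weight [g b u], or increases u, with weight 1. *)
Fixpoint cc g (b u : nat) : F :=
  match b with
  | 0 => (u == 0%N)%:R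
  | b'.+1 => g b' u * cc g b' u + (if u is u'.+1 then cc g b' u' else 0)
  end.

Lemma cc_gt g b u : (b < u)%N -> cc g b u = 0.
Proof.
elim: b u => [|b IH] [|u] //= h.
by rewrite IH ?IH ?mulr0 ?addr0 //; apply: leq_trans h; rewrite ltnW.
Qed.

Lemma cc_diag g b : cc g b b = 1.
Proof. by elim: b => //= b ->; rewrite cc_gt // mulr0 add0r. Qed.

Lemma cc_ext g g' b u : (forall b' u', (b' < b)%N -> g b' u' = g' b' u') -> cc g b u = cc g' b u.
Proof.
elim: b u => [|b IH] u h //=.
have h' b' u' : (b' < b)%N -> g b' u' = g' b' u' by move=> hb; apply: h; apply: ltnW.
by rewrite h // IH //; case: u => [|u] //; rewrite IH.
Qed.

(** The quantity N b + j - b starts nonnegative, and a step lowers it by at most one and only if it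
    keeps j. A path into the stated region therefore keeps j at some point where the quantity is 0,
    and there [g] vanishes. *)
Lemma cc_zero g (N : nat -> nat) : (forall b, N b <= N b.+1)%N ->
    (forall b j, (N b + j = b)%N -> g b j = 0) ->
  forall b j, (if b is b'.+1 then N b' + j < b else false)%N -> cc g b j = 0.
Proof.
move=> mono hg; elim=> [|b IH] j //= h.
have hlow j' : (N b + j' < b)%N -> cc g b j' = 0.
  case: b {h} IH => // b IH h; apply: IH; apply: leq_ltn_trans h; rewrite leq_add2r; exact: mono.
have -> : g b j * cc g b j = 0.
  have [/hg ->|/eqP hne] := (N b + j)%N =P b; first by rewrite mul0r.
  by rewrite hlow ?mulr0 //; lia.
case: j h => [|j] h; rewrite ?addr0 // add0r; apply: hlow; lia.
Qed.

Definition Sg g (A : seq nat) n : F :=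
  \sum_(w <- words A n | sorted leq w) \prod_(i < n) g (nth 0%N w i) i.

Lemma Sg0 g A : Sg g A 0 = 1.
Proof. by rewrite /Sg /= big_cons big_nil /= big_ord0 addr0. Qed.

Lemma Sg_nil g n : Sg g [::] n.+1 = 0.
Proof. by rewrite /Sg big_wordsS big_nil. Qed.

Lemma words_map (T T' : eqType) (f : T -> T') A n : words (map f A) n = map (map f) (words A n).
Proof.
have key (V : seq (seq T)) A' :
    [seq x :: w | x <- map f A', w <- map (map f) V] = map (map f) [seq x :: w | x <- A', w <- V].
  by elim: A' => //= x A' ->; rewrite map_cat -!map_comp.
by elim: n => //= n ->; apply: key.
Qed.

Lemma Sg_map g A n : Sg g (map S A) n = Sg (fun k i => g k.+1 i) A n.
Proof.
rewrite /Sg words_map big_map [LHS]big_seq_cond [RHS]big_seq_cond.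
apply: eq_big => w; first by rewrite sorted_map; congr (_ && _); apply: eq_sorted => a b /=.
case/andP; rewrite mem_words => /andP[/eqP hs _] _; apply: eq_bigr => k _.
by rewrite (nth_map 0%N) // hs.
Qed.

Lemma Sg_cons g lo A n : uniq (lo :: A) -> all (fun k => lo < k)%N A ->
  Sg g (lo :: A) n.+1 = g lo 0%N * Sg (fun k i => g k i.+1) (lo :: A) n + Sg g A n.+1.
Proof.
move=> uA hA; have uA' : uniq A by case/andP: uA.
rewrite /Sg big_wordsS big_cons; congr (_ + _).
  rewrite mulr_sumr [LHS]big_seq_cond [RHS]big_seq_cond; apply: eq_big => w.
    case hw: (w \in words _ _) => //=; move: hw; rewrite mem_words => /andP[_ /allP hw].
    case: w hw => [|x w] hw //=; have : (lo <= x)%N.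
      by have := hw x (mem_head _ _); rewrite inE => /orP[/eqP -> //|/(allP hA) /ltnW].
    by move=> ->.
  by rewrite big_ord_recl /= => _; congr (_ * _); apply: eq_bigr => k _; rewrite lift0.
rewrite big_wordsS; apply: eq_big_seq => x xA.
rewrite -[LHS]big_filter -[RHS]big_filter; apply: perm_big; apply: uniq_perm; try exact/filter_uniq/words_uniq.
move=> w; rewrite !mem_filter !mem_words; case hp: (sorted leq (x :: w)) => //=; congr (_ && _).
have hx : (lo < x)%N by apply: (allP hA).
apply/allP/allP => h y yw; have := h y yw; rewrite !inE; last by move=> ->; rewrite orbT.
case/orP=> // /eqP ye; have := order_path_min leq_trans hp => /allP /(_ y yw); lia.
Qed.

Lemma Sg_ext g g' A n : (forall k i, k \in A -> (i < n)%N -> g k i = g' k i) -> Sg g A n = Sg g' A n.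
Proof.
move=> h; rewrite /Sg [LHS]big_seq_cond [RHS]big_seq_cond; apply: eq_bigr => w /andP[].
rewrite mem_words => /andP[/eqP hs /allP hw] _; apply: eq_bigr => k _; apply: h => //.
by apply: hw; apply: mem_nth; rewrite hs.
Qed.

(** Read a path backwards from (b, u): the r-th entry of the nondecreasing sequence is the number of
    raising steps undone before the r-th step that keeps u. Its first entry is 0 exactly when the
    last step of the path keeps u. *)
Lemma Sg_cc (gg : nat -> nat -> F) b u : (u <= b)%N ->
  Sg (fun k i => gg (b - (k + i).+1)%N (u - k)%N) (iota 0 u.+1) (b - u) = cc gg b u.
Proof.
elim: b u => [|b IH] u hu.
  by case: u hu => // _; rewrite Sg0.
case: (ltngtP u b.+1) hu => // [hu _|-> _]; last by rewrite subnn Sg0 cc_diag.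
have hub : (u <= b)%N by [].
rewrite subSn // [iota 0 u.+1]/= Sg_cons; first last.
- by apply/allP => k; rewrite mem_iota => /andP[].
- by rewrite /= mem_iota iota_uniq.
rewrite /= subn0 subSS subn0; congr (_ * _ + _).
  by rewrite -IH //; apply: Sg_ext => k i _ _; congr (gg _ _); lia.
case: u hub {hu} => [|u] hub; first by rewrite Sg_nil.
have -> : iota 1 u.+1 = map S (iota 0 u.+1) by rewrite -{1}[1%N]addn0 iotaDl; apply: eq_map.
rewrite Sg_map -IH; last by lia.
have -> : (b - u.+1).+1 = (b - u)%N by lia.
by apply: Sg_ext => k i _ _; congr (gg _ _); lia.
Qed.

Lemma cbuN_cc (q : F) p (N : nat -> int) b u : (u <= b)%N ->
  cbuN q p N b u = cc (fun b' u' => gammaMN q p (N 0%N - u'%:Z) (isum N 0 b'.+1 - b'%:Z)) b u.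
Proof.
move=> hu; rewrite /cbuN; case: ltnP => [hub|hbu]; last first.
  by rewrite (_ : b = u) ?cc_diag //; lia.
rewrite -Sg_cc // /Sg; set n := (b - u)%N.
transitivity (\sum_(t : n.-tuple 'I_u.+1 | sorted (fun e f : 'I_u.+1 => (e <= f)%N) t)
   \prod_(i < n) gammaMN q p (N 0%N - u%:Z + (nth ord0 t i : 'I_u.+1)%:Z)
     (isum N 0 (b - (nth ord0 t i : 'I_u.+1) - i.+1).+1 - (b - (nth ord0 t i : 'I_u.+1) - i.+1)%N%:Z)).
  by apply: eq_bigr => t _; apply: eq_bigr => k _; rewrite (tnth_nth ord0).
rewrite (@big_tuple_words 'I_u.+1 F n (sorted (fun e f : 'I_u.+1 => (e <= f)%N)) (fun t => \prod_(i < n)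
  gammaMN q p (N 0%N - u%:Z + (nth ord0 t i : 'I_u.+1)%:Z)
     (isum N 0 (b - (nth ord0 t i : 'I_u.+1) - i.+1).+1 - (b - (nth ord0 t i : 'I_u.+1) - i.+1)%N%:Z))).
have -> : iota 0 u.+1 = map val (enum 'I_u.+1) by rewrite val_enum_ord.
rewrite (words_map (val : 'I_u.+1 -> nat)) [RHS]big_map [LHS]big_seq_cond [RHS]big_seq_cond.
apply: eq_big => w; first by rewrite sorted_map.
case/andP; rewrite mem_words => /andP[/eqP hs _] _; apply: eq_bigr => k _.
rewrite (nth_map ord0) ?hs //; set e := nth ord0 w k; have he := ltn_ord e.
have -> : (b - (val e + k).+1 = b - e - k.+1)%N by rewrite /=; lia.
by congr (gammaMN _ _ _ _); rewrite /=; lia.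
Qed.

End Nondecreasing.

(** * Weights of the paths through the split states *)

Definition nT (w : word) := count (pred1 (Some true)) w.

Lemma hz_nT w : hz w = (nT w)%:Z - (nE w)%:Z. Proof. by []. Qed.

(** For each down-step, the number of up-steps before it. For the middle stretch of a path, entry b
    - 1 is the partial sum N_1 + ... + N_b in the definition of sigma. *)
Fixpoint cumT (u : word) : seq nat :=
  match u with
  | [::] => [::]
  | None :: u' => cumT u'
  | Some true :: u' => map S (cumT u')
  | Some false :: u' => 0%N :: cumT u'
  end.

Lemma nth_mapS x0 s k : nth x0.+1 (map S s) k = (nth x0 s k).+1.
Proof. by elim: s k => [|x s IH] [|k] /=. Qed.

Lemma size_cumT u : size (cumT u) = nE u.
Proof. by rewrite /nE; elim: u => //= -[[]|] u; rewrite /= ?size_map => ->. Qed.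

Lemma cumT_mono u b : (nth (nT u) (cumT u) b <= nth (nT u) (cumT u) b.+1)%N.
Proof.
elim: u b => [|[[]|] u IH] b; rewrite /nT /=; first by rewrite !nth_nil.
- by rewrite add1n !nth_mapS ltnS; apply: IH.
- by rewrite add0n; case: b => //= b; apply: IH.
- by rewrite add0n; apply: IH.
Qed.

Lemma cumT_le u b : (nth (nT u) (cumT u) b <= nT u)%N.
Proof.
elim: u b => [|[[]|] u IH] b; rewrite /nT /=; first by rewrite !nth_nil.
- by rewrite add1n !nth_mapS ltnS; apply: IH.
- by rewrite add0n; case: b => //= b; apply: IH.
- by rewrite add0n; apply: IH.
Qed.

Lemma cumT_rcons u x : cumT (rcons u x) = if x is Some false then rcons (cumT u) (nT u) else cumT u.
Proof.
elim: u => [|[[]|] u IH] /=; first by case: x => [[]|].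
- by rewrite IH /nT /= add1n; case: x {IH} => [[]|] //; rewrite map_rcons.
- by rewrite IH /nT /= add0n; case: x {IH} => [[]|].
- by rewrite IH /nT /= add0n; case: x {IH} => [[]|].
Qed.

Lemma count_rcons (T : Type) (a : pred T) s x : count a (rcons s x) = (count a s + a x)%N.
Proof. by rewrite -cats1 count_cat /= addn0. Qed.

Section SplitWeights.
Context (F : fieldType) (q y c : F) (hq : not_root_of_unity q) (p : nat).
Let P := q ^+ p.
Let r := q ^- 2.
Let dq := q - q^-1.
Let q0 : q != 0 := q_neq0 hq.
Local Notation al := (al q).
Local Notation pweight := (pweight q c).
Local Notation sweight := (sweight q y c p).

Lemma letterprod_cat (g : option bool -> int -> F) h v w :
  letterprod g h (v ++ w) = letterprod g h v * letterprod g (h + hz v) w.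
Proof.
elim: v h => [|x v IH] h; first by rewrite /= /hz subrr addr0 mul1r.
by case: x => [[]|]; rewrite /= IH mulrA; congr (_ * letterprod _ _ _); rewrite hz_cons; lia.
Qed.

Lemma rpow h : r ^+ h = q ^ (- 2 * h%:Z).
Proof. by rewrite /r exprVn -exprM exprnN; congr (_ ^ _); lia. Qed.

(** [gv], [gu], [gw] weigh the letters before f, between f and the W-step, and after it. The W-step
    lowers the height without being a letter, so [gw] is given a height one too large and corrects
    it in [alphaN]; this is the shift nu in sigma. *)
Definition gv (x : option bool) (h : int) : F :=
  match x with None => q ^ (- 2 * h) | Some true => 1 | Some false => q ^ (- 2 * h) * alphaN q h end.
Definition gu (x : option bool) (h : int) : F :=
  match x with None => q ^ (- 2 * h) | Some true => 1 | Some false => q ^ (- 2 * h) end.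
Definition gw (x : option bool) (h : int) : F :=
  match x with None => q ^ (- 2 * h) | Some true => 1 | Some false => q ^ (- 2 * h) * alphaN q (h - 1) end.

Lemma pweight_gv h v : valid h v ->
  pweight h v = (c / dq) ^+ nE v * q ^+ (2 * nE v) * letterprod gv h v.
Proof.
rewrite /nE; elim: v h => [|[[]|] v IH] h /=.
- by rewrite muln0 !expr0 !mulr1.
- by move=> hv; rewrite IH // add0n mul1r (_ : h%:Z + 1 = h.+1%:Z) //; lia.
- case: h => [|h] //= hv; rewrite IH // add1n mulnS (_ : h.+1%:Z + -1 = h%:Z); last by lia.
  rewrite /epsE -(al_alphaN hq) -/dq [(c / dq) ^+ _.+1]exprS exprD -/r rpow.
  have -> : q ^ (-2 * h%:Z) = q ^+ 2 * q ^ (-2 * h.+1%:Z).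
    by rewrite exprnP -expfzDr //; congr (_ ^ _); lia.
  by move: (q ^ _) (q ^+ 2) (dq^-1) => ? ? ?; ring.
- by move=> hv; rewrite IH // add0n addr0 -/r rpow; move: (q ^ _) => ?; ring.
Qed.

Lemma pweight_gw h w : valid h w ->
  pweight h w = (c / dq) ^+ nE w * q ^+ (2 * nk w + 4 * nE w) * letterprod gw (h%:Z + 1) w.
Proof.
rewrite /nE /nk; elim: w h => [|[[]|] w IH] h /=.
- by rewrite !muln0 !expr0 !mulr1.
- by move=> hv; rewrite IH // !add0n mul1r (_ : h%:Z + 1 + 1 = h.+1%:Z + 1) //; lia.
- case: h => [|h] //= hv; rewrite IH // add1n add0n mulnS (_ : h.+1%:Z + 1 + -1 = h%:Z + 1); last by lia.
  have -> : alphaN q (h%:Z + 1) = al h.+1 by rewrite (al_alphaN hq); congr alphaN; lia.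
  rewrite /epsE -/dq [(c / dq) ^+ _.+1]exprS -/r rpow.
  set A := count _ w; set B := count _ w; have -> : (2 * B + (4 + 4 * A) = 4 + (2 * B + 4 * A))%N by lia.
  rewrite [q ^+ (4 + _)]exprD; have -> : q ^ (-2 * h%:Z) = q ^+ 4 * q ^ (-2 * (h.+1%:Z + 1)).
    by rewrite exprnP -expfzDr //; congr (_ ^ _); lia.
  by move: (q ^ _) (q ^+ 4) (dq^-1) => ? ? ?; ring.
- move=> hv; rewrite IH // add0n add1n addr0 -/r rpow.
  set A := count _ w; set B := count _ w; have -> : (2 * B.+1 + 4 * A = 2 + (2 * B + 4 * A))%N by lia.
  rewrite [q ^+ (2 + _)]exprD; have -> : q ^ (-2 * h%:Z) = q ^+ 2 * q ^ (-2 * (h%:Z + 1)).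
    by rewrite exprnP -expfzDr //; congr (_ ^ _); lia.
  by move: (q ^ _) (q ^+ 2) => ? ?; ring.
Qed.

(** Uniform in [L] and [M]: the case distinctions of [sweight] disappear because [al 0] is 0. *)
Lemma sweightF L M u : sweight L M (Some false :: u) =
  (c / dq * P * r ^+ (L + M).-1) * (al L * sweight L.-1 M u + P * r ^+ L * al M * sweight L M.-1 u).
Proof.
rewrite [LHS]/= -/dq -/P -/r; case: L => [|L]; case: M => [|M] //=; rewrite ?addn0 ?add0n ?addnS /= ?exprD ?expr0.
- by rewrite !mul0r !mulr0 !mul0r !addr0 mulr0.
- by move: (dq^-1) => d; ring.
- by move: (dq^-1) => d; ring.
- by rewrite ![r ^+ _.+1]exprS [r ^+ (L + M)]exprD; move: (dq^-1) => d; ring.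
Qed.

Lemma sweight_invalid L M u : ~~ (valid (L + M) u && (0 < height (L + M) u)%N) -> sweight L M u = 0.
Proof.
elim: u L M => [|[[]|] u IH] L M.
- by rewrite /= ; case: (L + M)%N.
- by rewrite /= -addnS => /IH.
- rewrite sweightF [valid _ _]/= [height _ _]/= => h.
  have -> : al L * sweight L.-1 M u = 0.
    case: L h => [|L] h; first by rewrite mul0r.
    by rewrite /= IH ?mulr0 //; move: h; rewrite addSn.
  have -> : P * r ^+ L * al M * sweight L M.-1 u = 0.
    case: M h => [|M] h; first by rewrite mulr0 mul0r.
    by rewrite /= IH ?mulr0 //; move: h; rewrite addnS.
  by rewrite addr0 mulr0.
- by rewrite /= => /IH ->; rewrite mulr0.
Qed.

(** This is how gamma enters sigma: as the weight for removing an F behind f. *)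
Lemma gamma_al (L M : nat) : gammaMN q p L%:Z (L%:Z + M%:Z) = P * r ^+ L * al M.
Proof.
rewrite (al_alphaN hq) /gammaMN /alphaN ltNge lez_nat leq0n /= addrAC subrr add0r rpow.
have -> : q ^ (- - p%:Z - 2 * (L%:Z + M%:Z) + 2) = P * q ^ (-2 * L%:Z) * q ^ (-2 * M%:Z + 2).
  by rewrite /P exprnP -!expfzDr //; congr (_ ^ _); lia.
by move: (q ^ _) (q ^ _) => ? ?; ring.
Qed.

Definition gcum (L0 : nat) (u : word) (b j : nat) : F :=
  gammaMN q p (L0%:Z - j%:Z) (L0%:Z + (nth (nT u) (cumT u) b)%:Z - b%:Z).

Definition aprod (L0 : nat) (j : nat) : F := \prod_(0 <= s < j) alphaN q (L0%:Z - s%:Z).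

Lemma aprodS L0 j : aprod L0 j.+1 = aprod L0 j * alphaN q (L0%:Z - j%:Z).
Proof. by rewrite /aprod big_nat_recr. Qed.

Lemma alphaN0 : alphaN q 0 = 0.
Proof. by rewrite -(al_alphaN hq 0). Qed.

Lemma aprod0 L0 j : (L0 < j)%N -> aprod L0 j = 0.
Proof.
move=> h; rewrite /aprod big_mkord (bigD1 (Ordinal h)) //=.
by rewrite subrr alphaN0 mul0r.
Qed.

Lemma gamma0 (z : int) : gammaMN q p z z = 0.
Proof. by rewrite /gammaMN subrr /qround expr0z subrr !mul0r. Qed.

Lemma cc_gcum0 L0 u j : (nT u + j < nE u)%N -> cc (gcum L0 u) (nE u) j = 0.
Proof.
move=> h; apply: (cc_zero (N := fun b => nth (nT u) (cumT u) b)); first exact: cumT_mono.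
  move=> b i hb; rewrite /gcum.
  have -> : L0%:Z + (nth (nT u) (cumT u) b)%:Z - b%:Z = L0%:Z - i%:Z by lia.
  exact: gamma0.
by case: (nE u) h => // n h; have := cumT_le u n; lia.
Qed.

Definition wtu (L0 : nat) (u : word) : F :=
  (c / dq) ^+ nE u * P ^+ (nk u + nE u) * q ^+ (2 * nE u) * letterprod gu L0%:Z u.

(** [j] counts the down-steps that remove an F in front of f. Their weights multiply to [aprod L0 j]
    wherever they occur, whereas the weight of a down-step behind f depends on how many of them came
    before; summing over the choices gives [cc (gcum L0 u)]. Factors common to all choices are in
    [wtu]. *)
Lemma sweight_expand L0 u u' : valid L0 u ->
  sweight L0 0 (u ++ u') = wtu L0 u * \sum_(j < (nE u).+1)
     cc (gcum L0 u) (nE u) j * aprod L0 j * sweight (L0 - j)%N (nT u + j - nE u)%N u'.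
Proof.
elim/last_ind: u u' => [|u x IH] u'.
  by rewrite /nE /nT big_ord1 /= /aprod big_geq // /wtu /= !expr0 !mulr1 !mul1r subn0.
rewrite cat_rcons -cats1 valid_cat => /andP[hv hx]; rewrite (IH (x :: u') hv) cats1.
have hh := height_valid hv; rewrite hz_nT in hh.
(* Renders the truncated differences harmless: a summand with j > L0 vanishes by [aprod0], and one
   with nT u + j < nE u by [cc_gcum0]. *)
have hgood j (X Y : F) : ((j <= L0)%N -> (nE u <= nT u + j)%N -> X = Y) ->
    cc (gcum L0 u) (nE u) j * aprod L0 j * X = cc (gcum L0 u) (nE u) j * aprod L0 j * Y.
  move=> h; case: (leqP j L0) => [hj|/aprod0 ->]; last by rewrite !mulr0 !mul0r.
  case: (leqP (nE u) (nT u + j)) => [hn|/cc_gcum0 ->]; last by rewrite !mul0r.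
  by rewrite h.
case: x hx => [[]|] hx.
- have eE : nE (rcons u (Some true)) = nE u by rewrite /nE count_rcons /= addn0.
  have eT : nT (rcons u (Some true)) = (nT u).+1 by rewrite /nT count_rcons /= addn1.
  have eW : wtu L0 (rcons u (Some true)) = wtu L0 u.
    by rewrite /wtu eE /nk count_rcons /= addn0 -cats1 letterprod_cat /= !mulr1.
  rewrite eW eE eT; congr (_ * _); apply: eq_bigr => j _.
  have -> : cc (gcum L0 (rcons u (Some true))) (nE u) j = cc (gcum L0 u) (nE u) j.
    apply: cc_ext => b' j' hb; rewrite /gcum cumT_rcons; congr (gammaMN _ _ _ (_ + _%:Z - _)).
    by apply: set_nth_default; rewrite size_cumT.
  by apply: hgood => h1 h2 /=; congr (sweight _ _ _); lia.
- have eE : nE (rcons u (Some false)) = (nE u).+1 by rewrite /nE count_rcons /= addn1.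
  have eT : nT (rcons u (Some false)) = nT u by rewrite /nT count_rcons /= addn0.
  have hpos : (0 < height L0 u)%N by move: hx => /= /andP[].
  set H := height L0 u in hh hpos.
  have eW : wtu L0 (rcons u (Some false)) = wtu L0 u * (c / dq * P * r ^+ H.-1).
    rewrite /wtu eE /nk count_rcons /= addn0 -cats1 letterprod_cat /= mulr1 addnS exprS [P ^+ _.+1]exprS.
    rewrite mulnS [q ^+ (2 + _)]exprD rpow hz_nT.
    have -> : q ^ (-2 * H.-1%:Z) = q ^+ 2 * q ^ (-2 * (L0%:Z + ((nT u)%:Z - (nE u)%:Z))).
      by rewrite exprnP -expfzDr //; congr (_ ^ _); lia.
    by move: (q ^ _) (q ^+ 2) (dq^-1) => ? ? ?; ring.
  rewrite eW -mulrA; congr (_ * _); rewrite eE eT mulr_sumr.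
  set n := nE u; set g' := gcum L0 (rcons u (Some false)).
  have hcc j : cc g' n j = cc (gcum L0 u) n j.
    apply: cc_ext => b' j' hb; rewrite /g' /gcum cumT_rcons eT; congr (gammaMN _ _ _ (_ + _%:Z - _)).
    by rewrite nth_rcons size_cumT hb.
  have hg j : (j <= L0)%N -> (n <= nT u + j)%N -> g' n j = P * r ^+ (L0 - j) * al (nT u + j - n).
    move=> h1 h2; rewrite -gamma_al /g' /gcum cumT_rcons eT nth_rcons size_cumT ltnn eqxx.
    by congr (gammaMN _ _ _ _); lia.
  have [v' ev] : exists v', v' = Some false :: u' by exists (Some false :: u').
  rewrite -ev.
  (* The two terms of [sweightF]: in the first sum j grows by one, in the second it stays, as in the
     recursion of [cc]. *)
  transitivity (\sum_(j < n.+1) (c / dq * P * r ^+ H.-1) *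
     (cc (gcum L0 u) n j * aprod L0 j * (al (L0 - j) * sweight (L0 - j).-1 (nT u + j - n) u'))
   + \sum_(j < n.+1) (c / dq * P * r ^+ H.-1) *
     (cc (gcum L0 u) n j * aprod L0 j * (P * r ^+ (L0 - j) * al (nT u + j - n) * sweight (L0 - j) (nT u + j - n).-1 u'))).
    rewrite -big_split /=; apply: eq_bigr => j _; rewrite -mulrDr -mulrDr mulrCA; apply: hgood => h1 h2.
    rewrite ev sweightF; congr (_ * r ^+ _ * _); lia.
  transitivity (\sum_(j < n.+2) (c / dq * P * r ^+ H.-1) * ((if val j is j'.+1 then cc g' n j' else 0) * aprod L0 j *
        sweight (L0 - j) (nT u + j - n.+1) u')
    + \sum_(j < n.+2) (c / dq * P * r ^+ H.-1) * (g' n j * cc g' n j * aprod L0 j *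
        sweight (L0 - j) (nT u + j - n.+1) u')); last first.
    rewrite -big_split /=; apply: eq_bigr => j _; rewrite -mulrDr; congr (_ * _).
    by rewrite -!mulrDl [_ + g' n j * _]addrC.
  congr (_ + _).
    rewrite [RHS]big_ord_recl /= !mul0r mulr0 add0r; apply: eq_bigr => j _; congr (_ * _).
    rewrite /bump leq0n !add1n ?add0n hcc aprodS -!mulrA; congr (_ * _); rewrite mulrA [in RHS]mulrA.
    case: (leqP j L0) => [hj|/aprod0 ->]; last by rewrite !mul0r.
    rewrite (al_alphaN hq) -mulrA -[in RHS]mulrA; congr (_ * (alphaN _ _ * sweight _ _ _)); lia.
  rewrite [RHS]big_ord_recr /= hcc cc_gt // mulr0 !mul0r mulr0 addr0.
  apply: eq_bigr => j _; congr (_ * _); rewrite hcc.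
  have -> : g' n j * cc (gcum L0 u) n j * aprod L0 j * sweight (L0 - j) (nT u + j - n.+1) u' =
     cc (gcum L0 u) n j * aprod L0 j * (g' n j * sweight (L0 - j) (nT u + j - n.+1) u') by ring.
  apply: hgood => h1 h2; rewrite hg //; congr (_ * sweight _ _ _); lia.
- have eE : nE (rcons u None) = nE u by rewrite /nE count_rcons /= addn0.
  have eT : nT (rcons u None) = nT u by rewrite /nT count_rcons /= addn0.
  set H := height L0 u in hh.
  have eW : wtu L0 (rcons u None) = wtu L0 u * (P * r ^+ H).
    rewrite /wtu eE /nk count_rcons /= addn1 addSn -cats1 letterprod_cat /= mulr1 [P ^+ _.+1]exprS rpow hz_nT.
    by rewrite -hh; move: (q ^ _) => ?; ring.
  rewrite eW eE eT -mulrA; congr (_ * _); rewrite mulr_sumr; apply: eq_bigr => j _.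
  have -> : cc (gcum L0 (rcons u None)) (nE u) j = cc (gcum L0 u) (nE u) j.
    by apply: cc_ext => b' j' hb; rewrite /gcum cumT_rcons eT.
  rewrite [RHS]mulrCA; apply: hgood => h1 h2 /=.
  rewrite -/r -/P; have -> : H = ((L0 - j) + (nT u + j - nE u))%N by lia.
  by rewrite exprD !mulrA.
Qed.

(** * The brackets of [sigma] *)

(** The identity behind both brackets of sigma, where q^a = P^-1: each collapses to a multiple of
    [alphaN q L]. *)
Lemma alpha_gamma (L H : nat) :
  alphaN q H%:Z - P^-1 * (P^-1 * alphaN q L%:Z + gammaMN q p L%:Z H%:Z) = (1 - P ^- 2) * alphaN q L%:Z.
Proof.
have P0 : P != 0 by rewrite expf_neq0.
have q2 : 1 - q ^+ 2 != 0 by rewrite subr_eq0 eq_sym; case: hq => _; apply.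
rewrite /alphaN /gammaMN /qround !ltNge !lez_nat !leq0n /=.
have hQ (z : int) : (q ^+ 2) ^ z = q ^ (2 * z) by rewrite exprnP exprz_exp.
rewrite !hQ; have -> : q ^ (- - p%:Z - 2 * H%:Z + 2) = P * (q ^+ 2 / q ^ (2 * H%:Z)).
  by rewrite /P exprnP exprnP invr_expz -!expfzDr //; congr (_ ^ _); lia.
have e (z : int) : q ^ (-2 * z + 2) = q ^+ 2 / q ^ (2 * z).
  by rewrite exprnP invr_expz -!expfzDr //; congr (_ ^ _); lia.
rewrite !e; have -> : q ^ (2 * (H%:Z - L%:Z)) = q ^ (2 * H%:Z) / q ^ (2 * L%:Z).
  by rewrite invr_expz -expfzDr //; congr (_ ^ _); lia.
have := qz_neq0 hq (2 * H%:Z); have := qz_neq0 hq (2 * L%:Z).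
move: (q ^ (2 * H%:Z)) (q ^ (2 * L%:Z)) q2 P0 => x z; move: (q ^+ 2) P => s t hs ht hx hz.
by field; rewrite hs ht hx hz.
Qed.

(** In the first sum the part with [P^-1 * alphaN q (L0 - j)] is shifted by one in j; together with
    the part with [g] it becomes [alphaN q H] times the recursion of [cc g T]. Both sums then carry
    [cc g T j], and [alpha_gamma] merges them. *)
Lemma bracket_sum (L0 : nat) (g : nat -> nat -> F) T (H : nat) : (0 < T)%N ->
  \sum_(0 <= j < T) P ^- j * (alphaN q H%:Z * cc g T.-1 j *
     (P^-1 * alphaN q (L0%:Z - j%:Z) + g T.-1 j) * aprod L0 j)
  + \sum_(0 <= j < T.+1) P ^- j * (- P^-1 * cc g T j *
     (P^-1 * alphaN q (L0%:Z - j%:Z) + gammaMN q p (L0%:Z - j%:Z) H%:Z) * aprod L0 j)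
  = (1 - P ^- 2) * \sum_(0 <= j < T.+1) P ^- j * (cc g T j * aprod L0 j * alphaN q (L0%:Z - j%:Z)).
Proof.
case: T => // T _ /=.
have -> : \sum_(0 <= j < T.+1) P ^- j * (alphaN q H%:Z * cc g T j *
     (P^-1 * alphaN q (L0%:Z - j%:Z) + g T j) * aprod L0 j) =
   \sum_(0 <= j < T.+2) P ^- j * (alphaN q H%:Z * (g T j * cc g T j + (if j is j'.+1 then cc g T j' else 0)) * aprod L0 j).
  transitivity (\sum_(0 <= j < T.+2) P ^- j * (alphaN q H%:Z * (g T j * cc g T j) * aprod L0 j)
     + \sum_(0 <= j < T.+2) P ^- j * (alphaN q H%:Z * (if j is j'.+1 then cc g T j' else 0) * aprod L0 j)); last first.
    by rewrite -big_split /=; apply: eq_bigr => j _; rewrite -mulrDr -mulrDl -mulrDr.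
  rewrite [X in _ = X + _]big_nat_recr //= cc_gt // mulr0 mulr0 mul0r mulr0 addr0.
  rewrite [X in _ = _ + X]big_nat_recl //= mulr0 mul0r mulr0 add0r -big_split /=.
  apply: eq_bigr => j _; rewrite aprodS exprS invfM; ring.
rewrite -big_split mulr_sumr /=; apply: eq_bigr => j _.
case: (leqP j L0) => [hj|/aprod0 ->]; last by rewrite !(mulr0, mul0r, addr0).
have -> : L0%:Z - j%:Z = (L0 - j)%N%:Z by lia.
set C := g T j * _ + _.
transitivity (P ^- j * C * aprod L0 j * (alphaN q H%:Z - P^-1 * (P^-1 * alphaN q (L0 - j)%N%:Z + gammaMN q p (L0 - j)%N%:Z H%:Z))).
  by move: (P ^- j) (P^-1) => ? ?; ring.
by rewrite alpha_gamma; move: (P ^- j) (P ^- 2) => ? ?; ring.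
Qed.

End SplitWeights.

Lemma hz_cat v w : hz (v ++ w) = hz v + hz w.
Proof. by rewrite /hz !count_cat; lia. Qed.

Lemma nT_cat v w : nT (v ++ w) = (nT v + nT w)%N.
Proof. exact: count_cat. Qed.

Lemma nE_cat v w : nE (v ++ w) = (nE v + nE w)%N.
Proof. exact: count_cat. Qed.

Lemma nk_cat v w : nk (v ++ w) = (nk v + nk w)%N.
Proof. exact: count_cat. Qed.

Lemma size_letters w : (nk w + nT w + nE w)%N = size w.
Proof. exact: count_letters. Qed.

Lemma cumT_position (u : word) b : (b < nE u)%N ->
  exists2 i, (i < size u)%N & [/\ nth None u i = Some false, nE (take i u) = b
    & nT (take i u) = nth 0%N (cumT u) b].
Proof.
rewrite /nE; elim: u b => [|[[]|] u IH] b //=.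
- rewrite add0n => /IH[i hi [h1 h2 h3]]; exists i.+1 => //; split => //=.
  rewrite /nT /= -/(nT _) h3 (nth_map 0%N) ?add1n //.
  by rewrite size_cumT /nE -h2 -[in X in (_ < X)%N](cat_take_drop i u) count_cat (drop_nth None hi) /= h1 /=; lia.
- case: b => [|b]; first by exists 0%N.
  rewrite add1n ltnS => /IH[i hi [h1 h2 h3]]; exists i.+1 => //; split => //=.
    by rewrite add1n h2.
- rewrite add0n => /IH[i hi [h1 h2 h3]]; exists i.+1 => //; split => //=.
Qed.

Lemma position_unique (u : word) i j : (i < size u)%N -> (j < size u)%N ->
  nth None u i = Some false -> nth None u j = Some false -> nE (take i u) = nE (take j u) -> i = j.
Proof.
have key a b : (a < b)%N -> (b < size u)%N -> nth None u a = Some false -> (nE (take a u) < nE (take b u))%N.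
  move=> hab hb ha; have hs : (a < size u)%N by lia.
  rewrite -(cat_take_drop a (take b u)) nE_cat take_takel; last by lia.
  suff : (0 < nE (drop a (take b u)))%N by lia.
  rewrite (drop_nth None); last by rewrite size_take; case: ifP; lia.
  by rewrite nth_take // ha /nE /=; lia.
move=> hi hj ei ej e; case: (ltngtP i j) => // h.
  by have := key _ _ h hj ei; lia.
by have := key _ _ h hi ej; lia.
Qed.

(** The W-step, placed after M letters of [s], lowers the height by one. Hence from M on the ballot
    condition is strict: the height at M is positive, and the rest is a ballot word started one step
    lower. *)
Lemma bvalid_split s M : (0 < M <= size s)%N ->
  all (fun i => i + (M <= i) <= 2 * psum s 1 i)%N (iota 1 (size s)) =
  [&& bvalid 0 (take M s), (M < 2 * psum s 1 M)%N & bvalid (2 * psum s 1 M - M).-1 (drop M s)].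
Proof.
case/andP=> M0 Ms; rewrite /bvalid size_drop size_takel //.
have h1 i : (i <= M)%N -> psum (take M s) 1 i = psum s 1 i by move=> hi; rewrite !psum1 take_takel.
have h2 i : psum s 1 (M + i) = (psum s 1 M + psum (drop M s) 1 i)%N.
  by rewrite !psum1 takeD count_cat.
apply/allP/and3P => [h|[/allP ha hb /allP hd] i].
  have hM : (M < 2 * psum s 1 M)%N.
    by have := h M; rewrite mem_iota leqnn => /(_ _); rewrite addn1; apply; lia.
  split=> //; apply/allP => i; rewrite mem_iota => hi.
    rewrite h1; last by lia.
    by have := h i; rewrite mem_iota => /(_ _); case: (M <= i)%N => hh; rewrite addn0; have := hh ltac:(lia); lia.
  have := h (M + i)%N; rewrite mem_iota h2 leq_addr => hh; have := hh ltac:(lia); lia.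
rewrite mem_iota => hi; case: (ltngtP i M) => hM.
- have hi' : i \in iota 1 M by rewrite mem_iota; lia.
  by move: (ha i hi'); rewrite (h1 _ (ltnW hM)) => h; clear -h; lia.
- have hi' : (i - M)%N \in iota 1 (size s - M) by rewrite mem_iota; lia.
  move: (hd _ hi') (h2 (i - M)%N); rewrite (subnKC (ltnW hM)) => h -> ; clear -h hM hb; lia.
- by rewrite hM; lia.
Qed.

Lemma merge_drop l s i : drop i (merge l s) = merge (drop i l) (drop (i - count id (take i l)) s).
Proof.
elim: l s i => [|[] l IH] s [|i]; rewrite /= ?drop0 //.
by case: s => [|x s] /=; rewrite IH ?add0n ?subSn ?count_take_le //.
Qed.

Lemma compatible_drop l s i : compatible l s -> (i <= size l)%N ->
  compatible (drop i l) (drop (i - count id (take i l)) s).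
Proof.
move=> hc hi; have := compatible_take hc hi; move: hc; rewrite /compatible !size_drop => /eqP hc.
have := count_cat id (take i l) (drop i l); rewrite cat_take_drop => hcat.
by have := count_take_le l i => h1 h2; apply/eqP; lia.
Qed.

Section SigmaMatch.
Context (F : fieldType) (q y c : F) (hq : not_root_of_unity q) (p : nat).
Let N := p.+1.
Let P := q ^+ p.
Let r := q ^- 2.
Let dq := q - q^-1.
Let dy := y - y^-1.
Let q0 : q != 0 := q_neq0 hq.
Local Notation al := (al q).
Local Notation pweight := (pweight q c).
Local Notation sweight := (sweight q y c p).

Definition bracket (L0 : nat) (u : word) : F :=
  \sum_(0 <= j < (nE u).+1) P ^- j * (cc (gcum q p L0 u) (nE u) j * aprod q L0 j * alphaN q (L0%:Z - j%:Z)).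

(** The closing W-step has a weight proportional to P^L al L with L = L0 - j; this supplies P^-j and
    the last factor of [bracket]. *)
Lemma sweight_bracket L0 u : valid L0 u -> (0 < height L0 u)%N ->
  sweight L0 0 u = wtu q c p L0 u * (c / (dq * dy) * P ^+ L0 * r ^+ (height L0 u).-1) *
    ((1 - P ^- 2) * bracket L0 u).
Proof.
move=> hv hp; have P0 : P != 0 by rewrite expf_neq0.
rewrite -{1}[u]cats0 (sweight_expand y c hq) // -mulrA; congr (_ * _).
rewrite /bracket !mulr_sumr big_mkord; apply: eq_bigr => j _.
have hh := height_valid hv; rewrite hz_nT in hh.
case: (leqP j L0) => [hj|/(aprod0 hq) ->]; last by rewrite !(mulr0, mul0r).
case: (leqP (nE u) (nT u + j)) => [hn|hn]; last first.
  have -> : cc (gcum q p L0 u) (nE u) j = 0 by apply: cc_gcum0.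
  by rewrite !(mulr0, mul0r).
have -> : sweight (L0 - j) (nT u + j - nE u) [::] = gwt q y c p (L0 - j) (height L0 u).-1.
  rewrite /=; have -> : (L0 - j + (nT u + j - nE u) = height L0 u)%N by lia.
  by case: (height L0 u) hp.
rewrite /gwt -/P -/r -/dq -/dy.
have -> : P ^+ (L0 - j) = P ^+ L0 * P ^- j by rewrite -{2}(subnK hj) exprD mulfK ?expf_neq0.
have -> : alphaN q (L0%:Z - j%:Z) = al (L0 - j) by rewrite (al_alphaN hq); congr alphaN; lia.
by move: (P ^- j) (dq * dy)^-1 (P ^- 2) => ? ? ?; ring.
Qed.

Lemma scoef_value v u w (L0 := height 0 v) (H := height L0 u) :
    valid 0 v -> valid L0 u -> (0 < H)%N -> valid H.-1 w -> height H.-1 w = 0%N ->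
  pweight 0 v * sweight L0 0 u * pweight H.-1 w * P ^- (nk v + nk u) =
  (c / dq) ^+ (nE v + nE u + nE w).+1 / dy *
  q ^ (p%:Z * (L0%:Z + (nE u)%:Z - (nk v)%:Z) + 2 * ((size w)%:Z + (nE v + nE u)%N%:Z)) *
  (letterprod (gv q) 0 v * letterprod (gu q) L0%:Z u * letterprod (gw q) H%:Z w) *
  ((1 - P ^- 2) * bracket L0 u).
Proof.
move=> hv hu hH hw h0; rewrite sweight_bracket // (pweight_gv c hq hv) (pweight_gw c hq hw) -/H -/dq -/dy.
have -> : H.-1%:Z + 1 = H%:Z by lia.
have := height_valid hw; rewrite h0 hz_nT => hh; have hs := size_letters w.
have -> : q ^ (p%:Z * (L0%:Z + (nE u)%:Z - (nk v)%:Z) + 2 * ((size w)%:Z + (nE v + nE u)%N%:Z)) =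
   (q ^+ (2 * nE v) * q ^+ (2 * nE u) * q ^+ (2 * nk w + 4 * nE w) * r ^+ H.-1) *
   (P ^+ (nk u + nE u) * P ^+ L0 * P ^- (nk v + nk u)).
  rewrite /P /r -!exprM exprVn -exprM !exprnP !invr_expz -!expfzDr //; congr (_ ^ _).
  rewrite !PoszM !PoszD; nia.
rewrite /wtu -/P -/dq [_ ^+ (_ + _ + _).+1]exprS [(c / dq) ^+ (_ + _ + _)]exprD [(c / dq) ^+ (_ + _)]exprD.
have -> : c / (dq * dy) = c / dq / dy by rewrite invfM mulrA.
move: (q ^+ (2 * _)) (q ^+ (2 * nE u)) (q ^+ (_ + _)) (P ^- 2) (P ^- _) (c / dq) (dy^-1) (r ^+ _) (P ^+ L0) (P ^+ (_ + _)) => *.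
by ring.
Qed.

(** * Matching with pairs of binary tuples *)

Section Pair.
Context (l s : seq bool) (k d t : nat) (hc : compatible l s) (hl : size l = p).
Context (k1 : (0 < k)%N) (kN : (k <= N)%N) (dk : (d < k)%N).
Let n0 := (p.+1 - k)%N.
Let om := merge l s.
Let v := take n0 om.
Let u := take d (drop n0 om).
Let w := drop (n0 + d) om.
Let m' := psum l 1 (n0 + d).

Let som : size om = p. Proof. by rewrite size_merge. Qed.
Let hnd : (n0 + d <= p)%N. Proof. rewrite /n0; lia. Qed.
Let sv : size v = n0. Proof. by rewrite size_takel // som; lia. Qed.
Let su : size u = d. Proof. by rewrite size_takel // size_drop som; lia. Qed.
Let sw : size w = (k - d.+1)%N. Proof. by rewrite size_drop som /n0; lia. Qed.
Let vu : take (n0 + d) om = v ++ u. Proof. by rewrite takeD. Qed.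
Let omE : om = v ++ u ++ w. Proof. by rewrite catA -vu cat_take_drop. Qed.

Let take_u i : (i <= d)%N -> take (n0 + i) om = v ++ take i u.
Proof. by move=> hi; rewrite takeD take_takel. Qed.

Let nth_u i : (i < d)%N -> nth None om (n0 + i) = nth None u i.
Proof. by move=> hi; rewrite nth_take // nth_drop. Qed.

Lemma psum_merge i : (i <= p)%N -> psum l 1 i = nk (take i om).
Proof.
move=> hi; rewrite psum1 merge_take nk_merge //; apply: compatible_prefix; rewrite ?hl //.
Qed.

Lemma psum_merge_true i : (i <= p)%N -> psum s 1 (i - psum l 1 i) = nT (take i om).
Proof.
move=> hi; rewrite !psum1 merge_take /nT nF_merge //; apply: compatible_prefix; rewrite ?hl //.
Qed.

Let zetaE i : (i <= p)%N -> zeta l s i = hz (take i om).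
Proof. by move=> hi; rewrite zeta_merge ?hl. Qed.

Hypothesis ht : t = nE (v ++ u).

Lemma T_merge : T_ p k t l s = nE u.
Proof.
rewrite /T_ -/n0 zetaE ?psum_merge_true; try by lia.
by rewrite hz_nT -/v ht nE_cat; lia.
Qed.

(** The Kronecker delta in [r_b] tests whether exactly b - 1 down-steps of the middle stretch
    precede position r. So the sum has one nonzero term, the position of the b-th down-step. *)
Lemma Ncum_merge b : (0 < b <= nE u)%N -> Ncum p k d t l s b = (nth 0%N (cumT u) b.-1)%:Z.
Proof.
case/andP=> b0 bT; rewrite /Ncum T_merge bT; case: b b0 bT => // b _ bT /=.
have [i hi [e1 e2 e3]] := cumT_position bT; rewrite su in hi.
have hk j : (j <= d)%N -> (psum l (p.+2 - k) (n0 + j)) = nk (take j u).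
  move=> hj; have -> : (p.+2 - k = n0.+1)%N by rewrite /n0; lia.
  have := @psum_tail l n0 (n0 + j) (leq_addr _ _); rewrite !psum_merge; try by rewrite /n0; lia.
  by rewrite take_u // nk_cat -/v; lia.
have hT j : (j <= d)%N -> psum s (p.+2 - k - psum l 1 (p.+1 - k)) (n0 + j - psum l 1 (n0 + j)) = nT (take j u).
  move=> hj; rewrite -/n0; have hle : (psum l 1 n0 <= n0)%N by rewrite psum1 count_take_le.
  have -> : (p.+2 - k - psum l 1 n0 = (n0 - psum l 1 n0).+1)%N by rewrite /n0 in hle *; lia.
  have hle2 : (n0 - psum l 1 n0 <= n0 + j - psum l 1 (n0 + j))%N.
    have := hk j hj; have -> : (p.+2 - k = n0.+1)%N by rewrite /n0; lia.
    have := @psum_tail l n0 (n0 + j) (leq_addr _ _); have := size_letters (take j u).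
    rewrite size_takel ?su //; lia.
  have := psum_tail s hle2; rewrite !psum_merge_true; try by rewrite /n0; lia.
  by rewrite take_u // nT_cat -/v; lia.
have hsel j : (j < d)%N -> sel0 l s (n0 + j.+1) = (nth None u j == Some false).
  by move=> hj; rewrite addnS sel0_merge ?hl ?nth_u //; lia.
have hlet j : (j < d)%N -> nth None u j = Some false ->
    nk (take j.+1 u) = nk (take j u) /\ nT (take j.+1 u) = nT (take j u).
  by move=> hj e; rewrite (take_nth None) ?su // e /nk /nT !count_rcons /= !addn0.
have hcond j : (j < d)%N -> nth None u j = Some false ->
   ((n0 + j.+1)%N%:Z + - p%:Z + k%:Z - b.+1%:Z - 1 - (psum l (p.+2 - k) (n0 + j.+1))%:Z ==
    (psum s (p.+2 - k - psum l 1 (p.+1 - k)) (n0 + j.+1 - psum l 1 (n0 + j.+1)))%:Z :> int) =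
   (nE (take j u) == b).
  move=> hj e; have [h1 h2] := hlet j hj e; rewrite hk // hT // h1 h2.
  have := size_letters (take j u); rewrite size_takel ?su; last by lia.
  by move=> hs; apply/eqP/eqP; rewrite /n0; lia.
have -> : r_b p k d l s b.+1 = (n0 + i.+1)%N.
  rewrite /r_b; have -> : (p.+2 - k = 0 + n0.+1)%N by rewrite /n0; lia.
  have -> : ((p.+1 - k + d).+1 = d + n0.+1)%N by rewrite /n0; lia.
  rewrite big_addn addnK big_mkord (bigD1 (Ordinal hi)) //=.
  have e0 : (0 + n0.+1 = p.+2 - k)%N by rewrite /n0; lia.
  rewrite e0 (_ : (i + n0.+1 = n0 + i.+1)%N); last by lia.
  rewrite hsel // e1 eqxx hcond // e2 eqxx !muln1 big1 ?addn0 // => j hj.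
  rewrite (_ : (j + n0.+1 = n0 + j.+1)%N); last by lia.
  rewrite hsel //; case: eqP => [ej|]; last by rewrite muln0.
  rewrite hcond //; case: eqP => [eb|]; last by rewrite muln0.
  case/eqP: hj; apply/val_inj => /=; apply: (position_unique _ _ ej e1); rewrite ?su //.
  by rewrite eb e2.
have [h1 h2] := hlet i hi e1; rewrite hk // h1.
have := size_letters (take i u); rewrite size_takel ?su; last by lia.
by rewrite /n0 -e3; lia.
Qed.

Lemma Ncum_last : Ncum p k d t l s (nE u).+1 = (nT u)%:Z.
Proof.
rewrite /Ncum T_merge /= ltnn -/n0 !zetaE; try by lia.
by rewrite vu hz_cat -/v !hz_nT; lia.
Qed.

Lemma isum_N0 b : isum (N_ p k d t l s) 0 b = hz v + Ncum p k d t l s b.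
Proof.
rewrite /isum big_nat_recl // /N_ zetaE -/n0 -/v; last by rewrite /n0; lia.
congr (_ + _); elim: b => [|b IH]; first by rewrite big_geq.
by rewrite big_nat_recr // IH /=; lia.
Qed.

Lemma isum_N1 b : isum (N_ p k d t l s) 1 b = Ncum p k d t l s b.
Proof.
rewrite /isum big_add1 /N_; elim: b => [|b IH]; first by rewrite big_geq.
by rewrite /= in IH *; rewrite big_nat_recr // IH /=; lia.
Qed.

Context (hv : valid 0 v) (hu : valid (height 0 v) u).
Let L0 := height 0 v.
Let H := height L0 u.

Let L0E : L0%:Z = hz v. Proof. by rewrite (height_valid hv) add0r. Qed.
Let HE : H%:Z = hz (v ++ u). Proof. by rewrite (height_valid hu) L0E hz_cat. Qed.
Let N0E : N_ p k d t l s 0 = L0%:Z. Proof. by rewrite /N_ -/n0 zetaE ?L0E //; lia. Qed.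
Let zH : zeta l s (p.+1 - k + d) = H%:Z. Proof. by rewrite -/n0 zetaE // vu HE. Qed.

Lemma cbuN_merge b j : (b <= nE u)%N -> (j <= b)%N ->
  cbuN q p (N_ p k d t l s) b j = cc (gcum q p L0 u) b j.
Proof.
move=> hb hj; rewrite cbuN_cc //; apply: cc_ext => b' j' hb'.
rewrite /gcum N0E isum_N0 Ncum_merge; last by lia.
rewrite L0E; congr (gammaMN _ _ _ (_ + _%:Z - _)); apply: set_nth_default.
by rewrite size_cumT; lia.
Qed.

(** For T = 0 this is [alpha_gamma], for T > 0 [bracket_sum]. The lower bounds xi of the summations
    omit only terms in which [cc] vanishes. *)
Lemma sigma_bracket :
  sigma_sum q p k d t l s ^+ (T_ p k t l s != 0%N) * sigma_zero q p k d t l s ^+ (T_ p k t l s == 0%N) =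
  (1 - P ^- 2) * bracket L0 u.
Proof.
have P0 : P != 0 by rewrite expf_neq0.
have ha : q ^ (- p%:Z) = P^-1 by rewrite exprnN.
have hau (j : nat) : q ^ (- p%:Z * j%:Z) = P ^- j.
  by rewrite /P -exprM exprnN; congr (_ ^ _); lia.
rewrite T_merge; case: (posnP (nE u)) => hT.
  rewrite [_ ^+ (~~ true)]expr0 mul1r [_ ^+ true]expr1 /sigma_zero zH ha N0E.
  have -> : L0%:Z + N_ p k d t l s 1 = H%:Z.
    have e1 : Ncum p k d t l s 1 = (nT u)%:Z by rewrite -[1%N]/(0.+1) -hT Ncum_last.
    have -> : N_ p k d t l s 1 = (nT u)%:Z by rewrite /N_ e1 /Ncum /= subr0.
    by rewrite HE hz_cat L0E (hz_nT u) hT; lia.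
  by rewrite -/P (alpha_gamma hq) /bracket hT big_nat1 /= /aprod big_geq // expr0 invr1 !mul1r subr0.
rewrite [_ ^+ (~~ false)]expr1 [_ ^+ false]expr0 mulr1 -(bracket_sum hq p L0 _ H hT) /sigma_sum T_merge.
have cNT : isum (N_ p k d t l s) 0 (nE u).+1 - (nE u)%:Z = H%:Z.
  by rewrite isum_N0 Ncum_last HE hz_cat (hz_nT u); lia.
have hN : Ncum p k d t l s (nE u) = (nth 0%N (cumT u) (nE u).-1)%:Z by rewrite Ncum_merge // hT leqnn.
have mono a b : (a <= b)%N -> (nth (nT u) (cumT u) a <= nth (nT u) (cumT u) b)%N.
  by elim: b => [|b IH]; rewrite leq_eqVlt => /predU1P[-> //|//]; rewrite ltnS => /IH h; apply: leq_trans h (cumT_mono _ _).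
congr (_ + _); rewrite big_mkcond [LHS]big_nat [RHS]big_nat; apply: eq_bigr => j /andP[_ hj].
  rewrite hau /omega0 T_merge zH cbuN_merge; [|lia|lia].
  have -> : gcum q p L0 u (nE u).-1 j = gammaMN q p (L0%:Z - j%:Z) (isum (N_ p k d t l s) 0 (nE u) - ((nE u)%:Z - 1)).
    rewrite /gcum isum_N0 hN L0E; congr (gammaMN _ _ _ _).
    rewrite (set_nth_default 0%N) ?size_cumT; lia.
  rewrite ha N0E -/P; case: ifP => // /negbT; rewrite -ltNge => hx.
  have -> : cc (gcum q p L0 u) (nE u).-1 j = 0; last by rewrite !(mulr0, mul0r).
  apply: (cc_zero (N := fun b => nth (nT u) (cumT u) b)); first exact: cumT_mono.
    move=> b i hb; rewrite /gcum; have -> : L0%:Z + (nth (nT u) (cumT u) b)%:Z - b%:Z = L0%:Z - i%:Z by lia.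
    exact: gamma0.
  move: hx; rewrite /xi T_merge addn0 isum_N1 hN.
  rewrite (set_nth_default (nT u)) ?size_cumT; last by lia.
  case: (nE u) hT hj => // -[|n] _ hj /=; first by lia.
  have := mono n n.+1 (leqnSn _); lia.
rewrite hau /omega1 T_merge cbuN_merge; [|lia|lia].
rewrite cNT ha N0E -/P; case: ifP => [_|/negbT]; first by rewrite !mulNr !mulrN ?mulNr.
rewrite -ltNge => hx; rewrite cc_gcum0 ?mulr0 ?mul0r ?mulr0 //.
by move: hx; rewrite /xi T_merge addn1 isum_N1 Ncum_last; lia.
Qed.

(** The middle stretch contributes powers of q but no alpha, which is why the product in sigma runs
    over R_{k,d} only. *)
Lemma letter_weights :
  letterprod (gv q) 0 v * letterprod (gu q) L0%:Z u * letterprod (gw q) H%:Z w =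
  q ^ (- 2 * (\sum_(1 <= r < p.+1) zeta l s r.-1 * (entry l r + sel0 l s r)%N%:Z)) *
  sigma_prod q p k d l s.
Proof.
pose g0 i := nth None om i; pose h0 i := hz (take i om).
have -> : q ^ (- 2 * (\sum_(1 <= r < p.+1) zeta l s r.-1 * (entry l r + sel0 l s r)%N%:Z)) =
   \prod_(0 <= i < p) q ^ (- 2 * (h0 i * (g0 i != Some true)%:Z)).
  rewrite mulr_sumr big_add1 /= !big_mkord (big_pow q0 p (fun i => - 2 * (h0 i * (g0 i != Some true)%:Z))); congr (q ^ _).
  apply: eq_bigr => i _; have hi : (i <= p)%N by rewrite ltnW.
  rewrite zetaE // (entry_merge hc) ?hl // (sel0_merge hc) ?hl // -/om /g0.
  by case: (nth None om i) => [[]|].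
have -> : sigma_prod q p k d l s = \prod_(0 <= i < p) (if (n0 <= i < n0 + d)%N then 1 else
    if g0 i == Some false then alphaN q (h0 i - (n0 <= i)%N%:Z) else 1).
  rewrite /sigma_prod big_add1 /= [LHS]big_mkcond !big_mkord; apply: eq_bigr => i _.
  have hi : (i <= p)%N by rewrite ltnW.
  have -> : (p.+2 - k <= i.+1 <= p.+1 - k + d)%N = (n0 <= i < n0 + d)%N by rewrite /n0; lia.
  case: ifP; case: ifP => // _ _; rewrite /= zetaE // (sel0_merge hc) ?hl // -/om -/(g0 i).
  by have -> : (p.+1 - k < i.+1)%N = (n0 <= i)%N by []; case: eqP.
rewrite -big_split /=.
have ep : p = (n0 + d + size w)%N by rewrite sw /n0; lia.
rewrite [RHS](big_cat_nat (n := n0)) ?leq0n //=; last by lia.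
rewrite [X in _ = _ * X](big_cat_nat (n := (n0 + d)%N)) /= ?leq_addr // [RHS]mulrA.
rewrite !letterprodE sv su; congr (_ * _ * _).
- rewrite big_mkord; apply: eq_bigr => i _; have hi := ltn_ord i.
  rewrite add0r /v nth_take // take_takel; last exact: ltnW.
  rewrite -/(g0 i) -/(h0 i) leqNgt hi /= subr0 /gv.
  by case: (g0 i) => [[]|]; rewrite /= ?mulr1 ?mulr0 ?expr0z ?mulr1.
- rewrite -{1}[n0]add0n [(n0 + d)%N]addnC big_addn addnK big_mkord; apply: eq_bigr => i _; have hi := ltn_ord i.
  have -> : (n0 <= i + n0 < d + n0)%N by lia.
  rewrite [(i + n0)%N]addnC mulr1 -nth_u // -/(g0 _).
  have -> : L0%:Z + hz (take i u) = h0 (n0 + i)%N by rewrite /h0 take_u 1?ltnW // hz_cat L0E.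
  by rewrite /gu; case: (g0 _) => [[]|]; rewrite /= ?mulr1 ?mulr0 ?expr0z.
rewrite -{1}[(n0 + d)%N]add0n big_addn big_mkord.
have -> : (p - (n0 + d) = size w)%N by lia.
apply: eq_bigr => i _; have hi := ltn_ord i.
have -> : (n0 <= i + (n0 + d) < n0 + d)%N = false by lia.
have -> : (n0 <= i + (n0 + d))%N by lia.
rewrite addnC /w nth_drop -/(g0 _).
have -> : H%:Z + hz (take i (drop (n0 + d) om)) = h0 (n0 + d + i)%N by rewrite /h0 takeD vu (hz_cat (v ++ u)) HE.
by rewrite /gw; case: (g0 _) => [[]|]; rewrite /= ?mulr1 ?mulr0 ?expr0z ?mul1r.
Qed.

Lemma kappa_merge : (0 < H)%N -> height H.-1 w = 0%N -> valid H.-1 w ->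
  kappa p k d m' t l s = - 2 * (\sum_(1 <= r < p.+1) zeta l s r.-1 * (entry l r + sel0 l s r)%N%:Z)
  + (p%:Z * (L0%:Z + (nE u)%:Z - (nk v)%:Z) + 2 * ((size w)%:Z + (nE v + nE u)%N%:Z)).
Proof.
move=> hH h0 hw; rewrite /kappa T_merge isum_N1 Ncum_last N0E -addrA; congr (_ + _).
have -> : m' = (nk v + nk u)%N by rewrite /m' psum_merge // vu nk_cat.
have := size_letters u; rewrite su sw ht nE_cat => hsu.
rewrite mulNr opprK.
have -> : L0%:Z - (nT u)%:Z - (nk v + nk u)%N%:Z + d%:Z = L0%:Z + (nE u)%:Z - (nk v)%:Z by lia.
by congr (_ + 2 * _); lia.
Qed.

End Pair.

Definition scoef k d (om : word) : F :=
  let v := take (p.+1 - k) om in let u := take d (drop (p.+1 - k) om) in let w := drop (p.+1 - k + d) om in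
  pweight 0 v * sweight (height 0 v) 0 u * pweight (height (height 0 v) u).-1 w * P ^- (nk v + nk u).

Definition sheight k d (om : word) : nat :=
  height (height 0 (take (p.+1 - k + d) om)).-1 (drop (p.+1 - k + d) om).

Definition svalid k d (om : word) : bool :=
  let v := take (p.+1 - k + d) om in
  [&& valid 0 v, (0 < height 0 v)%N & valid (height 0 v).-1 (drop (p.+1 - k + d) om)].

Lemma scoef_invalid k d om : ~~ svalid k d om -> scoef k d om = 0.
Proof.
rewrite /svalid /scoef takeD valid_cat height_cat.
set v := take _ om; set u := take d _; set w := drop _ om => h.
case: (boolP (valid 0 v)) h => [hv|hv]; last by rewrite (pweight_invalid _ _ hv) !mul0r.
case: (boolP (valid (height 0 v) u && (0 < height (height 0 v) u)%N)) => [/andP[hu hH]|hu].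
  by rewrite hu hH => /= hw; rewrite (pweight_invalid _ _ hw) mulr0 mul0r.
move=> _; have -> : sweight (height 0 v) 0 u = 0 by apply: sweight_invalid; rewrite ?addn0.
by rewrite mulr0 !mul0r.
Qed.

Lemma sigma_term m t k d l s :
  (m < p)%N -> (0 < k <= N)%N -> (d < k)%N -> ~~ odd (N - m) ->
  size l = p -> count id l = m -> size s = (p - m)%N ->
  let om := merge l s in let m' := psum l 1 (N - k + d) in
  (if (sheight k d om == 0%N) && (nE (take (N - k + d) om) == t) then scoef k d om else 0) =
  c ^+ (N - m)./2 *
  (if in_S' p m m' k t d s then
     q ^ kappa p k d m' t l s / (dq ^+ (N - m)./2 * dy) * sigma_prod q p k d l s
     * sigma_sum q p k d t l s ^+ (T_ p k t l s != 0%N)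
     * sigma_zero q p k d t l s ^+ (T_ p k t l s == 0%N) else 0).
Proof.
move=> hm /andP[k0 kN] dk odd hl cl hs om m'.
have hc : compatible l s by apply/eqP; rewrite hs cl hl; lia.
set n0 := (N - k)%N; set v := take (n0 + d) om; set w := drop (n0 + d) om.
have hnd : (n0 + d <= p)%N by rewrite /n0 /N; lia.
set M := (n0 + d - m')%N.
have hm'le : (m' <= n0 + d)%N by rewrite /m' psum1 count_take_le.
have hMs : (M <= size s)%N by have := compatible_take hc (i := (n0 + d)%N); rewrite hl hnd /M /m' psum1 => ->.
have ev : v = merge (take (n0 + d) l) (take M s) by rewrite /v merge_take /M /m' psum1.
have ew : w = merge (drop (n0 + d) l) (drop M s) by rewrite /w merge_drop /M /m' psum1.
have cv : compatible (take (n0 + d) l) (take M s).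
  by rewrite /M /m' psum1; apply: compatible_prefix => //; rewrite hl.
have cw : compatible (drop (n0 + d) l) (drop M s).
  by rewrite /M /m' psum1; apply: compatible_drop => //; rewrite hl.
have hTv : nT v = psum s 1 M by rewrite ev /nT nF_merge // psum1.
have hEv : nE v = (M - psum s 1 M)%N.
  rewrite ev nE_merge // psum1; have := count_predC id (take M s); rewrite size_takel // => h.
  by rewrite -[X in (X - _)%N]h addKn; apply: eq_count.
have hpM : (psum s 1 M <= M)%N by rewrite psum1 count_take_le.
have hTw : nT w = count id (drop M s) by rewrite ew /nT nF_merge.
have hEw : nE w = count negb (drop M s) by rewrite ew nE_merge.
have hTE : (nT w + nE w = p - m - M)%N by rewrite hTw hEw -hs -size_drop -(count_predC id).
have hcs : psum s 1 (p - m) = (psum s 1 M + nT w)%N.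
  by rewrite hTw !psum1 -hs take_size -count_cat cat_take_drop.
have hsp : in_S' p m m' k t d s && (0 < M)%N =
   [&& svalid k d om, sheight k d om == 0%N & nE v == t] && (0 < M)%N.
  case: (posnP M) => M0; rewrite ?andbF // !andbT /in_S' -/N -/n0 -/M.
  have hal : all (fun i => i + (M <= i) <= 2 * psum s 1 i)%N (iota 1 (p - m)) =
      [&& valid 0 v, (M < 2 * psum s 1 M)%N & valid (2 * psum s 1 M - M).-1 w].
    by rewrite -hs bvalid_split ?M0 ?hMs // ev ew !valid_merge.
  rewrite hal /svalid /sheight -/N -/n0 -/v -/w.
  case: (boolP (valid 0 v)) => hv; last by rewrite /= !andbF.
  have eh : height 0 v = (2 * psum s 1 M - M)%N.
    by have := height_valid hv; rewrite hz_nT hTv hEv; lia.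
  rewrite eh /=; have -> : (M < 2 * psum s 1 M)%N = (0 < 2 * psum s 1 M - M)%N by lia.
  case: (posnP (2 * psum s 1 M - M)) => hH; first by rewrite /= !andbF.
  case: (boolP (valid (2 * psum s 1 M - M).-1 w)) => hw; last by rewrite /= !andbF.
  have ehw := height_valid hw; rewrite hz_nT in ehw.
  rewrite hcs hEv; apply/idP/idP => [/and4P[/eqP h1 _ /eqP h2 _]|/and3P[_ /eqP h1 /eqP h2]].
    by apply/and3P; split => //; apply/eqP; lia.
  by apply/and4P; split => //; apply/eqP; lia.
(* The case M = 0, not covered by [bvalid_split], is impossible on both sides: in S' the conditions
   |s|_{1;M} = M - t and M - t <> 0 contradict each other, and a word without up-steps before the
   W-step has height 0 there. *)
have hS0 : in_S' p m m' k t d s -> (0 < M)%N.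
  have s0 : psum s 1 0 = 0%N by rewrite psum1 take0.
  rewrite lt0n => hS; apply/eqP => M0; move: hS; rewrite /in_S' -/N -/n0 -/M M0 s0.
  by move=> /and4P[_ _ /eqP h1 /eqP h2]; lia.
have hV0 : svalid k d om -> (0 < M)%N.
  rewrite lt0n /svalid -/N -/n0 -/v => /and3P[hv hH _]; apply: contraTneq hH => M0.
  by have := height_valid hv; rewrite hz_nT hTv hEv; lia.
have {hsp}hsp : in_S' p m m' k t d s = [&& svalid k d om, sheight k d om == 0%N & nE v == t].
  case: (posnP M) => M0; last by move: hsp; rewrite M0 !andbT.
  case: (boolP (in_S' p m m' k t d s)) => [/hS0|_]; first by rewrite M0.
  by case: (boolP (svalid k d om)) => [/hV0|//]; rewrite M0.
rewrite hsp; case: (boolP (svalid k d om)) => hV; last by rewrite (scoef_invalid hV) mulr0; case: ifP.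
rewrite /=; case: ifP => [/andP[/eqP h0 /eqP et]|_]; last by rewrite mulr0.
move: (hV); rewrite /svalid -/N -/n0 -/v -/w => /and3P[hv hH hw].
have vE : v = take n0 om ++ take d (drop n0 om) by rewrite /v takeD.
move: (hv); rewrite vE valid_cat => /andP[hv1 hu].
have hh : height 0 v = height (height 0 (take n0 om)) (take d (drop n0 om)) by rewrite vE height_cat.
have ht : t = nE (take n0 om ++ take d (drop n0 om)) by rewrite -vE.
rewrite hh in hH hw; have h0' := h0; rewrite /sheight -/N -/n0 -/v -/w hh in h0'.
rewrite -!mulrA [sigma_sum _ _ _ _ _ _ _ ^+ _ * _](sigma_bracket hc hl k0 kN dk ht hv1 hu).
rewrite (kappa_merge hc hl k0 kN dk ht hv1 hu) // /scoef -/N -/n0 -/w (scoef_value hv1 hu) //.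
rewrite (letter_weights hc hl k0 kN dk ht hv1 hu) [q ^ (- 2 * _ + _)]expfzDr //.
(* The extra one is the W-step, which carries a factor c / (q - q^-1) like every down-step. *)
have hE1 : (nE (take n0 om) + nE (take d (drop n0 om)) + nE w).+1 = (N - m)./2.
  have := height_valid hv; have := height_valid hw; rewrite h0' hh !hz_nT hTv hEv => e1 e2.
  rewrite -nE_cat -vE hEv.
  have e3 : (N - m)%N = (2 * ((M - psum s 1 M + nE w).+1))%N by rewrite /N; clear -e1 e2 hTE hpM hMs hs hm hH; clearbody M; lia.
  by rewrite e3 mul2n doubleK.
rewrite hE1 -/dq -/dy expr_div_n [(dq ^+ _ * dy)^-1]invfM.
by move: (q ^ _) (q ^ _) ((1 - P ^- 2) * _) (dq ^+ _)^-1 (dy^-1) => *; ring.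
Qed.

End SigmaMatch.

Lemma sum_pick (V : nmodType) (a m0 : nat) (G : nat -> V) :
  \sum_(m < a) (if m0 == m :> nat then G m else 0) = if (m0 < a)%N then G m0 else 0.
Proof.
rewrite -big_mkcond /=; case: ifP => h; first by rewrite (big_pred1 (Ordinal h)) // => i; rewrite eq_sym.
by rewrite big_pred0 // => i; apply: contraFF h => /eqP ->.
Qed.

Lemma parity_odd (P0 m : nat) : parity (- P0%:Z + m%:Z) = (odd (P0 + m))%:Z.
Proof. by rewrite /parity; case: (boolP (odd (P0 + m))) => /= h; lia. Qed.

(** * rho and sigma as sums over words *)

Section Coefficients.
Context (F : fieldType) (q y c : F) (hq : not_root_of_unity q) (p : nat).
Let N := p.+1.
Let q0 : q != 0 := q_neq0 hq.

Lemma rho_coef_invalid k w : ~~ valid 0 w -> rho_coef q c p k w = 0.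
Proof. by move=> h; rewrite /rho_coef (pweight_invalid _ _ h) mulr0. Qed.

(** The sign comes from solving the vanishing alternating sum for the Serre polynomial. Values of k
    outside the range in rho admit no word with the prescribed key. *)
Lemma rho_words m m' t : (m < p)%N -> (m' < p - m)%N ->
  rho q c p m m' t = - \sum_(0 <= k < N.+1) ((-1) ^+ k * qbinom q N k) *
    \sum_(w <- words letters N | (height 0 w == 0%N) && (rho_key p k w == (m, m', t)))
       rho_coef q c p k w.
Proof.
move=> hm hm'; rewrite /rho -/N.
have -> : - p%:Z + m%:Z + m'%:Z = - p%:Z + (m + m')%N%:Z by lia.
rewrite parity_odd.
case: (boolP (odd (N - m - m'))) => hodd.
  (* For this parity no valid word of length N with m + m' letters [None] returns to height 0, so
     the right side vanishes along with the factor [parity]. *)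
  have -> : odd (p + (m + m')) = false by move: hodd; rewrite /N; lia.
  rewrite mulr0z !mul0r big1 ?oppr0 // => k _; rewrite big1_seq ?mulr0 // => w /andP[/andP[/eqP h0 /eqP hk]].
  rewrite mem_words => /andP[/eqP hs _].
  case: (boolP (valid 0 w)) => [hv|]; last exact: rho_coef_invalid.
  have := height_valid hv; have := size_letters w; rewrite h0 hz_nT hs => h1 h2.
  have : nk w = (m + m')%N.
    by rewrite -(cat_take_drop (N - k) w) nk_cat; case: hk => -> ->.
  by move: hodd; rewrite /N in h1 *; lia.
have -> : odd (p + (m + m')) by move: hodd; rewrite /N; lia.
rewrite mulr1z mul1r.
have hmN : (m + m' <= N)%N by rewrite /N; lia.
have step k : (k <= N)%N ->
   \sum_(w <- words letters N | (height 0 w == 0%N) && (rho_key p k w == (m, m', t))) rho_coef q c p k w =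
   (c * q ^+ 2 / (q - q^-1)) ^+ (N - m - m')./2 *
   \sum_(l : N.-tuple bool | in_L p m m' k l) \sum_(s : (N - m - m').-tuple bool | in_S p m m' k t s)
     q ^ theta_exp p l s k * \prod_(1 <= r < p.+2) qround (q ^+ 2) (zeta l s r.-1 + 1) ^+ sel1 l s r.
  move=> kN.
  rewrite (big_bool_words N (in_L p m m' k) (fun l => \sum_(s : (N - m - m').-tuple bool | in_S p m m' k t s)
     q ^ theta_exp p l s k * \prod_(1 <= r < p.+2) qround (q ^+ 2) (zeta l s r.-1 + 1) ^+ sel1 l s r)).
  transitivity (\sum_(w <- words letters N | count (pred1 None) w == (m + m')%N)
     (if (height 0 w == 0%N) && (rho_key p k w == (m, m', t)) then rho_coef q c p k w else 0)).
    rewrite [LHS]big_mkcond [RHS]big_mkcond; apply: eq_bigr => w _.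
    case: ifP => [/andP[h0 /eqP hk]|]; last by case: ifP.
    suff -> : count (pred1 None) w == (m + m')%N by [].
    by rewrite -(cat_take_drop (N - k) w) count_cat; case: hk => <- <- _.
  rewrite big_merge // mulr_sumr [LHS]big_seq_cond [RHS]big_seq_cond.
  rewrite [LHS](bigID (in_L p m m' k)) [X in _ + X = _]big1 ?addr0; last first.
    move=> l /andP[/andP[]]; rewrite mem_words => /andP[/eqP hl _] /eqP hcl hL.
    rewrite big1_seq // => s /andP[_]; rewrite mem_words => /andP[/eqP hs _].
    have hc : compatible l s by apply/eqP; rewrite hl hs hcl; lia.
    case: ifP => // /andP[_ /eqP hk]; case/negP: hL; case: hk; rewrite /in_L -/N.
    rewrite merge_take merge_drop !nk_merge; first last.
    - by apply: compatible_prefix; rewrite ?hl // leq_subr.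
    - by apply: compatible_drop; rewrite ?hl // leq_subr.
    have h1 := @psum_tail l (N - k) N (leq_subr _ _).
    have h2 : psum l 1 N = count id l by rewrite psum1 -hl take_size.
    have h3 := count_cat id (take (N - k) l) (drop (N - k) l); rewrite cat_take_drop in h3.
    rewrite -[count id (take _ _)]psum1 => e1 e2 _; rewrite psum1 in h1; rewrite -psum1 in h1.
    have -> : (p.+2 - k = (N - k).+1)%N by rewrite /N; lia.
    by rewrite -psum1 in h3; apply/andP; split; apply/eqP; lia.
  apply: eq_big => l.
    rewrite mem_words; case: (boolP (in_L p m m' k l)) => hL; rewrite ?andbF ?andbT //.
    case: eqP => //= hl; suff -> : count id l == (m + m')%N by rewrite andbT.
    move: hL; rewrite /in_L -/N => /andP[/eqP e1 /eqP e2].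
    have h1 := @psum_tail l (N - k) N (leq_subr _ _).
    have h2 : psum l 1 N = count id l by rewrite psum1 -hl take_size.
    have e3 : (p.+2 - k = (N - k).+1)%N by rewrite /N; lia.
    by rewrite e3 in e2; apply/eqP; lia.
  rewrite mem_words => /andP[/andP[/andP[/eqP hl _] /eqP hcl] hL].
  have -> : (N - (m + m') = N - m - m')%N by lia.
  rewrite (big_bool_words (N - m - m') (in_S p m m' k t) (fun s => q ^ theta_exp p l s k *
     \prod_(1 <= r < p.+2) qround (q ^+ 2) (zeta l s r.-1 + 1) ^+ sel1 l s r)).
  rewrite [X in _ * X]big_mkcond mulr_sumr; apply: eq_big_seq => s.
  rewrite mem_words => /andP[/eqP hs _].
  rewrite -(rho_term c hq t hmN kN hodd hl hcl hs hL).
  have hc : compatible l s by apply/eqP; rewrite hl hs hcl; lia.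
  congr (if _ && _ then _ else _); rewrite /rho_key.
  move: hL; rewrite /in_L -/N => /andP[/eqP e1 /eqP e2].
  have e1' : nk (take (N - k) (merge l s)) = m.
    have hcp : compatible (take (N - k) l) (take (N - k - count id (take (N - k) l)) s).
      by apply: compatible_prefix; rewrite ?hl // leq_subr.
    by rewrite merge_take (nk_merge hcp) -psum1.
  have e2' : nk (drop (N - k) (merge l s)) = m'.
    have := nk_cat (take (N - k) (merge l s)) (drop (N - k) (merge l s)).
    by rewrite cat_take_drop nk_merge // e1' hcl; lia.
  by rewrite e1' e2'; apply/eqP/eqP => [[]|->].
have szN w : w \in words letters N -> size w = N by rewrite mem_words => /andP[/eqP].
rewrite -sumrN [RHS](big_cat_nat (n := m')) //=; last by rewrite /N; lia.
rewrite [X in _ = X + _]big_nat [X in _ = X + _]big1 ?add0r; last first.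
  move=> k /andP[_ hk]; rewrite big1_seq ?mulr0 ?oppr0 // => w /andP[/andP[_ /eqP hkey]] /szN hs.
  case: hkey => _ hd _.
  have := size_letters (drop (N - k) w); rewrite hd size_drop hs; lia.
rewrite [RHS](big_cat_nat (n := (p.+2 - m)%N)) /=; [|rewrite /N; lia|rewrite /N; lia].
rewrite [X in _ = _ + X]big_nat [X in _ = _ + X]big1 ?addr0; last first.
  move=> k /andP[hk hk2]; rewrite big1_seq ?mulr0 ?oppr0 // => w /andP[/andP[_ /eqP hkey]] /szN hs.
  case: hkey => hd _ _.
  have := size_letters (take (N - k) w); rewrite hd size_takel ?hs ?leq_subr //; rewrite /N in hk hk2 *; lia.
rewrite mulr_sumr [LHS]big_nat [RHS]big_nat; apply: eq_bigr => k /andP[_ hk].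
rewrite step; last by rewrite /N; lia.
rewrite [X in _ = - X]mulrCA -[RHS]mulrN; congr (_ * _); rewrite -mulNr mulr_sumr; apply: eq_bigr => l _.
rewrite mulr_sumr; apply: eq_bigr => s _; rewrite exprS.
by move: (qbinom _ _ _) ((-1) ^+ k) => ? ?; ring.
Qed.

(** For given [l] the value of m' is forced, so summing over m' in sigma only sorts the tuples
    [l]. *)
Lemma sigma_words m t : (m < p)%N ->
  sigma q y c p m t = - \sum_(0 <= k < N.+1) ((-1) ^+ k * qbinom q N k) *
    \sum_(0 <= d < k) \sum_(w <- words letters p |
        (sheight p k d w == 0%N) && ((nk w, nE (take (N - k + d) w)) == (m, t)))
      scoef q y c p k d w.
Proof.
move=> hm; rewrite /sigma parity_odd -/N.
case: (boolP (odd (N - m))) => hodd.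
  have -> : odd (p + m) = false by move: hodd; rewrite /N; lia.
  rewrite mulr0z !mul0r big1 ?oppr0 // => k _; rewrite big1 ?mulr0 // => d _.
  rewrite big1_seq // => w /andP[/andP[/eqP h0 /eqP[hk _]]]; rewrite mem_words => /andP[/eqP hs _].
  case: (boolP (svalid p k d w)) => [|hv]; last exact: scoef_invalid.
  rewrite /svalid /sheight in h0 *; rewrite -/N in h0 *.
  set v := take _ w in h0 *; set u := drop _ w in h0 * => /and3P[h1 h2 h3].
  have := height_valid h1; have := height_valid h3; rewrite h0 !hz_nT => e1 e2.
  have := size_letters w; rewrite hs hk; have -> : w = v ++ u by rewrite cat_take_drop.
  by rewrite nT_cat nE_cat; move: hodd; rewrite /N; lia.
have -> : odd (p + m) by move: hodd; rewrite /N; lia.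
rewrite mulr1z mul1r [X in _ = - X]big_ltn // [X in _ = - (_ * X + _)]big_geq // mulr0 add0r -sumrN mulr_sumr.
rewrite [LHS]big_nat [RHS]big_nat; apply: eq_bigr => k /andP[k0 kN].
rewrite mulr_sumr -mulrN -sumrN mulr_sumr [LHS]big_nat [RHS]big_nat; apply: eq_bigr => d /andP[_ dk].
have hnd : (N - k + d <= p)%N by rewrite /N in kN *; lia.
transitivity (- ((-1) ^+ k * qbinom q N k) * \sum_(w <- words letters p | count (pred1 None) w == m)
   (if (sheight p k d w == 0%N) && (nE (take (N - k + d) w) == t) then scoef q y c p k d w else 0)); last first.
  rewrite mulrN mulNr; congr (- (_ * _)); rewrite [LHS]big_mkcond [RHS]big_mkcond; apply: eq_bigr => w _.
  rewrite xpair_eqE -/(nk w); case: (nk w == m); first by rewrite andTb.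
  by rewrite andbF.
rewrite big_merge; last exact: ltnW.
pose G l s := (-1) ^+ k.+1 * qbinom q N k *
  (q ^ kappa p k d (psum l 1 (N - k + d)) t l s / ((q - q^-1) ^+ (N - m)./2 * (y - y^-1)))
  * sigma_prod q p k d l s * sigma_sum q p k d t l s ^+ (T_ p k t l s != 0%N)
  * sigma_zero q p k d t l s ^+ (T_ p k t l s == 0%N).
transitivity (c ^+ (N - m)./2 * \sum_(l <- words bits p | count id l == m)
   \sum_(s <- words bits (p - m) | in_S' p m (psum l 1 (N - k + d)) k t d s) G l s).
  congr (_ * _).
  transitivity (\sum_(0 <= m' < m.+1) \sum_(l <- words bits p | in_L' p m m' k d l)
      \sum_(s <- words bits (p - m) | in_S' p m (psum l 1 (N - k + d)) k t d s) G l s).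
    apply: eq_bigr => m' _.
    rewrite (big_bool_words p (in_L' p m m' k d) (fun l => \sum_(s : (p - m).-tuple bool | in_S' p m m' k t d s)
      (-1) ^+ k.+1 * qbinom q N k *
      (q ^ kappa p k d m' t l s / ((q - q^-1) ^+ (N - m)./2 * (y - y^-1)))
      * sigma_prod q p k d l s * sigma_sum q p k d t l s ^+ (T_ p k t l s != 0%N)
      * sigma_zero q p k d t l s ^+ (T_ p k t l s == 0%N))).
    apply: eq_bigr => l /andP[_ /eqP <-].
    exact: (big_bool_words (p - m) (in_S' p m (psum l 1 (N - k + d)) k t d) (G l)).
  under eq_bigr => m' _ do rewrite big_mkcond.
  rewrite exchange_big [RHS]big_mkcond; apply: eq_big_seq => l; rewrite mem_words => /andP[/eqP hl _].
  rewrite /in_L' -/N; have -> : psum l 1 p = count id l by rewrite psum1 -hl take_size.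
  case: (eqVneq (count id l) m) => [hc|_] /=; last by rewrite big1.
  rewrite big_mkord (sum_pick m.+1 (psum l 1 (N - k + d)) (fun _ =>
     \sum_(s <- words bits (p - m) | in_S' p m (psum l 1 (N - k + d)) k t d s) G l s)).
  suff -> : (psum l 1 (N - k + d) < m.+1)%N by [].
  rewrite psum1 -hc ltnS -[in X in (_ <= X)%N](cat_take_drop (N - k + d) l) count_cat leq_addr //.
rewrite !mulr_sumr [LHS]big_seq_cond [RHS]big_seq_cond; apply: eq_bigr => l.
rewrite mem_words => /andP[/andP[/eqP hl _] /eqP hcl].
rewrite [in LHS]big_mkcond !mulr_sumr; apply: eq_big_seq => s; rewrite mem_words => /andP[/eqP hs _].
have kN' : (0 < k <= N)%N by rewrite k0.
rewrite (sigma_term y c hq t hm kN' dk hodd hl hcl hs) mulrCA; congr (_ * _).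
case: ifP => _; last by rewrite mulr0.
rewrite /G exprS -!mulrA mulN1r; move: (sigma_sum _ _ _ _ _ _ _ ^+ _) (sigma_zero _ _ _ _ _ _ _ ^+ _) => *.
by rewrite !mulrA !mulNr.
Qed.

End Coefficients.

(** * The expansion of the Serre polynomial in an abstract algebra *)

Section Expansion.
Context (F : fieldType) (q y c : F) (hq : not_root_of_unity q).
Context (U : algType F) (p : nat) (e f Fm Z W : U).
Context (rels : quasi_relations q y c p e f Fm Z W).
Let N := p.+1.
Let b := Fm + e.
Local Notation rm := (rmon e f Fm Z).
Local Notation sm := (smon e Fm Z W).

(** The word consisting of [None] only has weight 1 and gives b^(N-k) f b^k, from which the Serre
    polynomial of b is rebuilt. Every other valid word ending at height 0 has an up-step and a
    down-step, whence m + m' < p. *)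
Lemma sum_words_rho k : (k <= N)%N ->
  \sum_(v <- words letters (N - k)) \sum_(w <- words letters k | height (height 0 v) w == 0%N)
     (q ^+ p ^+ height 0 v * pweight q c 0 v * pweight q c (height 0 v) w) *:
       rm (nE v) (nk v) (nk w) (nE w) =
  b ^+ (N - k) * f * b ^+ k +
  \sum_(m < p) \sum_(m' < p - m) \sum_(t < ((N - m - m')./2).+1)
    (\sum_(w <- words letters N | (height 0 w == 0%N) && (rho_key p k w == (m : nat, m' : nat, t : nat)))
       rho_coef q c p k w) *: rm t m m' ((N - m - m')./2 - t)%N.
Proof.
move=> kN.
pose X w := rho_coef q c p k w *: rm (nE (take (N - k) w)) (nk (take (N - k) w)) (nk (drop (N - k) w)) (nE (drop (N - k) w)).
transitivity (\sum_(w <- words letters N | height 0 w == 0%N) X w).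
  have eN : words letters N = words letters (N - k + k) by rewrite subnK.
  rewrite [RHS]big_mkcond eN [RHS]big_words_cat; apply: eq_big_seq => v; rewrite mem_words => /andP[/eqP hv _].
  rewrite big_mkcond; apply: eq_bigr => w _; rewrite height_cat /X /rho_coef pweight_cat -/N -hv take_size_cat // drop_size_cat //.
  by rewrite mulrA.
pose n0 := nseq N (None : option bool).
have hn0 : n0 \in words letters N by rewrite mem_words size_nseq eqxx; apply/allP => x /nseqP[->].
have hX0 : X n0 = b ^+ (N - k) * f * b ^+ k.
  have hh n : height 0 (nseq n None) = 0%N by elim: n.
  have hp n : pweight q c 0 (nseq n None) = 1 by elim: n => //= n ->; rewrite expr0 mulr1.
  have hk n : nk (nseq n None) = n by rewrite /nk count_nseq mul1n.
  have hE n : nE (nseq n None) = 0%N by rewrite /nE count_nseq.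
  rewrite /X /rho_coef -/N /n0 take_nseq ?leq_subr // drop_nseq subKn // !hh !hp !hk !hE expr0 mulr1 scale1r.
  by rewrite /rmon !expr0 mul1r mulr1.
have e0 : height 0 n0 == 0%N by rewrite /n0; elim: N.
rewrite (big_rem n0) //; case: ifP => [_|]; last by rewrite e0.
rewrite hX0; congr (_ + _).
have huniq : uniq (words letters N) by apply: words_uniq.
pose Y w := \sum_(m < p) \sum_(m' < p - m) \sum_(t < ((N - m - m')./2).+1)
   (if rho_key p k w == (m : nat, m' : nat, t : nat) then rho_coef q c p k w *: rm t m m' ((N - m - m')./2 - t)%N else 0).
have hY w : Y w = if ((nk w < p) && (nE (take (N - k) w) <= (N - nk w)./2))%N then
    rho_coef q c p k w *: rm (nE (take (N - k) w)) (nk (take (N - k) w)) (nk (drop (N - k) w))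
      ((N - nk w)./2 - nE (take (N - k) w))%N else 0.
  have ew : nk w = (nk (take (N - k) w) + nk (drop (N - k) w))%N by rewrite -nk_cat cat_take_drop.
  rewrite /Y ew /rho_key -/N.
  set m0 := nk (take _ w); set m1 := nk (drop _ w); set t0 := nE (take _ w).
  transitivity (\sum_(m < p) (if m0 == m then (if (m1 < p - m)%N then (if (t0 < ((N - m - m1)./2).+1)%N
      then rho_coef q c p k w *: rm t0 m m1 ((N - m - m1)./2 - t0)%N else 0) else 0) else 0)).
    apply: eq_bigr => m _.
    rewrite -(sum_pick (p - m)%N m1 (fun m1 => if (t0 < ((N - m - m1)./2).+1)%N
      then rho_coef q c p k w *: rm t0 m m1 ((N - m - m1)./2 - t0)%N else 0)).
    case: (eqVneq m0 m) => hm; last first.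
      by rewrite big1 // => m' _; rewrite big1 // => t _; rewrite !xpair_eqE (negPf hm).
    apply: eq_bigr => m' _.
    rewrite -(sum_pick _ t0 (fun t => rho_coef q c p k w *: rm t m m' ((N - m - m')./2 - t)%N)).
    case: (eqVneq m1 m') => hm1; last first.
      by rewrite big1 // => t _; rewrite !xpair_eqE (negPf hm1) andbF.
    by apply: eq_bigr => t _; rewrite !xpair_eqE hm hm1 !eqxx.
  rewrite (sum_pick p m0 (fun m => if (m1 < p - m)%N then (if (t0 < ((N - m - m1)./2).+1)%N
      then rho_coef q c p k w *: rm t0 m m1 ((N - m - m1)./2 - t0)%N else 0) else 0)).
  rewrite ltnS subnDA; case: (ltnP m0 p) => h1; case: (ltnP m1 (p - m0)) => h2; case: (ltnP (m0 + m1) p) => h3 //; lia.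
transitivity (\sum_(w <- words letters N | height 0 w == 0%N) Y w); last first.
  rewrite exchange_big; apply: eq_bigr => m _; rewrite exchange_big; apply: eq_bigr => m' _.
  rewrite exchange_big; apply: eq_bigr => t _; rewrite scaler_suml [RHS]big_mkcondr /=.
  by apply: eq_bigr.
have hY0 : Y n0 = 0 by rewrite hY /nk count_nseq /= mul1n ltnNge leqnSn.
rewrite [RHS](big_rem n0) //; case: ifP => [_|]; last by rewrite e0.
rewrite hY0; apply: etrans (esym (add0r _)).
rewrite [LHS]big_seq_cond [RHS]big_seq_cond; apply: eq_bigr => w /andP[hw /eqP h0].
have [hwn hww] : w != n0 /\ w \in words letters N.
  by move: hw; rewrite (rem_filter _ huniq) mem_filter => /andP[].
rewrite hY /X; move: hww; rewrite mem_words => /andP[/eqP hs _].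
case: (boolP (valid 0 w)) => [hv|hv]; last first.
  have -> : rho_coef q c p k w = 0 by apply: rho_coef_invalid.
  by rewrite !scale0r; case: ifP.
have := height_valid hv; have hsl := size_letters w; rewrite h0 hz_nT => hhz.
have hE : (0 < nE w)%N.
  rewrite lt0n; apply: contraNneq hwn => E0; rewrite /n0 -hs; apply/eqP/all_pred1P.
  by rewrite all_count; apply/eqP; rewrite -[LHS]/(nk w) -hsl; lia.
have hEs : nE w = (nE (take (N - k) w) + nE (drop (N - k) w))%N by rewrite -nE_cat cat_take_drop.
have hsl' : (nk w + nT w + nE w = N)%N by rewrite hsl hs.
have e1 : ((N - nk w)./2 = nE w)%N.
  have -> : (N - nk w = 2 * nE w)%N by rewrite -hsl'; lia.
  by rewrite mul2n doubleK.
rewrite e1; have -> : (nk w < p)%N by rewrite /N in hsl'; lia.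
have -> : (nE (take (N - k) w) <= nE w)%N by rewrite hEs leq_addr.
by rewrite hEs addKn.
Qed.

Lemma sum_words_sigma k d : (0 < k <= N)%N -> (d < k)%N ->
  \sum_(v <- words letters (N - k)) \sum_(u <- words letters d)
   \sum_(w <- words letters (k - d.+1) | height (height (height 0 v) u).-1 w == 0%N)
     (pweight q c 0 v * sweight q y c p (height 0 v) 0 u * pweight q c (height (height 0 v) u).-1 w
        * (q ^+ p) ^- (nk v + nk u)) *:
       sm (nE v + nE u) (nE w) (nk v + nk u + nk w) =
  \sum_(m < p) \sum_(t < ((p.-1 - m)./2).+1)
    (\sum_(w <- words letters p | (sheight p k d w == 0%N) && ((nk w, nE (take (N - k + d) w)) == (m : nat, t : nat)))
       scoef q y c p k d w) *: sm t ((p.-1 - m)./2 - t)%N m.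
Proof.
move=> /andP[k0 kN] dk.
pose X w := scoef q y c p k d w *: sm (nE (take (N - k + d) w)) (nE (drop (N - k + d) w)) (nk w).
transitivity (\sum_(w <- words letters p | sheight p k d w == 0%N) X w).
  have ep : p = (N - k + (d + (k - d.+1)))%N by rewrite /N in kN *; lia.
  have eN : words letters p = words letters (N - k + (d + (k - d.+1))) by rewrite -ep.
  rewrite [RHS]big_mkcond eN [RHS]big_words_cat; apply: eq_big_seq => v; rewrite mem_words => /andP[/eqP hv _].
  rewrite [RHS]big_words_cat; apply: eq_big_seq => u; rewrite mem_words => /andP[/eqP hu _].
  rewrite big_mkcond; apply: eq_bigr => w _; rewrite /X /scoef /sheight -/N.
  have e1 : take (N - k) (v ++ u ++ w) = v by rewrite -hv take_size_cat.
  have e2 : drop (N - k) (v ++ u ++ w) = u ++ w by rewrite -hv drop_size_cat.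
  have e3 : take (N - k + d) (v ++ u ++ w) = v ++ u by rewrite catA -hv -hu -size_cat take_size_cat.
  have e4 : drop (N - k + d) (v ++ u ++ w) = w by rewrite catA -hv -hu -size_cat drop_size_cat.
  rewrite e1 e2 e3 e4 -{1}hu take_size_cat // height_cat nE_cat !nk_cat addnA.
  by rewrite -hu take_size_cat.
pose Y w := \sum_(m < p) \sum_(t < ((p.-1 - m)./2).+1)
   (if (nk w, nE (take (N - k + d) w)) == (m : nat, t : nat) then scoef q y c p k d w *: sm t ((p.-1 - m)./2 - t)%N m else 0).
transitivity (\sum_(w <- words letters p | sheight p k d w == 0%N) Y w); last first.
  rewrite exchange_big; apply: eq_bigr => m _; rewrite exchange_big; apply: eq_bigr => t _.
  by rewrite scaler_suml [RHS]big_mkcondr.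
rewrite [LHS]big_seq_cond [RHS]big_seq_cond; apply: eq_bigr => w /andP[]; rewrite mem_words => /andP[/eqP hs _] /eqP h0.
have -> : Y w = if (nk w < p)%N then (if (nE (take (N - k + d) w) < ((p.-1 - nk w)./2).+1)%N then
    scoef q y c p k d w *: sm (nE (take (N - k + d) w)) ((p.-1 - nk w)./2 - nE (take (N - k + d) w))%N (nk w) else 0) else 0.
  rewrite -(sum_pick p (nk w) (fun m => if (nE (take (N - k + d) w) < ((p.-1 - m)./2).+1)%N then
    scoef q y c p k d w *: sm (nE (take (N - k + d) w)) ((p.-1 - m)./2 - nE (take (N - k + d) w))%N m else 0)).
  apply: eq_bigr => m _; case: (eqVneq (nk w) m) => hm; last first.
    by rewrite big1 // => t _; rewrite xpair_eqE (negPf hm).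
  rewrite -(sum_pick _ (nE (take (N - k + d) w)) (fun t => scoef q y c p k d w *: sm t ((p.-1 - m)./2 - t)%N m)).
  by apply: eq_bigr => t _; rewrite xpair_eqE hm eqxx.
rewrite /X; case: (boolP (svalid p k d w)) => [|hv]; last first.
  have -> : scoef q y c p k d w = 0 by apply: scoef_invalid.
  by rewrite !scale0r; do 2?case: ifP.
rewrite /svalid /sheight in h0 *; rewrite -/N in h0 *.
set v := take _ w in h0 *; set u := drop _ w in h0 * => /and3P[h1 h2 h3].
have := height_valid h1; have := height_valid h3; rewrite h0 !hz_nT => e1 e2.
have := size_letters w; have ew : w = v ++ u by rewrite cat_take_drop.
have hnE : nE w = (nE v + nE u)%N by rewrite ew nE_cat.
have hnT : nT w = (nT v + nT u)%N by rewrite ew nT_cat.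
rewrite hs => hsl.
have e3 : ((p.-1 - nk w)./2 = nE w)%N.
  have -> : (p.-1 - nk w = 2 * nE w)%N by lia.
  by rewrite mul2n doubleK.
rewrite e3; have -> : (nk w < p)%N by lia.
by rewrite hnE ltnS leq_addr addKn.
Qed.

Lemma serre_expansion :
  serre q N b f =
    \sum_(m < p) \sum_(m' < p - m) \sum_(t < ((N - m - m')./2).+1)
      rho q c p m m' t *: (Z ^+ t * b ^+ m * f * b ^+ m' * Z ^+ ((N - m - m')./2 - t))
    + \sum_(m < p) \sum_(t < ((p.-1 - m)./2).+1)
        sigma q y c p m t *: (Z ^+ t * W * Z ^+ ((p.-1 - m)./2 - t) * b ^+ m).
Proof.
pose R k := \sum_(m < p) \sum_(m' < p - m) \sum_(t < ((N - m - m')./2).+1)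
    (\sum_(w <- words letters N | (height 0 w == 0%N) && (rho_key p k w == (m : nat, m' : nat, t : nat)))
       rho_coef q c p k w) *: rm t m m' ((N - m - m')./2 - t)%N.
pose S k := \sum_(d < k) \sum_(m < p) \sum_(t < ((p.-1 - m)./2).+1)
    (\sum_(w <- words letters p | (sheight p k d w == 0%N) && ((nk w, nE (take (N - k + d) w)) == (m : nat, t : nat)))
       scoef q y c p k d w) *: sm t ((p.-1 - m)./2 - t)%N m.
have := alternating_eval hq rels.
have key k : (k < N.+1)%N -> eval q y c p e f Fm Z W (nseq (N - k) true ++ false :: nseq k true) (Before 0) =
    b ^+ (N - k) * f * b ^+ k + R k + S k.
  move=> kN; rewrite (eval_expand hq rels) sum_words_rho // -/(R k); congr (_ + _).
  apply: eq_bigr => d _; have dk := ltn_ord d; apply: sum_words_sigma => //.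
  by apply/andP; split; [apply: leq_ltn_trans dk|].
have -> : \sum_(0 <= k < N.+1) ((-1) ^+ k * qbinom q N k) *:
    eval q y c p e f Fm Z W (nseq (N - k) true ++ false :: nseq k true) (Before 0) =
    serre q N b f + \sum_(0 <= k < N.+1) ((-1) ^+ k * qbinom q N k) *: R k
     + \sum_(0 <= k < N.+1) ((-1) ^+ k * qbinom q N k) *: S k.
  rewrite /serre -!big_split /= [LHS]big_nat [RHS]big_nat; apply: eq_bigr => k /andP[_ hk].
  by rewrite key // !scalerDr.
have -> : \sum_(0 <= k < N.+1) ((-1) ^+ k * qbinom q N k) *: R k =
   - \sum_(m < p) \sum_(m' < p - m) \sum_(t < ((N - m - m')./2).+1)
      rho q c p m m' t *: rm t m m' ((N - m - m')./2 - t)%N.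
  under eq_bigr => k _ do rewrite /R scaler_sumr.
  rewrite exchange_big -sumrN; apply: eq_bigr => m _.
  under eq_bigr => k _ do rewrite scaler_sumr.
  rewrite exchange_big -sumrN; apply: eq_bigr => m' _.
  under eq_bigr => k _ do rewrite scaler_sumr.
  rewrite exchange_big -sumrN; apply: eq_bigr => t _.
  rewrite rho_words // scaleNr opprK scaler_suml; apply: eq_bigr => k _.
  by rewrite scalerA.
have -> : \sum_(0 <= k < N.+1) ((-1) ^+ k * qbinom q N k) *: S k =
   - \sum_(m < p) \sum_(t < ((p.-1 - m)./2).+1) sigma q y c p m t *: sm t ((p.-1 - m)./2 - t)%N m.
  transitivity (\sum_(0 <= k < N.+1) \sum_(m < p) \sum_(t < ((p.-1 - m)./2).+1)
    (((-1) ^+ k * qbinom q N k) * \sum_(0 <= d < k) \sum_(w <- words letters p |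
        (sheight p k d w == 0%N) && ((nk w, nE (take (N - k + d) w)) == (m : nat, t : nat)))
      scoef q y c p k d w) *: sm t ((p.-1 - m)./2 - t)%N m).
    apply: eq_bigr => k _; rewrite /S exchange_big scaler_sumr; apply: eq_bigr => m _.
    rewrite exchange_big scaler_sumr; apply: eq_bigr => t _.
    by rewrite big_mkord -scaler_suml scalerA.
  rewrite exchange_big -sumrN; apply: eq_bigr => m _.
  rewrite exchange_big -sumrN; apply: eq_bigr => t _.
  by rewrite sigma_words // scaleNr opprK scaler_suml.
by rewrite -addrA -opprD => /eqP; rewrite subr_eq0 => /eqP.
Qed.

(** Has the elements of the theorem as variables, so that it applies to the quantum group without
    rewriting inside the quotient. *)
Lemma serre_expansion_eq (bi bj k : U) (W0 : U) : bi = Fm + e -> bj = f -> W = W0 * k ->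
  serre q N bi bj =
    \sum_(m < p) \sum_(m' < p - m) \sum_(t < ((N - m - m')./2).+1)
      rho q c p m m' t *: (Z ^+ t * bi ^+ m * bj * bi ^+ m' * Z ^+ ((N - m - m')./2 - t))
    + \sum_(m < p) \sum_(t < ((p.-1 - m)./2).+1)
        sigma q y c p m t *: (Z ^+ t * W0 * k * Z ^+ ((p.-1 - m)./2 - t) * bi ^+ m).
Proof.
move=> -> -> eW; rewrite serre_expansion; congr (_ + _).
by apply: eq_bigr => m _; apply: eq_bigr => t _; rewrite eW (mulrA (Z ^+ t) W0 k).
Qed.

End Expansion.

(** * Quantum sl2-triples *)

Section Twists.
Context (F : fieldType) (U : algType F).
Implicit Types (X Y k : U) (cs : seq F).

Lemma qops_twistR X Y k th cs : k * X = th *: (X * k) ->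
  qops X cs (Y * k) = qops X [seq c * th | c <- cs] Y * k.
Proof.
move=> h; elim: cs => //= c cs ->; rewrite /qop mulrBl -scalerAl -!mulrA h.
by rewrite -!scalerAr scalerA.
Qed.

(** Multiplying X by an element that q-commutes with X and Y rescales the constants and leaves a
    power of that element on the right. *)
Lemma qops_twistL X Y k th et cs : et != 0 ->
  k * X = th *: (X * k) -> k * Y = et *: (Y * k) ->
  exists a, qops (X * k) cs Y = a *: (qops X [seq c / et | c <- cs] Y * k ^+ size cs).
Proof.
move=> et0 hX hY.
suff [a ha hk] : exists2 a, qops (X * k) cs Y =
    a *: (qops X [seq c / et | c <- cs] Y * k ^+ size cs) &
    k * qops X [seq c / et | c <- cs] Y =
      (et * th ^+ size cs) *: (qops X [seq c / et | c <- cs] Y * k).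
  by exists a.
have hkX t : k ^+ t * X = th ^+ t *: (X * k ^+ t).
  elim: t => [|t IH]; first by rewrite !expr0 scale1r mul1r mulr1.
  by rewrite exprS -mulrA IH -scalerAr (mulrA k) hX -scalerAl scalerA -mulrA exprSr.
elim: cs => [|c cs [a ha hk]] /=.
  by exists 1; rewrite ?scale1r ?expr0 !mulr1.
set y := qops X _ Y in ha hk *; exists (a * et * th ^+ size cs).
  rewrite ha /qop; set t := size cs in hk *.
  have e1 : X * k * (y * k ^+ t) = (et * th ^+ t) *: (X * y * k ^+ t.+1).
    by rewrite -!mulrA (mulrA k) hk -scalerAl -scalerAr -!mulrA -exprS.
  have e2 : y * k ^+ t * (X * k) = th ^+ t *: (y * X * k ^+ t.+1).
    by rewrite -!mulrA (mulrA (k ^+ t)) hkX -scalerAl -scalerAr -!mulrA -exprSr.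
  rewrite -scalerAr -scalerAl e1 e2; set M := k ^+ t.+1; nc; try ring.
  by field.
set w := et * th ^+ size cs in hk.
apply: (eq_certificate (z := (k * X - th *: (X * k)) * y + th *: (X * (k * y - w *: (y * k)))
  - (c / et) *: ((k * y - w *: (y * k)) * X) - (c / et * w) *: (y * (k * X - th *: (X * k))))).
  by rewrite hX hk !subrr !(mulr0, mul0r, scaler0, subr0, addr0).
by rewrite /qop exprS; nc; rewrite /w; ring.
Qed.

Definition qnil X Y := exists cs, qops X cs Y = 0.

Lemma qnilD X Y Y' : qnil X Y -> qnil X Y' -> qnil X (Y + Y').
Proof.
move=> [cs h] [cs' h']; exists (cs ++ cs'); rewrite qopsD !qops_cat h' qops0 addr0.
by rewrite qops_comm h qops0.
Qed.

Lemma qnilZ X a Y : qnil X Y -> qnil X (a *: Y).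
Proof. by move=> [cs h]; exists cs; rewrite qopsZ h scaler0. Qed.

(** The q-Leibniz rule qop (c d) (Y Y') = (qop c Y) Y' + c Y (qop d Y') shortens one of the two
    lists in each summand; the induction is on the sum of their lengths. *)
Lemma qnilM X Y Y' : qnil X Y -> qnil X Y' -> qnil X (Y * Y').
Proof.
move=> [cs h] [cs' h'].
elim: {cs cs'}(size cs + size cs')%N {-2}cs {-2}cs' (leqnn (size cs + size cs'))
  Y Y' h h' => [|m IH] [|c cs] [|d ds] hm Y Y' //= h h'; try by exists [::]; rewrite /= ?h ?h' ?mul0r ?mulr0.
have := IH cs (d :: ds) _ (qop X c Y) Y' _ h'; case.
- by move: hm; rewrite /= addSn ltnS.
- by rewrite qops_qop.
move=> es1 h1; have := IH (c :: cs) ds _ Y (qop X d Y') h _; case.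
- by move: hm; rewrite /= addnS ltnS.
- by rewrite qops_qop.
move=> es2 h2; exists (c * d :: es1 ++ es2); rewrite /= -qops_qop.
have -> : qop X (c * d) (Y * Y') = qop X c Y * Y' + c *: (Y * qop X d Y').
  by rewrite /qop; nc; ring.
rewrite qopsD qopsZ !qops_cat h2 qops0 scaler0 addr0.
by rewrite qops_comm h1 qops0.
Qed.

(** An Ore condition: a high power of X passes Y up to a left factor. Each q-commutator that is
    undone costs r more powers. *)
Lemma qnil_left X Y r : qnil X Y -> exists m u, X ^+ m * Y = u * X ^+ r.
Proof.
move=> [cs]; elim: cs Y => [|c cs IH] Y /=.
  by move=> ->; exists 0%N, 0; rewrite mulr0 mul0r.
rewrite -qops_qop => /IH [m [u hu]].
suff [v hv] : exists v, X ^+ (r + m) * Y = v * X ^+ r by exists (r + m)%N, v.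
elim: {-2}r (leqnn r) => [|s IHs] hs; first by exists (X ^+ m * Y); rewrite mulr1.
have [v hv] := IHs (ltnW hs); exists (X ^+ s * u * X ^+ (r - s.+1) + c *: v).
rewrite mulrDl -scalerAl [X ^+ s.+1 in RHS]exprSr (mulrA v) -hv -exprSr.
rewrite -[X in X + _]mulrA -exprD subnK // -mulrA -hu /qop.
have -> : (s.+1 + m = s + m.+1)%N by lia.
have -> : X ^+ (s + m.+1) = X ^+ s * X ^+ m * X by rewrite exprD exprSr mulrA.
by rewrite exprD; nc; ring.
Qed.

End Twists.

Section Triple.
Context (F : fieldType) (q : F) (hq : not_root_of_unity q) (U : algType F).
Context (E Fm K K' : U).
Context (hKK' : K * K' = 1) (hK'K : K' * K = 1).
Context (hKE : K * E = q ^+ 2 *: (E * K)).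
Context (hEF : E * Fm - Fm * E = (q - q^-1)^-1 *: (K - K')).

Let q0 := q_neq0 hq.
Let d0 := q_sub_inv_neq0 hq.
Let qq1 : q * q - 1 != 0.
Proof.
apply: contra_neq d0 => h; have -> : q - q^-1 = (q * q - 1) / q by field.
by rewrite h mul0r.
Qed.
Let q20 : q ^+ 2 != 0. Proof. by rewrite expf_neq0. Qed.

Lemma triple_inv (w : F) Y : w != 0 -> K * Y = w *: (Y * K) -> K' * Y = w^-1 *: (Y * K').
Proof.
move=> w0 h; have : K' * (K * Y) * K' = w *: (K' * (Y * K) * K') by rewrite h -scalerAr -scalerAl.
rewrite !mulrA hK'K mul1r -!mulrA hKK' mulr1 => ->.
by rewrite scalerA mulVf // scale1r.
Qed.

(** Inductive step of [chain_F]. That Y is a q-commutator of Yp is required only for c != 0, so that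
    the bottom of the chain is included. *)
Lemma triple_step (w c : F) Y Yp : w != 0 ->
    K * Y = w *: (Y * K) -> Fm * Y - Y * Fm = c *: (Yp * K') ->
    (c != 0 -> qop E (w * q ^- 2) Yp = Y) ->
  Fm * qop E w Y - qop E w Y * Fm = (c + (w^-1 - w) / (q - q^-1)) *: (Y * K').
Proof.
move=> w0 hK hF hc; have hK' := triple_inv w0 hK.
have hK'E := triple_inv q20 hKE.
set Z := qop _ _ _ in hc; have hcZ : c *: (Z - Y) = 0.
  by case: (eqVneq c 0) => [->|/hc ->]; rewrite ?scale0r // subrr scaler0.
set d := (q - q^-1)^-1.
apply: (eq_certificate (z :=
  - ((E * Fm - Fm * E - d *: (K - K')) * Y)
  + w *: (Y * (E * Fm - Fm * E - d *: (K - K')))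
  - d *: (K * Y - w *: (Y * K)) + d *: (K' * Y - w^-1 *: (Y * K'))
  + E * (Fm * Y - Y * Fm - c *: (Yp * K'))
  - w *: ((Fm * Y - Y * Fm - c *: (Yp * K')) * E)
  - (w * c) *: (Yp * (K' * E - q ^- 2 *: (E * K')))
  + c *: (Z - Y) * K')).
  by rewrite hEF hK hK' hF hK'E hcZ !subrr !(mulr0, mul0r, scaler0, subr0, addr0, oppr0).
rewrite /Z /qop; nc; try ring; by field; rewrite ?w0 ?q0.
Qed.

Lemma triple_K (w : F) Y n : w != 0 -> K * Y = w *: (Y * K) ->
  K * qops E (qgeom q w n) Y = (w * q ^+ (2 * n)) *: (qops E (qgeom q w n) Y * K).
Proof.
move=> w0 h; elim: n => [|n IH]; first by rewrite /= mulr1.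
rewrite qgeomS qops_rcons; set y := qops _ _ _ in IH *.
set v := w * _ in IH *; have -> : q ^+ (2 * n.+1) = q ^+ (2 * n) * q ^+ 2.
  by rewrite -exprD; congr (_ ^+ _); lia.
apply: (eq_certificate (z := (K * E - q ^+ 2 *: (E * K)) * y + q ^+ 2 *: (E * (K * y - v *: (y * K)))
  - v *: ((K * y - v *: (y * K)) * E) - (v * v) *: (y * (K * E - q ^+ 2 *: (E * K))))).
  by rewrite hKE IH !subrr !(mulr0, mul0r, scaler0, subr0, addr0).
by rewrite /qop; nc; rewrite /v; ring.
Qed.

Section Chain.
Context (p : nat) (Y0 : U).
Context (hF0 : Fm * Y0 = Y0 * Fm) (hK0 : K * Y0 = q ^- p *: (Y0 * K)).

Definition chain s := qops E (qgeom q (q ^- p) s) Y0.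

(** The usual computation on an sl2-string of lowest weight -p: lowering multiplies the s-th vector
    by [s][p+1-s]. *)
Lemma chain_F s : Fm * chain s - chain s * Fm =
  (qint q s%:Z * qint q (p.+1%:Z - s%:Z)) *: (chain s.-1 * K').
Proof.
have hP : q ^- p != 0 by rewrite invr_eq0 expf_neq0.
elim: s => [|s IH].
  by rewrite /chain /= hF0 subrr /qint subrr mul0r mul0r scale0r.
have hw : q ^- p * q ^+ (2 * s) != 0 by rewrite mulf_neq0 // expf_neq0.
rewrite {1 2}/chain qgeomS qops_rcons -/(chain s).
rewrite (triple_step hw (triple_K s hP hK0) IH); last first.
  case: s IH hw => [|s] IH hw; first by rewrite /qint subrr !mul0r eqxx.
  move=> _; rewrite qgeomS qops_rcons; congr (qop _ _ _).
  have -> : q ^+ (2 * s.+1) = q ^+ 2 * q ^+ (2 * s) by rewrite -exprD; congr (_ ^+ _); lia.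
  by field; rewrite q0 expf_neq0.
congr (_ *: _); rewrite /qint.
have e1 : q ^ s.+1%:Z = q * q ^+ s by rewrite -exprnP exprS.
have e2 : q ^ (p.+1%:Z - s.+1%:Z) = q ^+ p / q ^+ s.
  by rewrite exprnN exprnP -expfzDr //; congr (_ ^ _); lia.
have e3 : q ^ (p.+1%:Z - s%:Z) = q * q ^+ p / q ^+ s.
  by rewrite -exprS exprnN exprnP -expfzDr //; congr (_ ^ _); lia.
rewrite -!invr_expz e1 e2 e3 -exprnP [(2 * s)%N]mulnC exprM.
have := @expf_neq0 _ q s q0; have := @expf_neq0 _ q p q0.
move: (q ^+ s) (q ^+ p) => x z hz hx.
by field; rewrite ?qq1 ?q0 ?hx ?hz.
Qed.

End Chain.

(* The vanishing coefficient of [chain_F] at the end of the chain. *)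
Lemma serre_commutes p Y0 : Fm * Y0 = Y0 * Fm -> K * Y0 = q ^- p *: (Y0 * K) ->
  Fm * serre q p.+1 E Y0 = serre q p.+1 E Y0 * Fm.
Proof.
move=> hF0 hK0; apply/eqP; rewrite -subr_eq0 serreE //.
have -> : q ^ (1 - p.+1%:Z) = q ^- p by rewrite exprnN; congr (_ ^ _); lia.
by rewrite -/(chain p Y0 p.+1) (chain_F hF0 hK0) /qint subrr oppr0 subrr mul0r mulr0 scale0r.
Qed.

(** For 1 <= s <= p the coefficient in [chain_F] is nonzero, so the chain can be descended within
    any [P] that is closed under the operations and contains F and K. *)
Lemma chain_bottom (P : U -> Prop) p Y0 :
    Fm * Y0 = Y0 * Fm -> K * Y0 = q ^- p *: (Y0 * K) ->
    (forall c u, P u -> P (c *: u)) -> (forall u v, P u -> P v -> P (u + v)) ->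
    (forall u v, P u -> P v -> P (u * v)) -> P Fm -> P K ->
  P (qops E (qgeom q (q ^- p) p) Y0) -> P Y0.
Proof.
move=> hF0 hK0 PZ PD PM PF PK.
suff h s : (s <= p)%N -> P (chain p Y0 s) -> P Y0 by apply: h.
elim: s => [|s IH] hs // hP; apply: IH; first exact: ltnW.
have hc : qint q s.+1%:Z * qint q (p.+1%:Z - s.+1%:Z) != 0.
  by rewrite mulf_neq0 // qint_neq0 //; lia.
have := chain_F hF0 hK0 s.+1; set c := _ * _ in hc * => hF.
have -> : chain p Y0 s = c^-1 *: ((Fm * chain p Y0 s.+1 - chain p Y0 s.+1 * Fm) * K).
  by rewrite hF -scalerAl -mulrA hK'K mulr1 scalerA mulVf // scale1r.
apply: (PZ); apply: (PM) => //; rewrite -scaleN1r; apply: PD; first exact: (PM).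
by apply: (PZ); apply: (PM).
Qed.

(** * Vectors of positive weight commuting with F *)

Section HighestWeight.
Context (half : U -> Prop).
Context (half0 : half 0) (halfD : forall u v, half u -> half v -> half (u + v)).
Context (halfZ : forall c u, half u -> half (c *: u)).
Context (halfEl : forall u, half u -> half (E * u)) (halfEr : forall u, half u -> half (u * E)).
Context (half_sep : forall u v, half u -> half v -> u * K + v * K' = 0 -> u = 0 /\ v = 0).
Context (w : nat) (w0 : (0 < w)%N) (S : U) (hS : half S).
Context (hFS : Fm * S = S * Fm) (hKS : K * S = q ^+ w *: (S * K)).

Let mon m a := E ^+ a * S * E ^+ (m - a).

Lemma half_mon m a : half (mon m a).
Proof.
rewrite /mon; elim: (m - a)%N => [|b IH]; last by rewrite exprSr mulrA; apply: halfEr.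
by rewrite mulr1; elim: a => [|a IH]; rewrite ?mul1r // exprS -mulrA; apply: halfEl.
Qed.

Let KE n : K * E ^+ n = q ^+ (2 * n) *: (E ^+ n * K).
Proof.
elim: n => [|n IH]; first by rewrite scale1r mul1r mulr1.
rewrite exprS (mulrA K) hKE -scalerAl -(mulrA E K) IH -scalerAr scalerA (mulrA E) mulnS exprD.
by [].
Qed.

Let FE n : Fm * E ^+ n.+1 = E ^+ n.+1 * Fm - (qint q n.+1%:Z / (q - q^-1)) *:
  (q ^ n%:Z *: (E ^+ n * K) - q ^ (- n%:Z) *: (E ^+ n * K')).
Proof.
have FEm : Fm * E = E * Fm - (q - q^-1)^-1 *: (K - K') by rewrite -hEF opprB addrC subrK.
elim: n => [|n IH].
  by rewrite !expr1 !mul1r expr0z !scale1r /qint expr1z mulfV // mul1r.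
rewrite exprSr mulrA IH; set En := E ^+ n.+1 in IH *.
have hK'E := triple_inv q20 hKE.
rewrite mulrBl -scalerAl mulrBl -!scalerAl -!mulrA FEm hKE hK'E.
have -> : E ^+ n * (q ^+ 2 *: (E * K)) = q ^+ 2 *: (En * K).
  by rewrite -scalerAr mulrA -exprSr.
have -> : E ^+ n * (q ^- 2 *: (E * K')) = q ^- 2 *: (En * K').
  by rewrite -scalerAr mulrA -exprSr.
rewrite -[in RHS](invr_expz) -[in LHS]invr_expz /qint -!invr_expz -!exprnP !exprS.
by nc; try ring; field; rewrite ?qq1 ?q0 ?expf_neq0.
Qed.

Let commFK m a (c := q ^+ (w + 2 * (m - a))) :
  Fm * mon m a - mon m a * Fm = - (q - q^-1)^-1 *:
   ((qint q a%:Z * q ^ (a.-1%:Z) * c) *: (mon m.-1 a.-1 * K)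
    - (qint q a%:Z * q ^ (- a.-1%:Z) / c) *: (mon m.-1 a.-1 * K')
    + (qint q (m - a)%:Z * q ^ ((m - a).-1%:Z)) *: (mon m.-1 a * K)
    - (qint q (m - a)%:Z * q ^ (- (m - a).-1%:Z)) *: (mon m.-1 a * K')).
Proof.
have FEa n : Fm * E ^+ n = E ^+ n * Fm - (qint q n%:Z / (q - q^-1)) *:
    (q ^ n.-1%:Z *: (E ^+ n.-1 * K) - q ^ (- n.-1%:Z) *: (E ^+ n.-1 * K')).
  case: n => [|n]; last exact: FE.
  by rewrite /qint subrr !mul0r scale0r subr0 mul1r mulr1.
set b := (m - a)%N in c *; have c0 : c != 0 by rewrite expf_neq0.
have hc : K * (S * E ^+ b) = c *: (S * E ^+ b * K).
  by rewrite (mulrA K) hKS -scalerAl -(mulrA S K) KE -scalerAr scalerA -exprD mulrA.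
have hc' := triple_inv c0 hc.
have h1 : (qint q a%:Z) *: (mon m.-1 a.-1) = qint q a%:Z *: (E ^+ a.-1 * S * E ^+ b).
  case: (posnP a) => [->|ha]; first by rewrite /qint subrr mul0r !scale0r.
  by rewrite /mon (_ : m.-1 - a.-1 = b)%N //; rewrite /b; lia.
have h1' s Z : (qint q a%:Z * s) *: (mon m.-1 a.-1 * Z) =
    (qint q a%:Z * s) *: (E ^+ a.-1 * S * E ^+ b * Z).
  have -> : qint q a%:Z * s = s * qint q a%:Z by ring.
  by rewrite -[LHS]scalerA -[RHS]scalerA; congr (s *: _); rewrite [LHS]scalerAl h1 -scalerAl.
have h2 : mon m.-1 a = E ^+ a * S * E ^+ b.-1 by rewrite /mon (_ : m.-1 - a = b.-1)%N //; rewrite /b; lia.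
rewrite h2; have ha := FEa a; have hb := FEa b.
rewrite -![qint q a%:Z * _ * _]mulrA !h1'.
rewrite /mon -/b; move/eqP: ha; rewrite -subr_eq0 => /eqP ha.
move/eqP: hb; rewrite -subr_eq0 => /eqP hb.
set za := _ - _ in ha; set zb := _ - _ in hb.
set d := (q - q^-1)^-1 in za zb ha hb *.
apply: (eq_certificate (z := za * S * E ^+ b + E ^+ a * (Fm * S - S * Fm) * E ^+ b
   + E ^+ a * S * zb
   - (qint q a%:Z * q ^ a.-1%:Z * d) *: (E ^+ a.-1 * (K * (S * E ^+ b) - c *: (S * E ^+ b * K)))
   + (qint q a%:Z * q ^ (- a.-1%:Z) * d) *:
      (E ^+ a.-1 * (K' * (S * E ^+ b) - c^-1 *: (S * E ^+ b * K'))))).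
  by rewrite ha hb hFS hc hc' !subrr !(mulr0, mul0r, scaler0, subr0, addr0).
by rewrite /za /zb; nc; ring.
Qed.

(** Commuting a relation with F and separating its K-part from its K'-part gives two relations of
    degree one less. Eliminating c (a+1) between their coefficients leaves c a times a nonzero
    multiple of q^(2(m+w)) - 1, which is nonzero because w > 0. *)
Lemma highest_independent m (c : nat -> F) : S != 0 ->
  \sum_(a < m.+1) c a *: mon m a = 0 -> forall a, (a <= m)%N -> c a = 0.
Proof.
move=> S0; elim: m c => [|m IH] c h.
  move=> a; rewrite leqn0 => /eqP ->; move: h; rewrite big_ord1 /mon mul1r mulr1.
  by move/eqP; rewrite scaler_eq0 (negPf S0) orbF => /eqP.
pose cp a := c a.+1 * (qint q a.+1%:Z * q ^ a%:Z * q ^+ (w + 2 * (m - a)))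
  + c a * (qint q (m.+1 - a)%:Z * q ^ (m - a)%N%:Z).
pose cm a := c a.+1 * (qint q a.+1%:Z * q ^ (- a%:Z) / q ^+ (w + 2 * (m - a)))
  + c a * (qint q (m.+1 - a)%:Z * q ^ (- (m - a)%N%:Z)).
have hsep : (\sum_(a < m.+1) cp a *: mon m a) * K + (- \sum_(a < m.+1) cm a *: mon m a) * K' = 0.
  have h2 : \sum_(a < m.+2) c a *: (Fm * mon m.+1 a - mon m.+1 a * Fm) = 0.
    transitivity (Fm * (\sum_(a < m.+2) c a *: mon m.+1 a) - (\sum_(a < m.+2) c a *: mon m.+1 a) * Fm).
      rewrite mulr_sumr mulr_suml -sumrB; apply: eq_bigr => a _.
      by rewrite -scalerAr -scalerAl scalerBr.
    by rewrite h mulr0 mul0r subrr.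
  have : \sum_(a < m.+2) (
     ((c a * (qint q a%:Z * q ^ (a.-1%:Z) * q ^+ (w + 2 * (m.+1 - a)))) *: (mon m a.-1 * K)
     - (c a * (qint q a%:Z * q ^ (- a.-1%:Z) / q ^+ (w + 2 * (m.+1 - a)))) *: (mon m a.-1 * K'))
     + ((c a * (qint q (m.+1 - a)%:Z * q ^ ((m.+1 - a).-1%:Z))) *: (mon m a * K)
     - (c a * (qint q (m.+1 - a)%:Z * q ^ (- (m.+1 - a).-1%:Z))) *: (mon m a * K'))) = 0.
    apply: (scalerI (a := - (q - q^-1)^-1)); first by rewrite oppr_eq0 invr_eq0.
    rewrite scaler0 -[RHS]h2 scaler_sumr; apply: eq_bigr => a _; rewrite commFK.
    set x1 := mon _ _ * K; set x2 := mon _ _ * K'; set x3 := mon m.+1.-1 a * K.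
    set x4 := mon m.+1.-1 a * K'; rewrite /= -/x1 -/x2 -/x3 -/x4.
    by rewrite !scalerDr !scalerN !scalerA; nc; ring.
  rewrite big_split /= big_ord_recl [X in _ + X]big_ord_recr /=.
  have q00 : qint q 0 = 0 by rewrite /qint subrr mul0r.
  rewrite subnn !q00 !(mul0r, mulr0, scale0r, subr0, oppr0, add0r, addr0).
  move=> h3; rewrite -[RHS]h3 mulr_suml mulNr mulr_suml -sumrB -big_split /=.
  apply: eq_bigr => a _; rewrite /cp /cm -!scalerAl.
  have ha : (a <= m)%N by have := ltn_ord a.
  rewrite /bump /= add1n add0n subSS; have -> : ((m.+1 - a).-1 = m - a)%N by lia.
  set x1 := mon m a * K; set x2 := mon m a * K'.
  by nc; ring.
have half_sum (g : nat -> F) : half (\sum_(a < m.+1) g a *: mon m a).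
  by apply: (big_ind half) => // a _; apply/halfZ/half_mon.
have half_opp u : half u -> half (- u) by move=> hu; rewrite -scaleN1r; apply: halfZ.
have [h1 /eqP] := half_sep (half_sum cp) (half_opp _ (half_sum cm)) hsep.
rewrite oppr_eq0 => /eqP h2; have {h1} h1 := IH _ h1; have {h2} h2 := IH _ h2.
have hc a : (a <= m)%N -> c a = 0 /\ c a.+1 = 0.
  move=> ha; have := h1 a ha; have := h2 a ha; rewrite /cp /cm.
  have hm : (m + w)%:Z != 0 by lia.
  have hqa : qint q a.+1%:Z != 0 by apply: qint_neq0.
  have hqb : qint q (m.+1 - a)%N%:Z != 0 by apply: qint_neq0 => //; lia.
  have e1 : q ^ (m - a)%N%:Z = q ^+ m / q ^+ a.
    by rewrite exprnN exprnP -expfzDr //; congr (_ ^ _); lia.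
  have e2 : q ^+ (w + 2 * (m - a)) = q ^+ w * (q ^+ m / q ^+ a) * (q ^+ m / q ^+ a).
    by rewrite -e1 -exprnP -!exprD; congr (_ ^+ _); lia.
  rewrite -!invr_expz e1 e2 -!exprnP.
  have hM : q ^+ m * q ^+ w * (q ^+ m * q ^+ w) - 1 != 0.
    apply: contra_neq hm => /eqP; rewrite subr_eq0 -!exprD => /eqP hh.
    have : q ^ (m + w + (m + w))%N%:Z = q ^ 0 by rewrite expr0z -hh.
    by move/(qz_inj hq); lia.
  have := @expf_neq0 _ q m q0; have := @expf_neq0 _ q a q0; have := @expf_neq0 _ q w q0.
  move: hM hqa hqb; move: (q ^+ m) (q ^+ a) (q ^+ w) (qint q a.+1%:Z) (qint q (m.+1 - a)%N%:Z).
  move=> qm qa qw ia ib hM hia hib hqw hqa hqm E2 E1.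
  have hc0 : c a = 0.
    have : c a * (ib * (qm * qw * (qm * qw) - 1)) = 0.
      pose G := qw * (qm / qa) * (qm / qa).
      transitivity ((c a.+1 * (ia * qa^-1 / G) + c a * (ib / (qm / qa))) * (qa * G * (qm * qw))
        - (c a.+1 * (ia * qa * G) + c a * (ib * (qm / qa))) * (qa^-1 / G * (qm * qw))).
        by rewrite /G; field; rewrite ?hqm ?hqa ?hqw.
      by rewrite E1 E2 !mul0r subr0.
    by move/eqP; rewrite mulf_eq0 (negPf (mulf_neq0 hib hM)) orbF => /eqP.
  have hne : ia * qa * (qw * (qm / qa) * (qm / qa)) != 0 by rewrite !mulf_neq0 // invr_eq0.
  split=> //; move: E1; rewrite hc0 mul0r addr0 => /eqP; rewrite mulf_eq0 => /orP[/eqP //|].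
  by rewrite (negPf hne).
case=> [|a] ha; first by case: (hc 0%N isT).
by case: (hc a ha).
Qed.

(** An iterated q-commutator of E with S is a combination of monomials E^a S E^b in which the one
    with b = 0 has coefficient 1. *)
Lemma highest_nilpotent : qnil E S -> S = 0.
Proof.
move=> [cs h]; apply/eqP; apply/negPn/negP => S0.
have [c [hc hS0]] : exists c : nat -> F, c (size cs) = 1 /\
    qops E cs S = \sum_(a < (size cs).+1) c a *: mon (size cs) a.
  elim: (cs) => [|d ds [c [hc IH]]].
    by exists (fun=> 1); rewrite big_ord1 /mon /= scale1r mul1r mulr1.
  exists (fun a => (if a is a'.+1 then c a' else 0) - d * (if (a <= size ds)%N then c a else 0)).
  rewrite /= ltnn mulr0 subr0; split=> //; rewrite IH /qop mulr_sumr mulr_suml.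
  under [RHS]eq_bigr => a _ do rewrite scalerBl.
  rewrite sumrB [X in _ = X - _]big_ord_recl [X in _ = X + _ - _]scale0r add0r [X in _ = _ - X]big_ord_recr /= ltnn mulr0 scale0r addr0.
  rewrite scaler_sumr; congr (_ - _); apply: eq_bigr => a _; have ha := ltn_ord a.
    by rewrite /bump /= add1n /mon subSS exprS -scalerAr !mulrA.
  rewrite -ltnS ha -scalerAl scalerA; congr (_ *: _).
  by rewrite /mon subSn // exprSr mulrA.
rewrite h in hS0; have := highest_independent S0 (esym hS0) (leqnn _).
by rewrite hc => /eqP; rewrite oner_eq0.
Qed.

End HighestWeight.
End Triple.

(** * Quantum groups and their Verma modules *)

Lemma serre_lrmorphism (F : fieldType) (C D : algType F) (h : {lrmorphism C -> D}) x N X Y :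
  h (serre x N X Y) = serre x N (h X) (h Y).
Proof.
rewrite /serre linear_sum; apply: eq_bigr => l _.
by rewrite linearZ /= !rmorphM !rmorphXn.
Qed.

Lemma uq_rel_map (F : fieldType) (n : nat) (A : 'M[int]_n) (qi : 'I_n -> F) (C D : algType F)
    (e f k kv : 'I_n -> C) (h : {lrmorphism C -> D}) r :
  uq_rel A qi e f k kv r -> uq_rel A qi (h \o e) (h \o f) (h \o k) (h \o kv) (h r).
Proof.
have hB x y : h (x - y) = h x - h y by apply: raddfB.
have hZ c x : h (c *: x) = c *: h x by apply: linearZ.
case=> [i|i|i j|i j|i j|i j|i j ij|i j ij].
- rewrite rmorphB rmorphM rmorph1; exact: uq_KKV.
- rewrite rmorphB rmorphM rmorph1; exact: uq_KVK.
- rewrite rmorphB !rmorphM; exact: uq_KK.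
- rewrite hB hZ !rmorphM; exact: (uq_KE A qi (h \o e) _ (h \o k)).
- rewrite hB hZ !rmorphM; exact: (uq_KF A qi _ (h \o f) (h \o k)).
- rewrite !hB hZ !rmorphM hB.
  exact: (uq_EF A qi (h \o e) (h \o f) (h \o k) (h \o kv)).
- rewrite serre_lrmorphism.
  exact: (@uq_serreE _ _ A qi _ (h \o e) (h \o f) (h \o k) (h \o kv) i j ij).
- rewrite serre_lrmorphism.
  exact: (@uq_serreF _ _ A qi _ (h \o e) (h \o f) (h \o k) (h \o kv) i j ij).
Qed.

Lemma uq_rel_image (F : fieldType) (n : nat) (A : 'M[int]_n) (qi : 'I_n -> F) (C D : algType F)
    (e f k kv : 'I_n -> C) (h : {lrmorphism C -> D}) :
  (forall r, uq_rel A qi e f k kv r -> h r = 0) ->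
  forall r, uq_rel A qi (h \o e) (h \o f) (h \o k) (h \o kv) r -> r = 0.
Proof.
move=> hr.
have hB x y : h (x - y) = h x - h y by apply: raddfB.
have hZ c x : h (c *: x) = c *: h x by apply: linearZ.
move=> _ [i|i|i j|i j|i j|i j|i j ij|i j ij] /=.
- by rewrite -[RHS](hr _ (uq_KKV _ _ _ _ _ _ i)) rmorphB rmorphM rmorph1.
- by rewrite -[RHS](hr _ (uq_KVK _ _ _ _ _ _ i)) rmorphB rmorphM rmorph1.
- by rewrite -[RHS](hr _ (uq_KK _ _ _ _ _ _ i j)) rmorphB !rmorphM.
- by rewrite -[RHS](hr _ (uq_KE _ _ _ _ _ _ i j)) hB hZ !rmorphM.
- by rewrite -[RHS](hr _ (uq_KF _ _ _ _ _ _ i j)) hB hZ !rmorphM.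
- by rewrite -[RHS](hr _ (uq_EF _ _ _ _ _ _ i j)) !hB hZ !rmorphM hB.
- by rewrite -[RHS](hr _ (@uq_serreE _ _ A qi _ e f k kv i j ij)) serre_lrmorphism.
- by rewrite -[RHS](hr _ (@uq_serreF _ _ A qi _ e f k kv i j ij)) serre_lrmorphism.
Qed.

(* Working with these specifications instead of the quotients themselves keeps
   unification from unfolding the latter. *)
Record uq_spec (F : fieldType) (n : nat) (A : 'M[int]_n) (qi : 'I_n -> F) (U : algType F)
    (E Fm K KV : 'I_n -> U) := UqSpec {
  uqs_rel : forall r, uq_rel A qi E Fm K KV r -> r = 0;
  uqs_lift : forall (B : algType F) (e f k kv : 'I_n -> B),
    (forall r, uq_rel A qi e f k kv r -> r = 0) -> exists h : {lrmorphism U -> B},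
    forall i, [/\ h (E i) = e i, h (Fm i) = f i, h (K i) = k i & h (KV i) = kv i]
}.

Record up_spec (F : fieldType) (n : nat) (A : 'M[int]_n) (qi : 'I_n -> F) (M : algType F)
    (E : 'I_n -> M) := UpSpec {
  ups_serre : forall i j, i != j -> serre (qi i) `|1 - A i j|%N (E i) (E j) = 0;
  ups_lift : forall (B : algType F) (e : 'I_n -> B),
    (forall i j, i != j -> serre (qi i) `|1 - A i j|%N (e i) (e j) = 0) ->
    exists h : {lrmorphism M -> B}, forall i, h (E i) = e i;
  ups_ind : forall P : M -> Prop, P 1 -> (forall i u, P u -> P (E i * u)) ->
    (forall u v, P u -> P v -> P (u + v)) -> (forall c u, P u -> P (c *: u)) -> forall u, P u
}.

(* Keeps unification from unfolding the maps defined on quotients. *)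
Fact seal : unit. Proof. exact: tt. Qed.

Section UniversalProperty.
Context (F : fieldType) (n : nat) (A : 'M[int]_n) (qi : 'I_n -> F) (B : algType F).
Context (e f k kv : 'I_n -> B).
Context (hrel : forall r, uq_rel A qi e f k kv r -> r = 0).

Definition uq_gen_map (g : uq_gen n) : B :=
  match g with genE i => e i | genF i => f i | genK i => k i | genKV i => kv i end.

Let phi : {lrmorphism freealg F (uq_gen n) -> B} := free_lift uq_gen_map.

Let phi_rel r :
  uq_rel A qi (fun i => gen F (genE i)) (fun i => gen F (genF i))
    (fun i => gen F (genK i)) (fun i => gen F (genKV i)) r -> phi r = 0.
Proof.
move/(uq_rel_map phi) => h; apply: hrel; move: h.
have -> : phi \o (fun i => gen F (genE i)) = e by apply/funext => i; apply: free_lift_gen.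
have -> : phi \o (fun i => gen F (genF i)) = f by apply/funext => i; apply: free_lift_gen.
have -> : phi \o (fun i => gen F (genK i)) = k by apply/funext => i; apply: free_lift_gen.
by have -> : phi \o (fun i => gen F (genKV i)) = kv by apply/funext => i; apply: free_lift_gen.
Qed.

(** Mentioning [hrel] makes the map, and hence the morphism instances on it, depend on the
    relations; the body of [quot_map] alone would not. *)
Definition uq_map : Uq A qi -> B := locked_with seal (let _ := hrel in quot_map phi).

Let uq_mapE u : uq_map u = quot_map phi u. Proof. by rewrite /uq_map unlock. Qed.

Lemma uq_map_zmod : zmod_morphism uq_map.
Proof. by move=> u v; rewrite !uq_mapE; apply: quot_mapB. Qed.
Lemma uq_map_monoid : monoid_morphism uq_map.
Proof. by split=> [|u v]; rewrite !uq_mapE; [exact: quot_map1|exact: quot_mapM]. Qed.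
Lemma uq_map_scalable : scalable uq_map.
Proof. by move=> c u; rewrite !uq_mapE; apply: quot_mapZ. Qed.

HB.instance Definition _ := GRing.isZmodMorphism.Build (Uq A qi) B uq_map uq_map_zmod.
HB.instance Definition _ := GRing.isMonoidMorphism.Build (Uq A qi) B uq_map uq_map_monoid.
HB.instance Definition _ := GRing.isScalable.Build F (Uq A qi) B *:%R uq_map uq_map_scalable.

Lemma uq_map_E i : uq_map (uE A qi i) = e i.
Proof. by rewrite uq_mapE; exact: etrans (quot_map_pi phi_rel _) (free_lift_gen _ _). Qed.
Lemma uq_map_F i : uq_map (uF A qi i) = f i.
Proof. by rewrite uq_mapE; exact: etrans (quot_map_pi phi_rel _) (free_lift_gen _ _). Qed.
Lemma uq_map_K i : uq_map (uK A qi i) = k i.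
Proof. by rewrite uq_mapE; exact: etrans (quot_map_pi phi_rel _) (free_lift_gen _ _). Qed.
Lemma uq_map_KV i : uq_map (uKV A qi i) = kv i.
Proof. by rewrite uq_mapE; exact: etrans (quot_map_pi phi_rel _) (free_lift_gen _ _). Qed.

End UniversalProperty.

Section Presentation.
Context (F : fieldType) (n : nat) (A : 'M[int]_n) (qi : 'I_n -> F).
Local Notation U := (Uq A qi).
Local Notation E := (uE A qi). Local Notation Fm := (uF A qi).
Local Notation K := (uK A qi). Local Notation KV := (uKV A qi).

Let pi : {lrmorphism freealg F (uq_gen n) -> U} := quot_pi _.

Lemma uq_relations r : uq_rel A qi E Fm K KV r -> r = 0.
Proof.
apply: (uq_rel_image (h := pi)) => u hu; rewrite -[0](rmorph0 pi); apply/quot_pi_eq.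
by rewrite subr0; apply: ideal_rel.
Qed.

Lemma uq_ind (P : U -> Prop) :
    P 1 -> (forall i u, P u -> P (E i * u)) -> (forall i u, P u -> P (Fm i * u)) ->
    (forall i u, P u -> P (K i * u)) -> (forall i u, P u -> P (KV i * u)) ->
    (forall u v, P u -> P v -> P (u + v)) -> (forall c u, P u -> P (c *: u)) ->
  forall u, P u.
Proof.
move=> P1 PE PF PK PV PD PZ u; rewrite -[u]quot_pi_surj.
elim/freealg_ind: (repr u) => [|g v hv|v w hv hw|c v hv].
- by rewrite -/(pi 1) rmorph1.
- rewrite -/(pi _) rmorphM; case: g => i; [exact: PE|exact: PF|exact: PK|exact: PV].
- by rewrite -/(pi _) rmorphD; apply: PD.
- by rewrite -/(pi _) linearZ; apply: PZ.
Qed.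

End Presentation.

(** * The positive part as an algebra in its own right *)

Section PositivePart.
Context (F : fieldType) (n : nat) (A : 'M[int]_n) (qi : 'I_n -> F).

Inductive up_rel : freealg F 'I_n -> Prop :=
| up_serre i j : i != j -> up_rel (serre (qi i) `|1 - A i j|%N (gen F i) (gen F j)).

Definition Up := quotalg up_rel.

Let chi : {rmorphism freealg F 'I_n -> F} := character (fun=> 0).

Let chi_rel r : up_rel r -> chi r = 0.
Proof.
case=> i j _; rewrite raddf_sum big1 // => l _.
by rewrite /chi /= characterZ !characterM character_gen mulr0 mul0r mulr0.
Qed.

HB.instance Definition _ := GRing.PzRing.on Up.
HB.instance Definition _ := GRing.Lmodule.on Up.
HB.instance Definition _ := GRing.PzSemiRing_isNonZero.Build Up (quotalg_neq0 (f := chi) chi_rel).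
HB.instance Definition _ := GRing.LSemiModule_isLSemiAlgebra.Build F Up (@quot_scaleAl _ _ _).
HB.instance Definition _ := GRing.LSemiAlgebra_isSemiAlgebra.Build F Up (@quot_scaleAr _ _ _).

Definition upE i : Up := quot_pi _ (gen F i).

Let pi : {lrmorphism freealg F 'I_n -> Up} := quot_pi _.

Lemma up_serreE i j : i != j -> serre (qi i) `|1 - A i j|%N (upE i) (upE j) = 0.
Proof.
move=> ij; rewrite -[LHS](serre_lrmorphism pi) -[RHS](rmorph0 pi).
by apply/quot_pi_eq; rewrite subr0; apply/ideal_rel/up_serre.
Qed.

Lemma up_ind (P : Up -> Prop) :
    P 1 -> (forall i u, P u -> P (upE i * u)) ->
    (forall u v, P u -> P v -> P (u + v)) -> (forall c u, P u -> P (c *: u)) ->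
  forall u, P u.
Proof.
move=> P1 PE PD PZ u; rewrite -[u]quot_pi_surj.
elim/freealg_ind: (repr u) => [|g v hv|v w hv hw|c v hv].
- by rewrite -/(pi 1) rmorph1.
- rewrite -/(pi _) rmorphM; exact: PE.
- by rewrite -/(pi _) rmorphD; apply: PD.
- by rewrite -/(pi _) linearZ; apply: PZ.
Qed.

Section Map.
Context (B : algType F) (e : 'I_n -> B).
Context (he : forall i j, i != j -> serre (qi i) `|1 - A i j|%N (e i) (e j) = 0).

Let phi : {lrmorphism freealg F 'I_n -> B} := free_lift e.

Let phi_rel r : up_rel r -> phi r = 0.
Proof.
case=> i j ij; rewrite serre_lrmorphism.
by rewrite (free_lift_gen e i : phi (gen F i) = _) (free_lift_gen e j : phi (gen F j) = _) he.
Qed.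

Definition up_map : Up -> B := locked_with seal (let _ := he in quot_map phi).

Let up_mapE u : up_map u = quot_map phi u. Proof. by rewrite /up_map unlock. Qed.

Lemma up_map_zmod : zmod_morphism up_map.
Proof. by move=> u v; rewrite !up_mapE; apply: quot_mapB. Qed.
Lemma up_map_monoid : monoid_morphism up_map.
Proof. by split=> [|u v]; rewrite !up_mapE; [exact: quot_map1|exact: quot_mapM]. Qed.
Lemma up_map_scalable : scalable up_map.
Proof. by move=> c u; rewrite !up_mapE; apply: quot_mapZ. Qed.

HB.instance Definition _ := GRing.isZmodMorphism.Build (Up) B up_map up_map_zmod.
HB.instance Definition _ := GRing.isMonoidMorphism.Build (Up) B up_map up_map_monoid.
HB.instance Definition _ := GRing.isScalable.Build F (Up) B *:%R up_map up_map_scalable.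

Lemma up_map_E i : up_map (upE i) = e i.
Proof. by rewrite up_mapE; exact: etrans (quot_map_pi phi_rel _) (free_lift_gen _ _). Qed.

End Map.
End PositivePart.

Lemma Uq_spec (F : fieldType) (n : nat) (A : 'M[int]_n) (qi : 'I_n -> F) :
  uq_spec A qi (uE A qi) (uF A qi) (uK A qi) (uKV A qi).
Proof.
split=> [r|B e f k kv h]; first exact: uq_relations.
exists (uq_map h : {lrmorphism _ -> _}) => i.
by split; [exact: uq_map_E|exact: uq_map_F|exact: uq_map_K|exact: uq_map_KV].
Qed.

Lemma Up_spec (F : fieldType) (n : nat) (A : 'M[int]_n) (qi : 'I_n -> F) :
  up_spec A qi (upE A qi).
Proof.
split=> [i j|B e h|P P1 PE PD PZ u]; first exact: up_serreE.
  by exists (up_map h : {lrmorphism _ -> _}) => i; apply: up_map_E.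
exact: up_ind.
Qed.

Section SerreInversion.
Context (F : fieldType) (q : F) (hq : not_root_of_unity q).

Lemma not_root_of_unityV : not_root_of_unity q^-1.
Proof.
case: hq => q0 h; split; first by rewrite invr_eq0.
by move=> m /h; apply: contra_neq; rewrite exprVn => /(congr1 GRing.inv); rewrite invrK invr1.
Qed.

Lemma not_root_of_unityX e : (0 < e)%N -> not_root_of_unity (q ^+ e).
Proof.
case: hq => q0 h he; split; first by rewrite expf_neq0.
by move=> m hm; rewrite -exprM; apply: h; rewrite muln_gt0 he.
Qed.

Lemma qintV m : qint q^-1 m = qint q m.
Proof.
rewrite /qint !exprz_inv opprK invrK -opprB -[q^-1 - q]opprB invrN mulrNN.
by [].
Qed.

Lemma serreV (U : algType F) N (X Y : U) : serre q^-1 N X Y = serre q N X Y.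
Proof.
have h m : qfact q^-1 m = qfact q m by apply: eq_bigr => l _; apply: qintV.
by rewrite /serre /qbinom; apply: eq_bigr => l _; rewrite !h.
Qed.

End SerreInversion.

Lemma serreD_right (F : fieldType) (U : algType F) (q : F) N (X Y Y' : U) :
  serre q N X (Y + Y') = serre q N X Y + serre q N X Y'.
Proof.
rewrite /serre -big_split; apply: eq_bigr => l _.
by rewrite mulrDr mulrDl scalerDr.
Qed.

Lemma serreZ_right (F : fieldType) (U : algType F) (q : F) N (X Y : U) c :
  serre q N X (c *: Y) = c *: serre q N X Y.
Proof.
rewrite /serre scaler_sumr; apply: eq_bigr => l _.
by rewrite -scalerAr -scalerAl !scalerA mulrC.
Qed.

Section SerreScaling.
Context (F : fieldType) (U : algType F).

Lemma qops_mem (X Y : U) c cs : c \in cs -> qop X c Y = 0 -> qops X cs Y = 0.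
Proof.
elim: cs => //= d cs IH; rewrite inE => /orP[/eqP <-|hc] h; last by rewrite IH // raddf0.
by rewrite -qops_qop h qops0.
Qed.

Lemma qops_scale (X Y : U) a b cs :
  qops (a *: X) cs (b *: Y) = (a ^+ size cs * b) *: qops X cs Y.
Proof.
elim: cs => [|c cs IH] /=; first by rewrite mul1r.
by rewrite IH /qop exprS; nc; ring.
Qed.

Lemma size_qgeom (q c : F) m : size (qgeom q c m) = m.
Proof. by rewrite size_map size_iota. Qed.

Lemma serre_scale (q : F) (hq : not_root_of_unity q) N (X Y : U) a b :
  serre q N (a *: X) (b *: Y) = (a ^+ N * b) *: serre q N X Y.
Proof. by rewrite !serreE // qops_scale size_qgeom. Qed.

Lemma qgeom_first (q c : F) m : (0 < m)%N -> c \in qgeom q c m.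
Proof. by case: m => // m _; rewrite /qgeom /= mulr1 inE eqxx. Qed.

Lemma qgeom_last (q c : F) m : c * q ^+ (2 * m) \in qgeom q c m.+1.
Proof. by rewrite qgeomS mem_rcons inE eqxx. Qed.

End SerreScaling.

(** * Skew derivations through triangular matrices *)

Section TriangularBlocks.
Context (F : fieldType) (C : algType F).

Lemma pair_neq0 : ((1, 0) : C * C) != 0.
Proof. by apply/eqP => -[] /eqP; rewrite oner_eq0. Qed.

(** Upper triangular two by two matrices over C are sums of a diagonal [dgb] and a corner [ntb]. A
    homomorphism into them is multiplicative on the diagonal and a skew derivation in the corner, so
    constructing one reduces to checking the Serre relations. *)
Definition block := endo pair_neq0.

Lemma dgb_linear (a b : C) (c : F) (u v : C * C) :
  (a * (c *: u + v).1, b * (c *: u + v).2) = c *: (a * u.1, b * u.2) + (a * v.1, b * v.2).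
Proof. by congr (_, _); rewrite /= mulrDr -scalerAr. Qed.
Definition dgb a b : block := mk_endo pair_neq0 (dgb_linear a b).

Lemma ntb_linear (a : C) (c : F) (u v : C * C) :
  (a * (c *: u + v).2, 0) = c *: (a * u.2, 0) + (a * v.2, 0) :> C * C.
Proof. by congr (_, _); rewrite /= ?scaler0 ?addr0 // mulrDr -scalerAr. Qed.
Definition ntb a : block := mk_endo pair_neq0 (ntb_linear a).

Lemma dgbM a b c d : dgb a b * dgb c d = dgb (a * c) (b * d).
Proof. by apply: endoP => u; rewrite endoM /= !mulrA. Qed.
Lemma dgbB a b c d : dgb a b - dgb c d = dgb (a - c) (b - d).
Proof. by apply: endoP => u; rewrite endoB /= !mulrBl. Qed.
Lemma dgbZ s a b : s *: dgb a b = dgb (s *: a) (s *: b).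
Proof. by apply: endoP => u; rewrite endoZ /= -!scalerAl. Qed.
Lemma dgb0 : dgb 0 0 = 0.
Proof. by apply: endoP => u; rewrite /= !mul0r. Qed.
Lemma dgb_ntb a b c : dgb a b * ntb c = ntb (a * c).
Proof. by apply: endoP => u; rewrite endoM /= mulr0 !mulrA. Qed.
Lemma ntb_dgb a b c : ntb c * dgb a b = ntb (c * b).
Proof. by apply: endoP => u; rewrite endoM /= !mulrA. Qed.
Lemma ntbB a b : ntb a - ntb b = ntb (a - b).
Proof. by apply: endoP => u; rewrite endoB /= mulrBl; congr (_, _); rewrite /= subr0. Qed.
Lemma ntbZ s a : s *: ntb a = ntb (s *: a).
Proof. by apply: endoP => u; rewrite endoZ /= -!scalerAl; congr (_, _); rewrite /= scaler0. Qed.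
Lemma ntb0 : ntb 0 = 0.
Proof. by apply: endoP => u; rewrite /= !mul0r. Qed.

Lemma qops_dgb a b c d cs :
  qops (dgb a b) cs (dgb c d) = dgb (qops a cs c) (qops b cs d).
Proof. by elim: cs => //= s cs ->; rewrite /qop !dgbM dgbZ dgbB. Qed.

Lemma serre_dgb (q : F) (hq : not_root_of_unity q) N a b c d :
  serre q N (dgb a b) (dgb c d) = dgb (serre q N a c) (serre q N b d).
Proof. by rewrite !serreE // qops_dgb. Qed.

End TriangularBlocks.

Section CartanData.
Context (n : nat) (A : 'M[int]_n) (eps : 'I_n -> nat) (hA : gcm A eps).

Lemma cartan_diag i : A i i = 2. Proof. by case: hA => -[]. Qed.
Lemma cartan_off i j : i != j -> A i j <= 0. Proof. by case: hA => -[_ h _] *; apply: h. Qed.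
Lemma cartan_eq0 i j : A i j = 0 <-> A j i = 0. Proof. by case: hA => -[]. Qed.
Lemma cartan_eps i : (0 < eps i)%N. Proof. by case: hA. Qed.
Lemma cartan_sym i j : (eps i)%:Z * A i j = (eps j)%:Z * A j i. Proof. by case: hA. Qed.

Lemma cartan_serre i j : i != j -> exists2 p : nat, A i j = - p%:Z & `|1 - A i j|%N = p.+1.
Proof. by move/cartan_off => h; exists `|A i j|%N; lia. Qed.

Section QFamily.
Context (F : fieldType) (q : F) (hq : not_root_of_unity q).

Definition qfam i : F := q ^+ eps i.

Lemma qfam_root i : not_root_of_unity (qfam i).
Proof. by apply: not_root_of_unityX => //; apply: cartan_eps. Qed.

Lemma qfam_sym i j : qfam i ^ A i j = qfam j ^ A j i.
Proof. by rewrite /qfam !exprnP !exprz_exp cartan_sym. Qed.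

End QFamily.
End CartanData.

Section SkewDerivations.
Context (n : nat) (A : 'M[int]_n) (eps : 'I_n -> nat) (hA : gcm A eps).
Context (F : fieldType) (q : F) (hq : not_root_of_unity q).
Local Notation qi := (qfam eps q).
Context (M : algType F) (E : 'I_n -> M) (hM : up_spec A qi E).

Let hqi i : not_root_of_unity (qi i). Proof. exact: (qfam_root hA). Qed.

Lemma scaling_serre (z : 'I_n -> F) i j : i != j ->
  serre (qi i) `|1 - A i j|%N (z i *: E i) (z j *: E j) = 0.
Proof. by move=> ij; rewrite serre_scale // (ups_serre hM) // scaler0. Qed.

Definition scaling z : {lrmorphism M -> M} := sval (cid (ups_lift hM (scaling_serre z))).

Lemma scaling_E z i : scaling z (E i) = z i *: E i.
Proof. exact: (svalP (cid (ups_lift hM (scaling_serre z))) i). Qed.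
Lemma scalingM z u v : scaling z (u * v) = scaling z u * scaling z v. Proof. exact: rmorphM. Qed.
Lemma scaling1 z : scaling z 1 = 1. Proof. exact: rmorph1. Qed.
Lemma scalingD z u v : scaling z (u + v) = scaling z u + scaling z v. Proof. exact: rmorphD. Qed.
Lemma scalingZ z c u : scaling z (c *: u) = c *: scaling z u. Proof. exact: linearZ. Qed.
Lemma scaling0 z : scaling z 0 = 0. Proof. exact: rmorph0. Qed.

Lemma scaling_comp z z' u : scaling z (scaling z' u) = scaling (fun i => z i * z' i) u.
Proof.
elim/(ups_ind hM): u => [|i u IH|u v IHu IHv|c u IH].
- by rewrite !scaling1.
- by rewrite !scalingM !scaling_E scalingZ scaling_E scalerA [z' i * _]mulrC -IH.
- by rewrite !scalingD IHu IHv.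
- by rewrite !scalingZ IH.
Qed.

Lemma scaling_id u : scaling (fun=> 1) u = u.
Proof.
elim/(ups_ind hM): u => [|i u IH|u v IHu IHv|c u IH].
- by rewrite scaling1.
- by rewrite scalingM scaling_E scale1r IH.
- by rewrite scalingD IHu IHv.
- by rewrite scalingZ IH.
Qed.

Lemma eq_scaling z z' : z =1 z' -> scaling z =1 scaling z'.
Proof. by move=> /funext ->. Qed.

Section Skew.
Context (x : 'I_n -> F) (hx : forall i, not_root_of_unity (x i)).
Context (hxsym : forall i j, x i ^ A i j = x j ^ A j i).
Context (hserre : forall i N (U : algType F) (X Y : U), serre (x i) N X Y = serre (qi i) N X Y).
Context (k : 'I_n).

Definition skew_weight l : F := x k ^ A k l.

Definition skew_gen l : block M :=
  dgb (E l) (skew_weight l *: E l) + ntb (if l == k then 1 else 0).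

(** If k is neither index, the corner is 0. For k = j it enters linearly and one q-commutator factor
    annihilates it. For k = i the first argument is a sum of a diagonal and a corner that q-commute,
    and [serre_mixed] applies. *)
Lemma skew_serre i j : i != j -> serre (qi i) `|1 - A i j|%N (skew_gen i) (skew_gen j) = 0.
Proof.
move=> ij; have [p hp ->] := cartan_serre hA ij.
have hS : serre (qi i) p.+1 (E i) (E j) = 0.
  by have := ups_serre hM ij; have [p' hp' ->] := cartan_serre hA ij; rewrite (_ : p' = p) //; lia.
have hD : serre (qi i) p.+1 (dgb (E i) (skew_weight i *: E i)) (dgb (E j) (skew_weight j *: E j)) = 0.
  by rewrite serre_dgb // serre_scale // hS scaler0 dgb0.
have x0 l : x l != 0 by case: (hx l).
have hsk : skew_weight i = x i ^ A i k by rewrite /skew_weight hxsym.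
rewrite /skew_gen -!hserre in hD *.
have hxp : x i ^ (1 - p.+1%:Z) = x i ^ A i j by congr (_ ^ _); lia.
case: (eqVneq i k) => [ik|ik]; last first.
  rewrite ntb0 addr0 serreD_right hD add0r serreE // hxp.
  case: (eqVneq j k) => [jk|_]; last by rewrite ntb0 -/(qops _ _ _) qops0.
  apply: (qops_mem (c := x i ^ A i j * x i ^+ (2 * p))); first exact: qgeom_last.
  rewrite /qop dgb_ntb ntb_dgb mulr1 mul1r !ntbZ ntbB !scalerA.
  rewrite hsk -jk hp exprnP -!expfzDr // (_ : - p%:Z + (2 * p)%N%:Z + - p%:Z = 0); last by lia.
  by rewrite expr0z scale1r subrr ntb0.
have jk : (j == k) = false by apply/negbTE; rewrite -ik eq_sym.
rewrite jk ntb0 addr0 addrC.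
have sk2 : skew_weight i = x i ^+ 2 by rewrite /skew_weight -ik (cartan_diag hA).
have skj : skew_weight j = x i ^ A i j by rewrite /skew_weight -ik.
rewrite (serre_mixed (hx i)) ?hD ?addr0.
- rewrite serreE // hxp (qops_mem (c := x i ^ A i j)) ?qgeom_first //.
  by rewrite /qop dgb_ntb ntb_dgb mulr1 mul1r skj ntbZ ntbB subrr ntb0.
  by rewrite dgb_ntb ntb_dgb mulr1 mul1r sk2 ntbZ.
set a := x i ^ A i j; have -> : x i ^ (- p%:Z) = a by rewrite /a hp.
have -> : x i ^ (2 - p%:Z) = x i ^+ 2 * a by rewrite /a hp exprnP -expfzDr.
rewrite !dgbM !dgbZ !dgbB !dgb_ntb !ntb_dgb mul1r mulr1 ntbZ sk2 skj -/a.
by congr ntb; nc; ring.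
Qed.

Definition skew_map : {lrmorphism M -> block M} := sval (cid (ups_lift hM skew_serre)).
Let phi u : block M := skew_map u.
Let phiM u v : phi (u * v) = phi u * phi v. Proof. exact: rmorphM. Qed.
Let phiE l : phi (E l) = skew_gen l.
Proof. exact: (svalP (cid (ups_lift hM skew_serre)) l). Qed.
Let phi1 : phi 1 = 1. Proof. exact: rmorph1. Qed.
Let phiD u v : phi (u + v) = phi u + phi v. Proof. exact: rmorphD. Qed.
Let phiZ c u : phi (c *: u) = c *: phi u. Proof. exact: linearZ. Qed.

Definition skew u : M := (phi u (0, 1)).1.

Lemma skewD u v : skew (u + v) = skew u + skew v. Proof. by rewrite /skew phiD. Qed.
Lemma skewZ c u : skew (c *: u) = c *: skew u. Proof. by rewrite /skew phiZ. Qed.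
Lemma skew1 : skew 1 = 0. Proof. by rewrite /skew phi1. Qed.

Lemma skew_E l u : skew (E l * u) = E l * skew u + (if l == k then scaling skew_weight u else 0).
Proof.
have h v : (phi v (0, 1)).2 = scaling skew_weight v.
  elim/(ups_ind hM): v => [|i v IH|v w IHv IHw|c v IH].
  - by rewrite phi1 scaling1.
  - by rewrite phiM phiE endoM scalingM scaling_E -IH /skew_gen endoD /= addr0.
  - by rewrite phiD scalingD -IHv -IHw.
  - by rewrite phiZ scalingZ -IH.
by rewrite /skew phiM phiE endoM -h /skew_gen endoD /=; case: eqP; rewrite ?mul1r ?mul0r.
Qed.

Lemma skew_scaling z u : z k != 0 -> scaling z (skew u) = (z k)^-1 *: skew (scaling z u).
Proof.
move=> z0; elim/(ups_ind hM): u => [|l u IH|u v IHu IHv|c u IH].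
- by rewrite scaling1 skew1 scaling0 scaler0.
- rewrite scalingM scaling_E skew_E scalingD scalingM scaling_E IH.
  rewrite -[in RHS]scalerAl skewZ skew_E !scalerDr -!scalerAl -!scalerAr !scalerA.
  rewrite [z l * _]mulrC; congr (_ + _); case: eqVneq => [->|_]; last by rewrite scaling0 scaler0.
  rewrite mulVf // !scale1r !scaling_comp; apply: eq_scaling => m.
  exact: mulrC.
- by rewrite scalingD !skewD scalingD scalerDr IHu IHv.
- by rewrite scalingZ !skewZ scalingZ IH !scalerA mulrC.
Qed.

End Skew.
End SkewDerivations.

(* An element twisting X by a power of q occurring in the Serre relation satisfies it. *)
Lemma serre_twist (F : fieldType) (U : algType F) (q : F) (hq : not_root_of_unity q) p (X k : U) :
  k * X = q ^+ p *: (X * k) \/ k * X = q ^- p *: (X * k) -> serre q p.+1 X k = 0.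
Proof.
have q0 := q_neq0 hq; have hp : q ^+ p != 0 by rewrite expf_neq0.
move=> h; rewrite serreE //.
have -> : q ^ (1 - p.+1%:Z) = q ^- p by rewrite exprnN; congr (_ ^ _); lia.
case: h => h.
  apply: (qops_mem (c := q ^- p)); first exact: qgeom_first.
  by rewrite /qop h scalerA mulVf // scale1r subrr.
apply: (qops_mem (c := q ^- p * q ^+ (2 * p))); first exact: qgeom_last.
rewrite /qop h scalerA mul2n -addnn exprD mulrA mulVf // mul1r mulfV // scale1r.
by rewrite subrr.
Qed.

Section SerreF.
Context (n : nat) (A : 'M[int]_n) (eps : 'I_n -> nat) (hA : gcm A eps).
Context (F : fieldType) (q : F) (hq : not_root_of_unity q).
Local Notation qi := (qfam eps q).
Context (U : algType F) (e f k kv : 'I_n -> U).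
Context (hKKV : forall i, k i * kv i = 1) (hKVK : forall i, kv i * k i = 1).
Context (hKF : forall i j, k i * f j = qi i ^ (- A i j) *: (f j * k i)).
Context (hEF : forall i j, e i * f j - f j * e i =
  ((i == j)%:R / (qi i - (qi i)^-1)) *: (k i - kv i)).

Let hqi i : not_root_of_unity (qi i). Proof. exact: (qfam_root hA). Qed.

Lemma kvF i j : kv i * f j = qi i ^ A i j *: (f j * kv i).
Proof.
have := triple_inv (hKKV i) (hKVK i) (qz_neq0 (hqi i) _) (hKF i j).
by rewrite invr_expz opprK.
Qed.

(** For l = i this is [serre_commutes] with E and F exchanged. For l = j the commutator of E_j with
    F_j leaves Serre polynomials of F_i with K_j and K_j^-1, which vanish by [serre_twist]. *)
Lemma serreF_commutes i j l : i != j ->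
  e l * serre (qi i) `|1 - A i j|%N (f i) (f j) = serre (qi i) `|1 - A i j|%N (f i) (f j) * e l.
Proof.
move=> ij; have [p hp ->] := cartan_serre hA ij.
have hcomm a b : a != b -> e a * f b = f b * e a.
  by move=> ab; apply/eqP; rewrite -subr_eq0 hEF (negPf ab) mul0r scale0r.
have hhp : qi i ^ (- A i j) = qi i ^+ p by rewrite hp opprK.
have hhn : qi i ^ (A i j) = qi i ^- p by rewrite hp exprnN.
case: (eqVneq l i) => [->|li].
  have hij := hcomm _ _ ij.
  apply: (serre_commutes (K := kv i) (K' := k i) (hqi i)) => //.
  - by rewrite kvF (cartan_diag hA).
  - by rewrite -opprB hEF eqxx mul1r -scalerN opprB.
  - by rewrite kvF hhn.
have hli m : e l * f i ^+ m = f i ^+ m * e l.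
  elim: m => [|m IH]; first by rewrite mul1r mulr1.
  by rewrite exprS mulrA hcomm // -!mulrA IH.
have hs : serre (qi i) p.+1 (f i) (e l * f j - f j * e l) = 0.
  rewrite hEF; case: (eqVneq l j) => [->|_]; last first.
    by rewrite mul0r scale0r /serre big1 // => m _; rewrite mulr0 mul0r scaler0.
  rewrite serreZ_right -scaleN1r serreD_right serreZ_right.
  have hK : qi j ^ A j i = qi i ^ A i j by rewrite (qfam_sym hA).
  rewrite !(serre_twist (hqi i)) ?scaler0 ?addr0 ?scaler0 //.
    by right; rewrite kvF hK hhn.
  by left; rewrite hKF -invr_expz hK hhn invrK.
apply/eqP; rewrite -subr_eq0 -[X in _ == X]hs; apply/eqP.
rewrite /serre mulr_sumr mulr_suml -sumrB; apply: eq_bigr => m _.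
rewrite -scalerAr -scalerAl -scalerBr; congr (_ *: _).
rewrite mulrBr mulrBl !mulrA hli; congr (_ - _).
by rewrite -!mulrA hli.
Qed.

End SerreF.

Section Verma.
Context (n : nat) (A : 'M[int]_n) (eps : 'I_n -> nat) (hA : gcm A eps).
Context (F : fieldType) (q : F) (hq : not_root_of_unity q).
Local Notation qi := (qfam eps q).
Context (M : algType F) (E : 'I_n -> M) (hM : up_spec A qi E).
Context (U : algType F) (uE uF uK uKV : 'I_n -> U) (hU : uq_spec A qi uE uF uK uKV).
Context (la : 'I_n -> F) (la0 : forall i, la i != 0).

Let hqi i : not_root_of_unity (qi i). Proof. exact: (qfam_root hA). Qed.
Let hsc := scaling hA hq hM.

Definition rootp k := skew_weight A qi k.
Definition rootn k := skew_weight A (fun i => (qi i)^-1) k.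

Lemma rootn_inv k l : rootn k l = (rootp k l)^-1.
Proof. by rewrite /rootn /rootp /skew_weight exprz_inv invr_expz. Qed.

Let symV i j : (qi i)^-1 ^ A i j = (qi j)^-1 ^ A j i.
Proof. by rewrite !exprz_inv -!invr_expz (qfam_sym hA). Qed.

Let serreVi i N (C : algType F) (X Y : C) : serre (qi i)^-1 N X Y = serre (qi i) N X Y.
Proof. exact: serreV. Qed.

Definition skewp k : M -> M :=
  skew hA hq hM hqi (qfam_sym hA q) (fun _ _ _ _ _ => erefl) k.
Definition skewn k : M -> M :=
  skew hA hq hM (fun i => not_root_of_unityV (hqi i)) symV serreVi k.

Definition EndM := endo (oner_neq0 M).

Lemma vermaE_linear k c (u v : M) : E k * (c *: u + v) = c *: (E k * u) + E k * v.
Proof. by rewrite mulrDr scalerAr. Qed.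
Definition vermaE k : EndM := mk_endo (oner_neq0 M) (vermaE_linear k).

Lemma vermaK_linear z (t : F) c (u v : M) :
  t *: hsc z (c *: u + v) = c *: (t *: hsc z u) + t *: hsc z v.
Proof. by rewrite /hsc scalingD scalingZ scalerDr !scalerA mulrC. Qed.
Definition vermaK k : EndM := mk_endo (oner_neq0 M) (vermaK_linear (rootp k) (la k)).
Definition vermaKV k : EndM := mk_endo (oner_neq0 M) (vermaK_linear (rootn k) (la k)^-1).

(** The commutator of F_k with an element of the positive part is a combination of its two skew
    derivatives, for q and for q^-1, times K_k and K_k^-1. On the lowest weight vector these act by
    [la k] and its inverse. *)
Definition vermaF_fun k (u : M) : M :=
  - (qi k - (qi k)^-1)^-1 *: (la k *: skewp k u - (la k)^-1 *: skewn k u).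
Lemma vermaF_linear k c u v : vermaF_fun k (c *: u + v) = c *: vermaF_fun k u + vermaF_fun k v.
Proof.
rewrite /vermaF_fun /skewp /skewn !skewD !skewZ.
set a := skew _ _ _ _ _ _ _ u; set b := skew _ _ _ _ _ _ _ u.
set a' := skew _ _ _ _ _ _ _ v; set b' := skew _ _ _ _ _ _ _ v.
by nc; ring.
Qed.
Definition vermaF k : EndM := mk_endo (oner_neq0 M) (@vermaF_linear k).

Lemma vermaF_one k : vermaF k 1 = 0.
Proof. by rewrite /= /vermaF_fun /skewp /skewn !skew1 !scaler0 subrr scaler0. Qed.

Lemma rootp_neq0 k l : rootp k l != 0. Proof. exact: qz_neq0. Qed.

Lemma vermaKKV k : vermaK k * vermaKV k = 1.
Proof.
apply: endoP => u; rewrite endoM /= /hsc scalingZ scalerA mulfV // scale1r.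
rewrite scaling_comp -[RHS](scaling_id hA hq hM u); apply: eq_scaling => i.
by rewrite rootn_inv mulfV // rootp_neq0.
Qed.

Lemma vermaKVK k : vermaKV k * vermaK k = 1.
Proof.
apply: endoP => u; rewrite endoM /= /hsc scalingZ scalerA mulVf // scale1r.
rewrite scaling_comp -[RHS](scaling_id hA hq hM u); apply: eq_scaling => i.
by rewrite rootn_inv mulVf // rootp_neq0.
Qed.

Lemma vermaEF i j : vermaE i * vermaF j - vermaF j * vermaE i =
  ((i == j)%:R / (qi i - (qi i)^-1)) *: (vermaK i - vermaKV i).
Proof.
apply: endoP => u; rewrite endoB !endoM endoZ endoB /= /vermaF_fun /skewp /skewn !skew_E.
rewrite -/(rootp j) -/(rootn j) -/hsc; case: (eqVneq i j) => [->|_].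
  set a := skew _ _ _ _ _ _ _ u; set b := skew _ _ _ _ _ _ _ u.
  by set c := scaling _ _ _ _ u; set d := scaling _ _ _ _ u; rewrite mulr1n mul1r; nc; ring.
set a := skew _ _ _ _ _ _ _ u; set b := skew _ _ _ _ _ _ _ u.
by rewrite !addr0 mul0r scale0r; nc; ring.
Qed.

Lemma vermaKF i j : vermaK i * vermaF j = qi i ^ (- A i j) *: (vermaF j * vermaK i).
Proof.
apply: endoP => u; rewrite endoZ !endoM /= /vermaF_fun /skewp /skewn /hsc.
rewrite scalingZ -scaleN1r scalingD !scalingZ !skew_scaling ?rootp_neq0 //.
rewrite -invr_expz -/(skew_weight A qi i j) -/(rootp i j) !skewZ.
set a := skew _ _ _ _ _ _ _ _; set b := skew _ _ _ _ _ _ _ _.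
by nc; ring.
Qed.

(** The F-Serre elements cannot be computed directly; but they kill 1 and commute with all E_l,
    which generate the module from 1. *)
Lemma verma_relations r : uq_rel A qi vermaE vermaF vermaK vermaKV r -> r = 0.
Proof.
case=> [i|i|i j|i j|i j|i j|i j ij|i j ij].
- by rewrite vermaKKV subrr.
- by rewrite vermaKVK subrr.
- apply/eqP; rewrite subr_eq0; apply/eqP/endoP => u; rewrite !endoM /= /hsc !scalingZ.
  rewrite !scaling_comp !scalerA [la i * _]mulrC; congr (_ *: _).
  by apply: eq_scaling => l; apply: mulrC.
- apply/eqP; rewrite subr_eq0; apply/eqP/endoP => u; rewrite endoZ !endoM /= /hsc scalingM scaling_E.
  by rewrite -scalerAl -scalerAr !scalerA mulrC.
- by rewrite vermaKF subrr.
- by rewrite vermaEF subrr.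
- apply: endoP => u; rewrite endo0 -[u]mul1r.
  have h X Y N v : serre (qi i) N (vermaE X) (vermaE Y) v = serre (qi i) N (E X) (E Y) * v.
    rewrite /serre endo_sum mulr_suml; apply: eq_bigr => l _.
    rewrite endoZ -scalerAl !endoM; congr (_ *: _).
    have hX m w : (vermaE X ^+ m) w = E X ^+ m * w.
      elim: m => [|m IH]; first by rewrite mul1r.
      transitivity (vermaE X ((vermaE X ^+ m) w)); first by rewrite exprS.
      by rewrite IH exprS -mulrA.
    by rewrite !hX /= !mulrA.
  by rewrite h (ups_serre hM) // mul0r.
- set S := serre _ _ _ _; apply: endoP => u; rewrite endo0.
  have S1 : S 1 = 0.
    rewrite /S /serre endo_sum big1 // => l _; rewrite endoZ !endoM.
    case: l => [|l]; rewrite ?expr0 ?endo1 ?vermaF_one ?endo0_arg ?scaler0 //.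
    have -> : (vermaF i ^+ l.+1) 1 = (vermaF i ^+ l) (vermaF i 1) by rewrite exprSr.
    by rewrite vermaF_one !endo0_arg scaler0.
  have hS l : vermaE l * S = S * vermaE l.
    apply: (serreF_commutes hA hq vermaKKV vermaKVK vermaKF) => //; exact: vermaEF.
  elim/(ups_ind hM): u => [//|l u IH|u v IHu IHv|c u IH].
  - by rewrite -[E l * u]/(vermaE l u) -endoM -hS endoM IH endo0_arg.
  - by rewrite endoD_arg IHu IHv addr0.
  - by rewrite endoZ_arg IH scaler0.
Qed.

Definition verma : {lrmorphism U -> EndM} := sval (cid (uqs_lift hU verma_relations)).

Let vermaP i : [/\ verma (uE i) = vermaE i, verma (uF i) = vermaF i,
  verma (uK i) = vermaK i & verma (uKV i) = vermaKV i].
Proof. exact: (svalP (cid (uqs_lift hU verma_relations)) i). Qed.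

Lemma verma_E i u : verma (uE i) u = E i * u. Proof. by case: (vermaP i) => ->. Qed.
Lemma verma_K i u : verma (uK i) u = la i *: hsc (rootp i) u.
Proof. by case: (vermaP i) => _ _ ->. Qed.
Lemma verma_KV i u : verma (uKV i) u = (la i)^-1 *: hsc (rootn i) u.
Proof. by case: (vermaP i) => _ _ _ ->. Qed.

Lemma verma1 w : verma 1 w = w. Proof. by rewrite rmorph1. Qed.
Lemma vermaM x y w : verma (x * y) w = verma x (verma y w). Proof. by rewrite rmorphM. Qed.
Lemma vermaD x y w : verma (x + y) w = verma x w + verma y w. Proof. by rewrite rmorphD. Qed.
Lemma vermaZ c x w : verma (c *: x) w = c *: verma x w. Proof. by rewrite linearZ. Qed.

Lemma verma_incl (h : {lrmorphism M -> U}) : (forall i, h (E i) = uE i) ->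
  forall u v, verma (h u) v = u * v.
Proof.
move=> hh u v; elim/(ups_ind hM): u => [|i u IH|u w IHu IHw|c u IH].
- by rewrite rmorph1 verma1 mul1r.
- by rewrite rmorphM /= hh vermaM verma_E IH mulrA.
- by rewrite rmorphD /= vermaD IHu IHw mulrDl.
- by rewrite linearZ /= vermaZ IH scalerAl.
Qed.

End Verma.

(** * Weights *)

Section Form.
Context (n : nat) (A : 'M[int]_n) (eps : 'I_n -> nat) (hA : gcm A eps).
Local Notation Bf := (bform A eps).
Local Notation lattice := 'rV[int]_n.

Lemma simpleE i j : (simple i : lattice) 0 j = (j == i)%:R.
Proof. by rewrite mxE eqxx. Qed.

Lemma bformDl (u v w : lattice) : Bf (u + v) w = Bf u w + Bf v w.
Proof.
rewrite /bform -big_split; apply: eq_bigr => i _; rewrite -big_split; apply: eq_bigr => j _.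
by rewrite mxE /=; ring.
Qed.

Lemma bformZl c (v w : lattice) : Bf (c *: v) w = c * Bf v w.
Proof.
rewrite /bform mulr_sumr; apply: eq_bigr => i _; rewrite mulr_sumr; apply: eq_bigr => j _.
by rewrite mxE /=; ring.
Qed.

Lemma bformC (v w : lattice) : Bf v w = Bf w v.
Proof.
rewrite /bform exchange_big /=; apply: eq_bigr => i _; apply: eq_bigr => j _.
by rewrite [_%:Z * A i j](cartan_sym hA); ring.
Qed.

Lemma bformDr (u v w : lattice) : Bf w (u + v) = Bf w u + Bf w v.
Proof. by rewrite ![Bf w _]bformC bformDl. Qed.
Lemma bformZr c (v w : lattice) : Bf w (c *: v) = c * Bf w v.
Proof. by rewrite ![Bf w _]bformC bformZl. Qed.
Lemma bformNl (v w : lattice) : Bf (- v) w = - Bf v w.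
Proof. by rewrite -scaleN1r bformZl mulN1r. Qed.
Lemma bformNr (v w : lattice) : Bf w (- v) = - Bf w v.
Proof. by rewrite -scaleN1r bformZr mulN1r. Qed.
Lemma bform0l (w : lattice) : Bf 0 w = 0.
Proof. by rewrite -(scale0r (0 : lattice)) bformZl mul0r. Qed.
Lemma bform0r (w : lattice) : Bf w 0 = 0.
Proof. by rewrite bformC bform0l. Qed.

Lemma bform_simple i j : Bf (simple i) (simple j) = (eps i)%:Z * A i j.
Proof.
rewrite /bform (bigD1 i) //= [X in _ + X]big1 => [|k hk]; last first.
  by rewrite big1 // => l _; rewrite simpleE (negPf hk) !mul0r.
rewrite addr0 (bigD1 j) //= [X in _ + X]big1 => [|k hk]; last first.
  by rewrite [simple j 0 k]simpleE (negPf hk) mulr0 mul0r.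
by rewrite addr0 !simpleE !eqxx !mul1r.
Qed.

Lemma bform_coord (v w : lattice) : Bf v w = \sum_k v 0 k * Bf (simple k) w.
Proof.
rewrite {1}/bform; apply: eq_bigr => k _.
have -> : Bf (simple k) w = \sum_l w 0 l * ((eps k)%:Z * A k l).
  rewrite /bform (bigD1 k) //= [X in _ + X]big1 => [|l hl]; last first.
    by rewrite big1 // => m _; rewrite simpleE (negPf hl) !mul0r.
  by rewrite addr0; apply: eq_bigr => l _; rewrite simpleE eqxx mul1r.
by rewrite [RHS]mulr_sumr; apply: eq_bigr => l _; rewrite -mulrA.
Qed.

Lemma pairing_bform k (v : lattice) : (eps k)%:Z * pairing A v (simple k) = Bf v (simple k).
Proof.
rewrite bformC /pairing /bform (bigD1 k) //= [X in _ * (_ + X)]big1 => [|l hl]; last first.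
  by rewrite big1 // => m _; rewrite simpleE (negPf hl) !mul0r.
rewrite [RHS](bigD1 k) //= [X in _ = _ + X]big1 => [|l hl]; last first.
  by rewrite big1 // => m _; rewrite simpleE (negPf hl) !mul0r.
rewrite !addr0 mulr_sumr; apply: eq_bigr => l _.
by rewrite simpleE eqxx; ring.
Qed.

Lemma bform_refl k (u v : lattice) : Bf (refl_root A k u) (refl_root A k v) = Bf u v.
Proof.
rewrite /refl_root !(bformDl, bformDr, bformNl, bformNr, bformZl, bformZr).
rewrite -[Bf u (simple k)]pairing_bform (bformC (simple k) v) -[Bf v (simple k)]pairing_bform.
by rewrite bform_simple (cartan_diag hA); ring.
Qed.

Lemma bform_weyl w (u v : lattice) : Bf (weyl_root A w u) (weyl_root A w v) = Bf u v.
Proof. by elim: w => //= k w IH; rewrite bform_refl. Qed.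

Lemma refl_rootK k : involutive (refl_root A k).
Proof.
move=> u; rewrite /refl_root; set a := pairing A u _.
have -> : pairing A (u - a *: simple k) (simple k) = - a.
  have he : (eps k)%:Z != 0 :> int by have := cartan_eps hA k; lia.
  apply: (mulfI he); rewrite pairing_bform bformDl bformNl bformZl -pairing_bform.
  by rewrite bform_simple (cartan_diag hA) -/a; ring.
by rewrite scaleNr opprK subrK.
Qed.

Lemma weyl_revK w u : weyl_root A (rev w) (weyl_root A w u) = u.
Proof.
elim: w u => [|k w IH] u //; rewrite rev_cons -cats1 /weyl_root foldr_cat /=.
by rewrite refl_rootK; apply: IH.
Qed.

Lemma refl_rootD k (u v : lattice) : refl_root A k (u + v) = refl_root A k u + refl_root A k v.
Proof.
rewrite /refl_root; have -> : pairing A (u + v) (simple k) = pairing A u (simple k) + pairing A v (simple k).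
  rewrite /pairing -big_split; apply: eq_bigr => i _; rewrite -big_split; apply: eq_bigr => j _.
  by rewrite [(u + v) 0 j]mxE /=; ring.
by rewrite scalerDl opprD addrACA.
Qed.

Lemma weyl_rootD w (u v : lattice) : weyl_root A w (u + v) = weyl_root A w u + weyl_root A w v.
Proof. by elim: w => //= k w ->; rewrite refl_rootD. Qed.
Lemma weyl_rootN w (u : lattice) : weyl_root A w (- u) = - weyl_root A w u.
Proof.
apply: (addIr (weyl_root A w u)); rewrite -weyl_rootD !addNr.
have h := weyl_rootD w 0 0; rewrite addr0 in h.
by apply: (addIr (weyl_root A w 0)); rewrite add0r -h.
Qed.

End Form.

(** * Weight strings in sl2-modules *)

Section ModuleInjectivity.
Context (F : fieldType) (q : F) (hq : not_root_of_unity q).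
Context (V : lmodType F) (e f : V -> V) (P : int -> V -> Prop).
Context (eD : forall c u v, e (c *: u + v) = c *: e u + e v).
Context (fD : forall c u v, f (c *: u + v) = c *: f u + f v).
Context (Pe : forall m v, P m v -> P (m + 2) (e v)).
Context (Pf : forall m v, P m v -> P (m - 2) (f v)).
Context (hef : forall m v, P m v -> e (f v) - f (e v) = qint q m *: v).

Let e0 : e 0 = 0.
Proof.
have h : e 0 = e 0 + e 0 by have := eD 1 0 0; rewrite scaler0 addr0 scale1r.
by apply: (addrI (e 0)); rewrite -h addr0.
Qed.
Let f0 : f 0 = 0.
Proof.
have h : f 0 = f 0 + f 0 by have := fD 1 0 0; rewrite scaler0 addr0 scale1r.
by apply: (addrI (f 0)); rewrite -h addr0.
Qed.

Lemma iter_lower0 s : iter s f 0 = 0.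
Proof. by elim: s => //= s ->; rewrite f0. Qed.

Lemma iter_lower_wt m v s : P m v -> P (m - 2 * s%:Z) (iter s f v).
Proof.
elim: s => [|s IH] h /=; first by rewrite mulr0 subr0.
by rewrite (_ : m - 2 * s.+1%:Z = m - 2 * s%:Z - 2); [apply: Pf; apply: IH|lia].
Qed.

Lemma raise_lower m v s : P m v ->
  e (iter s f v) = iter s f (e v) + (qint q s%:Z * qint q (m - s%:Z + 1)) *: iter s.-1 f v.
Proof.
move=> h; elim: s => [|s IH] /=; first by rewrite /qint subrr !mul0r scale0r addr0.
have -> : e (f (iter s f v)) = f (e (iter s f v)) + qint q (m - 2 * s%:Z) *: iter s f v.
  by rewrite -(hef (iter_lower_wt s h)) addrC subrK.
have -> : f (e (iter s f v)) = f (iter s f (e v)) +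
    (qint q s%:Z * qint q (m - s%:Z + 1)) *: iter s f v.
  rewrite IH addrC fD addrC; congr (_ + _).
  by case: s {IH} => [|s] //=; rewrite /qint subrr !mul0r !scale0r.
rewrite -addrA -scalerDl; congr (_ + _ *: _).
have q0 := q_neq0 hq; have d0 := q_sub_inv_neq0 hq.
have es : q ^ s.+1%:Z = q * q ^ s%:Z by rewrite -exprnP exprS.
have e2 : q ^ (m - 2 * s%:Z) = q ^ m / (q ^ s%:Z * q ^ s%:Z).
  by rewrite -!expfzDr // invr_expz -expfzDr //; congr (_ ^ _); lia.
have e3 : q ^ (m - s%:Z + 1) = q ^ m / q ^ s%:Z * q.
  by rewrite expfzDr // expfzDr // invr_expz expr1z.
have e4 : q ^ (m - s.+1%:Z + 1) = q ^ m / q ^ s%:Z.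
  by rewrite invr_expz -!expfzDr //; congr (_ ^ _); lia.
have qq1 : q * q - 1 != 0.
  apply: contra_neq d0 => h'; have -> : q - q^-1 = (q * q - 1) / q by field.
  by rewrite h' mul0r.
rewrite /qint -!invr_expz es e2 e3 e4.
have := qz_neq0 hq m; have := qz_neq0 hq s%:Z; move: (q ^ m) (q ^ s%:Z) => z x hx hz.
by field; rewrite qq1 q0 hx hz.
Qed.

(** The vector e v has weight m + 2 and is killed by f^(m+2), so induction on r gives e v = 0. Then
    the coefficients [s+1][m-s] of [raise_lower] are nonzero all the way from f^m v down to v. *)
Lemma lower_injective (m : nat) v r : P m%:Z v -> iter r e v = 0 -> iter m f v = 0 -> v = 0.
Proof.
elim: r m v => [|r IH] m v hP he hf //.
have ev0 : e v = 0.
  apply: (IH m.+2); first by rewrite (_ : m.+2%:Z = m%:Z + 2); [apply: Pe|lia].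
    by rewrite -iterSr.
  have := raise_lower m.+2 hP; rewrite /= hf f0 f0 e0 scaler0 addr0 => h.
  by rewrite /= h.
suff h t : (t <= m)%N -> iter (m - t) f v = 0 by have := h m (leqnn m); rewrite subnn.
elim: t => [|t IHt] ht; first by rewrite subn0.
have := IHt (ltnW ht); have -> : (m - t = (m - t.+1).+1)%N by lia.
set s := (m - t.+1)%N => hs; have := raise_lower s.+1 hP.
rewrite hs e0 ev0 iter_lower0 add0r => /esym/eqP; rewrite scaler_eq0 => /orP[|/eqP //].
have hc : qint q s.+1%:Z * qint q (m%:Z - s.+1%:Z + 1) != 0.
  by rewrite mulf_neq0 //; apply: qint_neq0 => //; rewrite /s; lia.
by rewrite (negPf hc).
Qed.

End ModuleInjectivity.

(** * Weights, the embedded positive part and the adjoint action *)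

Section QuantumGroupRelations.
Context (n : nat) (A : 'M[int]_n) (eps : 'I_n -> nat) (hA : gcm A eps).
Context (F : fieldType) (q : F) (hq : not_root_of_unity q).
Local Notation qi := (qfam eps q).
Local Notation Bf := (bform A eps).
Local Notation lattice := 'rV[int]_n.
Context (U : algType F) (E Fm K KV : 'I_n -> U) (hU : uq_spec A qi E Fm K KV).

Let hqi i : not_root_of_unity (qi i). Proof. exact: (qfam_root hA). Qed.
Let rel0 (u v : U) : uq_rel A qi E Fm K KV (u - v) -> u = v.
Proof. by move/(uqs_rel hU)/eqP; rewrite subr_eq0 => /eqP. Qed.

Lemma rKKV i : K i * KV i = 1. Proof. exact/rel0/uq_KKV. Qed.
Lemma rKVK i : KV i * K i = 1. Proof. exact/rel0/uq_KVK. Qed.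
Lemma rKK i j : K i * K j = K j * K i. Proof. exact/rel0/uq_KK. Qed.
Lemma rEF i j : E i * Fm j - Fm j * E i =
  ((i == j)%:R / (qi i - (qi i)^-1)) *: (K i - KV i).
Proof. exact/rel0/uq_EF. Qed.
Lemma rEE i j : i != j -> serre (qi i) `|1 - A i j|%N (E i) (E j) = 0.
Proof. by move=> ij; apply/(uqs_rel hU)/uq_serreE. Qed.
Lemma rFF i j : i != j -> serre (qi i) `|1 - A i j|%N (Fm i) (Fm j) = 0.
Proof. by move=> ij; apply/(uqs_rel hU)/uq_serreF. Qed.
Lemma rEF_comm i j : i != j -> E i * Fm j = Fm j * E i.
Proof. by move=> ij; apply/eqP; rewrite -subr_eq0 rEF (negPf ij) mul0r scale0r. Qed.

Lemma qi_bform i (v : lattice) : qi i ^ pairing A v (simple i) = q ^ Bf (simple i) v.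
Proof. by rewrite (bformC hA) -(pairing_bform hA) /qfam exprnP exprz_exp. Qed.
Lemma qi_simple i j : qi i ^ A i j = q ^ Bf (simple i) (simple j).
Proof. by rewrite bform_simple /qfam exprnP exprz_exp. Qed.

(** Records only the commutation with the K_k, hence g at best up to the radical of the form;
    [graded] below is finer. *)
Definition wt (g : lattice) (u : U) : Prop :=
  forall k, K k * u = q ^ Bf (simple k) g *: (u * K k).

Lemma wt_E i : wt (simple i) (E i).
Proof. by move=> k; rewrite -qi_simple; apply/rel0/uq_KE. Qed.
Lemma wt_F i : wt (- simple i) (Fm i).
Proof. by move=> k; rewrite (bformNr hA) -invr_expz -qi_simple invr_expz; apply/rel0/uq_KF. Qed.
Lemma wt_K i : wt 0 (K i).
Proof. by move=> k; rewrite (bform0r hA) expr0z scale1r rKK. Qed.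
Lemma wt_1 : wt 0 1.
Proof. by move=> k; rewrite (bform0r hA) expr0z scale1r mulr1 mul1r. Qed.
Lemma wt_0 g : wt g 0. Proof. by move=> k; rewrite mulr0 mul0r scaler0. Qed.
Lemma wtD g u v : wt g u -> wt g v -> wt g (u + v).
Proof. by move=> hu hv k; rewrite mulrDr hu hv mulrDl scalerDr. Qed.
Lemma wtZ g c u : wt g u -> wt g (c *: u).
Proof. by move=> hu k; rewrite -scalerAr hu -scalerAl !scalerA mulrC. Qed.
Lemma wtM g h u v : wt g u -> wt h v -> wt (g + h) (u * v).
Proof.
move=> hu hv k; rewrite (mulrA (K k)) hu -scalerAl -(mulrA u (K k)) hv -scalerAr scalerA (mulrA u).
by rewrite (bformDr hA) expfzDr ?q_neq0.
Qed.
Lemma wtB g u v : wt g u -> wt g v -> wt g (u - v).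
Proof. by move=> hu hv; rewrite -scaleN1r; apply/wtD/wtZ. Qed.

Lemma wt_V g u k : wt g u -> KV k * u = q ^ (- Bf (simple k) g) *: (u * KV k).
Proof.
move=> /(_ k) h; rewrite -invr_expz.
exact: (triple_inv (rKKV k) (rKVK k) (qz_neq0 hq _) h).
Qed.

Lemma wt_KV i : wt 0 (KV i).
Proof.
move=> k; rewrite (bform0r hA) expr0z scale1r.
have := wt_V i (wt_K k); rewrite (bform0r hA) oppr0 expr0z scale1r => ->.
by [].
Qed.

Definition kz (i : 'I_n) (m : int) : U :=
  match m with Posz k => K i ^+ k | Negz k => KV i ^+ k.+1 end.
Definition kbeta (be : lattice) : U := \prod_i kz i (be 0 i).

Lemma kz_wt g u i m : wt g u -> kz i m * u = q ^ (m * Bf (simple i) g) *: (u * kz i m).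
Proof.
move=> h.
have pow (k : U) (t : F) (m' : nat) : k * u = t *: (u * k) -> k ^+ m' * u = t ^+ m' *: (u * k ^+ m').
  move=> hk; elim: m' => [|m' IH]; first by rewrite scale1r mul1r mulr1.
  by rewrite exprS -(mulrA k) IH -scalerAr (mulrA k) hk -scalerAl scalerA -(mulrA u) -exprSr.
case: m => m /=; first by rewrite (pow _ _ _ (h i)) exprnP exprz_exp mulrC.
rewrite (pow _ _ _ (wt_V i h)) exprnP exprz_exp; congr (q ^ _ *: _).
by rewrite NegzE; ring.
Qed.

Lemma kbeta_wt g u be : wt g u -> kbeta be * u = q ^ Bf be g *: (u * kbeta be).
Proof.
move=> h; rewrite /kbeta [Bf be g]bform_coord.
elim: (index_enum _) => [|i s IH]; first by rewrite !big_nil expr0z scale1r mul1r mulr1.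
rewrite !big_cons -(mulrA (kz _ _)) IH -scalerAr (mulrA (kz _ _)) (kz_wt _ _ h) -scalerAl scalerA -(mulrA u).
by rewrite mulrC -expfzDr ?q_neq0.
Qed.

Section Inclusion.
Context (M : algType F) (upE : 'I_n -> M) (hM : up_spec A qi upE).

Definition incl : {lrmorphism M -> U} := sval (cid (ups_lift hM rEE)).
Lemma inclE i : incl (upE i) = E i. Proof. exact: (svalP (cid (ups_lift hM rEE)) i). Qed.

Context (la : 'I_n -> F) (la0 : forall i, la i != 0).
Definition rho_la := verma hA hq hM hU la0.

Lemma rho_incl u : rho_la (incl u) 1 = u.
Proof. by rewrite /rho_la (verma_incl _ _ _ _ _ inclE) mulr1. Qed.

Lemma rho_kbeta be : rho_la (kbeta be) 1 = (\prod_i la i ^ be 0 i) *: 1.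
Proof.
have hz i m : rho_la (kz i m) 1 = la i ^ m *: 1.
  have pow (k : U) t (m' : nat) : rho_la k 1 = t *: 1 -> rho_la (k ^+ m') 1 = t ^+ m' *: 1.
    move=> hk; elim: m' => [|m' IH]; first by rewrite expr0 /rho_la verma1 scale1r.
    by rewrite exprSr /rho_la vermaM -/rho_la hk endoZ_arg IH scalerA exprS.
  case: m => m /=; first by apply: pow; rewrite /rho_la verma_K rmorph1.
  rewrite NegzE -invr_expz -exprnP -exprVn.
  by apply: pow; rewrite /rho_la verma_KV rmorph1.
rewrite /kbeta; elim: (index_enum _) => [|i s IH]; first by rewrite !big_nil /rho_la verma1 scale1r.
by rewrite !big_cons /rho_la vermaM -/rho_la IH endoZ_arg hz scalerA mulrC.
Qed.

End Inclusion.

(** On the lowest weight vector of a suitable Verma module K_be acts by t, so t a + t^-1 b = 0; the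
    values t = 1 and t = q suffice. *)
Lemma incl_separate (M : algType F) (upE : 'I_n -> M) (hM : up_spec A qi upE) (be : lattice) i a b :
    be 0 i = 1 ->
    incl hM a * kbeta be + incl hM b * kbeta (- be) = 0 -> a = 0 /\ b = 0.
Proof.
move=> hb h.
have q0 := q_neq0 hq.
have key (t : F) : t != 0 -> t *: a + t^-1 *: b = 0.
  move=> t0; have la0 k : (if k == i then t else 1) != 0 by case: (k == i); rewrite ?oner_neq0.
  have hp (g : lattice) : \prod_k (if k == i then t else 1) ^ g 0 k = t ^ g 0 i.
    rewrite (bigD1 i) //= eqxx big1 ?mulr1 // => k /negPf ->; exact: exp1rz.
  have := congr1 (fun u => rho_la hM la0 u 1) h.
  rewrite /rho_la vermaD !vermaM raddf0 endo0 -/(rho_la _ _) !rho_kbeta !endoZ_arg !rho_incl !hp.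
  by rewrite mxE hb expr1z exprN1.
have h1 := key 1 (oner_neq0 _); rewrite invr1 !scale1r in h1.
have h2 := key q q0.
have ha : (q - q^-1) *: a = 0.
  by rewrite scalerBl -[X in _ - X]opprK -scalerN (_ : - a = b) ?opprK //; apply/eqP;
     rewrite eq_sym -addr_eq0 addrC h1.
move/eqP: ha; rewrite scaler_eq0 (negPf (q_sub_inv_neq0 hq)) /= => /eqP ha.
by split=> //; move: h1; rewrite ha add0r.
Qed.

Lemma qops_lrmorphism (C D : algType F) (h : {lrmorphism C -> D}) X cs Y :
  h (qops X cs Y) = qops (h X) cs (h Y).
Proof. by elim: cs => //= c cs <-; rewrite /qop raddfB /= linearZ /= !rmorphM. Qed.

(** Let S be the Serre element of X = T(E_i) and F_j K_j. It lies in the positive part because the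
    first q-commutator already does; it commutes with T(F_i) and has weight p + 2 for the
    transported triple; and it is q-nilpotent because [y] is so for E_i. So [highest_nilpotent]
    gives S = 0. Dropping K_j from F_j K_j and multiplying X by K_i^-1 rescale the constants of the
    q-commutators by the same factor. *)
Lemma serre_transport (M : algType F) (upE : 'I_n -> M) (hM : up_spec A qi upE)
    (T : {lrmorphism U -> U}) (i j : 'I_n) (p : nat) (be : lattice) (xi eta : M) (y : U) :
    A i j = - p%:Z -> be 0 i = 1 -> T (E i) = incl hM xi -> wt be (T (E i)) ->
    T (K i) = kbeta be -> T (KV i) = kbeta (- be) ->
    Bf be (simple j) = - ((eps i)%:Z * A i j) ->
    T (E i) * Fm j - Fm j * T (E i) = incl hM eta * KV j ->
    T (Fm i) * (Fm j * K j) = Fm j * K j * T (Fm i) ->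
    T y = Fm j * K j -> qnil (E i) y ->
  serre (qi i) p.+1 (T (E i) * KV i) (Fm j) = 0.
Proof.
move=> hp hbi hX hwX hTK hTKV hbj hXF hX' hy hnil.
have qi0 := q_neq0 (hqi i).
set X := T (E i) in hX hwX hXF *; set phi := Fm j * K j in hX' hy.
have hKKV : T (K i) * T (KV i) = 1 by rewrite -rmorphM rKKV rmorph1.
have hKVK : T (KV i) * T (K i) = 1 by rewrite -rmorphM rKVK rmorph1.
have hKE : T (K i) * X = qi i ^+ 2 *: (X * T (K i)).
  by rewrite -!rmorphM /= wt_E -qi_simple (cartan_diag hA) linearZ.
have hEF : X * T (Fm i) - T (Fm i) * X = (qi i - (qi i)^-1)^-1 *: (T (K i) - T (KV i)).
  by rewrite -!rmorphM -raddfB /= rEF eqxx mul1r linearZ /= raddfB.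
have hKphi : T (K i) * phi = qi i ^- p *: (phi * T (K i)).
  have := kbeta_wt be (wtM (wt_F j) (wt_K j)); rewrite -hTK -/phi => ->.
  by rewrite addr0 (bformNr hA) hbj opprK hp exprnN /qfam exprnP exprz_exp.
have hjX : K j * X = qi i ^+ p *: (X * K j).
  rewrite hwX (bformC hA) hbj hp /qfam; congr (_ *: _).
  by rewrite mulrN opprK -PoszM -exprnP exprM.
set S := serre (qi i) p.+1 X phi.
have hcs : qi i ^ (1 - p.+1%:Z) = qi i ^- p by rewrite exprnN; congr (_ ^ _); lia.
have hS : S = qops X (qgeom (qi i) (qi i ^- p) p.+1) phi by rewrite /S serreE // hcs.
have Simg : exists s, S = incl hM s.
  rewrite hS /qgeom /= mulr1 -qops_qop.
  have -> : qop X (qi i ^- p) phi = incl hM eta.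
    have e1 : qi i ^- p * qi i ^+ p = 1 by rewrite mulVf // expf_neq0.
    rewrite /qop /phi -(mulrA (Fm j) (K j)) hjX -scalerAr scalerA e1 scale1r.
    by rewrite !mulrA -mulrBl hXF -mulrA rKVK mulr1.
  exists (qops xi [seq qi i ^- p * qi i ^+ (2 * t) | t <- iota 1 p] eta).
  by rewrite qops_lrmorphism -hX.
have S0 : S = 0.
  apply: (highest_nilpotent (hqi i) hKKV hKVK hKE hEF (half := fun u => exists s, u = incl hM s)
     _ _ _ _ _ _ (w := p.+2) _ Simg).
  - by exists 0; rewrite raddf0.
  - by move=> _ _ [s ->] [s' ->]; exists (s + s'); rewrite raddfD.
  - by move=> c _ [s ->]; exists (c *: s); rewrite linearZ.
  - by move=> _ [s ->]; exists (xi * s); rewrite rmorphM /= -hX.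
  - by move=> _ [s ->]; exists (s * xi); rewrite rmorphM /= -hX.
  - move=> _ _ [s ->] [s' ->]; rewrite hTK hTKV => /(incl_separate hbi) [-> ->].
    by rewrite !raddf0.
  - by [].
  - exact: (serre_commutes (hqi i) hKKV hKVK hKE hEF hX' hKphi).
  - have hp0 : qi i ^- p != 0 by rewrite invr_eq0 expf_neq0.
    have hT : T (K i) * S = (qi i ^- p * qi i ^+ (2 * p.+1)) *: (S * T (K i)).
      by rewrite hS; apply: triple_K.
    rewrite hT; congr (_ *: _).
    have -> : (2 * p.+1 = p + p.+2)%N by lia.
    by rewrite exprD mulrA mulVf ?mul1r // expf_neq0.
  - case: hnil => cs hcsy; exists cs; rewrite hS qops_comm -hy -qops_lrmorphism hcsy.
    by rewrite raddf0 qops0.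
have hXFj : qops X [seq c * qi i ^+ p | c <- qgeom (qi i) (qi i ^- p) p.+1] (Fm j) = 0.
  have := S0; rewrite hS /phi (qops_twistR _ _ hjX) => h.
  by rewrite -[LHS]mulr1 -(rKKV j) mulrA h mul0r.
rewrite serreE // hcs.
have het : KV i * Fm j = qi i ^- p *: (Fm j * KV i).
  by rewrite (wt_V i (wt_F j)) (bformNr hA) opprK -qi_simple hp exprnN.
have [a ->] := qops_twistL (qgeom (qi i) (qi i ^- p) p.+1)
  (invr_neq0 (expf_neq0 p qi0)) (wt_V i hwX) het.
under eq_map => c do rewrite invrK.
by rewrite hXFj mul0r scaler0.
Qed.

Local Notation EndU := (endo (oner_neq0 U)).
Context (adh : {lrmorphism U -> EndU}).
Context (adE : forall k u, adh (E k) u = E k * u - K k * u * KV k * E k).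
Context (adF : forall k u, adh (Fm k) u = (Fm k * u - u * Fm k) * K k).
Context (adK : forall k u, adh (K k) u = K k * u * KV k).
Context (adKV : forall k u, adh (KV k) u = KV k * u * K k).

Lemma adE_wt g u k : wt g u -> adh (E k) u = E k * u - q ^ Bf (simple k) g *: (u * E k).
Proof. by move=> h; rewrite adE h -scalerAl -(mulrA u) rKKV mulr1 -scalerAl. Qed.

Lemma adK_wt g u k : wt g u -> adh (K k) u = q ^ Bf (simple k) g *: u.
Proof. by move=> h; rewrite adK h -scalerAl -mulrA rKKV mulr1. Qed.

Lemma adKV_wt g u k : wt g u -> adh (KV k) u = q ^ (- Bf (simple k) g) *: u.
Proof. by move=> h; rewrite adKV (wt_V k h) -scalerAl -mulrA rKVK mulr1. Qed.

Lemma wt_adE g u k : wt g u -> wt (simple k + g) (adh (E k) u).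
Proof.
move=> h; rewrite (adE_wt _ h); apply: wtB; first exact: (wtM (wt_E k) h).
by apply: wtZ; rewrite addrC; apply: (wtM h (wt_E k)).
Qed.

Lemma adM x y u : adh (x * y) u = adh x (adh y u). Proof. by rewrite rmorphM. Qed.
Lemma adB x y u : adh (x - y) u = adh x u - adh y u. Proof. by rewrite raddfB. Qed.
Lemma adZ c x u : adh (c *: x) u = c *: adh x u. Proof. by rewrite linearZ. Qed.
Lemma adX x m u : adh (x ^+ m) u = iter m (adh x) u.
Proof.
elim: m u => [|m IH] u; first by rewrite rmorph1.
by rewrite exprS adM IH.
Qed.

Lemma ad_serre g u k p : wt g u -> q ^ Bf (simple k) g = qi k ^- p ->
  forall m, adh (E k ^+ m) u = qops (E k) (qgeom (qi k) (qi k ^- p) m) u.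
Proof.
move=> h hp; elim=> [|m IH]; first by rewrite expr0 rmorph1.
rewrite exprS adM IH qgeomS qops_rcons; set v := qops _ _ _.
have hv : K k * v = (qi k ^- p * qi k ^+ (2 * m)) *: (v * K k).
  have hKEk : K k * E k = qi k ^+ 2 *: (E k * K k) by rewrite wt_E -qi_simple (cartan_diag hA).
  have hp0 : qi k ^- p != 0 by rewrite invr_eq0 expf_neq0 // q_neq0.
  have hKu : K k * u = qi k ^- p *: (u * K k) by rewrite h hp.
  by apply: triple_K.
by rewrite adE hv -scalerAl -(mulrA v) rKKV mulr1 -scalerAl.
Qed.

Section HighestVector.
Context (X : {set 'I_n}) (i : 'I_n) (hi : i \notin X).

Definition content (w : seq 'I_n) : lattice := \sum_(k <- w) simple k.
Definition adw (w : seq 'I_n) : U := foldr (fun k u => adh (E k) u) (E i) w.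

Lemma content_cons k w : content (k :: w) = simple k + content w.
Proof. by rewrite /content big_cons. Qed.

Definition adspace (g : lattice) : U -> Prop :=
  Defs.span (fun v => exists w, [/\ word_in X w, content w = g & v = adw w]).

Lemma wt_adw w : wt (simple i + content w) (adw w).
Proof.
elim: w => [|k w IH]; first by rewrite /content big_nil addr0; apply: wt_E.
by rewrite content_cons addrCA; apply: wt_adE.
Qed.

Lemma adspace_wt g u : adspace g u -> wt (simple i + g) u.
Proof.
elim=> [v [w [_ <- ->]]||v w _ hv _ hw|c v _ hv].
- exact: wt_adw.
- exact: wt_0.
- exact: wtD.
- exact: wtZ.
Qed.

Lemma adspace_E g u k : k \in X -> adspace g u -> adspace (simple k + g) (adh (E k) u).
Proof.
move=> kX; elim=> [v [w [wX <- ->]]||v w _ hv _ hw|c v _ hv].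
- apply: span_in; exists (k :: w); split; rewrite ?content_cons //=.
  by rewrite kX wX.
- by rewrite endo0_arg; apply: span_0.
- by rewrite endoD_arg; apply: span_D.
- by rewrite endoZ_arg; apply: span_Z.
Qed.

Lemma ad_EF k l g u : wt g u ->
  adh (E k) (adh (Fm l) u) = adh (Fm l) (adh (E k) u) +
    ((k == l)%:R * qint (qi k) (pairing A g (simple k))) *: u.
Proof.
move=> h; have := congr1 (fun x => adh x u) (rEF k l).
rewrite /= adB !adM adZ adB (adK_wt _ h) (adKV_wt _ h).
move/eqP; rewrite subr_eq addrC => /eqP ->; congr (_ + _).
rewrite -scalerBl scalerA; congr (_ *: _); rewrite /qint -!invr_expz qi_bform.
by rewrite mulrAC -mulrA.
Qed.

Lemma adspace_F g u k : k \in X -> adspace g u -> adspace (g - simple k) (adh (Fm k) u).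
Proof.
move=> kX; elim=> [v [w [wX <- ->]]||v w _ hv _ hw|c v _ hv].
- elim: w wX => [|l w IH] /= => [_|/andP[lX wX]].
    rewrite adF rEF_comm; last by apply: contraNneq hi => ->.
    by rewrite subrr mul0r; apply: span_0.
  rewrite [adh (Fm k) _](_ : _ = adh (E l) (adh (Fm k) (adw w)) -
      ((l == k)%:R * qint (qi l) (pairing A (simple i + content w) (simple l))) *: adw w).
    rewrite content_cons -addrA; apply: span_D; first by apply: adspace_E => //; apply: IH.
    rewrite -scaleNr; case: (eqVneq l k) => [->|_]; last by rewrite mul0r oppr0 scale0r; apply: span_0.
    by apply: span_Z; apply: span_in; exists w; split=> //; rewrite addrC subrK.
  by rewrite (ad_EF l k (wt_adw w)) addrK.
- by rewrite endo0_arg; apply: span_0.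
- by rewrite endoD_arg; apply: span_D.
- by rewrite endoZ_arg; apply: span_Z.
Qed.

Lemma content_ge0 w k : 0 <= content w 0 k.
Proof.
by rewrite /content summxE sumr_ge0 // => l _; rewrite simpleE; case: (k == l).
Qed.

Lemma adspace_neg (g : lattice) u k : g 0 k < 0 -> adspace g u -> u = 0.
Proof.
move=> hg; elim=> [v [w [_ hw _]]||v w _ -> _ ->|c v _ ->].
- by move: hg; rewrite -hw ltNge content_ge0.
- by [].
- by rewrite addr0.
- by rewrite scaler0.
Qed.

Lemma adspace_iterF g u k s : k \in X -> adspace g u ->
  adspace (g - s%:Z *: simple k) (iter s (adh (Fm k)) u).
Proof.
move=> kX h; elim: s => [|s IH] /=; first by rewrite scale0r subr0.
have -> : s.+1%:Z = s%:Z + 1 by lia.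
by rewrite scalerDl scale1r opprD addrA; apply: adspace_F.
Qed.

Lemma adspace_iterE g u k s : k \in X -> adspace g u ->
  adspace (g + s%:Z *: simple k) (iter s (adh (E k)) u).
Proof.
move=> kX h; elim: s => [|s IH] /=; first by rewrite scale0r addr0.
have -> : s.+1%:Z = s%:Z + 1 by lia.
by rewrite scalerDl scale1r addrA addrC; apply: adspace_E.
Qed.

Lemma iterF_nil (g : lattice) u k : k \in X -> adspace g u -> exists r, iter r (adh (Fm k)) u = 0.
Proof.
move=> kX h; exists (absz (g 0 k)).+1.
apply: (adspace_neg (g := g - (absz (g 0 k)).+1%:Z *: simple k) (k := k)); last exact: adspace_iterF.
have -> : (g - (absz (g 0 k)).+1%:Z *: simple k) 0 k = g 0 k - (absz (g 0 k)).+1%:Z.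
  by rewrite mxE; congr (_ + _); rewrite mxE mxE simpleE eqxx mulr1.
by move: (g 0 k) => z; lia.
Qed.

(** On E_i itself this is a Serre relation. The Serre relation of E_k with E_l makes [qnil_left]
    available, which moves a high power of ad(E_k) past ad(E_l). *)
Lemma iterE_nil g u k : k \in X -> adspace g u -> exists r, iter r (adh (E k)) u = 0.
Proof.
move=> kX; elim=> [v [w [wX _ ->]]||v w _ [r hr] _ [r' hr']|c v _ [r hr]].
- elim: w wX => [|l w IH] /=.
    have ki : k != i by apply: contraNneq hi => <-.
    have [p hp hp1] := cartan_serre hA ki.
    exists p.+1; rewrite -adX (ad_serre (p := p) (wt_E i)); last first.
      by rewrite -qi_simple hp exprnN.
    have := rEE ki; rewrite hp1 serreE // (_ : qi k ^ (1 - p.+1%:Z) = qi k ^- p) //.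
    by rewrite exprnN; congr (_ ^ _); lia.
  case/andP=> lX /IH [r hr].
  have hl : qnil (E k) (E l).
    case: (eqVneq k l) => [->|kl]; first by exists [:: 1]; rewrite /= /qop scale1r subrr.
    have [p _ hp1] := cartan_serre hA kl.
    exists (qgeom (qi k) (qi k ^ (1 - p.+1%:Z)) p.+1).
    by rewrite -serreE // -hp1; apply: rEE.
  have [m [x hx]] := qnil_left r hl.
  by exists m; rewrite -adX -adM hx adM adX hr endo0_arg.
- by exists 0%N.
- exists (r + r')%N; rewrite -adX endoD_arg {1}addnC !exprD !adM !adX hr hr'.
  by rewrite -!adX !endo0_arg addr0.
- by exists r; rewrite -adX endoZ_arg adX hr scaler0.
Qed.

(** By local nilpotency and [lower_injective], the |m|-th power of ad(F_k), or of ad(E_k) if m < 0,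
    maps the weight space injectively into the reflected one. *)
Lemma adspace_refl g u k : k \in X -> adspace g u ->
  (forall v, adspace (refl_root A k (simple i + g) - simple i) v -> v = 0) -> u = 0.
Proof.
move=> kX hu h0.
set m := pairing A (simple i + g) (simple k).
have hg : refl_root A k (simple i + g) - simple i = g - m *: simple k.
  by rewrite /refl_root -/m addrAC [simple i + g]addrC addrK.
rewrite hg in h0.
pose P (s : int) (v : U) := exists2 g', adspace g' v & pairing A (simple i + g') (simple k) = s.
have pairD a b : pairing A (a + b) (simple k) = pairing A a (simple k) + pairing A b (simple k).
  have he : (eps k)%:Z != 0 :> int by have := cartan_eps hA k; lia.
  by apply: (mulfI he); rewrite mulrDr !(pairing_bform hA) (bformDl).
have pairk : pairing A (simple k) (simple k) = 2.
  have he : (eps k)%:Z != 0 :> int by have := cartan_eps hA k; lia.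
  by apply: (mulfI he); rewrite (pairing_bform hA) bform_simple (cartan_diag hA).
have pairN : pairing A (- simple k) (simple k) = - 2.
  have he : (eps k)%:Z != 0 :> int by have := cartan_eps hA k; lia.
  by apply: (mulfI he); rewrite (pairing_bform hA) bformNl bform_simple (cartan_diag hA) mulrN.
have PE s v : P s v -> P (s + 2) (adh (E k) v).
  case=> g' hg' <-; exists (simple k + g'); first exact: adspace_E.
  by rewrite !pairD pairk; ring.
have PF s v : P s v -> P (s - 2) (adh (Fm k) v).
  case=> g' hg' <-; exists (g' - simple k); first exact: adspace_F.
  by rewrite !pairD pairN; ring.
have PEF s v : P s v -> adh (E k) (adh (Fm k) v) - adh (Fm k) (adh (E k) v) = qint (qi k) s *: v.
  by case=> g' hg' <-; rewrite (ad_EF k k (adspace_wt hg')) eqxx mul1r addrC addKr.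
case: (lerP 0 m) => hm.
  have [r hr] := iterE_nil kX hu.
  apply: (lower_injective (hqi k) (endo_linear _) (endo_linear _) PE PF PEF (m := `|m|%N) _ hr).
    by exists g => //; rewrite gez0_abs.
  by apply: h0; have := adspace_iterF `|m|%N kX hu; rewrite gez0_abs.
have [r hr] := iterF_nil kX hu.
apply: (lower_injective (hqi k) (e := adh (Fm k)) (f := adh (E k)) (P := fun s v => P (- s) v) (endo_linear _) (endo_linear _) _ _ _
   (m := `|m|%N) _ hr).
- by move=> s v h; rewrite opprD; apply: PF.
- by move=> s v h; rewrite opprB addrC; apply: PE.
- move=> s v h; rewrite -opprB (PEF _ _ h) -scaleNr; congr (_ *: _).
  by rewrite /qint opprK -mulNr opprB.
- by exists g => //; rewrite ltz0_abs // opprK.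
by apply: h0; have := adspace_iterE `|m|%N kX hu; rewrite ltz0_abs // scaleNr.
Qed.

Lemma adspace_weyl w g u : word_in X w -> adspace g u ->
  (forall v, adspace (weyl_root A w (simple i + g) - simple i) v -> v = 0) -> u = 0.
Proof.
elim: w u => [|k w IH] u /= => [_ hu|/andP[kX wX] hu h].
  by rewrite [_ - _]addrC addKr => /(_ u hu).
apply: IH => // v hv; apply: (adspace_refl kX hv) => v'.
by rewrite [simple i + (_ - _)]addrC subrK; apply: h.
Qed.

(** The weight of ad(E_k)(x) is carried by [wX] to alpha_i - alpha_k', whose content is negative at
    k'. That weight space is 0, and by [adspace_weyl] so is ad(E_k)(x). *)
Lemma highest_vector w wX k k' : word_in X w -> word_in X wX -> k \in X -> k' != i ->
    weyl_root A wX (simple i + content w + simple k) = simple i - simple k' ->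
  E k * adw w = q ^ Bf (simple k) (simple i + content w) *: (adw w * E k).
Proof.
move=> hw hwX kX k'i hweyl; apply/eqP; rewrite -subr_eq0 -(adE_wt _ (wt_adw w)); apply/eqP.
have h : adspace (simple k + content w) (adh (E k) (adw w)).
  by apply: adspace_E => //; apply: span_in; exists w.
have e : simple i + (simple k + content w) = simple i + content w + simple k.
  by rewrite [simple k + _]addrC addrA.
apply: (adspace_weyl hwX h) => v; rewrite e hweyl addrAC subrr add0r.
by apply: (adspace_neg (k := k')); rewrite mxE simpleE eqxx.
Qed.

(** * Commutators of the adjoint monomials with F_i and F_j *)

Section MixedRelations.
Context (j : 'I_n) (hj : j \in X).

Let ij : i != j. Proof. by apply: contraNneq hi => ->. Qed.
Let Xi k : k \in X -> k != i. Proof. by move=> kX; apply: contraNneq hi => <-. Qed.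
Let q0 := q_neq0 hq.
Let di := qi i - (qi i)^-1.
Let dj := qi j - (qi j)^-1.
Local Notation B2 k l := (Bf (simple k) (simple l)).

(** Satisfies ad(E_w)(K_i^2) = zw K_i^2, so it is Z_i up to the scalar - v_i. It reappears as the
    K_i-part of the commutator of [adw w] with F_i. *)
Fixpoint zw (w : seq 'I_n) : U :=
  if w is k :: w' then
    E k * zw w' - q ^ (Bf (simple k) (content w') + 2 * B2 k i) *: (zw w' * E k)
  else 1.

(** The commutator of [adw w] with F_j is [yw] K_j^-1, and that of [zw w] is mu [Ww] K_j + [Vw]
    K_j^-1. The recursions result from letting ad(E_k) act on these identities; the source terms
    come from [E_j, F_j], hence from k = j. *)
Fixpoint yw (w : seq 'I_n) : U :=
  if w is k :: w' then
    let th := q ^ Bf (simple k) (simple i + content w') in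
    E k * yw w' - (th * q ^ (- B2 k j)) *: (yw w' * E k)
    + (if k == j then ((th - th^-1) / dj) *: adw w' else 0)
  else 0.

Fixpoint Ww (w : seq 'I_n) : U :=
  if w is k :: w' then
    E k * Ww w' - q ^ (Bf (simple k) (content w') + 2 * B2 k i + B2 k j) *: (Ww w' * E k)
    + (if k == j then q ^ Bf (simple j) (content w') *: zw w' else 0)
  else 0.

Fixpoint Vw (w : seq 'I_n) : U :=
  if w is k :: w' then
    E k * Vw w' - q ^ (Bf (simple k) (content w') + 2 * B2 k i - B2 k j) *: (Vw w' * E k)
    + (if k == j then ((q ^ (Bf (simple j) (content w') + 2 * B2 j i)
          - q ^ (- Bf (simple j) (content w'))) / dj) *: zw w' else 0)
  else 0.

Lemma adw_cons k w : adw (k :: w) =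
  E k * adw w - q ^ Bf (simple k) (simple i + content w) *: (adw w * E k).
Proof. by rewrite /= (adE_wt _ (wt_adw w)). Qed.

Lemma wt_zw w : wt (content w) (zw w).
Proof.
elim: w => [|k w IH] /=; first by rewrite /content big_nil; apply: wt_1.
rewrite content_cons; apply: wtB; first exact: (wtM (wt_E k) IH).
by apply: wtZ; rewrite addrC; apply: (wtM IH (wt_E k)).
Qed.

Lemma ad_zw w : adh (\prod_(k <- w) E k) (K i ^+ 2) = zw w * K i ^+ 2.
Proof.
elim: w => [|k w IH] /=; first by rewrite big_nil rmorph1 mul1r.
have hK : wt 0 (K i ^+ 2) by rewrite -[0]addr0; apply: (wtM (wt_K i) (wt_K i)).
have hz := wtM (wt_zw w) hK; rewrite addr0 in hz.
rewrite big_cons adM IH (adE_wt _ hz) mulrBl mulrA; congr (_ - _).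
have -> : zw w * K i ^+ 2 * E k = (q ^ (2 * B2 k i)) *: (zw w * E k * K i ^+ 2).
  have hKE : K i ^+ 2 * E k = q ^ (2 * B2 k i) *: (E k * K i ^+ 2).
    rewrite expr2 -(mulrA (K i)) wt_E -scalerAr (mulrA (K i) (E k)) wt_E -scalerAl scalerA -(mulrA (E k)).
    by rewrite -expfzDr // [B2 i k](bformC hA); congr (q ^ _ *: _); ring.
  by rewrite -(mulrA (zw w)) hKE -scalerAr mulrA.
by rewrite -scalerAl scalerA expfzDr.
Qed.

Lemma E_Fi k : k \in X -> E k * Fm i = Fm i * E k.
Proof. by move/Xi => ki; apply: rEF_comm. Qed.

Lemma adw_Fi w : word_in X w -> adw w * Fm i - Fm i * adw w =
  di^-1 *: (zw w * K i - (w == [::])%:R *: KV i).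
Proof.
elim: w => [_|k w IH]; first by rewrite rEF eqxx mul1r scale1r mul1r.
case/andP=> kX /IH h; rewrite adw_cons; have hE := E_Fi kX.
set th := q ^ _; set x := adw w in h *.
have -> : zw (k :: w) * K i - (k :: w == [::])%:R *: KV i =
    E k * (zw w * K i - (w == [::])%:R *: KV i)
    - th *: ((zw w * K i - (w == [::])%:R *: KV i) * E k).
  rewrite /= scale0r subr0 !mulrBl !mulrBr.
  have e1 : zw w * K i * E k = q ^ B2 k i *: (zw w * E k * K i).
    by rewrite -mulrA wt_E -scalerAr [B2 i k](bformC hA) mulrA.
  rewrite e1; case: eqP => [hw|_]; last first.
    rewrite !scale0r mulr0 mul0r !subr0 -scalerAl scalerA /th -expfzDr // mulrA.
    by congr (_ - q ^ _ *: _); rewrite (bformDr hA); ring.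
  have e2 : KV i * E k = q ^ (- B2 k i) *: (E k * KV i).
    by rewrite (wt_V i (wt_E k)) [B2 i k](bformC hA).
  rewrite !scale1r e2 hw /= /th hw /content big_nil addr0 (bform0r hA) add0r mul1r mulr1.
  rewrite scalerBr !scalerA -!expfzDr // subrr expr0z scale1r -scalerAl opprB addrA.
  by rewrite mul1r subrK; congr (_ - q ^ _ *: _); ring.
set r := _ - _ *: KV i in h *.
apply: (eq_certificate (z := E k * (x * Fm i - Fm i * x - di^-1 *: r)
   - th *: ((x * Fm i - Fm i * x - di^-1 *: r) * E k)
   + (E k * Fm i - Fm i * E k) * x - th *: (x * (E k * Fm i - Fm i * E k)))).
  by rewrite h hE !subrr !(mulr0, mul0r, scaler0, subr0, addr0).
by nc; ring.
Qed.

Lemma E_Fj k : E k * Fm j - Fm j * E k = if k == j then dj^-1 *: (K j - KV j) else 0.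
Proof. by rewrite rEF; case: eqP => [->|_]; rewrite ?mul1r // mul0r scale0r. Qed.

Lemma adw_Fj w : word_in X w -> adw w * Fm j - Fm j * adw w = yw w * KV j.
Proof.
elim: w => [_|k w IH]; first by rewrite /= mul0r (rEF_comm ij) subrr.
case/andP=> kX /IH h; rewrite adw_cons /=; have hx := wt_adw w.
have hE := E_Fj k; set th := q ^ _; set x := adw w in h hx *; set y := yw w in h *.
have th0 : th != 0 by apply: qz_neq0.
have hVE : KV j * E k = q ^ (- B2 k j) *: (E k * KV j).
  by rewrite (wt_V j (wt_E k)) [B2 j k](bformC hA).
set D := x * Fm j - Fm j * x - y * KV j; have hD : D = 0 by rewrite /D h subrr.
set r := if _ then _ else _ in hE.
have hr : r * x - th *: (x * r) = (if k == j then ((th - th^-1) / dj) *: x else 0) * KV j.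
  rewrite /r; case: eqP => [kj|_]; last by rewrite !mul0r mulr0 scaler0 subrr.
  have h1 : K j * x = th *: (x * K j) by rewrite hx /th kj.
  have h2 : KV j * x = th^-1 *: (x * KV j) by rewrite (wt_V j hx) /th kj invr_expz.
  apply: (eq_certificate (z := dj^-1 *: (K j * x - th *: (x * K j))
     - dj^-1 *: (KV j * x - th^-1 *: (x * KV j)))).
    by rewrite h1 h2 !subrr ?scaler0 ?subrr.
  by nc; ring.
rewrite [in RHS]mulrDl -hr.
apply: (eq_certificate (z := E k * D - th *: (D * E k) + (E k * Fm j - Fm j * E k - r) * x
   - th *: (x * (E k * Fm j - Fm j * E k - r))
   - th *: (y * (KV j * E k - q ^ (- B2 k j) *: (E k * KV j))))).
  by rewrite hD hE hVE !subrr !(mulr0, mul0r, scaler0, subr0, addr0).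
by rewrite /D; nc; ring.
Qed.

Definition mu := (1 - q ^ (2 * B2 i j)) / dj.

Lemma zw_Fj w : word_in X w ->
  zw w * Fm j - Fm j * zw w = mu *: (Ww w * K j) + Vw w * KV j.
Proof.
elim: w => [_|k w IH]; first by rewrite /= mul1r mulr1 subrr !mul0r scaler0 addr0.
case/andP=> kX /IH h /=; have hz := wt_zw w; have hE := E_Fj k.
set z := zw w in h hz *; set W := Ww w in h *; set V := Vw w in h *.
set eta := q ^ (_ + 2 * B2 k i).
have hKE : K j * E k = q ^ B2 k j *: (E k * K j) by rewrite wt_E [B2 j k](bformC hA).
have hVE : KV j * E k = q ^ (- B2 k j) *: (E k * KV j).
  by rewrite (wt_V j (wt_E k)) [B2 j k](bformC hA).
set D := z * Fm j - Fm j * z - (mu *: (W * K j) + V * KV j).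
have hD : D = 0 by rewrite /D h subrr.
have -> : q ^ (Bf (simple k) (content w) + 2 * B2 k i + B2 k j) = eta * q ^ B2 k j by rewrite expfzDr.
have -> : q ^ (Bf (simple k) (content w) + 2 * B2 k i - B2 k j) = eta * q ^ (- B2 k j) by rewrite expfzDr.
set r := if _ then _ else _ in hE.
set a := if k == j then _ *: z else 0; set b := if k == j then _ *: z else 0.
have hr : r * z - eta *: (z * r) = mu *: (a * K j) + b * KV j.
  rewrite /r /a /b; case: eqP => [kj|_]; last by rewrite !mul0r mulr0 !scaler0 subrr addr0.
  have h1 : K j * z = q ^ Bf (simple j) (content w) *: (z * K j) by rewrite hz.
  have h2 : KV j * z = q ^ (- Bf (simple j) (content w)) *: (z * KV j) by rewrite (wt_V j hz).
  have he : eta = q ^ Bf (simple j) (content w) * q ^ (2 * B2 i j).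
    by rewrite /eta kj expfzDr // [B2 j i](bformC hA).
  have -> : q ^ (Bf (simple j) (content w) + 2 * B2 j i) = eta by rewrite /eta kj.
  move: he h1 h2; rewrite /mu; clearbody eta.
  move: (q ^ Bf (simple j) (content w)) (q ^ (- Bf (simple j) (content w))) (q ^ (2 * B2 i j)).
  move=> qb qc q2 -> h1 h2.
  apply: (eq_certificate (z := dj^-1 *: (K j * z - qb *: (z * K j))
     - dj^-1 *: (KV j * z - qc *: (z * KV j)))).
    by rewrite h1 h2 !subrr ?scaler0 ?subrr.
  by clear; move: dj^-1 => d; nc; ring.
rewrite [in RHS]mulrDl [in RHS]mulrDl.
apply: (eq_certificate (z := E k * D - eta *: (D * E k) + (E k * Fm j - Fm j * E k - r) * z
   - eta *: (z * (E k * Fm j - Fm j * E k - r))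
   + (r * z - eta *: (z * r) - (mu *: (a * K j) + b * KV j))
   - (eta * mu) *: (W * (K j * E k - q ^ B2 k j *: (E k * K j)))
   - eta *: (V * (KV j * E k - q ^ (- B2 k j) *: (E k * KV j))))).
  by rewrite hD hE hKE hVE hr !subrr !(mulr0, mul0r, scaler0, subr0, addr0).
rewrite /D; clear; clearbody r a b z W V eta.
move: mu (q ^ B2 k j) (q ^ (- B2 k j)) => m Q1 Q2.
by nc; ring.
Qed.

(** The general formula, proved as [H], has an additional K_i^-1 term supported at the word
    [[:: j]]; this is the word that later has to be excluded. *)
Lemma yw_Fi w : word_in X w -> w != [:: j] ->
  yw w * Fm i - Fm i * yw w = (di^-1 * q ^ (- B2 i j)) *: (Vw w * K i).
Proof.
pose c0 := (q ^ B2 j i - (q ^ B2 j i)^-1) / dj.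
suff H : word_in X w -> yw w * Fm i - Fm i * yw w = (di^-1 * q ^ (- B2 i j)) *: (Vw w * K i)
    - (di^-1 * ((w == [:: j])%:R * c0)) *: KV i.
  by move=> wX /negPf hw; rewrite H // hw mul0r mulr0 scale0r subr0.
elim: w => [_|k w IH]; first by rewrite /= ?mulr0n !(mul0r, mulr0, scaler0, scale0r, subr0, subrr).
case/andP=> kX wX; have h := IH wX; have hx := adw_Fi wX; rewrite [yw _]/= [Vw _]/=.
set th := q ^ _; set x := adw w in hx *; set y := yw w in h *; set V := Vw w in h *.
set z := zw w in hx *.
have hE := E_Fi kX.
have hKE : K i * E k = q ^ B2 k i *: (E k * K i) by rewrite wt_E [B2 i k](bformC hA).
have hVE : KV i * E k = q ^ (- B2 k i) *: (E k * KV i).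
  by rewrite (wt_V i (wt_E k)) [B2 i k](bformC hA).
set D := y * Fm i - Fm i * y - ((di^-1 * q ^ (- B2 i j)) *: (V * K i)
   - (di^-1 * ((w == [:: j])%:R * c0)) *: KV i).
have hD : D = 0 by rewrite /D h subrr.
set G := x * Fm i - Fm i * x - di^-1 *: (z * K i - (w == [::])%:R *: KV i).
have hG : G = 0 by rewrite /G hx subrr.
have -> : q ^ (Bf (simple k) (content w) + 2 * B2 k i - B2 k j) = th * q ^ (- B2 k j) * q ^ B2 k i.
  by rewrite /th -!expfzDr //; congr (q ^ _); rewrite (bformDr hA); ring.
have hjw : (w == [:: j])%:R * (th * q ^ (- B2 k j) * q ^ (- B2 k i)) = (w == [:: j])%:R :> F.
  case: eqP => [hw|_]; last by rewrite !mul0r.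
  rewrite !mul1r /th -!expfzDr // hw /content big_seq1 -[RHS](expr0z q); congr (q ^ _).
  by rewrite (bformDr hA); ring.
have kw : (k :: w == [:: j])%:R = (k == j)%:R * (w == [::])%:R :> F.
  by rewrite eqseq_cons; case: (k == j); case: (w == [::]); rewrite ?mul1r ?mul0r.
have hc0 : (k == j)%:R * (w == [::])%:R * ((th - th^-1) / dj) = (k == j)%:R * (w == [::])%:R * c0.
  case: eqP => [kj|_]; last by rewrite !mul0r.
  case: eqP => [hw|_]; last by rewrite mulr0 !mul0r.
  by rewrite /th hw kj /content big_nil addr0.
have hsrc : (q ^ (Bf (simple j) (content w) + 2 * B2 j i) - q ^ (- Bf (simple j) (content w))) / dj
    * q ^ (- B2 i j) = (q ^ Bf (simple j) (simple i + content w)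
      - (q ^ Bf (simple j) (simple i + content w))^-1) / dj.
  rewrite mulrAC mulrBl -!expfzDr // invr_expz (bformDr hA) [B2 i j](bformC hA).
  by congr ((q ^ _ - q ^ _) / _); ring.
rewrite kw.
have : exists2 c1 : F, (if k == j then ((th - th^-1) / dj) *: x else 0) = c1 *: x &
   exists2 s : F, (if k == j then ((q ^ (Bf (simple j) (content w) + 2 * B2 j i)
          - q ^ (- Bf (simple j) (content w))) / dj) *: z else 0) = s *: z &
   s * q ^ (- B2 i j) = c1 /\ (w == [::])%:R * c1 = (k == j)%:R * (w == [::])%:R * c0.
  move: hc0; case: (eqVneq k j) => [kj|_] hc0; last first.
    by exists 0; rewrite ?scale0r //; exists 0; rewrite ?scale0r // mul0r mulr0 !mul0r.
  exists ((th - th^-1) / dj) => //; eexists; first by [].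
  by rewrite -hc0 mul1r; split=> //; rewrite hsrc /th kj.
case=> c1 -> [s -> [hs hc1]].
move: hD hG hE hKE hVE hjw hs hc1; rewrite /D /G; clear.
set e1 := (w == [:: j])%:R; set e2 := (w == [::])%:R; set e3 := (k == j)%:R.
clearbody e1 e2 e3 x y V z th c0; move: (di^-1) => d1.
move: (q ^ (- B2 k j)) (q ^ (- B2 i j)) (q ^ B2 k i) (q ^ (- B2 k i)) => Q1 Q2 Q3 Q4.
move=> hD hG hE hKE hVE hjw hs hc1.
set D := (X in X = 0) in hD; set G := (X in X = 0) in hG.
apply: (eq_certificate (z := E k * D - (th * Q1) *: (D * E k) + c1 *: G
     + (E k * Fm i - Fm i * E k) * y - (th * Q1) *: (y * (E k * Fm i - Fm i * E k))
     - (th * Q1 * d1 * Q2) *: (V * (K i * E k - Q3 *: (E k * K i)))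
     + (th * Q1 * d1 * (e1 * c0)) *: (KV i * E k - Q4 *: (E k * KV i))
     + (d1 * c0 * (e1 * (th * Q1 * Q4) - e1)) *: (E k * KV i)
     - (d1 * (s * Q2 - c1)) *: (z * K i)
     - (d1 * (e2 * c1 - e3 * e2 * c0)) *: KV i)).
  by rewrite hD hG hE hKE hVE hjw hs hc1 !subrr !(mulr0, mul0r, scaler0, subr0, addr0, scale0r).
by rewrite /D /G; nc; ring.
Qed.

Section Quasi.
Context (w : seq 'I_n) (wX : word_in X w) (w0 : w != [::]) (wj : w != [:: j]).
Let be : lattice := simple i + content w.
Let x := adw w.
Context (hw : forall k, k \in X -> E k * x = q ^ Bf (simple k) be *: (x * E k)).
Context (hbb : Bf be be = B2 i i) (p : nat) (hp : A i j = - p%:Z).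

(** The E_k with k in X have these properties, hence so has everything built from them; this gives
    the commutation of Z and W with F_i and with e. *)
Definition good (g : lattice) (u : U) : Prop :=
  [/\ wt g u, u * Fm i = Fm i * u & u * x = q ^ Bf g be *: (x * u)].

Lemma good0 g : good g 0.
Proof. by split; rewrite ?(mulr0, mul0r, scaler0) //; apply: wt_0. Qed.

Lemma goodD g u v : good g u -> good g v -> good g (u + v).
Proof.
move=> [h1 h2 h3] [k1 k2 k3]; split; first exact: wtD.
  by rewrite mulrDl mulrDr h2 k2.
by rewrite mulrDl mulrDr h3 k3 scalerDr.
Qed.

Lemma goodZ g c u : good g u -> good g (c *: u).
Proof.
move=> [h1 h2 h3]; split; first exact: wtZ.
  by rewrite -scalerAl -scalerAr h2.
by rewrite -scalerAl -scalerAr h3 !scalerA mulrC.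
Qed.

Lemma goodM g h u v : good g u -> good h v -> good (g + h) (u * v).
Proof.
move=> [h1 h2 h3] [k1 k2 k3]; split; first exact: wtM.
  by rewrite -(mulrA u) k2 mulrA h2 -mulrA.
by rewrite -(mulrA u) k3 -scalerAr (mulrA u x v) h3 -scalerAl scalerA -(mulrA x) bformDl expfzDr // mulrC.
Qed.

Lemma goodE k : k \in X -> good (simple k) (E k).
Proof. by move=> kX; split; [apply: wt_E|apply: E_Fi|apply: hw]. Qed.

Lemma good_step g u k t : k \in X -> good g u -> good (simple k + g) (E k * u - t *: (u * E k)).
Proof.
move=> kX hu; apply: goodD; first exact: (goodM (goodE kX) hu).
by rewrite -scaleNr; apply: goodZ; rewrite addrC; apply: (goodM hu (goodE kX)).
Qed.

Lemma good_zw u : word_in X u -> good (content u) (zw u).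
Proof.
elim: u => [_|k u IH] /=.
  rewrite /content big_nil; split; first exact: wt_1.
    by rewrite mulr1 mul1r.
  by rewrite mulr1 mul1r bform0l expr0z scale1r.
by case/andP=> kX uX; rewrite content_cons; apply: good_step => //; apply: IH.
Qed.

Lemma good_Ww u : word_in X u -> good (content u - simple j) (Ww u).
Proof.
elim: u => [_|k u IH] /=; first exact: good0.
case/andP=> kX uX; rewrite content_cons -addrA; apply: goodD; first by apply: good_step => //; apply: IH.
case: (eqVneq k j) => [->|_]; last exact: good0.
by rewrite addrC subrK; apply/goodZ/good_zw.
Qed.

Lemma good_Vw u : word_in X u -> good (content u - simple j) (Vw u).
Proof.
elim: u => [_|k u IH] /=; first exact: good0.
case/andP=> kX uX; rewrite content_cons -addrA; apply: goodD; first by apply: good_step => //; apply: IH.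
case: (eqVneq k j) => [->|_]; last exact: good0.
by rewrite addrC subrK; apply/goodZ/good_zw.
Qed.

Context (c v : F) (hef : serre (qi i) p.+1 (x * KV i) (Fm j) = 0).

(** That Z commutes with e rests on be and alpha_i having equal norm: with g = be - alpha_i the
    exponent (g, be) + (alpha_i, g) equals (be, be) - (alpha_i, alpha_i) = 0. The relation for W
    follows in the same way. *)
Lemma quasi_generators : quasi_relations (qi i) (qi j) c p (- (c * v) *: (x * KV i)) (Fm j) (Fm i)
  (- v *: zw w) (- v *: (Ww w * K j)).
Proof.
have hQ : q ^ B2 i j = qi i ^- p by rewrite -qi_simple hp exprnN.
have hQ' : q ^ (- B2 i j) = qi i ^+ p by rewrite -invr_expz hQ invrK.
have hQ2 : q ^ (2 * B2 i j) = (qi i ^+ p) ^- 2 by rewrite mulrC -exprz_exp hQ -exprnP exprVn.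
have hii : q ^ B2 i i = qi i ^+ 2 by rewrite -qi_simple (cartan_diag hA).
have P0 : qi i ^+ p != 0 by rewrite expf_neq0 // q_neq0.
have di0 : di != 0 by apply: q_sub_inv_neq0.
have hmu : mu = (1 - (qi i ^+ p) ^- 2) / (qi j - (qi j)^-1) by rewrite /mu hQ2.
have [wz zF zx] := good_zw wX; have [wW WF Wx] := good_Ww wX; have [wV VF Vx] := good_Vw wX.
have zwF := zw_Fj wX; have xFi := adw_Fi wX; have xFj := adw_Fj wX; have yFi := yw_Fi wX wj.
rewrite (negPf w0) scale0r subr0 -/x in xFi; rewrite -/x in xFj; rewrite hQ' in yFi.
have VFi : KV i * Fm i = qi i ^+ 2 *: (Fm i * KV i) by rewrite (wt_V i (wt_F i)) (bformNr hA) opprK hii.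
have VFj : KV i * Fm j = qi i ^- p *: (Fm j * KV i) by rewrite (wt_V i (wt_F j)) (bformNr hA) opprK hQ.
have VjFi : KV j * Fm i = qi i ^- p *: (Fm i * KV j).
  by rewrite (wt_V j (wt_F i)) (bformNr hA) opprK [B2 j i](bformC hA) hQ.
have KjFi : K j * Fm i = qi i ^+ p *: (Fm i * K j).
  by rewrite wt_F (bformNr hA) [B2 j i](bformC hA) hQ'.
have hV : - v *: zw w * Fm j - Fm j * (- v *: zw w)
   - (1 - (qi i ^+ p) ^- 2) / (qi j - (qi j)^-1) *: (- v *: (Ww w * K j)) = - v *: (Vw w * KV j).
  rewrite -hmu; apply: (eq_certificate (z := - v *: (zw w * Fm j - Fm j * zw w
     - (mu *: (Ww w * K j) + Vw w * KV j)))); first by rewrite zwF subrr scaler0.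
  by nc; ring.
have hKV : K i * KV j = KV j * K i.
  by have := wt_KV j i; rewrite (bform0r hA) expr0z scale1r.
have hVV : KV i * KV j = KV j * KV i.
  by rewrite (wt_V i (wt_KV j)) (bform0r hA) oppr0 expr0z scale1r.
have hefF : - (c * v) *: (x * KV i) * Fm j - (qi i ^+ p)^-1 *: (Fm j * (- (c * v) *: (x * KV i))) =
    (- (c * v) / qi i ^+ p) *: (yw w * KV j * KV i).
  rewrite -xFj; apply: (eq_certificate (z := - (c * v) *: (x * (KV i * Fm j - qi i ^- p *: (Fm j * KV i))))).
    by rewrite VFj subrr mulr0 scaler0.
  by clear; move: (qi i ^- p) => t; nc; ring.
split.
- by have := rFF ij; rewrite hp (_ : `|1 - - p%:Z|%N = p.+1) //; lia.
- by rewrite -[Fm j]scale1r (serre_scale (hqi i)) hef scaler0.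
- apply: (eq_certificate (z := - (c * v) *: (x * (KV i * Fm i - qi i ^+ 2 *: (Fm i * KV i)))
    - (c * v * qi i ^+ 2) *: ((x * Fm i - Fm i * x - di^-1 *: (zw w * K i)) * KV i)
    - (c * v * qi i ^+ 2 / di) *: (zw w * (K i * KV i - 1)))).
    by rewrite VFi xFi rKKV !subrr !(mulr0, mul0r, scaler0, subr0, addr0).
  by rewrite -/di; clear; move: (qi i ^+ 2) (di^-1) => t d; nc; ring.
- by rewrite -scalerAl zF scalerAr.
- have h1 : KV i * zw w = q ^ (- Bf (simple i) (content w)) *: (zw w * KV i) by rewrite (wt_V i wz).
  have h2 : q ^ Bf (content w) be * q ^ Bf (simple i) (content w) = 1.
    rewrite -expfzDr // -[RHS](expr0z q); congr (_ ^ _); move: hbb; rewrite /be.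
    by rewrite !(bformDl, bformDr hA) [Bf (content w) (simple i)](bformC hA); lia.
  have h3 : zw w * KV i = q ^ Bf (simple i) (content w) *: (KV i * zw w).
    by rewrite h1 scalerA -expfzDr // subrr expr0z scale1r.
  have e1 : zw w * (x * KV i) = x * KV i * zw w.
    by rewrite (mulrA (zw w) x (KV i)) zx -scalerAl -(mulrA x (zw w)) h3 -scalerAr scalerA h2 scale1r mulrA.
  by rewrite -!scalerAl -!scalerAr e1 !scalerA mulrC.
- have WKF : Ww w * K j * Fm i = qi i ^+ p *: (Fm i * (Ww w * K j)).
    by rewrite -(mulrA (Ww w)) KjFi -scalerAr (mulrA (Ww w)) WF -(mulrA (Fm i)).
  by rewrite -scalerAl WKF -scalerAr scalerA [in RHS]scalerA mulrC.
- have h3 : Ww w * KV i = q ^ Bf (simple i) (content w - simple j) *: (KV i * Ww w).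
    by rewrite (wt_V i wW) scalerA -expfzDr // subrr expr0z scale1r.
  have hKjx : K j * x = q ^ Bf (simple j) be *: (x * K j) by rewrite (wt_adw w).
  have hKK : K j * KV i = KV i * K j.
    by have := wt_KV i j; rewrite (bform0r hA) expr0z scale1r.
  have h2 : q ^ Bf (simple j) be * (q ^ Bf (content w - simple j) be
       * q ^ Bf (simple i) (content w - simple j)) = qi i ^+ p.
    rewrite -!expfzDr // -hQ'; congr (_ ^ _); move: hbb; rewrite /be.
    rewrite !(bformDl, bformDr hA, bformNl, bformNr hA) [Bf (content w) (simple i)](bformC hA).
    by lia.
  have e1 : Ww w * K j * (x * KV i) = qi i ^+ p *: (x * KV i * (Ww w * K j)).
    rewrite -h2; move: hKjx Wx h3.
    move: (q ^ Bf (simple j) be) (q ^ Bf (content w - simple j) be) (q ^ Bf (simple i) (content w - simple j)).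
    move=> t1 t2 t3 k1 k2 k3.
    apply: (eq_certificate (z := Ww w * (K j * x - t1 *: (x * K j)) * KV i
      + t1 *: ((Ww w * x - t2 *: (x * Ww w)) * K j * KV i)
      + (t1 * t2) *: (x * Ww w * (K j * KV i - KV i * K j))
      + (t1 * t2) *: (x * (Ww w * KV i - t3 *: (KV i * Ww w)) * K j))).
      by rewrite k1 k2 k3 hKK !subrr !(mulr0, mul0r, scaler0, addr0).
    by clear; nc; ring.
  by rewrite -!scalerAl -!scalerAr e1 !scalerA; congr (_ *: _); ring.
- rewrite hV; move: VjFi; move: (qi i ^- p) => t VjFi'.
  apply: (eq_certificate (z := - v *: (Vw w * (KV j * Fm i - t *: (Fm i * KV j)))
      - (v * t) *: ((Vw w * Fm i - Fm i * Vw w) * KV j))).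
    by rewrite VjFi' VF !subrr !(mulr0, mul0r, scaler0, subr0, addr0).
  by clear; nc; ring.
- rewrite hefF hV.
  apply: (eq_certificate (z := (- (c * v) / qi i ^+ p) *: (yw w * KV j * (KV i * Fm i - qi i ^+ 2 *: (Fm i * KV i)))
    + (- (c * v) / qi i ^+ p * qi i ^+ 2) *: (yw w * (KV j * Fm i - qi i ^- p *: (Fm i * KV j)) * KV i)
    + (- (c * v) / qi i ^+ p * qi i ^+ 2 / qi i ^+ p) *: ((yw w * Fm i - Fm i * yw w
          - (di^-1 * qi i ^+ p) *: (Vw w * K i)) * KV j * KV i)
    + (- (c * v) / qi i ^+ p * qi i ^+ 2 / di) *: (Vw w * (K i * KV j - KV j * K i) * KV i)
    + (- (c * v) / qi i ^+ p * qi i ^+ 2 / di) *: (Vw w * KV j * (K i * KV i - 1)))).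
    by rewrite VFi VjFi yFi hKV rKKV !subrr !(mulr0, mul0r, scaler0, subr0, addr0).
  have := mulVf P0; rewrite -/di; clear; move: (qi i ^+ p) ((qi i ^+ p)^-1) (qi i ^+ 2) (di^-1) => P t t2 d htP.
  apply: (eq_certificate (z := (- (c * v) * t * t2 * d * (t * P - 1)) *: (Vw w * K i * KV j * KV i))).
    by rewrite htP subrr mulr0 scale0r.
  by nc; ring.
Qed.

End Quasi.

End MixedRelations.
End HighestVector.
End QuantumGroupRelations.

(** * Lusztig automorphisms *)

Section DividedPowers.
Context (F : fieldType) (x : F) (hx : not_root_of_unity x) (U : algType F).

Definition dpow (u : U) (r : nat) : U := (qfact x r)^-1 *: u ^+ r.

Lemma dpow_reverse (G : nat -> nat -> U) m :
  \sum_(0 <= r < m.+1) ((-1) ^+ r * x ^- r) *: G (m - r)%N r =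
  ((-1) ^+ m * x ^- m) *: \sum_(0 <= r < m.+1) ((-1) ^+ r * x ^+ r) *: G r (m - r)%N.
Proof.
have x0 := q_neq0 hx.
rewrite big_nat_rev /= add0n scaler_sumr; apply: eq_big_nat => r /andP[_ hr].
rewrite subSS subKn // scalerA; congr (_ *: _).
have h1 : (-1) ^+ m = (-1) ^+ (m - r) * (-1) ^+ r :> F by rewrite -exprD subnK.
have h2 : x ^+ m = x ^+ (m - r) * x ^+ r by rewrite -exprD subnK.
have e1 : (-1) ^+ r * (-1) ^+ r = 1 :> F by rewrite -expr2 sqrr_sign.
have e2 : x ^- r * x ^+ r = 1 by rewrite mulVf // expf_neq0.
transitivity ((-1) ^+ (m - r) * x ^- (m - r) * ((-1) ^+ r * (-1) ^+ r) * (x ^- r * x ^+ r)).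
  by rewrite e1 e2 !mulr1.
rewrite h1 h2 invfM; move: (x ^- (m - r)) (x ^- r) (x ^+ r) => y z t; ring.
Qed.

(** Shows T_i(E_j) to be, up to a quantum factorial, the top of a chain of q-commutators, so that
    [chain_bottom] applies to it. *)
Lemma dpow_qops (X Y : U) m :
  \sum_(0 <= r < m.+1) ((-1) ^+ r * x ^- r) *: (dpow X (m - r) * Y * dpow X r) =
  (qfact x m)^-1 *: qops X (qgeom x (x ^- m) m) Y.
Proof.
have x0 := q_neq0 hx.
rewrite (qops_qgeom hx) scaler_sumr; apply: eq_big_nat => r /andP[_ hr].
rewrite /dpow -!scalerAl -scalerAr !scalerA; congr (_ *: _).
rewrite -!mulrA.
have -> : (x ^- m) ^+ r * x ^+ (r * m.-1) = x ^- r.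
  rewrite -exprVn -exprM exprVn; case: m hr => [|m] hr; first by case: r hr => // _; rewrite !mul0n expr0 mulr1.
  by rewrite mulSn exprD invfM [(m * r)%N]mulnC -mulrA mulVf ?mulr1 // expf_neq0.
rewrite /qbinom; have := qfact_neq0 hx m; have := qfact_neq0 hx r; have := qfact_neq0 hx (m - r).
move: (qfact x m) (qfact x r) (qfact x (m - r)) (x ^- r) ((-1) ^+ r) => a b c d e hc hb ha.
by field; rewrite ha hb hc.
Qed.

End DividedPowers.

Lemma prod_only1 (R : pzRingType) (I : finType) (i : I) (G : I -> R) :
  (forall k, k != i -> G k = 1) -> \prod_k G k = G i.
Proof. by move=> h; rewrite (big_only1 i) // => k ki _; apply: h. Qed.

Section LusztigMaps.
Context (n : nat) (A : 'M[int]_n) (eps : 'I_n -> nat) (hA : gcm A eps).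
Context (F : fieldType) (q : F) (hq : not_root_of_unity q).
Local Notation qi := (qfam eps q).
Local Notation Bf := (bform A eps).
Local Notation lattice := 'rV[int]_n.
Context (U : algType F) (E Fm K KV : 'I_n -> U) (hU : uq_spec A qi E Fm K KV).
Context (uind : forall P : U -> Prop,
    P 1 -> (forall i u, P u -> P (E i * u)) -> (forall i u, P u -> P (Fm i * u)) ->
    (forall i u, P u -> P (K i * u)) -> (forall i u, P u -> P (KV i * u)) ->
    (forall u v, P u -> P v -> P (u + v)) -> (forall c u, P u -> P (c *: u)) ->
  forall u, P u).
Local Notation kb := (kbeta K KV).
Local Notation wt := (wt A eps q K).
Local Notation dp i := (dpow (qi i)).
Let hqi i : not_root_of_unity (qi i). Proof. exact: (qfam_root hA). Qed.
Let q0 := q_neq0 hq.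

Context (T : 'I_n -> {lrmorphism U -> U}).
Context (TEi : forall i, T i (E i) = - (Fm i * K i)).
Context (TFi : forall i, T i (Fm i) = - (KV i * E i)).
Context (Tkb : forall i be, T i (kb be) = kb (refl_root A i be)).
Context (TEj : forall i j, j != i -> T i (E j) =
  \sum_(0 <= r < `|A i j|%N.+1) ((-1) ^+ r * qi i ^- r) *:
    (dp i (E i) (`|A i j| - r) * E j * dp i (E i) r)).
Context (TFj : forall i j, j != i -> T i (Fm j) =
  \sum_(0 <= r < `|A i j|%N.+1) ((-1) ^+ r * qi i ^+ r) *:
    (dp i (Fm i) r * Fm j * dp i (Fm i) (`|A i j| - r))).

Lemma kb_simple i : kb (simple i) = K i.
Proof.
rewrite /kbeta (prod_only1 (i := i)) ?simpleE ?eqxx //= ?expr1 // => k ki.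
by rewrite simpleE (negPf ki).
Qed.

Lemma kb_simpleN i : kb (- simple i) = KV i.
Proof.
rewrite /kbeta (prod_only1 (i := i)) ?mxE ?simpleE ?eqxx //= ?expr1 // => k ki.
by rewrite !mxE (negPf ki) andbF.
Qed.

Let TM k u v : T k (u * v) = T k u * T k v. Proof. exact: rmorphM. Qed.
Let TZ k c u : T k (c *: u) = c *: T k u. Proof. exact: linearZ. Qed.
Let TN k u : T k (- u) = - T k u. Proof. exact: raddfN. Qed.
Let TD k u v : T k (u + v) = T k u + T k v. Proof. exact: raddfD. Qed.
Let T1 k : T k 1 = 1. Proof. exact: rmorph1. Qed.

Lemma refl_rootN k (v : lattice) : refl_root A k (- v) = - refl_root A k v.
Proof. exact: (weyl_rootN A [:: k]). Qed.

Lemma T_K k l : T k (K l) = kb (refl_root A k (simple l)).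
Proof. by rewrite -{1}kb_simple Tkb. Qed.

Lemma T_KV k l : T k (KV l) = kb (- refl_root A k (simple l)).
Proof. by rewrite -{1}kb_simpleN Tkb refl_rootN. Qed.

Lemma refl_self k : refl_root A k (simple k) = - simple k.
Proof.
have he : (eps k)%:Z != 0 :> int by have := cartan_eps hA k; lia.
have -> : refl_root A k (simple k) = simple k - 2%:Z *: simple k.
  rewrite /refl_root; congr (_ - _ *: _); apply: (mulfI he).
  by rewrite (pairing_bform hA) bform_simple (cartan_diag hA).
by apply/rowP => a; rewrite !mxE; ring.
Qed.

Lemma wt_T k g u : wt g u -> wt (refl_root A k g) (T k u).
Proof.
move=> h l; have e : T k (kb (refl_root A k (simple l))) = K l.
  by rewrite Tkb (refl_rootK hA) kb_simple.
rewrite -{1}e -TM (kbeta_wt hq hU _ h) TZ TM e; congr (_ ^ _ *: _).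
by rewrite -[in RHS](bform_refl hA k) (refl_rootK hA).
Qed.

Definition Tl (w : seq 'I_n) (u : U) : U := foldr (fun k v => T k v) u w.

Lemma Tl_lrmorphism w : exists h : {lrmorphism U -> U}, forall u, h u = Tl w u.
Proof.
elim: w => [|k w [h hh]]; first by exists idfun.
pose g : {lrmorphism U -> U} := T k \o h.
by exists g => u; rewrite /= -hh.
Qed.

Lemma wt_Tl w g u : wt g u -> wt (weyl_root A w g) (Tl w u).
Proof. by move=> h; elim: w => //= k w IH; apply: wt_T. Qed.

Lemma Tl_kb w be : Tl w (kb be) = kb (weyl_root A w be).
Proof. by elim: w => //= k w ->; apply: Tkb. Qed.

Lemma Tl_K w i : Tl w (K i) = kb (weyl_root A w (simple i)).
Proof. by rewrite -{1}kb_simple Tl_kb. Qed.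

Lemma Tl_KV w i : Tl w (KV i) = kb (- weyl_root A w (simple i)).
Proof. by rewrite -{1}kb_simpleN Tl_kb weyl_rootN. Qed.

(** * Compatibility of the T_k with the Chevalley involution *)

Section Chevalley.
Context (om : {lrmorphism U -> U}) (omE : forall i, om (E i) = - Fm i)
  (omF : forall i, om (Fm i) = - E i) (omK : forall i, om (K i) = KV i).

Let oM u v : om (u * v) = om u * om v. Proof. exact: rmorphM. Qed.
Let oZ c u : om (c *: u) = c *: om u. Proof. exact: linearZ. Qed.
Let oN u : om (- u) = - om u. Proof. exact: raddfN. Qed.
Let oD u v : om (u + v) = om u + om v. Proof. exact: raddfD. Qed.
Let o1 : om 1 = 1. Proof. exact: rmorph1. Qed.

Lemma omKV i : om (KV i) = K i.
Proof.
have h : om (KV i) * KV i = 1 by rewrite -[X in _ * X]omK -oM (rKVK hU) o1.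
by rewrite -[LHS]mulr1 -(rKVK hU i) mulrA h mul1r.
Qed.

Lemma om_kb be : om (kb be) = kb (- be).
Proof.
rewrite /kbeta rmorph_prod /=; apply: eq_bigr => k _; rewrite mxE.
case: (be 0 k) => [[|m]|m] /=; rewrite ?expr0 ?o1 //.
- by rewrite rmorphXn /= omK.
- by rewrite rmorphXn /= omKV.
Qed.

Let oX u m : om (u ^+ m) = om u ^+ m. Proof. exact: rmorphXn. Qed.

Lemma om_dpE i k r : om (dp i (E k) r) = (-1) ^+ r *: dp i (Fm k) r.
Proof. by rewrite oZ oX omE -scaleN1r exprZn /dpow !scalerA mulrC. Qed.

Lemma om_dpF i k r : om (dp i (Fm k) r) = (-1) ^+ r *: dp i (E k) r.
Proof. by rewrite oZ oX omF -scaleN1r exprZn /dpow !scalerA mulrC. Qed.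

(** Applying the involution reverses the sums defining T_k on generators; the factor produced by
    [dpow_reverse] is the one by which conjugation with K_k acts on the generator. *)
Lemma om_T k u : om (T k u) = T k (om (K k * u * KV k)).
Proof.
have hc (a b : U) : K k * (a * b) * KV k = (K k * a * KV k) * (K k * b * KV k).
  by rewrite -!mulrA (mulrA (KV k) (K k)) (rKVK hU) mul1r.
have hkk (a : U) : wt 0 a -> K k * a * KV k = a.
  by move/(_ k) ->; rewrite (bform0r hA) expr0z scale1r -mulrA (rKKV hU) mulr1.
have step (a b : U) : om (T k a) = T k (om (K k * a * KV k)) ->
    om (T k b) = T k (om (K k * b * KV k)) -> om (T k (a * b)) = T k (om (K k * (a * b) * KV k)).
  by move=> h1 h2; rewrite hc TM oM h1 h2 -TM -oM.
have kE l : K k * E l * KV k = qi k ^ A k l *: E l.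
  by rewrite (wt_E hU) -scalerAl -mulrA (rKKV hU) mulr1 qi_simple.
have kF l : K k * Fm l * KV k = qi k ^ (- A k l) *: Fm l.
  by rewrite (wt_F hA hU) -scalerAl -mulrA (rKKV hU) mulr1 (bformNr hA) -!invr_expz qi_simple.
have hm l : l != k -> A k l = - `|A k l|%N%:Z by move=> lk; have := cartan_off hA (i:=k) (j:=l); rewrite eq_sym => /(_ lk); lia.
move: u; apply: uind.
- by rewrite mulr1 (rKKV hU) !T1 !o1 T1.
- move=> l u h; apply: step => //; rewrite kE oZ TZ omE TN.
  case: (eqVneq l k) => [->|lk].
    rewrite TEi TFi oN oM omF omK mulNr !opprK (cartan_diag hA).
    have := wt_V hq hU k (wt_E hU k); rewrite -invr_expz -qi_simple (cartan_diag hA) => ->.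
    by rewrite scalerA mulfV ?scale1r // expf_neq0 // q_neq0.
  rewrite TEj // TFj //; set m := `|A k l|%N.
  have e : qi k ^ A k l = qi k ^- m by rewrite (hm l lk) exprnN.
  rewrite e raddf_sum scalerN.
  have -> : \sum_(0 <= r < m.+1) om (((-1) ^+ r * qi k ^- r) *: (dp k (E k) (m - r) * E l * dp k (E k) r)) =
     - ((-1) ^+ m *: \sum_(0 <= r < m.+1) ((-1) ^+ r * qi k ^- r) *: (dp k (Fm k) (m - r) * Fm l * dp k (Fm k) r)).
    rewrite scaler_sumr -sumrN; apply: eq_big_nat => r /andP[_ hr].
    rewrite oZ !oM !om_dpE omE mulrN mulNr -!scalerAl -scalerAr !scalerN !scalerA; congr (- (_ *: _)).
    have -> : (-1) ^+ m = (-1) ^+ (m - r) * (-1) ^+ r :> F by rewrite -exprD subnK.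
    by ring.
  rewrite (dpow_reverse (hqi k) (fun a b => dp k (Fm k) a * Fm l * dp k (Fm k) b)) scalerA mulrA.
  by rewrite -expr2 sqrr_sign mul1r.
- move=> l u h; apply: step => //; rewrite kF oZ TZ omF TN.
  case: (eqVneq l k) => [->|lk].
    rewrite TEi TFi oN oM omE omKV mulrN !opprK (cartan_diag hA).
    by rewrite (wt_F hA hU) (bformNr hA) -!invr_expz -qi_simple (cartan_diag hA).
  rewrite TEj // TFj //; set m := `|A k l|%N.
  have e : qi k ^ (- A k l) = qi k ^+ m by rewrite (hm l lk) opprK.
  rewrite e raddf_sum scalerN.
  have -> : \sum_(0 <= r < m.+1) om (((-1) ^+ r * qi k ^+ r) *: (dp k (Fm k) r * Fm l * dp k (Fm k) (m - r))) =
     - ((-1) ^+ m *: \sum_(0 <= r < m.+1) ((-1) ^+ r * qi k ^+ r) *: (dp k (E k) r * E l * dp k (E k) (m - r))).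
    rewrite scaler_sumr -sumrN; apply: eq_big_nat => r /andP[_ hr].
    rewrite oZ !oM !om_dpF omF mulrN mulNr -!scalerAl -scalerAr !scalerN !scalerA; congr (- (_ *: _)).
    have -> : (-1) ^+ m = (-1) ^+ (m - r) * (-1) ^+ r :> F by rewrite -exprD subnK.
    by ring.
  rewrite (dpow_reverse (hqi k) (fun a b => dp k (E k) a * E l * dp k (E k) b)) scalerA mulrCA mulfV ?mulr1 //.
  by rewrite expf_neq0 // q_neq0.
- move=> l u h; apply: step => //; rewrite (hkk _ (wt_K hA hU l)) T_K om_kb omK T_KV //.
- move=> l u h; apply: step => //; rewrite (hkk _ (wt_KV hA hq hU l)) T_KV om_kb opprK omKV T_K //.
- by move=> u v hu hv; rewrite mulrDr mulrDl !(TD, oD) hu hv.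
- by move=> c u hu; rewrite -scalerAr -scalerAl !(TZ, oZ) hu.
Qed.

Lemma om_Tl w g u : wt g u -> exists2 c, c != 0 & om (Tl w u) = c *: Tl w (om u).
Proof.
move=> h; elim: w => [|k w [c c0 IH]] /=; first by exists 1; rewrite ?oner_neq0 ?scale1r.
exists (q ^ Bf (simple k) (weyl_root A w g) * c); first by rewrite mulf_neq0 // qz_neq0.
by rewrite om_T (wt_Tl w h) -scalerAl -mulrA (rKKV hU) mulr1 oZ IH !TZ scalerA.
Qed.

(** The involution turns the hypothesis into a q-commutation of F_j with T(F_i), by [om_Tl]; the
    factor K_j cancels the power of q. *)
Lemma Tl_F_comm w i j (be := weyl_root A w (simple i)) :
    E j * Tl w (E i) = q ^ Bf (simple j) be *: (Tl w (E i) * E j) ->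
  Tl w (Fm i) * (Fm j * K j) = Fm j * K j * Tl w (Fm i).
Proof.
move=> h; have [c c0 hc] := om_Tl w (wt_E hU i).
have hF : Tl w (Fm i) = (- c^-1) *: om (Tl w (E i)).
  have [t ht] := Tl_lrmorphism w.
  by rewrite hc omE -!ht raddfN /= !(scaleNr, scalerN) opprK scalerA mulVf ?scale1r.
have h2 : Fm j * Tl w (Fm i) = q ^ Bf (simple j) be *: (Tl w (Fm i) * Fm j).
  rewrite hF; have := congr1 om h; rewrite oZ !oM omE => h3.
  rewrite -scalerAr -scalerAl scalerA [_ * - _]mulrC -scalerA; congr (_ *: _).
  by move: h3; rewrite mulNr mulrN scalerN => /oppr_inj.
have wF : wt (- be) (Tl w (Fm i)) by rewrite -weyl_rootN; apply: wt_Tl; apply: (wt_F hA hU).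
rewrite -(mulrA (Fm j) (K j)) wF -scalerAr (mulrA (Fm j) (Tl w (Fm i))) h2 -scalerAl scalerA.
by rewrite (bformNr hA) -expfzDr // addNr expr0z scale1r mulrA.
Qed.

End Chevalley.

(** * Surjectivity of the T_k on the Levi subalgebra *)

Section LeviSubalgebra.
Context (X : {set 'I_n}).

Inductive levi : U -> Prop :=
| levi_E k : k \in X -> levi (E k)
| levi_F k : k \in X -> levi (Fm k)
| levi_K l : levi (K l)
| levi_KV l : levi (KV l)
| levi_1 : levi 1
| levi_D u v : levi u -> levi v -> levi (u + v)
| levi_Z c u : levi u -> levi (c *: u)
| levi_M u v : levi u -> levi v -> levi (u * v).

Lemma levi_X u m : levi u -> levi (u ^+ m).
Proof.
move=> h; elim: m => [|m IH]; first by rewrite expr0; apply: levi_1.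
by rewrite exprS; apply: levi_M.
Qed.

Lemma levi_kb be : levi (kb be).
Proof.
rewrite /kbeta; elim/big_rec: _ => [|k u _]; first exact: levi_1.
by apply: levi_M; case: (be 0 k) => m /=; apply: levi_X; [apply: levi_K|apply: levi_KV].
Qed.

(** For the generators this is a Serre relation, commutation with F_k, or q-commutation with the
    K's; [qnilD] and [qnilM] extend it to the subalgebra. *)
Lemma levi_nil i u : i \notin X -> levi u -> qnil (E i) u.
Proof.
move=> hi; have hK (c : F) (k : U) : k * E i = c *: (E i * k) -> c != 0 -> qnil (E i) k.
  move=> h c0; exists [:: c^-1]; rewrite /= /qop h scalerA mulVf // scale1r subrr //.
elim=> [k kX|k kX|l|l||a b _ ha _ hb|c a _ ha|a b _ ha _ hb].
- have ik : i != k by apply: contraNneq hi => ->.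
  have [p _ hp] := cartan_serre hA ik; exists (qgeom (qi i) (qi i ^ (1 - p.+1%:Z)) p.+1).
  by rewrite -(serreE (hqi i)) -hp; apply: (rEE hU).
- have ik : i != k by apply: contraNneq hi => ->.
  by exists [:: 1]; rewrite /= /qop scale1r (rEF_comm hU ik) subrr.
- by apply: (hK _ _ (wt_E hU i l)); apply: qz_neq0.
- by apply: (hK _ _ (wt_V hq hU l (wt_E hU i))); apply: qz_neq0.
- by exists [:: 1]; rewrite /= /qop scale1r mulr1 mul1r subrr.
- exact: qnilD.
- exact: qnilZ.
- exact: qnilM.
Qed.

(** The inverse of T_k is not given, so preimages are found on generators. Those of E_k, F_k and the
    K's are explicit; E_l and F_l are the bottoms of chains whose tops are multiples of T_k(E_l) and
    T_k(F_l), and [chain_bottom] descends inside the image. *)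
Lemma T_levi k u : k \in X -> levi u -> exists2 y, levi y & T k y = u.
Proof.
move=> kX; set P := fun u => exists2 y, levi y & T k y = u.
have PZ c a : P a -> P (c *: a) by case=> y hy <-; exists (c *: y); [apply: levi_Z|apply: TZ].
have PD a b : P a -> P b -> P (a + b).
  by case=> y hy <- [z hz <-]; exists (y + z); [apply: levi_D|apply: TD].
have PM a b : P a -> P b -> P (a * b).
  by case=> y hy <- [z hz <-]; exists (y * z); [apply: levi_M|apply: TM].
have PK l : P (K l).
  by exists (kb (refl_root A k (simple l))); [apply: levi_kb|rewrite Tkb (refl_rootK hA) kb_simple].
have PV l : P (KV l).
  exists (kb (- refl_root A k (simple l))); first exact: levi_kb.
  by rewrite Tkb refl_rootN (refl_rootK hA) kb_simpleN.
have PFk : P (Fm k).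
  exists (- 1 *: (E k * K k)); first by apply/levi_Z/levi_M; [apply: levi_E|apply: levi_K].
  by rewrite TZ TM TEi T_K refl_self kb_simpleN scaleN1r mulNr opprK -mulrA (rKKV hU) mulr1.
have PEk : P (E k).
  exists (- 1 *: (KV k * Fm k)); first by apply/levi_Z/levi_M; [apply: levi_KV|apply: levi_F].
  by rewrite TZ TM TFi T_KV refl_self opprK kb_simple scaleN1r mulrN opprK mulrA (rKKV hU) mul1r.
have qk0 m : qi k ^+ m != 0 by rewrite expf_neq0 // q_neq0.
have hmp l m : A k l = - m%:Z -> `|A k l|%N = m by move=> ->; lia.
have hKE : K k * E k = qi k ^+ 2 *: (E k * K k) by rewrite (wt_E hU) -qi_simple (cartan_diag hA).
have hVF : KV k * Fm k = qi k ^+ 2 *: (Fm k * KV k).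
  by rewrite (wt_V hq hU k (wt_F hA hU k)) (bformNr hA) opprK -qi_simple (cartan_diag hA).
have hEF : E k * Fm k - Fm k * E k = (qi k - (qi k)^-1)^-1 *: (K k - KV k) by rewrite (rEF hU) eqxx mul1r.
have hFE : Fm k * E k - E k * Fm k = (qi k - (qi k)^-1)^-1 *: (KV k - K k).
  by rewrite -opprB hEF -scalerN opprB.
elim=> [l lX|l lX|l|l||a b _ ha _ hb|c a _ ha|a b _ ha _ hb] //.
- case: (eqVneq l k) => [->//|lk]; have [|m hm _] := cartan_serre hA (i := k) (j := l); first by rewrite eq_sym.
  apply: (chain_bottom (hqi k) (rKKV hU k) (rKVK hU k) hKE hEF (P := P) (p := m)) => //.
  + by rewrite (rEF_comm hU lk).
  + by rewrite (wt_E hU) -qi_simple hm exprnN.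
  + have -> : qops (E k) (qgeom (qi k) (qi k ^- m) m) (E l) = qfact (qi k) m *: T k (E l).
      by rewrite TEj // (hmp _ _ hm) (dpow_qops (hqi k)) scalerA mulfV ?scale1r // qfact_neq0.
    by apply: PZ; exists (E l) => //; apply: levi_E.
- case: (eqVneq l k) => [->//|lk]; have [|m hm _] := cartan_serre hA (i := k) (j := l); first by rewrite eq_sym.
  apply: (chain_bottom (hqi k) (rKVK hU k) (rKKV hU k) hVF hFE (P := P) (p := m)) => //.
  + by rewrite -(rEF_comm hU (i := k) (j := l)) // eq_sym.
  + by rewrite (wt_V hq hU k (wt_F hA hU l)) (bformNr hA) opprK -qi_simple hm exprnN.
  + have -> : qops (Fm k) (qgeom (qi k) (qi k ^- m) m) (Fm l) =
       (qfact (qi k) m * ((-1) ^+ m * qi k ^- m)) *: T k (Fm l).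
      have e := dpow_reverse (hqi k) (fun a b => dp k (Fm k) a * Fm l * dp k (Fm k) b) m.
      rewrite TFj // (hmp _ _ hm) -scalerA -e (dpow_qops (hqi k)) scalerA mulfV ?scale1r // qfact_neq0 //.
    by apply: PZ; exists (Fm l) => //; apply: levi_F.
- exact: PK.
- exact: PV.
- by exists 1; [apply: levi_1|apply: T1].
- exact: PD.
- exact: PZ.
- exact: PM.
Qed.

Lemma Tl_levi w u : word_in X w -> levi u -> exists2 y, levi y & Tl w y = u.
Proof.
elim: w u => [|k w IH] u /=; first by move=> _ h; exists u.
case/andP=> kX wX /(T_levi kX) [v hv <-]; have [y hy <-] := IH v wX hv.
by exists y.
Qed.

End LeviSubalgebra.

(** * The grading by the root lattice *)

(** Unlike [wt], the grading determines the weight of a nonzero element even when A is singular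
    ([graded_unique]). *)
Inductive graded : lattice -> U -> Prop :=
| graded_E i : graded (simple i) (E i)
| graded_F i : graded (- simple i) (Fm i)
| graded_K i : graded 0 (K i)
| graded_KV i : graded 0 (KV i)
| graded_1 : graded 0 1
| graded_0 al : graded al 0
| graded_D al u v : graded al u -> graded al v -> graded al (u + v)
| graded_Z al c u : graded al u -> graded al (c *: u)
| graded_M al be u v : graded al u -> graded be v -> graded (al + be) (u * v).

Lemma torus_relations (z : 'I_n -> F) (z0 : forall i, z i != 0) r :
  uq_rel A qi (fun i => z i *: E i) (fun i => (z i)^-1 *: Fm i) K KV r -> r = 0.
Proof.
case=> [i|i|i j|i j|i j|i j|i j ij|i j ij].
- by rewrite (rKKV hU) subrr.
- by rewrite (rKVK hU) subrr.
- by rewrite (rKK hU) subrr.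
- by rewrite -scalerAr (wt_E hU) -qi_simple -scalerAl !scalerA [z j * _]mulrC subrr.
- rewrite -scalerAr (wt_F hA hU) (bformNr hA) -!invr_expz -qi_simple -scalerAl !scalerA.
  by rewrite [(z j)^-1 * _]mulrC subrr.
- rewrite -!scalerAl -!scalerAr !scalerA [(z j)^-1 * _]mulrC -scalerBr (rEF hU) scalerA.
  case: (eqVneq i j) => [->|_]; last by rewrite mul0r mulr0 subrr.
  by rewrite mulfV // mul1r subrr.
- by rewrite (serre_scale (hqi i)) (rEE hU) // scaler0.
- by rewrite (serre_scale (hqi i)) (rFF hU) // scaler0.
Qed.

Definition torus (z : 'I_n -> F) (z0 : forall i, z i != 0) : {lrmorphism U -> U} :=
  sval (cid (uqs_lift hU (torus_relations z0))).

Lemma torusP z z0 i : [/\ @torus z z0 (E i) = z i *: E i, torus z0 (Fm i) = (z i)^-1 *: Fm i,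
  torus z0 (K i) = K i & torus z0 (KV i) = KV i].
Proof. exact: (svalP (cid (uqs_lift hU (torus_relations z0)))). Qed.

Definition zpow (z : 'I_n -> F) (g : lattice) : F := \prod_k z k ^ g 0 k.

Lemma zpow_simple z i : zpow z (simple i) = z i.
Proof.
rewrite /zpow (bigD1 i) //= simpleE eqxx expr1z big1 ?mulr1 // => k ki.
by rewrite simpleE (negPf ki) expr0z.
Qed.

Lemma zpowN z g : zpow z (- g) = (zpow z g)^-1.
Proof. by rewrite /zpow -prodfV; apply: eq_bigr => k _; rewrite mxE invr_expz. Qed.

Lemma zpowD z g h : (forall i, z i != 0) -> zpow z (g + h) = zpow z g * zpow z h.
Proof. by move=> z0; rewrite -big_split; apply: eq_bigr => k _; rewrite mxE expfzDr. Qed.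

Lemma zpow0 z : zpow z 0 = 1.
Proof. by rewrite /zpow big1 // => k _; rewrite mxE expr0z. Qed.

Lemma torus_graded z (z0 : forall i, z i != 0) g u : graded g u -> torus z0 u = zpow z g *: u.
Proof.
elim=> [i|i|i|i||al|al a b _ ha _ hb|al c a _ ha|al be a b _ ha _ hb].
- by have [-> _ _ _] := torusP z0 i; rewrite zpow_simple.
- by have [_ -> _ _] := torusP z0 i; rewrite zpowN zpow_simple.
- by have [_ _ -> _] := torusP z0 i; rewrite zpow0 scale1r.
- by have [_ _ _ ->] := torusP z0 i; rewrite zpow0 scale1r.
- by rewrite rmorph1 zpow0 scale1r.
- by rewrite raddf0 scaler0.
- by rewrite raddfD /= ha hb scalerDr.
- by rewrite linearZ /= ha !scalerA mulrC.
- by rewrite rmorphM /= ha hb zpowD // -scalerAl -scalerAr scalerA.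
Qed.

Lemma qspot_neq0 (k i : 'I_n) : (if i == k then q else 1) != 0.
Proof. by case: (i == k); rewrite ?oner_neq0 ?q0. Qed.

Lemma zpow_spot k g : zpow (fun i => if i == k then q else 1) g = q ^ g 0 k.
Proof.
rewrite /zpow (bigD1 k) //= eqxx big1 ?mulr1 // => i /negPf ->; exact: exp1rz.
Qed.

(** The torus automorphism that scales only E_k by q and F_k by q^-1 acts on weight g by q^(g_k),
    and q is not a root of unity. *)
Lemma graded_unique g h u : graded g u -> graded h u -> u != 0 -> g = h.
Proof.
move=> hg hh u0; apply/rowP => k.
have := torus_graded (qspot_neq0 k) hg; rewrite (torus_graded (qspot_neq0 k) hh) !zpow_spot.
move/eqP; rewrite -subr_eq0 -scalerBl scaler_eq0 (negPf u0) orbF subr_eq0 => /eqP.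
by move/(qz_inj hq).
Qed.

Lemma graded_X g u m : graded g u -> graded (m%:Z *: g) (u ^+ m).
Proof.
move=> h; elim: m => [|m IH]; first by rewrite scale0r; apply: graded_1.
by rewrite exprS (_ : m.+1%:Z = 1 + m%:Z) // scalerDl scale1r; apply: graded_M.
Qed.

Lemma graded_sum g I (r : seq I) (P : pred I) (G : I -> U) :
  (forall k, P k -> graded g (G k)) -> graded g (\sum_(k <- r | P k) G k).
Proof. by move=> h; elim/big_rec: _ => [|k u hk hu]; [apply: graded_0|apply: graded_D => //; apply: h]. Qed.

Lemma graded_kb be : graded 0 (kb be).
Proof.
rewrite /kbeta; elim/big_rec: _ => [|k u _ hu]; first exact: graded_1.
rewrite -[0]addr0; apply: graded_M => //; rewrite /kz.
have h m (v : U) : graded 0 v -> graded 0 (v ^+ m) by move=> hv; rewrite -(scaler0 _ m%:Z); apply: graded_X.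
by case: (be 0 k) => m; apply: h; [apply: graded_K|apply: graded_KV].
Qed.

Lemma refl_simple k l : refl_root A k (simple l) = simple l - A k l *: simple k.
Proof.
have he : (eps k)%:Z != 0 :> int by have := cartan_eps hA k; lia.
rewrite /refl_root; congr (_ - _ *: _); apply: (mulfI he).
by rewrite (pairing_bform hA) (bformC hA) bform_simple.
Qed.

Lemma graded_T k g u : graded g u -> graded (refl_root A k g) (T k u).
Proof.
have r0 : refl_root A k 0 = 0.
  by have h := refl_rootD A k 0 0; rewrite addr0 in h; apply: (addrI (refl_root A k 0)); rewrite -h addr0.
have hm l : l != k -> A k l = - `|A k l|%N%:Z by move=> lk; have := cartan_off hA (i:=k) (j:=l); rewrite eq_sym => /(_ lk); lia.
elim=> [l|l|l|l||al|al a b _ ha _ hb|al c a _ ha|al be a b _ ha _ hb].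
- case: (eqVneq l k) => [->|lk].
    rewrite refl_self TEi -(scaleN1r (Fm k * K k)) -[- simple k]addr0; apply/graded_Z/graded_M; [apply: graded_F|apply: graded_K].
  have -> : refl_root A k (simple l) = simple l + `|A k l|%N%:Z *: simple k.
    by rewrite refl_simple {1}(hm l lk) scaleNr opprK.
  rewrite TEj // big_nat; set m := `|_|%N.
  apply: graded_sum => r /andP[_ hr]; apply: graded_Z; rewrite /dpow.
  have -> : simple l + m%:Z *: simple k = (m - r)%N%:Z *: simple k + simple l + r%:Z *: simple k.
    rewrite [_ + simple l]addrC -addrA -scalerDl; congr (_ + _ *: _); lia.
  apply: graded_M; last by apply/graded_Z/graded_X/graded_E.
  by apply: graded_M; [apply/graded_Z/graded_X|]; apply: graded_E.
- case: (eqVneq l k) => [->|lk].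
    rewrite refl_rootN refl_self opprK TFi -scaleN1r -[simple k]add0r.
    by apply/graded_Z/graded_M; [apply: graded_KV|apply: graded_E].
  have -> : refl_root A k (- simple l) = - (simple l + `|A k l|%N%:Z *: simple k).
    by rewrite refl_rootN refl_simple {1}(hm l lk) scaleNr opprK.
  rewrite TFj // big_nat; set m := `|_|%N.
  apply: graded_sum => r /andP[_ hr]; apply: graded_Z; rewrite /dpow.
  have -> : - (simple l + m%:Z *: simple k) = r%:Z *: (- simple k) + - simple l + (m - r)%N%:Z *: (- simple k).
    have -> : m%:Z = r%:Z + (m - r)%N%:Z by lia.
    by rewrite scalerDl !scalerN opprD opprD !addrA; congr (_ - _); rewrite addrC.
  apply: graded_M; last by apply/graded_Z/graded_X/graded_F.
  by apply: graded_M; [apply/graded_Z/graded_X|]; apply: graded_F.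
- by rewrite r0 T_K; apply: graded_kb.
- by rewrite r0 T_KV; apply: graded_kb.
- by rewrite r0 T1; apply: graded_1.
- by rewrite raddf0; apply: graded_0.
- by rewrite TD; apply: graded_D.
- by rewrite TZ; apply: graded_Z.
- by rewrite TM refl_rootD; apply: graded_M.
Qed.

Lemma graded_Tl w g u : graded g u -> graded (weyl_root A w g) (Tl w u).
Proof. by move=> h; elim: w => //= k w; apply: graded_T. Qed.

(** Otherwise the image of [E_i, F_i] would give K_be = K_-be, against [incl_separate]. *)
Lemma Tl_E_neq0 (M : algType F) (upE : 'I_n -> M) (hM : up_spec A qi upE) w i :
  weyl_root A w (simple i) 0 i = 1 -> Tl w (E i) != 0.
Proof.
move=> hb; apply/eqP => h0; have [h hh] := Tl_lrmorphism w.
have := congr1 h (rEF hU i i); rewrite raddfB /= !rmorphM /= linearZ /= raddfB /= !hh h0 mul0r mulr0 subrr eqxx mul1r.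
rewrite Tl_K Tl_KV => /esym/eqP.
rewrite scaler_eq0 invr_eq0 (negPf (q_sub_inv_neq0 (hqi i))) /= => /eqP h1.
have h2 : incl hU hM 1 * kb (weyl_root A w (simple i)) + incl hU hM (-1) * kb (- weyl_root A w (simple i)) = 0.
  by rewrite raddfN /= rmorph1 mul1r mulN1r.
have [/eqP] := incl_separate hA hq hb h2; by rewrite oner_eq0.
Qed.

End LusztigMaps.

(** * Tensor squares and the coproduct *)

Record tensor_spec (F : fieldType) (U U2 : algType F) (pr : U -> U -> U2) := TensorSpec {
  tsDl : forall x y z, pr (x + y) z = pr x z + pr y z;
  tsDr : forall x y z, pr x (y + z) = pr x y + pr x z;
  tsZl : forall c x y, pr (c *: x) y = c *: pr x y;
  tsZr : forall c x y, pr x (c *: y) = c *: pr x y;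
  tsM : forall x y x' y', pr x y * pr x' y' = pr (x * x') (y * y');
  ts_lift : forall (B : algType F) (g : U -> U -> B),
    (forall x y z, g (x + y) z = g x z + g y z) -> (forall x y z, g x (y + z) = g x y + g x z) ->
    (forall c x y, g (c *: x) y = c *: g x y) -> (forall c x y, g x (c *: y) = c *: g x y) ->
    (forall x y x' y', g x y * g x' y' = g (x * x') (y * y')) -> g 1 1 = 1 ->
    exists h : {lrmorphism U2 -> B}, forall x y, h (pr x y) = g x y
}.

Lemma serre_strict (F : fieldType) (B : algType F) (x : F) N (X Y : B) :
  X * X = 0 -> X * Y * X = 0 -> (1 < N)%N -> serre x N X Y = 0.
Proof.
move=> hXX hXYX hN; have hX m : X ^+ m.+2 = 0 by rewrite !exprS mulrA hXX mul0r.
rewrite /serre big1_seq // => l /=; rewrite mem_index_iota => hl.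
case: l hl => [|[|l]] hl; last by rewrite hX mulr0 scaler0.
  by rewrite subn0; case: N hN {hl} => [|[|N]] // _; rewrite hX !mul0r scaler0.
case: N hN {hl} => [|[|[|N]]] // _; first by rewrite !expr1 hXYX scaler0.
by rewrite hX !mul0r scaler0.
Qed.

Lemma serre_zero (F : fieldType) (B : algType F) (x : F) N (X Y : B) :
  (0 < N)%N -> X = 0 \/ Y = 0 -> serre x N X Y = 0.
Proof.
move=> hN; rewrite /serre => h; rewrite big1_seq // => l; rewrite mem_index_iota => /andP[_ hl].
case: h => ->; last by rewrite mulr0 mul0r scaler0.
case: l hl => [|l] hl; first by rewrite subn0; case: N hN {hl} => // N _; rewrite exprS !mul0r scaler0.
by rewrite [0 ^+ l.+1]exprS mul0r mulr0 scaler0.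
Qed.

(** * A functional that singles out one word of length two *)

Section Strict3.
Context (F : fieldType) (n : nat) (i j : 'I_n) (ij : i != j).
Local Notation M3 := 'M[F]_3.
Local Notation o0 := (ord0 : 'I_3).
Local Notation o1 := (inord 1 : 'I_3).
Local Notation o2 := (ord_max : 'I_3).

(** Words in the E_k are linearly dependent, so the coefficient of E_i E_j has to be read from a
    representation: E_i and E_j become consecutive matrix units, and the corner entry of a word is
    nonzero for E_i E_j only. Triple products vanish, which takes care of Serre relations of degree
    at least three. *)
Definition strict3 (k : 'I_n) : M3 :=
  \matrix_(a, b) ((val a == 0%N) && (val b == 1%N) && (k == i)
               || (val a == 1%N) && (val b == 2%N) && (k == j))%:R.

Lemma strict3_mul k (N : M3) a c : (strict3 k * N) a c =
  if val a == 0%N then (k == i)%:R * N o1 c else if val a == 1%N then (k == j)%:R * N o2 c else 0.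
Proof.
have h1 : lift ord0 ord0 = o1 :> 'I_3 by apply: val_inj; rewrite /= inordK.
have h2 : lift ord0 (lift ord0 ord0) = o2 :> 'I_3 by apply: val_inj.
rewrite [LHS]mxE !big_ord_recl big_ord0 addr0 !mxE h2 h1 /= inordK //.
case: a => -[|[|[|a]]] ha //=; rewrite ?andbF ?andbT ?orbF /= ?mul0r ?add0r ?addr0 //.
Qed.

Lemma strict3_sq k : strict3 k * strict3 k = 0.
Proof.
apply/matrixP => a c; rewrite strict3_mul !mxE /= inordK //=.
case: (val a) => [|[|?]] //=; last by rewrite mulr0.
case: (eqVneq k i) => [->|]; last by rewrite mul0r.
by rewrite (negPf ij) !andbF mulr0.
Qed.

Lemma strict3_cube k l m : strict3 k * (strict3 l * strict3 m) = 0.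
Proof.
apply/matrixP => a c; rewrite !strict3_mul !mxE /= inordK //=.
by case: (val a) => [|[|?]] //=; rewrite ?mulr0.
Qed.

Definition word3 (u : seq 'I_n) : M3 := \prod_(k <- u) strict3 k.

Lemma word3_entry u : word3 u o0 o2 = (u == [:: i; j])%:R.
Proof.
rewrite /word3; case: u => [|k [|l [|m u]]].
- by rewrite big_nil mxE.
- by rewrite big_seq1 mxE /= eqseq_cons andbF.
- rewrite !big_cons big_nil mulr1 strict3_mul /= mxE /= inordK //= !eqseq_cons eqxx andbT.
  by case: (k == i); case: (l == j); rewrite ?mulr0 ?mul0r ?mulr1.
- by rewrite !big_cons !mulrA -(mulrA (strict3 k)) strict3_cube mul0r mxE !eqseq_cons /= !andbF.
Qed.

End Strict3.

Section Coproduct.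
Context (n : nat) (A : 'M[int]_n) (eps : 'I_n -> nat) (hA : gcm A eps).
Context (F : fieldType) (q : F) (hq : not_root_of_unity q).
Local Notation qi := (qfam eps q).
Local Notation Bf := (bform A eps).
Local Notation lattice := 'rV[int]_n.
Context (U : algType F) (E Fm K KV : 'I_n -> U) (hU : uq_spec A qi E Fm K KV).
Context (M : algType F) (upE : 'I_n -> M) (hM : up_spec A qi upE).
Context (U2 : algType F) (pr : U -> U -> U2) (hT : tensor_spec pr).
Context (De : {lrmorphism U -> U2}) (S : {linear U -> U}).
Context (DeE : forall i, De (E i) = pr (E i) 1 + pr (K i) (E i)).
Context (DeF : forall i, De (Fm i) = pr (Fm i) (KV i) + pr 1 (Fm i)).
Context (DeK : forall i, De (K i) = pr (K i) (K i)).
Context (S1 : S 1 = 1) (SM : forall u v, S (u * v) = S v * S u).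
Context (SE : forall i, S (E i) = - (KV i * E i)) (SF : forall i, S (Fm i) = - (Fm i * K i)).
Context (SK : forall i, S (K i) = KV i).
Let q0 := q_neq0 hq.
Local Notation graded := (graded E Fm K KV).
Local Notation inc := (incl hU hM).

Lemma SKV i : S (KV i) = K i.
Proof.
have h : S (KV i) * KV i = 1 by rewrite -[X in _ * X]SK -SM (rKKV hU) S1.
by rewrite -[LHS]mulr1 -(rKVK hU i) mulrA h mul1r.
Qed.

Let pDl := tsDl hT. Let pDr := tsDr hT. Let pZl := tsZl hT. Let pZr := tsZr hT.
Let pM := tsM hT.
Let DM u v : De (u * v) = De u * De v. Proof. exact: rmorphM. Qed.
Let D1' : De 1 = 1. Proof. exact: rmorph1. Qed.
Let DB u v : De (u - v) = De u - De v. Proof. exact: raddfB. Qed.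
Let DD u v : De (u + v) = De u + De v. Proof. exact: raddfD. Qed.
Let DZ c u : De (c *: u) = c *: De u. Proof. exact: linearZ. Qed.

Lemma DeKV i : De (KV i) = pr (KV i) (KV i).
Proof.
have e1 : De (KV i) * De (K i) = 1 by rewrite -DM (rKVK hU) D1'.
have e2 : De (K i) * pr (KV i) (KV i) = De (K i) * De (KV i).
  have e3 : De (K i) * (pr (KV i) (KV i) * De (K i)) = De (K i).
    by rewrite DeK !pM !(rKVK hU) !mulr1.
  have e4 : De (K i) * De (KV i) = 1 by rewrite -DM (rKKV hU) D1'.
  by rewrite e4 -[LHS]mulr1 -e4 -!mulrA (mulrA (pr _ _)) (mulrA (De (K i)) _ (De (KV i))) e3.
by rewrite -[RHS]mul1r -e1 -mulrA e2 mulrA e1 mul1r.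
Qed.

Section TensorAction.
Context (B : algType F) (al : {lrmorphism U -> B}).
Let aM u v : al (u * v) = al u * al v. Proof. exact: rmorphM. Qed.
Let aZ c u : al (c *: u) = c *: al u. Proof. exact: linearZ. Qed.
Let aD u v : al (u + v) = al u + al v. Proof. exact: raddfD. Qed.
Let SD u v : S (u + v) = S u + S v. Proof. exact: raddfD. Qed.
Let SZ c u : S (c *: u) = c *: S u. Proof. exact: linearZ. Qed.

Lemma tact_linear x y (c : F) (u v : B) :
  al x * (c *: u + v) * al (S y) = c *: (al x * u * al (S y)) + al x * v * al (S y).
Proof. by rewrite mulrDr mulrDl -scalerAr -scalerAl. Qed.

Definition tact x y : endo (oner_neq0 B) := mk_endo (oner_neq0 B) (tact_linear x y).

(** Serves twice: with the identity of U it yields the adjoint action, and with a Verma module it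
    yields functionals on the tensor square. *)
Lemma tensor_action : exists h : {lrmorphism U2 -> endo (oner_neq0 B)},
  forall x y b, h (pr x y) b = al x * b * al (S y).
Proof.
have [||||||h hh] := ts_lift hT (g := tact).
- by move=> x y z; apply: endoP => b; rewrite endoD /= aD !mulrDl.
- by move=> x y z; apply: endoP => b; rewrite endoD /= SD aD mulrDr.
- by move=> c x y; apply: endoP => b; rewrite endoZ /= aZ -!scalerAl.
- by move=> c x y; apply: endoP => b; rewrite endoZ /= SZ aZ -scalerAr.
- by move=> x y x' y'; apply: endoP => b; rewrite endoM /= SM !aM !mulrA.
- by apply: endoP => b; rewrite /= S1 rmorph1 mul1r mulr1.
by exists h => x y b; rewrite hh.
Qed.

End TensorAction.

Context (adf : U -> U -> U).
Context (adfE : forall x u, exists2 s : seq (U * U), De x = \sum_(p <- s) pr p.1 p.2 &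
   adf x u = \sum_(p <- s) p.1 * u * S p.2).

Lemma adjoint_action : exists adh : {lrmorphism U -> endo (oner_neq0 U)},
  [/\ forall x u, adf x u = adh x u,
      forall k u, adh (E k) u = E k * u - K k * u * KV k * E k,
      forall k u, adh (Fm k) u = (Fm k * u - u * Fm k) * K k,
      forall k u, adh (K k) u = K k * u * KV k &
      forall k u, adh (KV k) u = KV k * u * K k].
Proof.
have [h hh] := tensor_action (B := U) idfun.
pose adh : {lrmorphism U -> endo (oner_neq0 U)} := h \o De.
have ae x : adh x = h (De x) by [].
have hD a b u : h (a + b) u = h a u + h b u by rewrite raddfD.
exists adh; split=> [x u|k u|k u|k u|k u]; rewrite ae.
- have [s -> ->] := adfE x u; elim: s => [|p s IH]; first by rewrite !big_nil raddf0 endo0.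
  by rewrite !big_cons hD IH hh.
- by rewrite DeE hD !hh /= S1 mulr1 SE mulrN !mulrA.
- by rewrite DeF hD !hh /= SKV SF mul1r mulrN mulrBl !mulrA.
- by rewrite DeK hh /= SK.
- by rewrite DeKV hh /= SKV.
Qed.

Section WordFunctional.
Context (i j : 'I_n) (ij : i != j) (hAij : A i j != 0).
Context (X : {set 'I_n}) (hi : i \notin X) (hj : j \in X).
Local Notation B2 k l := (Bf (simple k) (simple l)).
Context (adh : {lrmorphism U -> endo (oner_neq0 U)}).
Context (adE : forall k u, adh (E k) u = E k * u - K k * u * KV k * E k).

Let la0 (k : 'I_n) : (1 : F) != 0 := oner_neq0 F.
Local Notation rho := (rho_la hA hq hU hM la0).
Local Notation sc := (scaling hA hq hM).

Definition wordM (u : seq 'I_n) : M := \prod_(k <- u) upE k.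
Definition wordE (u : seq 'I_n) : U := \prod_(k <- u) E k.

Lemma inc_word u : inc (wordM u) = wordE u.
Proof. by rewrite rmorph_prod; apply: eq_bigr => k _; rewrite /= inclE. Qed.

Lemma scaling_word z u : sc z (wordM u) = (\prod_(k <- u) z k) *: wordM u.
Proof.
rewrite /wordM; elim: u => [|k u IH]; first by rewrite !big_nil scaling1 scale1r.
by rewrite !big_cons scalingM scaling_E IH -scalerAl -scalerAr scalerA.
Qed.

Lemma rho_KV_word k u : exists2 s : F, s != 0 & rho (KV k) (wordM u) = s *: wordM u.
Proof.
exists (1^-1 * \prod_(l <- u) rootn A eps q k l); last by rewrite /rho_la verma_KV scaling_word scalerA.
rewrite mulf_neq0 ?invr_eq0 ?oner_neq0 // prodf_seq_neq0; apply/allP => l _ /=.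
by rewrite rootn_inv invr_eq0 rootp_neq0.
Qed.

Lemma rho_K_word k u : exists2 s : F, s != 0 & rho (K k) (wordM u) = s *: wordM u.
Proof.
exists (1 * \prod_(l <- u) rootp A eps q k l); last by rewrite /rho_la verma_K scaling_word scalerA.
by rewrite mulf_neq0 ?oner_neq0 // prodf_seq_neq0; apply/allP => l _ /=; rewrite rootp_neq0.
Qed.

Let SZ c u : S (c *: u) = c *: S u. Proof. exact: linearZ. Qed.
Let SDD u v : S (u + v) = S u + S v. Proof. exact: raddfD. Qed.

Lemma rho_S_word v u : exists2 s : F, s != 0 & rho (S (wordE v)) (wordM u) = s *: wordM (rev v ++ u).
Proof.
elim: v u => [|k v IH] u.
  by exists 1; rewrite ?oner_neq0 // /wordE big_nil S1 /rho_la verma1 scale1r.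
have [s s0 hs] := IH (k :: u); have [t t0 ht] := rho_KV_word k (k :: u).
exists (- (t * s)); first by rewrite oppr_eq0 mulf_neq0.
rewrite /wordE big_cons -/(wordE v) SM SE.
have -> : - (KV k * E k) = - 1 *: (KV k * E k) by rewrite scaleN1r.
rewrite /rho_la !vermaM vermaZ vermaM verma_E -/(rho _) .
have -> : upE k * wordM u = wordM (k :: u) by rewrite /wordM big_cons.
by rewrite -!/(rho _ _) ht !endoZ_arg hs !scalerA rev_cons cat_rcons mulN1r mulNr.
Qed.

(** A Serre relation of degree two means A k l = 0. Since A i j is nonzero, k and l are then not i
    and j in some order, so one of the two matrices is 0. *)
Lemma strict3_serre k l : k != l ->
  serre (qi k) `|1 - A k l|%N (strict3 F i j k) (strict3 F i j l) = 0.
Proof.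
move=> kl; have [m hm hm1] := cartan_serre hA kl; rewrite hm1.
have z m' : m' != i -> m' != j -> strict3 F i j m' = 0.
  by move=> h1 h2; apply/matrixP => a b; rewrite !mxE (negPf h1) (negPf h2) !andbF.
case: (posnP m) => [m0|m0]; last first.
  by apply: serre_strict => //; [apply: strict3_sq|rewrite -mulrA strict3_cube].
have hkl : ~ ((k == i) && (l == j) || (k == j) && (l == i)).
  have hz : A k l = 0 by rewrite hm m0.
  case/orP=> /andP[/eqP e1 /eqP e2]; move: hAij; first by rewrite -e1 -e2 hz.
  by have [h _] := cartan_eq0 hA k l; rewrite -e1 -e2 h.
apply: serre_zero => //.
case: (boolP ((k == i) || (k == j))) => [hk|]; last by rewrite negb_or => /andP[h1 h2]; left; apply: z.
case: (boolP ((l == i) || (l == j))) => [hl|]; last by rewrite negb_or => /andP[h1 h2]; right; apply: z.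
exfalso; apply: hkl; move: kl.
by case/orP: hk => /eqP ->; case/orP: hl => /eqP ->; rewrite ?eqxx ?orbT.
Qed.

Definition hom3 : {lrmorphism M -> 'M[F]_3} := sval (cid (ups_lift hM strict3_serre)).
Lemma hom3_E k : hom3 (upE k) = strict3 F i j k. Proof. exact: (svalP (cid (ups_lift hM strict3_serre)) k). Qed.
Lemma hom3_word u : hom3 (wordM u) = word3 F i j u.
Proof. by rewrite rmorph_prod; apply: eq_bigr => k _; rewrite /= hom3_E. Qed.

Definition coef (m : M) : F := hom3 m ord0 ord_max.

Lemma coef_linear c u v : coef (c *: u + v) = c * coef u + coef v.
Proof. by rewrite /coef linearP !mxE. Qed.
Lemma coefZ c u : coef (c *: u) = c * coef u.
Proof. by rewrite /coef linearZ mxE. Qed.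
Lemma coef_word u : coef (wordM u) = (u == [:: i; j])%:R.
Proof. by rewrite /coef hom3_word word3_entry. Qed.

(** The antipode reverses words, so this functional detects E_j E_i K_i^-1 although [coef] detects
    E_i E_j. *)
Definition psi (y : U) : F := coef (rho (S y) 1).

Lemma psiD u v : psi (u + v) = psi u + psi v.
Proof.
rewrite /psi SDD /rho_la vermaD -!/(rho _ _).
by have := coef_linear 1 (rho (S u) 1) (rho (S v) 1); rewrite scale1r mul1r.
Qed.

Lemma psiZ c u : psi (c *: u) = c * psi u.
Proof. by rewrite /psi SZ /rho_la vermaZ -/(rho _) coefZ. Qed.

Lemma psi_word v : exists2 s : F, s != 0 & psi (wordE v * KV i) = s * (v == [:: j; i])%:R.
Proof.
have [s s0 hs] := rho_S_word v [::]; have [t t0 ht] := rho_K_word i (rev v ++ [::]).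
exists (s * t); first by rewrite mulf_neq0.
have e1 : wordM [::] = 1 by rewrite /wordM big_nil.
have hs' : rho (S (wordE v)) 1 = s *: wordM (rev v ++ [::]) by rewrite -hs e1.
rewrite /psi SM SKV /rho_la vermaM -!/(rho _) hs' endoZ_arg ht scalerA coefZ coef_word cats0.
congr (_ * (_ : bool)%:R); rewrite -[in LHS](revK [:: i; j]) /=.
by rewrite (inj_eq (can_inj revK)).
Qed.

Lemma psi_scaling z m :
  psi (inc (sc z m) * KV i) = z i * z j * psi (inc m * KV i).
Proof.
have key : exists r : seq (F * seq 'I_n), m = \sum_(x <- r) x.1 *: wordM x.2.
  elim/(ups_ind hM): m => [|k u [r ->]|u v [r ->] [r' ->]|c u [r ->]].
  - by exists [:: (1, [::])]; rewrite big_seq1 scale1r /wordM big_nil.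
  - exists [seq (x.1, k :: x.2) | x <- r]; rewrite big_map mulr_sumr; apply: eq_bigr => x _.
    by rewrite -scalerAr /wordM big_cons.
  - by exists (r ++ r'); rewrite big_cat.
  - exists [seq (c * x.1, x.2) | x <- r]; rewrite big_map scaler_sumr; apply: eq_bigr => x _.
    by rewrite scalerA.
case: key => r ->; elim: r => [|x r IH].
  have p0 : psi (inc 0 * KV i) = 0 by rewrite raddf0 mul0r -(scale0r (1 : U)) psiZ mul0r.
  by rewrite big_nil scaling0 p0 mulr0.
rewrite big_cons scalingD scalingZ !raddfD /= !mulrDl !psiD IH mulrDr; congr (_ + _).
rewrite scaling_word !linearZ /= -!scalerAl !psiZ inc_word.
have [s _ ->] := psi_word x.2; case: eqP => [->|_]; last by rewrite !mulr0.
by rewrite !big_cons big_nil; ring.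
Qed.

Lemma torus_inc z (z0 : forall k, z k != 0) m : torus hA hq hU z0 (inc m) = inc (sc z m).
Proof.
have iM u v : inc (u * v) = inc u * inc v by rewrite rmorphM.
have iZ c u : inc (c *: u) = c *: inc u by rewrite linearZ.
have iD u v : inc (u + v) = inc u + inc v by rewrite raddfD.
have tM u v : torus hA hq hU z0 (u * v) = torus hA hq hU z0 u * torus hA hq hU z0 v by rewrite rmorphM.
elim/(ups_ind hM): m => [|k u IH|u v IHu IHv|c u IH].
- by rewrite scaling1 !rmorph1.
- rewrite scalingM scaling_E -scalerAl iM iZ iM !inclE -IH tM.
  by have [-> _ _ _] := torusP hA hq hU z0 k; rewrite scalerAl.
- by rewrite scalingD !iD raddfD /= IHu IHv.
- by rewrite scalingZ !iZ linearZ /= IH.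
Qed.

Lemma inc_inj m m' : inc m = inc m' -> m = m'.
Proof. by move=> h; rewrite -(rho_incl hA hq hU hM la0 m) h rho_incl. Qed.

(** By [psi_scaling] the functional has torus weight alpha_i + alpha_j, so it is blind to every
    other weight. *)
Lemma psi_graded m ga : graded ga (inc m) -> ga != simple i + simple j -> psi (inc m * KV i) = 0.
Proof.
move=> hg hne; have [k hk] : exists k, ga 0 k != (simple i + simple j : lattice) 0 k.
  apply/existsP; apply: contraNT hne; rewrite negb_exists => /forallP h.
  by apply/eqP/rowP => k; apply/eqP; have := h k; rewrite negbK.
have z0 := qspot_neq0 hq k.
have e : sc (fun l => if l == k then q else 1) m = q ^ ga 0 k *: m.
  apply: inc_inj; rewrite -(torus_inc z0) linearZ /= (torus_graded hA hq hU z0 hg) zpow_spot //.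
have := psi_scaling (fun l => if l == k then q else 1) m; rewrite e linearZ /= -scalerAl psiZ.
have -> : (if i == k then q else 1) * (if j == k then q else 1) = q ^ ((simple i + simple j : lattice) 0 k).
  rewrite mxE !simpleE expfzDr // ![k == _]eq_sym.
  by congr (_ * _); case: eqP; rewrite ?expr1z ?expr0z.
move/eqP; rewrite -subr_eq0 -mulrBl mulf_eq0 => /orP[|/eqP //].
by rewrite subr_eq0 => /eqP /(qz_inj hq) h; rewrite h eqxx in hk.
Qed.

Lemma functional_linear (t : M) (c : F) (u v : M) :
  coef (c *: u + v) *: t = c *: (coef u *: t) + coef v *: t.
Proof. by rewrite coef_linear scalerDl scalerA. Qed.

Definition rank1 : EndM M := mk_endo (oner_neq0 M) (functional_linear 1).

(** This is the tensor product of the identity with [psi], followed by evaluation at the lowest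
    weight vector. It results from [tensor_action] by inserting [rank1] between the actions of x and
    of S(y). *)
Lemma word_functional : exists L : U2 -> M,
  [/\ forall s t, L (s + t) = L s + L t, forall c t, L (c *: t) = c *: L t &
      forall x y, L (pr x y) = psi y *: rho x 1].
Proof.
have [h hh] := tensor_action (B := EndM M) rho.
have hD a b u : h (a + b) u = h a u + h b u by rewrite raddfD.
have hZ c a u : h (c *: a) u = c *: h a u by rewrite linearZ.
exists (fun t => h t rank1 1); split=> [s t|c t|x y].
- by rewrite hD; exact: endoD.
- by rewrite hZ; exact: endoZ.
- by rewrite hh !endoM /= endoZ_arg.
Qed.

Definition Gij : U := E j * E i - qi i ^ A i j *: (E i * E j).

(** The part of the coproduct that [psi], applied to the second factor times K_i^-1, does not see;
    it is stable under multiplication by the coproduct of E_k ([rem_step]). *)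
Inductive remainder : U2 -> Prop :=
| rem_pure a v : (2 < size v)%N || (size v == 2%N) && (v != [:: j; i]) && (v != [:: i; j]) ->
    remainder (pr a (wordE v))
| rem_0 : remainder 0
| rem_D s t : remainder s -> remainder t -> remainder (s + t)
| rem_Z c t : remainder t -> remainder (c *: t).

Lemma rem_step k t : remainder t -> [/\ remainder (De (E k) * t) & remainder (t * De (E k))].
Proof.
elim=> [a v hv||s r _ [h1 h2] _ [h3 h4]|c r _ [h1 h2]].
- have sz : (1 < size v)%N by case/orP: hv => [|/andP[/andP[/eqP ->]]] //; apply: ltnW.
  rewrite DeE mulrDl mulrDr !pM mulr1 mul1r; split; apply: rem_D; try exact: rem_pure.
    rewrite (_ : E k * wordE v = wordE (k :: v)); last by rewrite /wordE big_cons.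
    by apply: rem_pure; rewrite /= !ltnS sz.
  rewrite (_ : wordE v * E k = wordE (rcons v k)); last by rewrite /wordE big_rcons.
  by apply: rem_pure; rewrite size_rcons !ltnS sz.
- by rewrite mulr0 mul0r; split; apply: rem_0.
- by rewrite mulrDr mulrDl; split; apply: rem_D.
- by rewrite -scalerAr -scalerAl; split; apply: rem_Z.
Qed.

Let x := adw E adh i.
Let z := zw A eps q E i.
Let W := Ww A eps q E i j.

(** Applying ad(E_k) preserves the shape of the first three terms. For k = j the term with E_i in
    the second factor yields in addition a multiple of [Gij], and this is the source term in the
    recursion of [Ww]. *)
Lemma coproduct_adw w : word_in X w -> exists2 r, remainder r &
  De (x w) = pr (x w) 1 + pr (z w * K i) (E i) + pr (W w * K j * K i) Gij + r.
Proof.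
elim: w => [_|k w IH].
  exists 0; first exact: rem_0.
  by rewrite /x /z /W /= DeE !mul0r mul1r addr0 -(scale0r (0 : U)) pZl scale0r addr0.
case/andP=> kX /IH [r hr e].
have ki : k != i by apply: contraNneq hi => <-.
have hx := wt_adw hA hq hU adE i w.
set th := q ^ Bf (simple k) (simple i + content w).
have hxk : x (k :: w) = E k * x w - th *: (x w * E k) by exact: (adw_cons hA hq hU adE).
rewrite hxk DB DZ !DM e.
set z0 := z w; set W0 := W w; set x0 := x w; set De_k := De (E k).
have hz := wt_zw hA hq hU i w; rewrite -/(z w) -/z0 in hz.
have hKx : K k * x0 = th *: (x0 * K k) by apply: hx.
have wE (a b : 'I_n) : K a * E b = q ^ B2 b a *: (E b * K a).
  by rewrite (wt_E hU) [B2 a b](bformC hA).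
have KK (a b : 'I_n) : K a * K b = K b * K a by apply: (rKK hU).
have ez : z (k :: w) * K i = E k * (z0 * K i) - th *: (z0 * K i * E k).
  have -> : z (k :: w) = E k * z0 - q ^ (Bf (simple k) (content w) + 2 * B2 k i) *: (z0 * E k) by [].
  rewrite mulrBl !mulrA -(mulrA z0 (K i)) wE -scalerAr -scalerAl scalerA mulrA; congr (_ - _ *: _).
  by rewrite /th -expfzDr //; congr (_ ^ _); rewrite (bformDr hA); ring.
set s := if k == j then q ^ Bf (simple j) (content w) *: z0 else 0.
have eW : W (k :: w) * K j * K i = E k * (W0 * K j * K i) - th *: (W0 * K j * K i * E k) + s * K j * K i.
  have -> : W (k :: w) = E k * W0 - q ^ (Bf (simple k) (content w) + 2 * B2 k i + B2 k j) *: (W0 * E k) + s by [].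
  rewrite !mulrDl !mulrA; congr (_ + _ + _).
  have -> : W0 * K j * K i * E k = (q ^ B2 k i * q ^ B2 k j) *: (W0 * E k * K j * K i).
    rewrite -(mulrA (W0 * K j) (K i)) wE -scalerAr (mulrA (W0 * K j) (E k)) -(mulrA W0 (K j) (E k)) wE.
    by rewrite -!scalerAr -!scalerAl scalerA !mulrA.
  rewrite scalerA !mulNr -!scalerAl; congr (- (_ *: _)).
  by rewrite /th -!expfzDr //; congr (_ ^ _); rewrite (bformDr hA); ring.
have [hr1 hr2] := rem_step k hr.
pose r1 := pr (K k * (W0 * K j * K i)) (E k * Gij) - th *: pr (W0 * K j * K i * K k) (Gij * E k)
    + (De_k * r - th *: (r * De_k)).
have hGl : remainder (pr (K k * (W0 * K j * K i)) (E k * Gij)).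
  have -> : E k * Gij = wordE [:: k; j; i] - qi i ^ A i j *: wordE [:: k; i; j].
    by rewrite /Gij mulrBr -scalerAr /wordE !big_cons !big_nil !mulr1.
  by rewrite -scaleN1r pDr !pZr; apply: rem_D; [|do 2!apply: rem_Z]; apply: rem_pure.
have hGr : remainder (pr (W0 * K j * K i * K k) (Gij * E k)).
  have -> : Gij * E k = wordE [:: j; i; k] - qi i ^ A i j *: wordE [:: i; j; k].
    by rewrite /Gij mulrBl -scalerAl /wordE !big_cons !big_nil !mulr1 !mulrA.
  by rewrite -scaleN1r pDr !pZr; apply: rem_D; [|do 2!apply: rem_Z]; apply: rem_pure.
have hr1' : remainder r1.
  rewrite /r1 -!scaleN1r; apply: rem_D; first by apply: rem_D => //; do 2!apply: rem_Z.
  by apply: rem_D => //; do 2!apply: rem_Z.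
pose r2 := pr (K k * (z0 * K i)) (E k * E i) - th *: pr (z0 * K i * K k) (E i * E k)
    - pr (s * K j * K i) Gij.
have hr2' : remainder r2.
  rewrite /r2 /s; case: (eqVneq k j) => [kj|kj].
    suff -> : pr (K k * (z0 * K i)) (E k * E i) - th *: pr (z0 * K i * K k) (E i * E k)
      - pr (q ^ Bf (simple j) (content w) *: z0 * K j * K i) Gij = 0 by apply: rem_0.
    have -> : K k * (z0 * K i) = q ^ Bf (simple j) (content w) *: (z0 * K j * K i).
      by rewrite mulrA hz -scalerAl kj.
    have -> : z0 * K i * K k = z0 * K j * K i by rewrite -mulrA (KK i k) mulrA kj.
    have -> : th = q ^ Bf (simple j) (content w) * qi i ^ A i j.
      by rewrite /th kj (bformDr hA) addrC expfzDr // qi_simple [B2 j i](bformC hA).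
    have hG P : pr P Gij = pr P (E j * E i) - qi i ^ A i j *: pr P (E i * E j).
      by rewrite /Gij -scaleN1r pDr !pZr scaleN1r.
    by rewrite -!scalerAl !pZl hG kj scalerBr scalerA subrr.
  rewrite !mul0r -(scale0r (0 : U)) pZl scale0r subr0.
  rewrite (_ : E k * E i = wordE [:: k; i]); last by rewrite /wordE !big_cons big_nil mulr1.
  rewrite (_ : E i * E k = wordE [:: i; k]); last by rewrite /wordE !big_cons big_nil mulr1.
  rewrite -scaleN1r; apply: rem_D; [|do 2!apply: rem_Z]; apply: rem_pure; rewrite /= !eqseq_cons.
    by rewrite (negPf kj) (negPf ki).
  by rewrite (negPf ij) (negPf kj) !andbF.
exists (r1 + r2); first exact: rem_D.
have dk : De_k = pr (E k) 1 + pr (K k) (E k) by apply: DeE.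
rewrite ez eW /r1 /r2 dk; move: Gij => g.
rewrite -!scaleN1r !(pDl, pZl) !(mulrDl, mulrDr) !pM !mulr1 !mul1r hKx pZl.
by clear; nc; ring.
Qed.

(** Apply [word_functional] to the two expressions for the coproduct of B_i. Apart from the common
    term with F_i only the [Gij] term is seen, with the same nonzero factor in both, and its first
    tensor factor is recovered in the Verma module. *)
Lemma W_determined w (Wx Zx Bi : U) (c v s0 : F) (Y2 : U2) : word_in X w -> c != 0 ->
    (exists m, Wx = inc m) ->
    Bi = Fm i + c *: ((- v *: x w) * KV i) + s0 *: KV i ->
    Defs.span (fun t => exists a m, [/\ exists2 ga, graded ga (inc m) & ga != simple i + simple j
       & t = pr a (inc m * KV i)]) Y2 ->
    De Bi = pr Bi (KV i) + pr 1 (Fm i) + c *: pr Zx (E i * KV i)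
      + c *: pr (Wx * K j) (Gij * KV i) + Y2 ->
  Wx = - v *: W w.
Proof.
move=> hw c0 [m hm] hBi hY hDe.
have [L [LD LZ Lp]] := word_functional.
have psi0 : psi (KV i) = 0.
  by have [t _] := psi_word [::]; rewrite /wordE big_nil mul1r mulr0.
have psi1 : psi (E i * KV i) = 0.
  by have [t _] := psi_word [:: i]; rewrite /wordE big_seq1 eqseq_cons andbF mulr0.
have [g g0 psiG] : exists2 g, g != 0 & psi (Gij * KV i) = g.
  have [t t0] := psi_word [:: j; i]; rewrite eqxx mulr1 => h1.
  have [t' _] := psi_word [:: i; j]; rewrite eqseq_cons (negPf ij) mulr0 => h2.
  have w2 (a b : 'I_n) : wordE [:: a; b] = E a * E b by rewrite /wordE !big_cons big_nil mulr1.
  rewrite !w2 in h1 h2.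
  by exists t => //; rewrite /Gij -scaleN1r mulrDl -!scalerAl psiD !psiZ h1 h2 !mulr0 addr0.
have LY : L Y2 = 0.
  have L0 : L 0 = 0 by rewrite -(scale0r (0 : U2)) LZ scale0r.
  elim: hY => [t [a [m' [[ga hga hne] ->]]]|//|a b _ ha _ hb|t a _ ha].
  - by rewrite Lp (psi_graded hga hne) scale0r.
  - by rewrite LD ha hb addr0.
  - by rewrite LZ ha scaler0.
have [r hr hDx] := coproduct_adw hw.
have Lr : L (r * pr (KV i) (KV i)) = 0.
  have L0 : L 0 = 0 by rewrite -(scale0r (0 : U2)) LZ scale0r.
  elim: hr => [a u hu||a b _ ha _ hb|t a _ ha].
  - rewrite pM Lp; have [t _ ->] := psi_word u.
    case: (eqVneq u [:: j; i]) hu => [-> //|_ _].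
    by rewrite mulr0 scale0r.
  - by rewrite mul0r.
  - by rewrite mulrDl LD ha hb addr0.
  - by rewrite -scalerAl LZ ha scaler0.
have h1 : L (De Bi) = L (pr 1 (Fm i)) + (c * - v * g) *: rho (W w * K j) 1.
  rewrite hBi !DD !DZ DM DZ DeF DeKV hDx -scalerAl !mulrDl !pM.
  rewrite !(LD, LZ) Lr !Lp !mul1r psi0 psi1 psiG !scale0r !(addr0, add0r, scaler0) !scalerA.
  congr (_ + _ *: rho _ 1).
  by rewrite -(mulrA _ (K i)) (rKKV hU) mulr1.
have h2 : L (De Bi) = L (pr 1 (Fm i)) + (c * g) *: rho (Wx * K j) 1.
  by rewrite hDe !(LD, LZ) LY !Lp psi0 psi1 psiG !scale0r !(addr0, add0r, scaler0) scalerA.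
have rK u : rho (inc u * K j) 1 = u.
  have e1 : (1 : M) = wordM [::] by rewrite /wordM big_nil.
  rewrite /rho_la vermaM verma_K scaling1 scale1r -/(rho _); exact: rho_incl.
have [b hb] : exists b, W w = inc b.
  have iM u v' : inc (u * v') = inc u * inc v' by rewrite rmorphM.
  have iZ c' u : inc (c' *: u) = c' *: inc u by rewrite linearZ.
  have iD u v' : inc (u + v') = inc u + inc v' by rewrite raddfD.
  have hinc : forall u, (exists b, z u = inc b) /\ (exists b, W u = inc b).
    elim=> [|k u [[b1 e1] [b2 e2]]].
      by split; [exists 1; rewrite rmorph1|exists 0; rewrite raddf0].
    have -> : z (k :: u) = E k * z u - q ^ (Bf (simple k) (content u) + 2 * B2 k i) *: (z u * E k) by [].
    have -> : W (k :: u) = E k * W u - q ^ (Bf (simple k) (content u) + 2 * B2 k i + B2 k j) *: (W u * E k)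
       + (if k == j then q ^ Bf (simple j) (content u) *: z u else 0) by [].
    split; first by rewrite e1 -scaleNr -(inclE hU hM k) -!iM -iZ -iD; eexists.
    rewrite e1 e2 -scaleNr -(inclE hU hM k) -!iM -iZ -iD.
    by case: (k == j); rewrite ?addr0 -?iZ -?iD; eexists.
  by have [_] := hinc w.
have : (c * g) *: m = (c * g) *: (- v *: b).
  rewrite scalerA; have := h1; rewrite h2 => /addrI.
  by rewrite hm hb !rK => ->; congr (_ *: _); ring.
move/eqP; rewrite -subr_eq0 -scalerBr scaler_eq0 mulf_eq0 (negPf c0) (negPf g0) /= subr_eq0 => /eqP hmb.
by rewrite hm hmb linearZ /= hb.
Qed.

End WordFunctional.
End Coproduct.

From mathcomp Require Import classical_sets cardinality fsbigop.

(** * The root [w_X(alpha_i)] *)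

Section LongestRoot.
Context (n : nat) (A : 'M[int]_n) (eps : 'I_n -> nat) (hA : gcm A eps).
Context (X : {set 'I_n}) (tau : {perm 'I_n}) (wX : seq 'I_n) (hX : admissible A X tau wX).
Context (i : 'I_n) (hi : i \notin X) (hti : tau i = i).
Local Notation Bf := (bform A eps).
Local Notation lattice := 'rV[int]_n.
Let be : lattice := weyl_root A wX (simple i).

Lemma longest_norm : Bf be be = Bf (simple i) (simple i).
Proof. exact: (bform_weyl hA). Qed.

Lemma bform_tau k : Bf (simple i) (simple (tau k)) = Bf (simple i) (simple k).
Proof. by rewrite !bform_simple -{2}hti (adm_tauA hX). Qed.

Lemma longest_simple k : k \in X -> weyl_root A wX (simple (tau k)) = - simple k.
Proof.
move=> kX; have h := adm_root hX (j := tau k).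
by rewrite (adm_tauK hX) (adm_tauX hX) in h; rewrite (h kX) opprK.
Qed.

Lemma longest_bform k : k \in X -> Bf be (simple k) = - Bf (simple i) (simple k).
Proof.
move=> kX; have e : simple k = - weyl_root A wX (simple (tau k)) by rewrite longest_simple ?opprK.
by rewrite {1}e (bformNr hA) (bform_weyl hA) bform_tau.
Qed.

Lemma longest_raise k : k \in X ->
  weyl_root A (rev wX) (be + simple k) = simple i - simple (tau k).
Proof.
move=> kX; rewrite weyl_rootD (weyl_revK hA); congr (_ + _).
have -> : simple k = - weyl_root A wX (simple (tau k)) by rewrite longest_simple ?opprK.
by rewrite weyl_rootN (weyl_revK hA).
Qed.

Lemma weyl_root_outside w (v : lattice) : word_in X w -> weyl_root A w v 0 i = v 0 i.
Proof.
elim: w => //= k w IH /andP[kX /IH <-].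
rewrite /refl_root mxE [X in _ + X]mxE [X in - X]mxE simpleE.
by case: eqVneq => [ik|_]; [rewrite -ik (negPf hi) in kX|rewrite mulr0 subr0].
Qed.

Section SingleRoot.
Context (j : 'I_n) (hj : j \in X).

Lemma longest_neq_simple : A i j != 0 -> be != simple i.
Proof.
apply: contra_neqN => /eqP h; have := longest_bform hj; rewrite h bform_simple.
by have := cartan_eps hA i; move: (A i j) => z; lia.
Qed.

Hypothesis hbe : be = simple i + simple j.

Lemma single_bform k : k \in X -> Bf (simple j) (simple k) = - 2 * Bf (simple i) (simple k).
Proof. by move=> kX; have := longest_bform kX; rewrite hbe bformDl; lia. Qed.

Lemma single_entry : A j i = - 1.
Proof.
have := single_bform hj; rewrite [Bf (simple i) _](bformC hA) !bform_simple (cartan_diag hA).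
by have := cartan_eps hA j; move: (A j i) => z; nia.
Qed.

Lemma single_isolated k : k \in X -> k != j -> [/\ A j k = 0, A k j = 0 & A k i = 0].
Proof.
move=> kX kj; have := single_bform kX; rewrite !bform_simple.
have h1 : A j k <= 0 by apply: (cartan_off hA); rewrite eq_sym.
have ki : i != k by apply: contraNneq hi => ->.
have h2 := cartan_off hA ki; have := cartan_eps hA j; have := cartan_eps hA i => e1 e2 h.
have hjk : A j k = 0 by move: h h1 h2; move: (A j k) (A i k) => y z; nia.
have hik : A i k = 0 by move: h h1 h2; move: (A j k) (A i k) => y z; nia.
by split=> //; apply/(cartan_eq0 hA).
Qed.

Lemma pairing_simple k (h : lattice) : pairing A (simple k) h = \sum_a h 0 a * A a k.
Proof.
apply: eq_bigr => a _; rewrite (bigD1 k) //= simpleE eqxx mulr1 big1 ?addr0 // => b bk.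
by rewrite simpleE (negPf bk) mulr0 mul0r.
Qed.

Lemma refl_corootE k (h : lattice) a :
  refl_coroot A k h 0 a = h 0 a - pairing A (simple k) h * (a == k)%:R.
Proof. by rewrite /refl_coroot mxE [X in _ + X]mxE [X in - X]mxE simpleE. Qed.

Lemma single_coroot w l (h := weyl_coroot A w (simple l)) : word_in X w -> l \in X ->
  (forall a, a \notin X -> h 0 a = 0) /\
  (h = simple j \/ h = - simple j \/ h 0 j = 0).
Proof.
move=> hw lX; rewrite /h {h}; elim: w hw => [_|k w IH] /=.
  split=> [a aX|]; first by rewrite simpleE; case: eqP aX => [->|//]; rewrite lX.
  case: (eqVneq l j) => [->|lj]; first by left.
  by right; right; rewrite simpleE eq_sym (negPf lj).
case/andP=> kX /IH; set h := weyl_coroot A w _ => -[h1 h2]; split=> [a aX|].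
  rewrite refl_corootE h1 //; case: eqP aX => [->|_]; first by rewrite kX.
  by rewrite mulr0 subr0.
have pj v : (v : lattice) = simple j -> pairing A (simple k) v = A j k.
  move=> ->; rewrite pairing_simple (bigD1 j) //= simpleE eqxx mul1r big1 ?addr0 // => a aj.
  by rewrite simpleE (negPf aj) mul0r.
have pN v : pairing A (simple k) (- v) = - pairing A (simple k) v.
  by rewrite !pairing_simple -sumrN; apply: eq_bigr => a _; rewrite mxE mulNr.
case: (eqVneq k j) => [kj|kj].
  have djj : A j k = 2 by rewrite kj (cartan_diag hA).
  case: h2 => [e|[e|e]].
  - by right; left; rewrite e /refl_coroot (pj _ erefl) djj kj; apply/rowP => a; rewrite !mxE; ring.
  - by left; rewrite e /refl_coroot pN (pj _ erefl) djj kj; apply/rowP => a; rewrite !mxE; ring.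
  - right; right; rewrite refl_corootE e kj pairing_simple big1 ?mul0r ?subr0 // => a _.
    case: (boolP (a \in X)) => [aX|/h1 ->]; last by rewrite mul0r.
    case: (eqVneq a j) => [->|aj]; first by rewrite e mul0r.
    by have [_ -> _] := single_isolated aX aj; rewrite mulr0.
have [jk _ _] := single_isolated kX kj.
case: h2 => [e|[e|e]].
- by left; rewrite e /refl_coroot (pj _ erefl) jk scale0r subr0.
- by right; left; rewrite e /refl_coroot pN (pj _ erefl) jk oppr0 scale0r subr0.
- by right; right; rewrite refl_corootE e [j == k]eq_sym (negPf kj) mulr0 subr0.
Qed.

(** Carries the finiteness of W_X, which is formulated on roots, over to coroots. *)
Lemma coroot_root w l a : (eps l)%:Z * weyl_coroot A w (simple l) 0 a =
  (eps a)%:Z * weyl_root A w (simple l) 0 a.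
Proof.
elim: w a => [|k w IH] a /=.
  by rewrite !simpleE; case: eqP => [->|_]; rewrite ?mulr1 ?mulr0.
rewrite refl_corootE /refl_root mxE [X in _ = _ * (_ + X)]mxE [X in _ = _ * (_ - X)]mxE simpleE.
rewrite !mulrBr IH; congr (_ - _); case: eqP => [->|_]; last by rewrite !mulr0.
rewrite !mulr1 (pairing_bform hA) bform_coord pairing_simple mulr_sumr.
by apply: eq_bigr => b _; rewrite bform_simple (mulrA (eps l)%:Z) IH; ring.
Qed.

(** Finiteness makes [two_rho] a genuine sum; over an infinite set it would be 0 by convention. *)
Lemma finite_positive_coroots : finite_set (positive_coroots A X).
Proof.
pose g (x : (lattice -> lattice) * 'I_n) : lattice :=
  \row_a divz ((eps a)%:Z * x.1 (simple x.2) 0 a) (eps x.2)%:Z.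
have hfin := finite_image g (finite_setX (adm_finite hX) (@finite_finset _ [set: 'I_n]%classic)).
apply: sub_finite_set hfin => h [[w [l [wX' lX ->]]] _] /=.
exists (weyl_root A w, l); first by split=> //=; exists w.
apply/rowP => a; rewrite mxE /= -coroot_root mulrC mulzK //.
by have := cartan_eps hA l; lia.
Qed.

Lemma two_rho_coord a : two_rho A X 0 a =
  \sum_(h <- finmap.enum_fset (fset_set (positive_coroots A X))) h 0 a.
Proof. by rewrite /two_rho fsbig_finite ?summxE //; exact: finite_positive_coroots. Qed.

(** If w_X(alpha_i) = alpha_i + alpha_j, then (alpha_j, alpha_k) = -2 (alpha_i, alpha_k) for all k
    in X. For k = j this gives a_ji = -1; for other k both sides vanish by their signs, so j is
    isolated in X and is the only neighbour of i there. Then alpha_i(2 rho_X^vee) = -1 is odd,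
    against [adm_rho]. *)
Lemma single_absurd : False.
Proof.
have hfin := finite_positive_coroots.
have inPC h : h \in finmap.enum_fset (fset_set (positive_coroots A X)) -> positive_coroots A X h.
  by move=> hh; apply/set_mem; rewrite -(in_fset_set hfin).
have jPC : simple j \in finmap.enum_fset (fset_set (positive_coroots A X)).
  have h0 : positive_coroots A X (simple j).
    split; first by exists [::], j; split.
    by move=> k; rewrite simpleE; case: (k == j).
  by have := in_fset_set hfin (simple j); rewrite (mem_set h0).
have out a : a \notin X -> two_rho A X 0 a = 0.
  move=> aX; rewrite two_rho_coord big1_seq // => h /= /inPC [[w [l [hw lX ->]]] _].
  by have [h0 _] := single_coroot hw lX; apply: h0.
have hjj : two_rho A X 0 j = 1.
  rewrite two_rho_coord (bigD1_seq (simple j)) ?finmap.fset_uniq //= simpleE eqxx.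
  rewrite big1_seq ?addr0 // => h /andP[hne /inPC [[w [l [hw lX he]]] hpos]].
  have [_ []] := single_coroot hw lX; rewrite -he; first by move=> e; rewrite e eqxx in hne.
  by case=> // e; have := hpos j; rewrite e mxE simpleE eqxx.
have [z hz] := adm_rho hX hi hti.
move: hz; rewrite pairing_simple (bigD1 j) //= hjj single_entry big1 ?addr0.
  by move=> h; lia.
move=> a aj; case: (boolP (a \in X)) => [aX|/out ->]; last by rewrite mul0r.
by have [_ _ ->] := single_isolated aX aj; rewrite mulr0.
Qed.

End SingleRoot.
End LongestRoot.

(** * Relations in the coideal subalgebra *)

Section SymmetricPair.
Context (n : nat) (A : 'M[int]_n) (eps : 'I_n -> nat) (hA : gcm A eps).
Context (F : fieldType) (q : F) (hq : not_root_of_unity q).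
Local Notation qi := (qfam eps q).
Local Notation Bf := (bform A eps).
Local Notation lattice := 'rV[int]_n.
Context (U : algType F) (E Fm K KV : 'I_n -> U) (hU : uq_spec A qi E Fm K KV).
Context (uind : forall P : U -> Prop,
    P 1 -> (forall i u, P u -> P (E i * u)) -> (forall i u, P u -> P (Fm i * u)) ->
    (forall i u, P u -> P (K i * u)) -> (forall i u, P u -> P (KV i * u)) ->
    (forall u v, P u -> P v -> P (u + v)) -> (forall c u, P u -> P (c *: u)) ->
  forall u, P u).
Context (M : algType F) (upE : 'I_n -> M) (hM : up_spec A qi upE).
Context (U2 : algType F) (pr : U -> U -> U2) (hT : tensor_spec pr).
Context (De : {lrmorphism U -> U2}) (S : {linear U -> U}).
Context (DeE : forall i, De (E i) = pr (E i) 1 + pr (K i) (E i)).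
Context (DeF : forall i, De (Fm i) = pr (Fm i) (KV i) + pr 1 (Fm i)).
Context (DeK : forall i, De (K i) = pr (K i) (K i)).
Context (S1 : S 1 = 1) (SM : forall u v, S (u * v) = S v * S u).
Context (SE : forall i, S (E i) = - (KV i * E i)) (SF : forall i, S (Fm i) = - (Fm i * K i)).
Context (SK : forall i, S (K i) = KV i).
Context (adf : U -> U -> U).
Context (adfE : forall x u, exists2 s : seq (U * U), De x = \sum_(p <- s) pr p.1 p.2 &
   adf x u = \sum_(p <- s) p.1 * u * S p.2).
Local Notation kb := (kbeta K KV).
Local Notation dp i := (dpow (qi i)).
Context (T : 'I_n -> {lrmorphism U -> U}).
Context (TEi : forall i, T i (E i) = - (Fm i * K i)).
Context (TFi : forall i, T i (Fm i) = - (KV i * E i)).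
Context (Tkb : forall i be, T i (kb be) = kb (refl_root A i be)).
Context (TEj : forall i j, j != i -> T i (E j) =
  \sum_(0 <= r < `|A i j|%N.+1) ((-1) ^+ r * qi i ^- r) *:
    (dp i (E i) (`|A i j| - r) * E j * dp i (E i) r)).
Context (TFj : forall i j, j != i -> T i (Fm j) =
  \sum_(0 <= r < `|A i j|%N.+1) ((-1) ^+ r * qi i ^+ r) *:
    (dp i (Fm i) r * Fm j * dp i (Fm i) (`|A i j| - r))).
Context (om : {lrmorphism U -> U}) (omE : forall i, om (E i) = - Fm i)
  (omF : forall i, om (Fm i) = - E i) (omK : forall i, om (K i) = KV i).
Context (X : {set 'I_n}) (tau : {perm 'I_n}) (wX : seq 'I_n) (hX : admissible A X tau wX).
Context (i j : 'I_n) (hi : i \notin X) (hti : tau i = i) (hj : j \in X).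
Context (p : nat) (hp : A i j = - p%:Z).
Context (w : seq 'I_n) (hw : word_in X w) (az : F).
Let x := adf (wordE E w) (E i).
Context (hTw : Tl T wX (E i) = az *: x).
Local Notation graded := (graded E Fm K KV).
Local Notation inc := (incl hU hM).
Let be : lattice := weyl_root A wX (simple i).

Let hwX : word_in X wX. Proof. by case: (adm_longest hX). Qed.
Let bei : be 0 i = 1.
Proof. by rewrite /be (weyl_root_outside A hi _ hwX) simpleE eqxx. Qed.

Section Adjoint.
Context (adh : {lrmorphism U -> endo (oner_neq0 U)}) (hadh : forall x u, adf x u = adh x u).
Context (adE : forall k u, adh (E k) u = E k * u - K k * u * KV k * E k).
Context (adF : forall k u, adh (Fm k) u = (Fm k * u - u * Fm k) * K k).
Context (adK : forall k u, adh (K k) u = K k * u * KV k).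
Context (adKV : forall k u, adh (KV k) u = KV k * u * K k).

Lemma adw_word u : adw E adh i u = adh (wordE E u) (E i).
Proof.
elim: u => [|k u IH] /=; first by rewrite /wordE big_nil rmorph1.
by rewrite /wordE big_cons -/(wordE E u) rmorphM endoM -IH.
Qed.

Let xw : x = adw E adh i w. Proof. by rewrite adw_word -hadh. Qed.

Lemma graded_adw u : graded (simple i + content u) (adw E adh i u).
Proof.
elim: u => [|k u IH]; first by rewrite /content big_nil addr0; apply: graded_E.
rewrite (adw_cons hA hq hU adE) content_cons addrCA -scaleN1r; apply: graded_D.
  by apply: graded_M => //; apply: graded_E.
do 2!apply: graded_Z; rewrite addrC; apply: graded_M => //; apply: graded_E.
Qed.

Let iM u v : inc (u * v) = inc u * inc v. Proof. by rewrite rmorphM. Qed.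
Let iZ c u : inc (c *: u) = c *: inc u. Proof. by rewrite linearZ. Qed.
Let iD u v : inc (u + v) = inc u + inc v. Proof. by rewrite raddfD. Qed.
Let iS k m t : E k * inc m - t *: (inc m * E k) = inc (upE k * m + (- t) *: (m * upE k)).
Proof. by rewrite iD iZ !iM !inclE scaleNr. Qed.

Lemma adw_incl u : exists m, adw E adh i u = inc m.
Proof.
elim: u => [|k u [m hm]]; first by exists (upE i); rewrite inclE.
by rewrite (adw_cons hA hq hU adE) hm iS; eexists.
Qed.

Lemma yw_incl u : exists m, yw A eps q E adh i j u = inc m.
Proof.
elim: u => [|k u [m hm]] /=; first by exists 0; rewrite raddf0.
have [m' hm'] := adw_incl u; rewrite hm hm' iS.
by case: (k == j); rewrite ?addr0 -?iZ -?iD; eexists.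
Qed.

Lemma Tl_longest_neq0 : Tl T wX (E i) != 0.
Proof. exact: (Tl_E_neq0 hA hq hU Tkb hM bei). Qed.

Lemma az_neq0 : az != 0.
Proof. by apply: contra_neq Tl_longest_neq0 => h; rewrite hTw h scale0r. Qed.

(** T_{w_X}(E_i) is homogeneous of weight be and proportional to [adw w]; being nonzero, it has only
    one weight. *)
Lemma longest_content : be = simple i + content w.
Proof.
have h1 : graded be (Tl T wX (E i)) by apply: (graded_Tl hA hq TEi TFi Tkb TEj TFj wX); apply: graded_E.
apply: (graded_unique hA hq hU h1 _ Tl_longest_neq0).
by rewrite hTw xw; apply/graded_Z/graded_adw.
Qed.

Lemma highest_x k : k \in X -> E k * adw E adh i w =
  q ^ Bf (simple k) (simple i + content w) *: (adw E adh i w * E k).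
Proof.
move=> kX; apply: (highest_vector hA hq hU adE adF adK adKV hi (wX := rev wX) (k' := tau k)) => //.
- by rewrite /word_in all_rev.
- by apply: contraNneq hi => <-; rewrite (adm_tauX hX).
- by rewrite -longest_content; exact: (longest_raise hA hX i kX).
Qed.

(** This is [serre_transport] for T_{w_X}. The highest weight property of x gives the commutation of
    F_j K_j with T_{w_X}(F_i), the Levi subalgebra a preimage of F_j K_j, and the factor [az] drops
    out because it is nonzero. *)
Lemma serre_x : serre (qi i) p.+1 (adw E adh i w * KV i) (Fm j) = 0.
Proof.
have [h hh] := Tl_lrmorphism T wX.
have [m hm] := adw_incl w; have [m' hm'] := yw_incl w.
have [y hy hTy] : exists2 y, levi E Fm K KV X y & Tl T wX y = Fm j * K j.
  by apply: (Tl_levi hA hq hU TEi TFi Tkb TEj TFj hwX); apply: levi_M; [apply: levi_F|apply: levi_K].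
have hhE : h (E i) = az *: adw E adh i w by rewrite hh hTw xw.
have := serre_transport hA hq (hU := hU) (hM := hM) (T := h) (i := i) (j := j) (p := p) (be := be)
  (xi := az *: m) (eta := az *: m') (y := y).
have e : serre (qi i) p.+1 (h (E i) * KV i) (Fm j) =
    az ^+ p.+1 *: serre (qi i) p.+1 (adw E adh i w * KV i) (Fm j).
  rewrite hhE -scalerAl -{1}[Fm j]scale1r (serre_scale (qfam_root hA hq i)) mulr1 //.
rewrite e => H; have /eqP : az ^+ p.+1 *: serre (qi i) p.+1 (adw E adh i w * KV i) (Fm j) = 0.
  apply: H => //.
  - by rewrite hhE iZ hm.
  - by rewrite hhE longest_content; apply: wtZ; apply: (wt_adw hA hq hU adE).
  - by rewrite hh (Tl_K Tkb).
  - by rewrite hh (Tl_KV Tkb).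
  - by rewrite (longest_bform hA hX hti hj) bform_simple.
  - rewrite hhE iZ -hm' -scalerAl -scalerAr -scalerBr -scalerAl; congr (_ *: _).
    exact: (adw_Fj hA hq hU adE hi hj hw).
  - rewrite hh; apply: (Tl_F_comm hA hq hU uind TEi TFi Tkb TEj TFj omE omF omK).
    rewrite hTw xw -scalerAr -scalerAl (highest_x hj) !scalerA mulrC -/be longest_content //.
  - by rewrite hh.
  - exact: (levi_nil hA hq hU hi hy).
by rewrite scaler_eq0 expf_eq0 (negPf az_neq0) andbF /= => /eqP.
Qed.

Lemma quasi_x (c v s0 : F) (Wx Zx Bi : U) (Y2 : U2) : (0 < p)%N -> c != 0 ->
    (exists m, Wx = inc m) ->
    Bi = Fm i + c *: ((- v *: adw E adh i w) * KV i) + s0 *: KV i ->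
    Defs.span (fun t => exists a m, [/\ exists2 ga, graded ga (inc m) & ga != simple i + simple j
       & t = pr a (inc m * KV i)]) Y2 ->
    De Bi = pr Bi (KV i) + pr 1 (Fm i) + c *: pr Zx (E i * KV i)
      + c *: pr (Wx * K j) (Gij A eps q E i j * KV i) + Y2 ->
  quasi_relations (qi i) (qi j) c p (- (c * v) *: (adw E adh i w * KV i)) (Fm j) (Fm i)
    (- v *: (adh (wordE E w) (K i ^+ 2) * KV i * KV i)) (Wx * K j).
Proof.
move=> p0 c0 hW hB hY hDe.
have ij : i != j by apply: contraNneq hi => ->.
have hAij : A i j != 0 by rewrite hp; lia.
have -> : Wx * K j = - v *: (Ww A eps q E i j w * K j).
  have hWW := W_determined hA hq hT DeE DeF DeK S1 SM SE SK ij hAij hi adE hw c0 hW hB hY hDe.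
  by rewrite {1}hWW -scalerAl.
have -> : adh (wordE E w) (K i ^+ 2) * KV i * KV i = zw A eps q E i w.
  rewrite (ad_zw hA hq hU adE) expr2 -!mulrA (mulrA (K i) (KV i)) (rKKV hU) mul1r (rKKV hU) mulr1 //.
apply: (quasi_generators hA hq hU adE hi hj) => //.
- apply: contraTneq isT => w0; have := longest_neq_simple hA hX hi hti hj hAij.
  by rewrite -/be longest_content w0 /content big_nil addr0 eqxx.
- apply/eqP => wj; apply: (single_absurd hA hX hi hti hj).
  by rewrite -/be longest_content wj /content big_seq1.
- exact: highest_x.
- by rewrite -longest_content; apply: (longest_norm hA).
- exact: serre_x.
Qed.

End Adjoint.

Lemma serre_adjoint : serre (qi i) p.+1 (x * KV i) (Fm j) = 0.
Proof.
have [adh [h1 h2 h3 h4 h5]] := adjoint_action hU hT DeE DeF DeK S1 SM SE SF SK adfE.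
by rewrite /x h1 -adw_word; apply: serre_x.
Qed.

Lemma quasi_adjoint (c v s0 : F) (Wx Zx Bi : U) (Y2 : U2) : (0 < p)%N -> c != 0 ->
    (exists m, Wx = inc m) ->
    Bi = Fm i + c *: ((- v *: x) * KV i) + s0 *: KV i ->
    Defs.span (fun t => exists a m, [/\ exists2 ga, graded ga (inc m) & ga != simple i + simple j
       & t = pr a (inc m * KV i)]) Y2 ->
    De Bi = pr Bi (KV i) + pr 1 (Fm i) + c *: pr Zx (E i * KV i)
      + c *: pr (Wx * K j) (Gij A eps q E i j * KV i) + Y2 ->
  quasi_relations (qi i) (qi j) c p (- (c * v) *: (x * KV i)) (Fm j) (Fm i)
    (- v *: (adf (wordE E w) (K i ^+ 2) * KV i * KV i)) (Wx * K j).
Proof.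
have [adh [h1 h2 h3 h4 h5]] := adjoint_action hU hT DeE DeF DeK S1 SM SE SF SK adfE.
rewrite /x !h1 -adw_word => p0 c0 hW hB hY hD.
exact: (quasi_x h1 h2 h3 h4 h5 p0 c0 hW hB hY hD).
Qed.

End SymmetricPair.

(** * The tensor square and the quantum group of the theorem *)

Section TensorMap.
Context (F : fieldType) (n : nat) (A : 'M[int]_n) (qi : 'I_n -> F).
Local Notation U := (Uq A qi).
Local Notation pr := (@pure F U U).

Let tpi : {lrmorphism freealg F (U * U)%type -> Uq2 A qi} := quot_pi (@tensor_rel F U U).

Let pure_rel (x y : freealg F (U * U)%type) : tensor_rel (x - y) -> tpi x = tpi y.
Proof. by move=> h; apply/quot_pi_eq; apply: ideal_rel. Qed.

Let prE (x y : U) : pr x y = tpi (gen F (x, y)). Proof. by []. Qed.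

Lemma pure_addl (x y z : U) : pr (x + y) z = pr x z + pr y z :> Uq2 A qi.
Proof. by rewrite !prE -raddfD; apply: pure_rel; rewrite opprD addrA; apply: tensor_addl. Qed.
Lemma pure_addr (x y z : U) : pr x (y + z) = pr x y + pr x z :> Uq2 A qi.
Proof. by rewrite !prE -raddfD; apply: pure_rel; rewrite opprD addrA; apply: tensor_addr. Qed.
Lemma pure_scalel c (x y : U) : pr (c *: x) y = c *: pr x y :> Uq2 A qi.
Proof. by rewrite !prE -linearZ; apply: pure_rel; apply: tensor_scalel. Qed.
Lemma pure_scaler c (x y : U) : pr x (c *: y) = c *: pr x y :> Uq2 A qi.
Proof. by rewrite !prE -linearZ; apply: pure_rel; apply: tensor_scaler. Qed.
Lemma pure_mul (x y x' y' : U) : (pr x y : Uq2 A qi) * pr x' y' = pr (x * x') (y * y').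
Proof. by rewrite !prE -rmorphM; apply: pure_rel; apply: tensor_mul. Qed.
Lemma pure_one : pr 1 1 = 1 :> Uq2 A qi.
Proof. by rewrite prE -(rmorph1 tpi); apply: pure_rel; apply: tensor_one. Qed.

Lemma pure_span (t : Uq2 A qi) : exists s : seq (U * U), t = \sum_(p <- s) pr p.1 p.2.
Proof.
have -> : t = tpi (repr t) by apply/esym/quot_pi_surj.
elim/freealg_ind: (repr t) => [|[x y] u [s hs]|u v [s hs] [s' hs']|c u [s hs]].
- by exists [:: (1, 1)]; rewrite rmorph1 big_seq1 pure_one.
- exists [seq (x * p.1, y * p.2) | p <- s]; rewrite rmorphM /= hs big_map mulr_sumr.
  by apply: eq_bigr => p _; rewrite -pure_mul.
- by exists (s ++ s'); rewrite raddfD /= hs hs' big_cat.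
- exists [seq (c *: p.1, p.2) | p <- s]; rewrite linearZ /= hs big_map scaler_sumr.
  by apply: eq_bigr => p _; rewrite -pure_scalel.
Qed.

Lemma sweedlerP (t : Uq2 A qi) : t = \sum_(p <- sweedler t) pr p.1 p.2.
Proof. exact: (xgetPex [::] (pure_span t)). Qed.

Section Map.
Context (B : algType F) (g : U -> U -> B).
Context (gDl : forall x y z, g (x + y) z = g x z + g y z).
Context (gDr : forall x y z, g x (y + z) = g x y + g x z).
Context (gZl : forall c x y, g (c *: x) y = c *: g x y).
Context (gZr : forall c x y, g x (c *: y) = c *: g x y).
Context (gM : forall x y x' y', g x y * g x' y' = g (x * x') (y * y')).
Context (g1 : g 1 1 = 1).

Let phi : {lrmorphism freealg F (U * U)%type -> B} := free_lift (fun p => g p.1 p.2).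
Let phiE x y : phi (gen F (x, y)) = g x y. Proof. exact: free_lift_gen. Qed.

Let phi_rel r : tensor_rel r -> phi r = 0.
Proof.
case=> *.
- by rewrite !raddfB /= !phiE gDl addrAC addrK subrr.
- by rewrite !raddfB /= !phiE gDr addrAC addrK subrr.
- by rewrite raddfB /= linearZ /= !phiE gZl subrr.
- by rewrite raddfB /= linearZ /= !phiE gZr subrr.
- by rewrite raddfB /= rmorphM /= !phiE gM subrr.
- by rewrite raddfB /= rmorph1 /= !phiE g1 subrr.
Qed.

Definition tensor_map : Uq2 A qi -> B :=
  locked_with seal (let _ := (gDl, gDr, gZl, gZr, gM, g1) in quot_map phi).

Let tensor_mapE u : tensor_map u = quot_map phi u. Proof. by rewrite /tensor_map unlock. Qed.

Let tensor_map_tpi a : tensor_map (tpi a) = phi a.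
Proof. by rewrite tensor_mapE; exact: quot_map_pi phi_rel a. Qed.
Let tpi_surj u : exists a, u = tpi a.
Proof. by exists (repr u); apply/esym/quot_pi_surj. Qed.
Let tpiB a b : tpi a - tpi b = tpi (a - b). Proof. by rewrite raddfB. Qed.
Let tpiM a b : tpi a * tpi b = tpi (a * b). Proof. by rewrite rmorphM. Qed.
Let tpi1 : 1 = tpi 1. Proof. by rewrite rmorph1. Qed.
Let tpiZ k a : k *: tpi a = tpi (k *: a). Proof. by rewrite linearZ. Qed.

Lemma tensor_map_zmod : zmod_morphism tensor_map.
Proof.
by move=> u v; have [a ->] := tpi_surj u; have [b ->] := tpi_surj v; rewrite tpiB !tensor_map_tpi raddfB.
Qed.
Lemma tensor_map_monoid : monoid_morphism tensor_map.
Proof.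
split=> [|u v]; first by rewrite tpi1 tensor_map_tpi rmorph1.
by have [a ->] := tpi_surj u; have [b ->] := tpi_surj v; rewrite tpiM !tensor_map_tpi rmorphM.
Qed.
Lemma tensor_map_scalable : scalable tensor_map.
Proof. by move=> k u; have [a ->] := tpi_surj u; rewrite tpiZ !tensor_map_tpi linearZ. Qed.

HB.instance Definition _ := GRing.isZmodMorphism.Build (Uq2 A qi) B tensor_map tensor_map_zmod.
HB.instance Definition _ := GRing.isMonoidMorphism.Build (Uq2 A qi) B tensor_map tensor_map_monoid.
HB.instance Definition _ := GRing.isScalable.Build F (Uq2 A qi) B *:%R tensor_map tensor_map_scalable.

Lemma tensor_map_pure x y : tensor_map (pr x y) = g x y.
Proof. by rewrite prE tensor_map_tpi phiE. Qed.

End Map.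

Lemma Uq2_spec : tensor_spec (pr : U -> U -> Uq2 A qi).
Proof.
split.
- exact: pure_addl.
- exact: pure_addr.
- exact: pure_scalel.
- exact: pure_scaler.
- exact: pure_mul.
move=> B g gDl gDr gZl gZr gM g1.
exists (tensor_map gDl gDr gZl gZr gM g1 : {lrmorphism _ -> _}) => x y.
exact: tensor_map_pure.
Qed.

End TensorMap.

Lemma serre_one (F : fieldType) (q : F) (hq : not_root_of_unity q) (U : algType F) (X Y : U) :
  serre q 1 X Y = X * Y - Y * X.
Proof.
rewrite (serreE hq) /qgeom /= /qop subrr expr0z muln0 expr0 mulr1 scale1r; by [].
Qed.

Lemma commuting_generators (n : nat) (A : 'M[int]_n) (eps : 'I_n -> nat) (hA : gcm A eps)
    (F : fieldType) (q : F) (hq : not_root_of_unity q) (U : algType F) (E Fm K KV : 'I_n -> U)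
    (hU : uq_spec A (qfam eps q) E Fm K KV) i j (x : U) c v s :
    i != j -> A i j = 0 -> serre (qfam eps q i) 1 (x * KV i) (Fm j) = 0 ->
  serre (qfam eps q i) 1 (Fm i + c *: ((v *: x) * KV i) + s *: KV i) (Fm j) = 0.
Proof.
move=> ij hp; have hqi := qfam_root hA hq i; rewrite !(serre_one hqi) => hs.
have hF : Fm i * Fm j - Fm j * Fm i = 0.
  by have := rFF hU ij; rewrite hp subr0 (serre_one hqi).
have hV : KV i * Fm j - Fm j * KV i = 0.
  have := wt_V hq hU i (wt_F hA hU j).
  by rewrite (bformNr hA) opprK -qi_simple hp expr0z scale1r => ->; rewrite subrr.
apply: (eq_certificate (z := (Fm i * Fm j - Fm j * Fm i) + (c * v) *: (x * KV i * Fm j - Fm j * (x * KV i))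
   + s *: (KV i * Fm j - Fm j * KV i))).
  by rewrite hF hV hs !scaler0 !addr0.
by clear; nc; ring.
Qed.

Lemma drop_term (F : fieldType) (U : algType F) (a x k : U) (c v : F) :
  a + c *: ((- v *: x) * k) + 0 *: k = a + - (c * v) *: (x * k).
Proof. by rewrite scale0r addr0 -scalerAl scalerA mulrN. Qed.

Section Concrete.
Context (F : fieldType) (q : F) (hq : not_root_of_unity q).
Context (n : nat) (A : 'M[int]_n) (eps : 'I_n -> nat) (hA : gcm A eps).
Local Notation qi := (qfam eps q).
Local Notation U := (Uq A qi).
Local Notation E := (uE A qi). Local Notation Fm := (uF A qi).
Local Notation K := (uK A qi). Local Notation KV := (uKV A qi).
Local Notation hU := (Uq_spec A qi).
Local Notation hM := (Up_spec A qi).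
Local Notation inc := (incl hU hM).
Context (X : {set 'I_n}) (tau : {perm 'I_n}) (wX : seq 'I_n) (hX : admissible A X tau wX).
Context (sq : F) (H : hopf_maps A qi) (Th : theta_maps A qi X tau sq).
Context (Zw : 'I_n -> seq 'I_n) (az v : 'I_n -> F) (hZ : Zchoice wX H Th Zw az v).
Context (i j : 'I_n) (hi : i \notin X) (hti : tau i = i) (hj : j \in X).
Context (W : U) (hW : calW eps wX H Th Zw v i j W).
Context (c s : 'I_n -> F) (hcs : parameters A eps X tau wX c s).
Local Notation B := (Bgen wX Th c s).
Let x := ad H (monoE A qi (Zw i)) (E i).
Let p := `|A i j|%N.

Let ij : i != j. Proof. by apply: contraNneq hi => ->. Qed.
Let hp : A i j = - p%:Z. Proof. by have := cartan_off hA ij; rewrite /p; lia. Qed.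

Lemma weight_graded al (u : U) : weight al u -> graded E Fm K KV al u.
Proof.
elim=> *.
- exact: graded_E.
- exact: graded_F.
- exact: graded_K.
- exact: graded_KV.
- exact: graded_1.
- exact: graded_0.
- exact: graded_D.
- exact: graded_Z.
- exact: graded_M.
Qed.

Let iM a b : inc (a * b) = inc a * inc b. Proof. exact: rmorphM. Qed.
Let iZ a b : inc (a *: b) = a *: inc b. Proof. exact: linearZ. Qed.
Let iD a b : inc (a + b) = inc a + inc b. Proof. exact: raddfD. Qed.

Lemma MXplus_incl (u : U) : MXplus X u -> exists m, u = inc m.
Proof.
elim=> [_ [k _ ->]||a b _ [m ->] _ [m' ->]|a b _ [m ->] _ [m' ->]|a b _ [m ->]].
- by exists (upE A qi k); rewrite inclE.
- by exists 1; rewrite rmorph1.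
- by exists (m + m'); rewrite iD.
- by exists (m * m'); rewrite iM.
- by exists (a *: m); rewrite iZ.
Qed.

Lemma Uhat_incl (u : U) : Uhat X i j u ->
  exists m, u = inc m /\ exists2 ga, graded E Fm K KV ga (inc m) & ga != simple i + simple j.
Proof.
case=> hs [ga [/weight_graded hg _ _ hne]].
have [m hm] : exists m, u = inc m.
  elim: hs => [_ [a [b [/MXplus_incl [m ->] /MXplus_incl [m' ->] ->]]]||a b _ [m ->] _ [m' ->]|a b _ [m ->]].
  - by exists (m * upE A qi i * m'); rewrite !iM inclE.
  - by exists 0; rewrite raddf0.
  - by exists (m + m'); rewrite iD.
  - by exists (a *: m); rewrite iZ.
by exists m; split=> //; exists ga; rewrite -?hm.
Qed.

Let adfE (y u : U) : exists2 t : seq (U * U), comul H y = \sum_(p <- t) pure p.1 p.2 :> Uq2 A qi &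
   ad H y u = \sum_(p <- t) p.1 * u * antipode H p.2.
Proof. by exists (sweedler (comul H y)) => //; apply: sweedlerP. Qed.

Let hTw : Tl (lusztig Th) wX (E i) = az i *: x. Proof. exact: (Zw_T hZ hi). Qed.

Let Bi_eq : B i = Fm i + c i *: ((- v i *: x) * KV i) + s i *: KV i.
Proof.
have e : thetaq Th wX (Fm i * K i) = - v i *: x.
  by have := Zw_theta hZ hi; rewrite hti => ->; exact: esym (scaleNr _ _).
have -> : B i = Fm i + c i *: (thetaq Th wX (Fm i * K i) * KV i) + s i *: KV i.
  by rewrite /Bgen (negPf hi).
by rewrite e.
Qed.

Lemma coideal_serre : serre (qi i) p.+1 (x * KV i) (Fm j) = 0.
Proof.
apply: (serre_adjoint hA hq hU (@uq_ind F n A qi) hM (Uq2_spec A qi) (comulE H) (comulF H) (comulK H)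
  (antipode1 H) (antipodeM H) (antipodeE H) (antipodeF H) (antipodeK H) adfE
  (lusztigEi Th) (lusztigFi Th) (lusztigK Th) (lusztigEj Th) (lusztigFj Th)
  (omE Th) (omF Th) (omK Th) hX hi hti hj hp (Zw_X hZ hi) hTw).
Qed.

Lemma coideal_relations : (0 < p)%N ->
  quasi_relations (qi i) (qi j) (c i) p (- (c i * v i) *: (x * KV i)) (Fm j) (Fm i)
    (calZ tau H Zw v i) (W * K j).
Proof.
move=> p0; have [hWX hWc] := hW; have [Y2 hY hDe] := hWc c s hcs.
have -> : calZ tau H Zw v i = - v i *: (ad H (monoE A qi (Zw i)) (K i ^+ 2) * KV i * KV i).
  by rewrite /calZ hti scaleNr.
have hY' : Defs.span (fun t => exists a m, [/\ exists2 ga, graded E Fm K KV ga (inc m) &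
    ga != simple i + simple j & t = pure a (inc m * KV i) :> Uq2 A qi]) Y2.
  elim: hY => [_ [m [z [u [_ _ /Uhat_incl [u0 [-> hu]] ->]]]]||a b _ ha _ hb|a b _ ha].
  - by apply: span_in; exists (m * z), u0.
  - exact: span_0.
  - exact: span_D.
  - exact: span_Z.
apply: (quasi_adjoint hA hq (hU := hU) (@uq_ind F n A qi) (hM := hM) (Uq2_spec A qi) (comulE H) (comulF H) (comulK H)
  (antipode1 H) (antipodeM H) (antipodeE H) (antipodeF H) (antipodeK H) adfE
  (lusztigEi Th) (lusztigFi Th) (lusztigK Th) (lusztigEj Th) (lusztigFj Th)
  (omE Th) (omF Th) (omK Th) hX hi hti hj hp (Zw_X hZ hi) hTw p0 (c_neq0 hcs hi) (MXplus_incl hWX) Bi_eq hY' hDe).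
Qed.

Lemma Bgen_X : B j = Fm j. Proof. by rewrite /Bgen hj. Qed.

Lemma Bgen_sum : (0 < p)%N -> B i = Fm i + - (c i * v i) *: (x * KV i).
Proof.
move=> p0; rewrite Bi_eq; suff e : s i = 0; first by rewrite e; exact: drop_term.
(* A nonzero s_i would put i into I_ns, and then a_ij = 0 because j lies in X. *)
apply: contraTeq p0 => /(s_ns hcs hi) [+ _]; rewrite inE => /and3P[_ _ /forallP /(_ j)].
by rewrite hj /= /p => /eqP ->.
Qed.

(** For a_ij = 0 the term s_i K_i^-1 may be present in B_i, but K_i^-1 then commutes with F_j. *)
Lemma Bgen_commutes : p = 0%N -> serre (qi i) p.+1 (B i) (B j) = 0.
Proof.
move=> p0; have hs := coideal_serre; rewrite p0 in hs *.
rewrite Bgen_X Bi_eq; apply: (commuting_generators hA hq hU) => //.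
by rewrite hp p0.
Qed.

End Concrete.

Lemma qvar_root (K : fieldType) : not_root_of_unity (qvar K).
Proof.
split=> [|n n0]; first by rewrite /qvar tofrac_eq0 polyX_eq0.
rewrite /qvar -tofracXn -tofrac1 tofrac_eq; apply: contraTneq n0 => /(congr1 (fun r : {poly K} => size r)).
by rewrite size_polyXn size_poly1 => -[->].
Qed.
(* [functions] also has a [cst]. *)
Import Pilot.Defs.

Theorem theorem3p19
    (K : closedFieldType) (charK : [pchar K] =i pred0)
    (n : nat) (A : 'M[int]_n) (eps : 'I_n -> nat) (hA : gcm A eps)
    (X : {set 'I_n}) (tau : {perm 'I_n}) (wX : seq 'I_n)
    (hX : admissible A X tau wX)
    (sqrtm1 : K) (hsqrtm1 : sqrtm1 ^+ 2 = - 1)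
    (H : hopf_maps A (qpow K eps)) (Th : theta_maps A (qpow K eps) X tau (cst sqrtm1))
    (Zw : 'I_n -> seq 'I_n) (az v : 'I_n -> ratfun K)
    (hZ : Zchoice wX H Th Zw az v)
    (i j : 'I_n) (hi : i \notin X) (htau : tau i = i) (hj : j \in X)
    (W : Uq A (qpow K eps)) (hW : calW eps wX H Th Zw v i j W)
    (c s : 'I_n -> ratfun K) (hcs : parameters A eps X tau wX c s) :
  let qi := qpow K eps in
  let p := `|A i j|%N in
  let Z := calZ tau H Zw v i in
  let B := Bgen wX Th c s in
  serre (qi i) p.+1 (B i) (B j) =
    \sum_(m < p) \sum_(m' < p - m) \sum_(t < ((p.+1 - m - m')./2).+1)
      rho (qi i) (c i) p m m' t *:
        (Z ^+ t * B i ^+ m * B j * B i ^+ m' * Z ^+ ((p.+1 - m - m')./2 - t))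
    + \sum_(m < p) \sum_(t < ((p.-1 - m)./2).+1)
        sigma (qi i) (qi j) (c i) p m t *:
          (Z ^+ t * W * uK A qi j * Z ^+ ((p.-1 - m)./2 - t) * B i ^+ m).

Proof.
move=> qi p Z B; have hq := qvar_root K.
(* For a_ij = 0 both sums are empty and the claim is that B_i and B_j commute. Otherwise s_i = 0 and
   the general expansion applies. *)
case: (posnP p) => [p0|p0].
  rewrite !big1 ?addr0; first exact: (Bgen_commutes hq hA hX hZ hi htau hj c s p0).
  - by move=> m _; have := ltn_ord m; rewrite {2}p0.
  - by move=> m _; have := ltn_ord m; rewrite {2}p0.
exact: (serre_expansion_eq (qfam_root hA hq i) (coideal_relations hq hA hX hZ hi htau hj hW hcs p0)
  (Bgen_sum hZ hi htau hj hcs p0) (Bgen_X wX Th hj c s) erefl).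
Qed.
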